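(* Let $\mathbb{D}$ and $\mathbb{E}$ be double categories with lax products. Then, for each choice of one of the following four kinds of arrows, there is a virtual double category with units whose - objects are product-preserving lax double functors from $\mathbb{D}$ to $\mathbb{E}$, - arrows are either (strict) natural transformations, or product-preserving pseudo natural transformations, or product-preserving lax natural transformations, or product-preserving oplax natural transformations, - proarrows are product-preserving modules, and - multicells are multimodulations.
   Context: Conventions. Double categories and double functors are pseudo unless otherwise stated. A proarrow is written $m\colon x\nrightarrow y$; a cell $\alpha\colon m\to n$ over $(f,g)$ has left side $f$ and right side $g$. External composition $\odot$ is in diagrammatic order; $\mathrm{id}_x$ is the external identity proarrow and $\mathrm{id}_f\colon\mathrm{id}_x\to\mathrm{id}_y$ the identity cell on $f\colon x\to y$; $\circ$ is composition of arrows and of cells in the arrow direction. Associators and unitors of double categories are suppressed below. A lax double functor $F$ has laxators $F_{m,n}\colon Fm\odot Fn\to F(m\odot n)$ and unitors $F_x\colon\mathrm{id}_{Fx}\to F\mathrm{id}_x$. For a span of sets $A\colon I\nrightarrow J$ with legs $\ell,r$, $a\colon i\nrightarrow j$ means $a\in A$, $\ell(a)=i$, $r(a)=j$. Lax products. $\mathbb{F}\mathsf{am}^*(\mathbb{D})$ is the double category with: objects $(I,\underline{x})$, a set $I$ and objects $x_i$ of $\mathbb D$; arrows $(f_0,f)\colon(I,\underline{x})\to(J,\underline{y})$, a function $f_0\colon J\to I$ and arrows $f_j\colon x_{f_0(j)}\to y_j$; proarrows $(A,\underline{m})\colon(I,\underline{x})\nrightarrow(J,\underline{y})$, a span of sets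 $A\colon I\nrightarrow J$ and proarrows $m_a\colon x_i\nrightarrow y_j$ for $a\colon i\nrightarrow j$; cells $(A,\underline{m})\to(B,\underline{n})$ over $((f_0,f),(g_0,g))$, a map of spans $(f_0,\alpha_0,g_0)$ from $B$ to $A$ and cells $\alpha_b\colon m_{\alpha_0(b)}\to n_b$ over $(f_k,g_l)$ for $b\colon k\nrightarrow l$; external composition by pullback of spans and $(\underline m\odot\underline n)_{(a,b)}=m_a\odot n_b$. $\mathbb{D}$ has lax products if $\Delta\colon\mathbb{D}\to\mathbb{F}\mathsf{am}^*(\mathbb{D})$ (singleton families) has a right adjoint $\Pi$ in the 2-category of double categories, lax functors and natural transformations; the projections are $\pi_i\colon\Pi\underline{x}\to x_i$ and $\pi_a\colon\Pi\underline{m}\to m_a$ over $(\pi_i,\pi_j)$. Product-preserving lax functors. A lax functor $F\colon\mathbb{D}\to\mathbb{E}$ preserves products if the canonical comparisons $\Phi_{\underline{x}}\colon F\Pi\underline{x}\to\Pi F\underline{x}$ (determined by $\pi_i\circ\Phi_{\underline x}=F\pi_i$) and $\Phi_{\underline{m}}\colon F\Pi\underline{m}\to\Pi F\underline{m}$ over $(\Phi_{\underline{x}},\Phi_{\underline{y}})$ (determined by $\pi_a\circ\Phi_{\underline m}=F\pi_a$) are isomorphisms for all families of objects and proarrows, where $F$ is applied elementwise to families. Lax transformations. For lax functors $F,G\colon\mathbb{D}\to\mathbb{E}$, a lax natural transformation $\alpha\colon F\Rightarrow G$ consists of arrows $\alpha_x\colon Fx\to Gx$; cells $\alpha_m\colon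 Fm\to Gm$ over $(\alpha_x,\alpha_y)$ for each $m\colon x\nrightarrow y$; and, for each arrow $f\colon x\to y$, a naturality comparison cell $\alpha_f\colon\mathrm{id}_{Fx}\to G\mathrm{id}_y$ over $(Gf\circ\alpha_x,\ \alpha_y\circ Ff)$; subject to: - $\alpha_{m\odot n}\circ F_{m,n}=G_{m,n}\circ(\alpha_m\odot\alpha_n)$ and $\alpha_{\mathrm{id}_x}\circ F_x=G_x\circ\mathrm{id}_{\alpha_x}$; - $\alpha_{1_x}=G_x\circ\mathrm{id}_{\alpha_x}$, and for $f\colon x\to y$, $g\colon y\to z$, $\alpha_{g\circ f}=G_{\mathrm{id}_z,\mathrm{id}_z}\circ\big((G\mathrm{id}_g\circ\alpha_f)\odot(\alpha_g\circ\mathrm{id}_{Ff})\big)$; - for each cell $\gamma\colon m\to n$ over $(f,g)$ with $n\colon w\nrightarrow z$, $G_{n,\mathrm{id}_z}\circ\big((G\gamma\circ\alpha_m)\odot\alpha_g\big)=G_{\mathrm{id}_w,n}\circ\big(\alpha_f\odot(\alpha_n\circ F\gamma)\big)$. Oplax transformations are defined dually, with $\alpha_f\colon\mathrm{id}_{Fx}\to G\mathrm{id}_y$ over $(\alpha_y\circ Ff,\ Gf\circ\alpha_x)$ and the order of external pasting with comparison cells reversed. A pseudo transformation is a lax one in which each $\alpha_f$ is invertible, i.e. there is a cell $\mathrm{id}_{Fx}\to G\mathrm{id}_y$ over $(\alpha_y\circ Ff,Gf\circ\alpha_x)$ whose two external composites with $\alpha_f$, followed by $G_{\mathrm{id}_y,\mathrm{id}_y}$,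 are $G_y\circ\mathrm{id}_{Gf\circ\alpha_x}$ and $G_y\circ\mathrm{id}_{\alpha_y\circ Ff}$. A (strict) natural transformation is one with $Gf\circ\alpha_x=\alpha_y\circ Ff$ and $\alpha_f=G_y\circ\mathrm{id}_{\alpha_y\circ Ff}$ for all $f$. A lax (pseudo, oplax) transformation preserves products if for every object family $(I,\underline{x})$ in $\mathbb{D}$ and $i\in I$, $G\pi_i\circ\alpha_{\Pi\underline{x}}=\alpha_{x_i}\circ F\pi_i$ and $\alpha_{\pi_i}=G_{x_i}\circ\mathrm{id}_{\alpha_{x_i}\circ F\pi_i}$. Transformations $\alpha\colon F\Rightarrow G$, $\beta\colon G\Rightarrow H$ compose componentwise on objects and proarrows, with (lax case) $(\beta\alpha)_f=H_{\mathrm{id}_y,\mathrm{id}_y}\circ\big((\beta_f\circ\mathrm{id}_{\alpha_x})\odot(\beta_{\mathrm{id}_y}\circ\alpha_f)\big)$. Modules. Let $\mathbb{I}=\{0\nrightarrow1\}$ be the walking proarrow. A module $M\colon F\nRightarrow G$ between lax functors $F,G\colon\mathbb{D}\to\mathbb{E}$ is a lax functor $M\colon\mathbb{D}\times\mathbb{I}\to\mathbb{E}$ with $M(-,0)=F$, $M(-,1)=G$. Thus it has proarrows $Mm\colon Fx\nrightarrow Gy$ for $m\colon x\nrightarrow y$, cells $M\gamma\colon Mm\to Mn$ over $(Ff,Gg)$ for cells $\gamma\colon m\to n$ over $(f,g)$, and left and right actions $M^\ell_{m,n}\colon Fm\odot Mn\to M(m\odot n)$ and $M^r_{m,n}\colon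 Mm\odot Gn\to M(m\odot n)$. When $F$ and $G$ have product comparisons $\Phi$ and $\Psi$, $M$ preserves products if for every proarrow family $(A,\underline{m})\colon(I,\underline{x})\nrightarrow(J,\underline{y})$ the canonical cell $M\Pi\underline{m}\to\Pi M\underline{m}$ over $(\Phi_{\underline{x}},\Psi_{\underline{y}})$, determined by having composite $M\pi_a$ with $\pi_a\colon\Pi M\underline{m}\to Mm_a$ for every $a\in A$, is an isomorphism. Multimodulations. Given lax functors $F_0,\dots,F_k,G,H$ ($k\ge0$), modules $M_i\colon F_{i-1}\nRightarrow F_i$ and $N\colon G\nRightarrow H$, and transformations $\alpha\colon F_0\Rightarrow G$, $\beta\colon F_k\Rightarrow H$ (of the chosen kind), a multimodulation $\mu\colon(M_1,\dots,M_k)\to N$ over $(\alpha,\beta)$ assigns to each path $x_0\overset{m_1}{\nrightarrow}\cdots\overset{m_k}{\nrightarrow}x_k$ in $\mathbb{D}$ a cell $\mu_{m_1,\dots,m_k}\colon M_1m_1\odot\cdots\odot M_km_k\to N(m_1\odot\cdots\odot m_k)$ over $(\alpha_{x_0},\beta_{x_k})$ (for $k=0$: a cell $\mu_x\colon\mathrm{id}_{F_0x}\to N\mathrm{id}_x$ for each object $x$), subject to: - naturality: for cells $\gamma_i\colon m_i\to n_i$ over $(f_{i-1},f_i)$, with $f_i\colon x_i\to y_i$, $n=n_1\odot\cdots\odot n_k$, $\gamma=\gamma_1\odot\cdots\odot\gamma_k$ (for $k=0$, $\gamma=\mathrm{id}_{f_0}$), one has $N^r_{n,\mathrm{id}}\circ\big((N\gamma\circ\mu_{m_1,\dots,m_k})\odot\beta_{f_k}\big)=N^\ell_{\mathrm{id},n}\circ\big(\alpha_{f_0}\odot(\mu_{n_1,\dots,n_k}\circ(M_1\gamma_1\odot\cdots\odot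 M_k\gamma_k))\big)$ in the lax case (order of pasting reversed in the oplax case; for strict transformations this reduces to $N\gamma\circ\mu_{m_1,\dots,m_k}=\mu_{n_1,\dots,n_k}\circ(M_1\gamma_1\odot\cdots\odot M_k\gamma_k)$); - outer equivariance ($k\geq 1$): $\mu_{p\odot m_1,m_2,\dots,m_k}\circ((M_1)^\ell_{p,m_1}\odot1)=N^\ell\circ(\alpha_p\odot\mu_{m_1,\dots,m_k})$ and $\mu_{m_1,\dots,m_k\odot p}\circ(1\odot(M_k)^r_{m_k,p})=N^r\circ(\mu_{m_1,\dots,m_k}\odot\beta_p)$; for $k=0$, instead, $N^\ell\circ(\alpha_p\odot\mu_y)=N^r\circ(\mu_x\odot\beta_p)$ for all $p\colon x\nrightarrow y$; - inner equivariance: for $1\le i<k$ and $p$ composable between $m_i$ and $m_{i+1}$, $\mu_{\dots,m_i\odot p,m_{i+1},\dots}\circ(1\odot(M_i)^r_{m_i,p}\odot1)=\mu_{\dots,m_i,p\odot m_{i+1},\dots}\circ(1\odot(M_{i+1})^\ell_{p,m_{i+1}}\odot1)$. Multimodulations compose by pasting of components: the component of the composite of $\nu$ with $\mu_1,\dots,\mu_k$ is the component of $\nu$ at the composites of the respective blocks of proarrows, composed with the external composite of the corresponding components of the $\mu_i$. A virtual double category has objects, arrows forming a category, proarrows, and multicells from a finite (possibly empty) path of proarrows to a single proarrow, bounded by two arrows, with associative and unital composition of multicells. It has units if every object $F$ has a proarrow $U_F\colon F\nRightarrow F$ and a nullary multicell into $U_F$ over identity arrows, composition with which induces bijections between multicells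 with source $(M_1,\dots,M_j,U_F,M_{j+1},\dots,M_k)$ and multicells with source $(M_1,\dots,M_j,M_{j+1},\dots,M_k)$ (same target and bounding arrows). *)

(* Defs.v *)
From Stdlib Require Import FunctionalExtensionality ProofIrrelevance Eqdep.

Declare Scope dbl_scope.
Open Scope dbl_scope.

(** * Pseudo double categories *)

Record dbl_data := {
  ob :> Type;
  hom : ob -> ob -> Type;
  idh : forall x, hom x x;
  comph : forall {x y z}, hom y z -> hom x y -> hom x z;
  pro : ob -> ob -> Type;
  cell : forall {x y x' y'}, hom x x' -> hom y y' -> pro x y -> pro x' y' -> Type;
  cid : forall {x y} (m : pro x y), cell (idh x) (idh y) m m;
  vcomp : forall {x y x' y' x'' y''} {f : hom x x'} {g : hom y y'}
    {f' : hom x' x''} {g' : hom y' y''} {m : pro x y} {n : pro x' y'} {p : pro x'' y''},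
    cell f' g' n p -> cell f g m n -> cell (comph f' f) (comph g' g) m p;
  punit : forall x, pro x x;
  cunit : forall {x y} (f : hom x y), cell f f (punit x) (punit y);
  ptens : forall {x y z}, pro x y -> pro y z -> pro x z;
  ctens : forall {x y z x' y' z'} {f : hom x x'} {g : hom y y'} {h : hom z z'}
    {m : pro x y} {n : pro y z} {m' : pro x' y'} {n' : pro y' z'},
    cell f g m m' -> cell g h n n' -> cell f h (ptens m n) (ptens m' n');
  assoc : forall {x y z w} (m : pro x y) (n : pro y z) (p : pro z w),
    cell (idh x) (idh w) (ptens (ptens m n) p) (ptens m (ptens n p));
  associ : forall {x y z w} (m : pro x y) (n : pro y z) (p : pro z w),
    cell (idh x) (idh w) (ptens m (ptens n p)) (ptens (ptens m n) p);
  lun : forall {x y} (m : pro x y), cell (idh x) (idh y) (ptens (punit x) m) m;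
  luni : forall {x y} (m : pro x y), cell (idh x) (idh y) m (ptens (punit x) m);
  run : forall {x y} (m : pro x y), cell (idh x) (idh y) (ptens m (punit y)) m;
  runi : forall {x y} (m : pro x y), cell (idh x) (idh y) m (ptens m (punit y))
}.

Arguments hom {_} _ _.
Arguments idh {_} _.
Arguments comph {_ _ _ _} _ _.
Arguments pro {_} _ _.
Arguments cell {_ _ _ _ _} _ _ _ _.
Arguments cid {_ _ _} _.
Arguments vcomp {_ _ _ _ _ _ _ _ _ _ _ _ _ _} _ _.
Arguments punit {_} _.
Arguments cunit {_ _ _} _.
Arguments ptens {_ _ _ _} _ _.
Arguments ctens {_ _ _ _ _ _ _ _ _ _ _ _ _ _} _ _.
Arguments assoc {_ _ _ _ _} _ _ _.
Arguments associ {_ _ _ _ _} _ _ _.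
Arguments lun {_ _ _} _.
Arguments luni {_ _ _} _.
Arguments run {_ _ _} _.
Arguments runi {_ _ _} _.

Notation "g ∘ f" := (comph g f) (at level 40, left associativity) : dbl_scope.
Notation "b ∙ a" := (vcomp b a) (at level 40, left associativity) : dbl_scope.
Notation "m ⊙ n" := (ptens m n) (at level 35, right associativity) : dbl_scope.
Notation "a ⊗ b" := (ctens a b) (at level 35, right associativity) : dbl_scope.

(** Arrow composition is associative and unital only up to propositional
    equality, so two cells between the same proarrows may have boundary arrows
    that are equal without being convertible.  [a ≈ b] says that the boundary
    arrows of [a] and [b] are equal and that [a] and [b] are equal over these
    equalities. *)
Inductive ceq {D : dbl_data} {x y x' y' : D} {m : pro x y} {n : pro x' y'}
    {f : hom x x'} {g : hom y y'} (a : cell f g m n) :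
    forall (f' : hom x x') (g' : hom y y'), cell f' g' m n -> Prop :=
  ceq_refl : ceq a f g a.
Arguments ceq {D x y x' y' m n f g} a {f' g'} _.
Arguments ceq_refl {D x y x' y' m n f g} a.
Notation "a ≈ b" := (ceq a b) (at level 70) : dbl_scope.

Definition ccast {D : dbl_data} {x y x' y' : D} {m : pro x y} {n : pro x' y'}
    {f f' : hom x x'} {g g' : hom y y'} (ef : f = f') (eg : g = g')
    (a : cell f g m n) : cell f' g' m n :=
  match ef in _ = u, eg in _ = v return cell u v m n with
  | eq_refl, eq_refl => a
  end.

Record dbl_laws (D : dbl_data) : Prop := {
  comph_id_l : forall (x y : D) (f : hom x y), idh y ∘ f = f;
  comph_id_r : forall (x y : D) (f : hom x y), f ∘ idh x = f;
  comph_assoc : forall (x y z w : D) (h : hom z w) (g : hom y z) (f : hom x y),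
    h ∘ (g ∘ f) = (h ∘ g) ∘ f;
  vcomp_id_l : forall (x y x' y' : D) (f : hom x x') (g : hom y y') m n
    (a : cell f g m n), cid n ∙ a ≈ a;
  vcomp_id_r : forall (x y x' y' : D) (f : hom x x') (g : hom y y') m n
    (a : cell f g m n), a ∙ cid m ≈ a;
  vcomp_assoc : forall (x y x1 y1 x2 y2 x3 y3 : D)
    (f1 : hom x x1) (g1 : hom y y1) (f2 : hom x1 x2) (g2 : hom y1 y2)
    (f3 : hom x2 x3) (g3 : hom y2 y3) m m1 m2 m3
    (c : cell f3 g3 m2 m3) (b : cell f2 g2 m1 m2) (a : cell f1 g1 m m1),
    c ∙ (b ∙ a) ≈ (c ∙ b) ∙ a;
  cunit_id : forall x : D, cunit (idh x) = cid (punit x);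
  cunit_comp : forall (x y z : D) (g : hom y z) (f : hom x y),
    cunit (g ∘ f) = cunit g ∙ cunit f;
  ctens_id : forall (x y z : D) (m : pro x y) (n : pro y z),
    cid m ⊗ cid n = cid (m ⊙ n);
  ctens_comp : forall (x y z x1 y1 z1 x2 y2 z2 : D)
    (f1 : hom x x1) (g1 : hom y y1) (h1 : hom z z1)
    (f2 : hom x1 x2) (g2 : hom y1 y2) (h2 : hom z1 z2)
    m n m1 n1 m2 n2
    (a : cell f1 g1 m m1) (a' : cell g1 h1 n n1)
    (b : cell f2 g2 m1 m2) (b' : cell g2 h2 n1 n2),
    (b ∙ a) ⊗ (b' ∙ a') = (b ⊗ b') ∙ (a ⊗ a');
  assoc_nat : forall (x y z w x' y' z' w' : D)
    (f : hom x x') (g : hom y y') (h : hom z z') (k : hom w w')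
    m n p m' n' p' (a : cell f g m m') (b : cell g h n n') (c : cell h k p p'),
    assoc m' n' p' ∙ ((a ⊗ b) ⊗ c) ≈ (a ⊗ (b ⊗ c)) ∙ assoc m n p;
  lun_nat : forall (x y x' y' : D) (f : hom x x') (g : hom y y') m n
    (a : cell f g m n), lun n ∙ (cunit f ⊗ a) ≈ a ∙ lun m;
  run_nat : forall (x y x' y' : D) (f : hom x x') (g : hom y y') m n
    (a : cell f g m n), run n ∙ (a ⊗ cunit g) ≈ a ∙ run m;
  assoc_associ : forall (x y z w : D) (m : pro x y) (n : pro y z) (p : pro z w),
    assoc m n p ∙ associ m n p ≈ cid (m ⊙ (n ⊙ p));
  associ_assoc : forall (x y z w : D) (m : pro x y) (n : pro y z) (p : pro z w),
    associ m n p ∙ assoc m n p ≈ cid ((m ⊙ n) ⊙ p);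
  lun_luni : forall (x y : D) (m : pro x y), lun m ∙ luni m ≈ cid m;
  luni_lun : forall (x y : D) (m : pro x y), luni m ∙ lun m ≈ cid (punit x ⊙ m);
  run_runi : forall (x y : D) (m : pro x y), run m ∙ runi m ≈ cid m;
  runi_run : forall (x y : D) (m : pro x y), runi m ∙ run m ≈ cid (m ⊙ punit y);
  triangle : forall (x y z : D) (m : pro x y) (n : pro y z),
    (cid m ⊗ lun n) ∙ assoc m (punit y) n ≈ run m ⊗ cid n;
  pentagon : forall (x y z w v : D)
    (m : pro x y) (n : pro y z) (p : pro z w) (q : pro w v),
    assoc m n (p ⊙ q) ∙ assoc (m ⊙ n) p q
    ≈ (cid m ⊗ assoc n p q) ∙ (assoc m (n ⊙ p) q ∙ (assoc m n p ⊗ cid q))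
}.

Record double_category := {
  dc_data :> dbl_data;
  dc_laws : dbl_laws dc_data
}.

Arguments comph_id_l {D} _ {x y} f.
Arguments comph_id_r {D} _ {x y} f.
Arguments comph_assoc {D} _ {x y z w} h g f.

(** ** Equality of cells *)

Lemma ceq_of_eq {D : dbl_data} {x y x' y' : D} {m : pro x y} {n : pro x' y'}
    {f : hom x x'} {g : hom y y'} {a b : cell f g m n} : a = b -> a ≈ b.
Proof. intros ->; constructor. Qed.

Lemma ceq_sym {D : dbl_data} {x y x' y' : D} {m : pro x y} {n : pro x' y'}
    {f f' : hom x x'} {g g' : hom y y'} {a : cell f g m n} {b : cell f' g' m n} :
  a ≈ b -> b ≈ a.
Proof. intros []; constructor. Qed.

Lemma ceq_trans {D : dbl_data} {x y x' y' : D} {m : pro x y} {n : pro x' y'}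
    {f f' f'' : hom x x'} {g g' g'' : hom y y'}
    {a : cell f g m n} {b : cell f' g' m n} {c : cell f'' g'' m n} :
  a ≈ b -> b ≈ c -> a ≈ c.
Proof. intros H []; exact H. Qed.

Lemma ceq_inv {D : dbl_data} {x y x' y' : D} {m : pro x y} {n : pro x' y'}
    {f f' : hom x x'} {g g' : hom y y'} {a : cell f g m n} {b : cell f' g' m n} :
  a ≈ b -> exists (ef : f = f') (eg : g = g'), ccast ef eg a = b.
Proof. intros []; exists eq_refl, eq_refl; reflexivity. Qed.

Lemma eq_of_ceq {D : dbl_data} {x y x' y' : D} {m : pro x y} {n : pro x' y'}
    {f : hom x x'} {g : hom y y'} {a b : cell f g m n} : a ≈ b -> a = b.
Proof.
  intros H; destruct (ceq_inv H) as (ef & eg & E).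
  rewrite (proof_irrelevance _ ef eq_refl), (proof_irrelevance _ eg eq_refl) in E.
  exact E.
Qed.

Lemma ceq_cast {D : dbl_data} {x y x' y' : D} {m : pro x y} {n : pro x' y'}
    {f f' : hom x x'} {g g' : hom y y'} (ef : f = f') (eg : g = g')
    (a : cell f g m n) : ccast ef eg a ≈ a.
Proof. destruct ef, eg; constructor. Qed.

Lemma ceq_vcomp {D : dbl_data} {x y x' y' x'' y'' : D}
    {m : pro x y} {n : pro x' y'} {p : pro x'' y''}
    {f f1 : hom x x'} {g g1 : hom y y'} {h h1 : hom x' x''} {k k1 : hom y' y''}
    {b : cell h k n p} {b1 : cell h1 k1 n p} {a : cell f g m n} {a1 : cell f1 g1 m n} :
  b ≈ b1 -> a ≈ a1 -> b ∙ a ≈ b1 ∙ a1.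
Proof. intros [] []; constructor. Qed.

Lemma ceq_ctens {D : dbl_data} {x y z x' y' z' : D}
    {m : pro x y} {n : pro y z} {m' : pro x' y'} {n' : pro y' z'}
    {f f1 : hom x x'} {g g1 : hom y y'} {h h1 : hom z z'}
    {a : cell f g m m'} {a1 : cell f1 g1 m m'}
    {b : cell g h n n'} {b1 : cell g1 h1 n n'} :
  a ≈ a1 -> b ≈ b1 -> a ⊗ b ≈ a1 ⊗ b1.
Proof.
  intros Ha; revert h1 b1; destruct Ha; intros h1 b1 Hb.
  destruct (ceq_inv Hb) as (ef & eg & E).
  rewrite (proof_irrelevance _ ef eq_refl) in E; destruct eg; subst b1; constructor.
Qed.

(** Vertical composite of globular cells, again over identity arrows. *)
Definition gcomp {D : double_category} {x y : D} {m n p : pro x y}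
    (b : cell (idh x) (idh y) n p) (a : cell (idh x) (idh y) m n) :
    cell (idh x) (idh y) m p :=
  ccast (comph_id_l (dc_laws D) _) (comph_id_l (dc_laws D) _) (b ∙ a).

(** External composite of cells whose common boundary arrow agrees only up to
    a given equality. *)
Definition ctens_along {D : dbl_data} {x y z x' y' z' : D}
    {f : hom x x'} {g g' : hom y y'} {h : hom z z'}
    {m : pro x y} {n : pro y z} {m' : pro x' y'} {n' : pro y' z'}
    (e : g = g') (a : cell f g m m') (b : cell g' h n n') :
    cell f h (m ⊙ n) (m' ⊙ n') :=
  ccast eq_refl e a ⊗ b.

Definition is_iso {D : dbl_data} {x y : D} (f : hom x y) : Prop :=
  exists g : hom y x, g ∘ f = idh x /\ f ∘ g = idh y.

Definition is_iso_cell {D : dbl_data} {x y x' y' : D} {f : hom x x'} {g : hom y y'}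
    {m : pro x y} {n : pro x' y'} (a : cell f g m n) : Prop :=
  exists (f' : hom x' x) (g' : hom y' y) (b : cell f' g' n m),
    b ∙ a ≈ cid m /\ a ∙ b ≈ cid n.

(** * Lax double functors *)

Record lax_data (D E : dbl_data) := {
  lob :> D -> E;
  lhom : forall {x y : D}, hom x y -> hom (lob x) (lob y);
  lpro : forall {x y : D}, pro x y -> pro (lob x) (lob y);
  lcell : forall {x y x' y' : D} {f : hom x x'} {g : hom y y'} {m : pro x y} {n : pro x' y'},
    cell f g m n -> cell (lhom f) (lhom g) (lpro m) (lpro n);
  ltens : forall {x y z : D} (m : pro x y) (n : pro y z),
    cell (idh (lob x)) (idh (lob z)) (lpro m ⊙ lpro n) (lpro (m ⊙ n));
  lunit : forall x : D, cell (idh (lob x)) (idh (lob x)) (punit (lob x)) (lpro (punit x))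
}.

Arguments lob {D E} _ _.
Arguments lhom {D E} _ {x y} _.
Arguments lpro {D E} _ {x y} _.
Arguments lcell {D E} _ {x y x' y' f g m n} _.
Arguments ltens {D E} _ {x y z} m n.
Arguments lunit {D E} _ x.

Record lax_laws {D E : dbl_data} (F : lax_data D E) : Prop := {
  lhom_id : forall x : D, lhom F (idh x) = idh (F x);
  lhom_comp : forall (x y z : D) (g : hom y z) (f : hom x y),
    lhom F (g ∘ f) = lhom F g ∘ lhom F f;
  lcell_id : forall (x y : D) (m : pro x y), lcell F (cid m) ≈ cid (lpro F m);
  lcell_comp : forall (x y x1 y1 x2 y2 : D)
    (f1 : hom x x1) (g1 : hom y y1) (f2 : hom x1 x2) (g2 : hom y1 y2) m m1 m2
    (b : cell f2 g2 m1 m2) (a : cell f1 g1 m m1),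
    lcell F (b ∙ a) ≈ lcell F b ∙ lcell F a;
  ltens_nat : forall (x y z x' y' z' : D)
    (f : hom x x') (g : hom y y') (h : hom z z') m n m' n'
    (a : cell f g m m') (b : cell g h n n'),
    lcell F (a ⊗ b) ∙ ltens F m n ≈ ltens F m' n' ∙ (lcell F a ⊗ lcell F b);
  lunit_nat : forall (x y : D) (f : hom x y),
    lcell F (cunit f) ∙ lunit F x ≈ lunit F y ∙ cunit (lhom F f);
  ltens_assoc : forall (x y z w : D) (m : pro x y) (n : pro y z) (p : pro z w),
    lcell F (assoc m n p) ∙ (ltens F (m ⊙ n) p ∙ (ltens F m n ⊗ cid (lpro F p)))
    ≈ ltens F m (n ⊙ p) ∙ ((cid (lpro F m) ⊗ ltens F n p)
                             ∙ assoc (lpro F m) (lpro F n) (lpro F p));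
  ltens_lun : forall (x y : D) (m : pro x y),
    lcell F (lun m) ∙ (ltens F (punit x) m ∙ (lunit F x ⊗ cid (lpro F m)))
    ≈ lun (lpro F m);
  ltens_run : forall (x y : D) (m : pro x y),
    lcell F (run m) ∙ (ltens F m (punit y) ∙ (cid (lpro F m) ⊗ lunit F y))
    ≈ run (lpro F m)
}.

Record lax_functor (D E : dbl_data) := {
  lf_data :> lax_data D E;
  lf_laws : lax_laws lf_data
}.

(** Cells between two proarrows with arbitrary boundary arrows; [≈] is equality
    of the corresponding elements, so that vertical pastings can be rewritten. *)
Definition sq {D : dbl_data} {x y x' y' : D} (m : pro x y) (n : pro x' y') :=
  {f : hom x x' & {g : hom y y' & cell f g m n}}.
Definition to_sq {D : dbl_data} {x y x' y' : D} {m : pro x y} {n : pro x' y'}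
    {f : hom x x'} {g : hom y y'} (a : cell f g m n) : sq m n :=
  existT _ f (existT _ g a).
Definition sq_comp {D : dbl_data} {x y x' y' x'' y'' : D}
    {m : pro x y} {n : pro x' y'} {p : pro x'' y''} (b : sq n p) (a : sq m n) : sq m p :=
  to_sq (projT2 (projT2 b) ∙ projT2 (projT2 a)).

Lemma to_sq_comp {D : dbl_data} {x y x' y' x'' y'' : D}
    {m : pro x y} {n : pro x' y'} {p : pro x'' y''}
    {f : hom x x'} {g : hom y y'} {f' : hom x' x''} {g' : hom y' y''}
    (b : cell f' g' n p) (a : cell f g m n) :
  to_sq (b ∙ a) = sq_comp (to_sq b) (to_sq a).
Proof. reflexivity. Qed.

Lemma sq_of_ceq {D : dbl_data} {x y x' y' : D} {m : pro x y} {n : pro x' y'}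
    {f f' : hom x x'} {g g' : hom y y'} {a : cell f g m n} {b : cell f' g' m n} :
  a ≈ b -> to_sq a = to_sq b.
Proof. intros []; reflexivity. Qed.

Lemma ceq_of_sq {D : dbl_data} {x y x' y' : D} {m : pro x y} {n : pro x' y'}
    {f f' : hom x x'} {g g' : hom y y'} {a : cell f g m n} {b : cell f' g' m n} :
  to_sq a = to_sq b -> a ≈ b.
Proof.
  intros H.
  change (projT2 (projT2 (to_sq a)) ≈ b); rewrite H; constructor.
Qed.

Lemma sq_cast {D : dbl_data} {x y x' y' : D} {m : pro x y} {n : pro x' y'}
    {f f' : hom x x'} {g g' : hom y y'} (ef : f = f') (eg : g = g')
    (a : cell f g m n) : to_sq (ccast ef eg a) = to_sq a.
Proof. apply sq_of_ceq, ceq_cast. Qed.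

Lemma sq_comp_assoc {D : dbl_data} (HD : dbl_laws D) {x y x1 y1 x2 y2 x3 y3 : D}
    {m : pro x y} {m1 : pro x1 y1} {m2 : pro x2 y2} {m3 : pro x3 y3}
    (c : sq m2 m3) (b : sq m1 m2) (a : sq m m1) :
  sq_comp c (sq_comp b a) = sq_comp (sq_comp c b) a.
Proof.
  destruct a as (? & ? & a), b as (? & ? & b), c as (? & ? & c).
  apply sq_of_ceq, (vcomp_assoc _ HD).
Qed.

Lemma sq_comp_idl {D : dbl_data} (HD : dbl_laws D) {x y x1 y1 : D}
    {m : pro x y} {m1 : pro x1 y1} (a : sq m m1) : sq_comp (to_sq (cid m1)) a = a.
Proof. destruct a as (? & ? & a); apply (sq_of_ceq (vcomp_id_l _ HD _ _ _ _ _ _ _ _ a)). Qed.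

Lemma sq_comp_idr {D : dbl_data} (HD : dbl_laws D) {x y x1 y1 : D}
    {m : pro x y} {m1 : pro x1 y1} (a : sq m m1) : sq_comp a (to_sq (cid m)) = a.
Proof. destruct a as (? & ? & a); apply (sq_of_ceq (vcomp_id_r _ HD _ _ _ _ _ _ _ _ a)). Qed.

Lemma ceq_lcell {D E : dbl_data} (F : lax_data D E) {x y x' y' : D}
    {m : pro x y} {n : pro x' y'} {f f' : hom x x'} {g g' : hom y y'}
    {a : cell f g m n} {b : cell f' g' m n} : a ≈ b -> lcell F a ≈ lcell F b.
Proof. intros []; constructor. Qed.

Lemma sq_lcell {D E : dbl_data} (F : lax_data D E) {x y x' y' : D}
    {m : pro x y} {n : pro x' y'} {f f' : hom x x'} {g g' : hom y y'}
    {a : cell f g m n} {b : cell f' g' m n} :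
  to_sq a = to_sq b -> to_sq (lcell F a) = to_sq (lcell F b).
Proof. intros H; apply sq_of_ceq, ceq_lcell, ceq_of_sq, H. Qed.

Lemma sq_lcell_comp {D E : dbl_data} {F : lax_data D E} (HF : lax_laws F)
    {x y x1 y1 x2 y2 : D} {f1 : hom x x1} {g1 : hom y y1} {f2 : hom x1 x2} {g2 : hom y1 y2}
    {m m1 m2} (b : cell f2 g2 m1 m2) (a : cell f1 g1 m m1) :
  to_sq (lcell F (b ∙ a)) = sq_comp (to_sq (lcell F b)) (to_sq (lcell F a)).
Proof. exact (sq_of_ceq (lcell_comp _ HF _ _ _ _ _ _ _ _ _ _ _ _ _ b a)). Qed.

Lemma sq_ctens {D : dbl_data} {x y z x' y' z' : D}
    {m : pro x y} {n : pro y z} {m' : pro x' y'} {n' : pro y' z'}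
    {f f1 : hom x x'} {g g1 : hom y y'} {h h1 : hom z z'}
    {a : cell f g m m'} {a1 : cell f1 g1 m m'}
    {b : cell g h n n'} {b1 : cell g1 h1 n n'} :
  to_sq a = to_sq a1 -> to_sq b = to_sq b1 -> to_sq (a ⊗ b) = to_sq (a1 ⊗ b1).
Proof. intros Ha Hb; apply sq_of_ceq, ceq_ctens; apply ceq_of_sq; assumption. Qed.

(** ** Identity and composite lax functors *)

Definition lax_id_data (D : dbl_data) : lax_data D D :=
  {| lob := fun x => x;
     lhom := fun _ _ f => f;
     lpro := fun _ _ m => m;
     lcell := fun _ _ _ _ _ _ _ _ a => a;
     ltens := fun _ _ _ m n => cid (m ⊙ n);
     lunit := fun x => cid (punit x) |}.

Lemma lax_id_laws (D : double_category) : lax_laws (lax_id_data D).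
Proof.
  pose proof (dc_laws D) as HD.
  constructor; cbn; intros; try reflexivity; try constructor; apply ceq_of_sq;
    rewrite ?to_sq_comp, ?(ctens_id _ HD), ?(sq_comp_idl HD), ?(sq_comp_idr HD);
    reflexivity.
Qed.

Definition lax_id (D : double_category) : lax_functor D D :=
  {| lf_data := lax_id_data D; lf_laws := lax_id_laws D |}.

Lemma lhom_id_comp {D E : dbl_data} (HE : dbl_laws E) (F : lax_data D E)
    (HF : lax_laws F) (x : D) : lhom F (idh x) ∘ idh (F x) = idh (F x).
Proof. rewrite (lhom_id _ HF); apply (comph_id_l HE). Qed.

Lemma sq_ltens_nat {D E : dbl_data} {F : lax_data D E} (HF : lax_laws F)
    {x y z x' y' z' : D} {f : hom x x'} {g : hom y y'} {h : hom z z'} {m n m' n'}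
    (a : cell f g m m') (b : cell g h n n') :
  sq_comp (to_sq (lcell F (a ⊗ b))) (to_sq (ltens F m n))
  = sq_comp (to_sq (ltens F m' n')) (to_sq (lcell F a ⊗ lcell F b)).
Proof. exact (sq_of_ceq (ltens_nat _ HF _ _ _ _ _ _ _ _ _ _ _ _ _ a b)). Qed.

Lemma sq_ltens_assoc {D E : dbl_data} {F : lax_data D E} (HF : lax_laws F)
    {x y z w : D} (m : pro x y) (n : pro y z) (p : pro z w) :
  sq_comp (to_sq (lcell F (assoc m n p)))
    (sq_comp (to_sq (ltens F (m ⊙ n) p)) (to_sq (ltens F m n ⊗ cid (lpro F p))))
  = sq_comp (to_sq (ltens F m (n ⊙ p)))
      (sq_comp (to_sq (cid (lpro F m) ⊗ ltens F n p))
         (to_sq (assoc (lpro F m) (lpro F n) (lpro F p)))).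
Proof. exact (sq_of_ceq (ltens_assoc _ HF _ _ _ _ m n p)). Qed.

Lemma sq_ltens_lun {D E : dbl_data} {F : lax_data D E} (HF : lax_laws F)
    {x y : D} (m : pro x y) :
  sq_comp (to_sq (lcell F (lun m)))
    (sq_comp (to_sq (ltens F (punit x) m)) (to_sq (lunit F x ⊗ cid (lpro F m))))
  = to_sq (lun (lpro F m)).
Proof. exact (sq_of_ceq (ltens_lun _ HF _ _ m)). Qed.

Lemma sq_ltens_run {D E : dbl_data} {F : lax_data D E} (HF : lax_laws F)
    {x y : D} (m : pro x y) :
  sq_comp (to_sq (lcell F (run m)))
    (sq_comp (to_sq (ltens F m (punit y))) (to_sq (cid (lpro F m) ⊗ lunit F y)))
  = to_sq (run (lpro F m)).
Proof. exact (sq_of_ceq (ltens_run _ HF _ _ m)). Qed.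

Lemma sq_cid_lcell {D E : dbl_data} (HE : dbl_laws E) {F : lax_data D E}
    (HF : lax_laws F) {x y : D} (m : pro x y) :
  to_sq (cid (lpro F m)) = to_sq (lcell F (cid m) ∙ cid (lpro F m)).
Proof.
  rewrite to_sq_comp, (sq_comp_idr HE); symmetry; apply sq_of_ceq, (lcell_id _ HF).
Qed.

Lemma sq_whisker_r {D E : dbl_data} (HE : dbl_laws E) {G : lax_data D E}
    (HG : lax_laws G) {x y z : D} {m m' : pro x y} {n : pro y z} {k : pro (G x) (G y)}
    (b : cell (idh x) (idh y) m m') (a : cell (idh (G x)) (idh (G y)) k (lpro G m))
    (e : lhom G (idh x) ∘ idh (G x) = idh (G x))
    (e' : lhom G (idh y) ∘ idh (G y) = idh (G y)) :
  to_sq (ccast e e' (lcell G b ∙ a) ⊗ cid (lpro G n))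
  = sq_comp (to_sq (lcell G b ⊗ lcell G (cid n))) (to_sq (a ⊗ cid (lpro G n))).
Proof.
  transitivity (to_sq ((lcell G b ∙ a) ⊗ (lcell G (cid n) ∙ cid (lpro G n)))).
  - apply sq_ctens; [apply sq_cast | apply (sq_cid_lcell HE HG)].
  - rewrite (ctens_comp _ HE); reflexivity.
Qed.

Lemma sq_whisker_l {D E : dbl_data} (HE : dbl_laws E) {G : lax_data D E}
    (HG : lax_laws G) {x y z : D} {m : pro x y} {n n' : pro y z} {k : pro (G y) (G z)}
    (b : cell (idh y) (idh z) n n') (a : cell (idh (G y)) (idh (G z)) k (lpro G n))
    (e : lhom G (idh y) ∘ idh (G y) = idh (G y))
    (e' : lhom G (idh z) ∘ idh (G z) = idh (G z)) :
  to_sq (cid (lpro G m) ⊗ ccast e e' (lcell G b ∙ a))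
  = sq_comp (to_sq (lcell G (cid m) ⊗ lcell G b)) (to_sq (cid (lpro G m) ⊗ a)).
Proof.
  transitivity (to_sq ((lcell G (cid m) ∙ cid (lpro G m)) ⊗ (lcell G b ∙ a))).
  - apply sq_ctens; [apply (sq_cid_lcell HE HG) | apply sq_cast].
  - rewrite (ctens_comp _ HE); reflexivity.
Qed.

Definition lax_comp_data {C D : dbl_data} {E : double_category}
    (G : lax_functor D E) (F : lax_data C D) : lax_data C E :=
  {| lob := fun x => G (F x);
     lhom := fun _ _ f => lhom G (lhom F f);
     lpro := fun _ _ m => lpro G (lpro F m);
     lcell := fun _ _ _ _ _ _ _ _ a => lcell G (lcell F a);
     ltens := fun x y z m n =>
       ccast (lhom_id_comp (dc_laws E) G (lf_laws _ _ G) (F x))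
             (lhom_id_comp (dc_laws E) G (lf_laws _ _ G) (F z))
             (lcell G (ltens F m n) ∙ ltens G (lpro F m) (lpro F n));
     lunit := fun x =>
       ccast (lhom_id_comp (dc_laws E) G (lf_laws _ _ G) (F x))
             (lhom_id_comp (dc_laws E) G (lf_laws _ _ G) (F x))
             (lcell G (lunit F x) ∙ lunit G (F x)) |}.

Lemma lax_comp_laws {C : dbl_data} {D E : double_category}
    (G : lax_functor D E) (F : lax_functor C D) : lax_laws (lax_comp_data G F).
Proof.
  pose proof (dc_laws D) as HD; pose proof (dc_laws E) as HE.
  destruct F as [F HF]; destruct G as [G HG]; cbn [lf_data].
  constructor; cbn; intros.
  - rewrite (lhom_id _ HF); apply (lhom_id _ HG).
  - rewrite (lhom_comp _ HF); apply (lhom_comp _ HG).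
  - eapply ceq_trans; [apply ceq_lcell, (lcell_id _ HF) | apply (lcell_id _ HG)].
  - eapply ceq_trans; [apply ceq_lcell, (lcell_comp _ HF) | apply (lcell_comp _ HG)].
  - apply ceq_of_sq.
    rewrite !to_sq_comp, !sq_cast, !to_sq_comp, (sq_comp_assoc HE),
      <- (sq_lcell_comp HG), (sq_lcell G (sq_of_ceq (ltens_nat _ HF _ _ _ _ _ _ _ _ _ _ _ _ _ a b))),
      (sq_lcell_comp HG), <- !(sq_comp_assoc HE).
    f_equal; exact (sq_of_ceq (ltens_nat _ HG _ _ _ _ _ _ _ _ _ _ _ _ _ _ _)).
  - apply ceq_of_sq.
    rewrite !to_sq_comp, !sq_cast, !to_sq_comp, (sq_comp_assoc HE),
      <- (sq_lcell_comp HG), (sq_lcell G (sq_of_ceq (lunit_nat _ HF _ _ f))),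
      (sq_lcell_comp HG), <- !(sq_comp_assoc HE).
    f_equal; exact (sq_of_ceq (lunit_nat _ HG _ _ _)).
  - apply ceq_of_sq.
    rewrite !to_sq_comp, !sq_cast, !to_sq_comp, (sq_whisker_r HE HG),
      (sq_whisker_l HE HG), <- !(sq_comp_assoc HE).
    rewrite (sq_comp_assoc HE _ (to_sq (lcell G (ltens F m n) ⊗ _))),
      <- (sq_ltens_nat HG), (sq_comp_assoc HE _ (to_sq (_ ⊗ lcell G (ltens F n p)))),
      <- (sq_ltens_nat HG), <- !(sq_comp_assoc HE).
    rewrite <- (sq_ltens_assoc HG).
    rewrite !(sq_comp_assoc HE), <- !(sq_lcell_comp HG).
    do 2 f_equal.
    apply sq_lcell, sq_of_ceq.
    eapply ceq_trans; [| eapply ceq_trans; [apply (ltens_assoc _ HF) |]];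
      [apply ceq_sym |]; apply (vcomp_assoc _ HD).
  - apply ceq_of_sq.
    rewrite !to_sq_comp, !sq_cast, !to_sq_comp, (sq_whisker_r HE HG),
      <- !(sq_comp_assoc HE).
    rewrite (sq_comp_assoc HE _ (to_sq (lcell G (lunit F x) ⊗ _))),
      <- (sq_ltens_nat HG), <- !(sq_comp_assoc HE).
    rewrite !(sq_comp_assoc HE), <- !(sq_lcell_comp HG), <- !(sq_comp_assoc HE).
    rewrite <- (sq_ltens_lun HG), !(sq_comp_assoc HE).
    do 2 f_equal.
    apply sq_lcell, sq_of_ceq.
    eapply ceq_trans; [apply ceq_sym, (vcomp_assoc _ HD) | apply (ltens_lun _ HF)].
  - apply ceq_of_sq.
    rewrite !to_sq_comp, !sq_cast, !to_sq_comp, (sq_whisker_l HE HG),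
      <- !(sq_comp_assoc HE).
    rewrite (sq_comp_assoc HE _ (to_sq (_ ⊗ lcell G (lunit F y)))),
      <- (sq_ltens_nat HG), <- !(sq_comp_assoc HE).
    rewrite !(sq_comp_assoc HE), <- !(sq_lcell_comp HG), <- !(sq_comp_assoc HE).
    rewrite <- (sq_ltens_run HG), !(sq_comp_assoc HE).
    do 2 f_equal.
    apply sq_lcell, sq_of_ceq.
    eapply ceq_trans; [apply ceq_sym, (vcomp_assoc _ HD) | apply (ltens_run _ HF)].
Qed.

Definition lax_comp {C : dbl_data} {D E : double_category}
    (G : lax_functor D E) (F : lax_functor C D) : lax_functor C E :=
  {| lf_data := lax_comp_data G F; lf_laws := lax_comp_laws G F |}.

(** * Products and the walking proarrow *)

Definition prod_data (D E : dbl_data) : dbl_data :=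
  {| ob := ob D * ob E;
     hom := fun x y => (hom (fst x) (fst y) * hom (snd x) (snd y))%type;
     idh := fun x => (idh (fst x), idh (snd x));
     comph := fun _ _ _ g f => (fst g ∘ fst f, snd g ∘ snd f);
     pro := fun x y => (pro (fst x) (fst y) * pro (snd x) (snd y))%type;
     cell := fun _ _ _ _ f g m n =>
       (cell (fst f) (fst g) (fst m) (fst n) * cell (snd f) (snd g) (snd m) (snd n))%type;
     cid := fun _ _ m => (cid (fst m), cid (snd m));
     vcomp := fun _ _ _ _ _ _ _ _ _ _ _ _ _ b a => (fst b ∙ fst a, snd b ∙ snd a);
     punit := fun x => (punit (fst x), punit (snd x));
     cunit := fun _ _ f => (cunit (fst f), cunit (snd f));
     ptens := fun _ _ _ m n => (fst m ⊙ fst n, snd m ⊙ snd n);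
     ctens := fun _ _ _ _ _ _ _ _ _ _ _ _ _ a b => (fst a ⊗ fst b, snd a ⊗ snd b);
     assoc := fun _ _ _ _ m n p =>
       (assoc (fst m) (fst n) (fst p), assoc (snd m) (snd n) (snd p));
     associ := fun _ _ _ _ m n p =>
       (associ (fst m) (fst n) (fst p), associ (snd m) (snd n) (snd p));
     lun := fun _ _ m => (lun (fst m), lun (snd m));
     luni := fun _ _ m => (luni (fst m), luni (snd m));
     run := fun _ _ m => (run (fst m), run (snd m));
     runi := fun _ _ m => (runi (fst m), runi (snd m)) |}.

Lemma ceq_pair {D E : dbl_data} {x y x' y' : D} {u v u' v' : E}
    {f f1 : hom x x'} {g g1 : hom y y'} {m : pro x y} {n : pro x' y'}
    {h h1 : hom u u'} {k k1 : hom v v'} {p : pro u v} {q : pro u' v'}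
    {a : cell f g m n} {a1 : cell f1 g1 m n} {b : cell h k p q} {b1 : cell h1 k1 p q} :
  a ≈ a1 -> b ≈ b1 ->
  @ceq (prod_data D E) (x, u) (y, v) (x', u') (y', v') (m, p) (n, q)
    (f, h) (g, k) (a, b) (f1, h1) (g1, k1) (a1, b1).
Proof. intros [] []; constructor. Qed.

Ltac destruct_pairs := repeat match goal with H : (_ * _)%type |- _ => destruct H end.

Lemma prod_laws (D E : double_category) : dbl_laws (prod_data D E).
Proof.
  destruct (dc_laws D), (dc_laws E).
  constructor; cbn; intros; destruct_pairs; cbn in *; destruct_pairs; cbn in *;
    try apply ceq_pair; try (f_equal; auto); auto.
Qed.

Definition dbl_prod (D E : double_category) : double_category :=
  {| dc_data := prod_data D E; dc_laws := prod_laws D E |}.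

Inductive two := zero | one.

Definition arrI (i j : two) : Type :=
  match i, j with zero, zero | one, one => unit | _, _ => Empty_set end.
Definition proI (i j : two) : Type :=
  match i, j with one, zero => Empty_set | _, _ => unit end.

Definition arrI_id (i : two) : arrI i i := match i with zero => tt | one => tt end.
Definition arrI_comp {i j k : two} : arrI j k -> arrI i j -> arrI i k :=
  match i, j, k with
  | zero, zero, zero | one, one, one => fun _ _ => tt
  | zero, zero, one | one, one, zero => fun e _ => match e with end
  | zero, one, _ | one, zero, _ => fun _ e => match e with end
  end.
Definition proI_id (i : two) : proI i i := match i with zero => tt | one => tt end.
Definition proI_comp {i j k : two} : proI i j -> proI j k -> proI i k :=
  match i, j, k with
  | zero, _, zero | zero, _, one | one, one, one => fun _ _ => tt
  | one, zero, _ => fun e _ => match e with end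
  | one, one, zero => fun _ e => match e with end
  end.

(** The only arrows are identities, the only proarrow besides the external
    identities is [0 ⇸ 1], and the only cells are identities; hence there is
    exactly one cell on each boundary. *)
Definition walking_data : dbl_data :=
  {| ob := two;
     hom := arrI;
     idh := arrI_id;
     comph := fun _ _ _ => arrI_comp;
     pro := proI;
     cell := fun _ _ _ _ _ _ _ _ => unit;
     cid := fun _ _ _ => tt;
     vcomp := fun _ _ _ _ _ _ _ _ _ _ _ _ _ _ _ => tt;
     punit := proI_id;
     cunit := fun _ _ _ => tt;
     ptens := fun _ _ _ => proI_comp;
     ctens := fun _ _ _ _ _ _ _ _ _ _ _ _ _ _ _ => tt;
     assoc := fun _ _ _ _ _ _ _ => tt;
     associ := fun _ _ _ _ _ _ _ => tt;
     lun := fun _ _ _ => tt;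
     luni := fun _ _ _ => tt;
     run := fun _ _ _ => tt;
     runi := fun _ _ _ => tt |}.

Lemma arrI_irr {i j : two} (f g : arrI i j) : f = g.
Proof. destruct i, j, f, g; reflexivity. Qed.

Lemma ceqI {i j i' j' : walking_data} {m : pro i j} {n : pro i' j'}
    {f f' : hom i i'} {g g' : hom j j'} (a : cell f g m n) (b : cell f' g' m n) : a ≈ b.
Proof.
  destruct (arrI_irr f f'), (arrI_irr g g'), a, b; constructor.
Qed.

Lemma walking_laws : dbl_laws walking_data.
Proof. constructor; intros; try apply arrI_irr; try apply ceqI; reflexivity. Qed.

Definition walking_proarrow : double_category :=
  {| dc_data := walking_data; dc_laws := walking_laws |}.

(** * Modules *)

(** Data of a double functor [D × 𝕀 → E] that restricts to [F] on [D × {0}] and to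
    [G] on [D × {1}]: what is left to specify is the value on proarrows
    [(m, 0 ⇸ 1)], on the cells between them, and the laxators at the composites
    [(m, id_0) ⊙ (n, 0 ⇸ 1)] and [(m, 0 ⇸ 1) ⊙ (n, id_1)]. *)
Section Glue.
Context {D E : double_category} (F G : lax_functor D E).
Context (M : forall (x y : D), pro x y -> pro (F x) (G y)).
Context (Mc : forall (x y x' y' : D) (f : hom x x') (g : hom y y')
  (m : pro x y) (n : pro x' y'), cell f g m n -> cell (lhom F f) (lhom G g) (M _ _ m) (M _ _ n)).
Context (Ml : forall (x y z : D) (m : pro x y) (n : pro y z),
  cell (idh (F x)) (idh (G z)) (lpro F m ⊙ M _ _ n) (M _ _ (m ⊙ n))).
Context (Mr : forall (x y z : D) (m : pro x y) (n : pro y z),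
  cell (idh (F x)) (idh (G z)) (M _ _ m ⊙ lpro G n) (M _ _ (m ⊙ n))).

Let DI := dbl_prod D walking_proarrow.

Definition glue_at (i : two) : lax_functor D E :=
  match i with zero => F | one => G end.

Definition glue_hom {i j : two} : forall {x y : D}, hom x y -> arrI i j ->
    hom (glue_at i x) (glue_at j y) :=
  match i, j with
  | zero, zero => fun x y f _ => lhom F f
  | one, one => fun x y f _ => lhom G f
  | zero, one | one, zero => fun x y f e => match e with end
  end.

Definition glue_pro {i j : two} : forall {x y : D}, pro x y -> proI i j ->
    pro (glue_at i x) (glue_at j y) :=
  match i, j with
  | zero, zero => fun x y m _ => lpro F m
  | one, one => fun x y m _ => lpro G m
  | zero, one => fun x y m _ => M _ _ m
  | one, zero => fun x y m e => match e with end
  end.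

Definition glue_cell {i j i' j' : two} :
    forall {x y x' y' : D} {f : hom x x'} {g : hom y y'} {m : pro x y} {n : pro x' y'}
      (ef : arrI i i') (eg : arrI j j') (em : proI i j) (en : proI i' j'),
    cell f g m n ->
    cell (glue_hom f ef) (glue_hom g eg) (glue_pro m em) (glue_pro n en).
Proof.
  destruct i, j, i', j'; intros x y x' y' f g m n ef eg em en a; cbn in *;
    try (exact (match ef with end)); try (exact (match eg with end));
    try (exact (match em with end)); try (exact (match en with end)).
  - exact (lcell F a).
  - exact (Mc _ _ _ _ _ _ _ _ a).
  - exact (lcell G a).
Defined.

Definition glue_tens {i j k : two} :
    forall {x y z : D} (m : pro x y) (n : pro y z) (em : proI i j) (en : proI j k),
    cell (idh (glue_at i x)) (idh (glue_at k z))
      (glue_pro m em ⊙ glue_pro n en) (glue_pro (m ⊙ n) (proI_comp em en)).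
Proof.
  destruct i, j, k; intros x y z m n em en; cbn in *;
    try (exact (match em with end)); try (exact (match en with end)).
  - exact (ltens F m n).
  - exact (Ml _ _ _ m n).
  - exact (Mr _ _ _ m n).
  - exact (ltens G m n).
Defined.

Definition glue_unit (i : two) (x : D) :
    cell (idh (glue_at i x)) (idh (glue_at i x))
      (punit (glue_at i x)) (glue_pro (punit x) (proI_id i)) :=
  match i with zero => lunit F x | one => lunit G x end.

Definition glue : lax_data DI E :=
  {| lob := fun x : DI => glue_at (snd x) (fst x);
     lhom := fun (x y : DI) (f : hom x y) => glue_hom (fst f) (snd f);
     lpro := fun (x y : DI) (m : pro x y) => glue_pro (fst m) (snd m);
     lcell := fun (x y x' y' : DI) (f : hom x x') (g : hom y y') (m : pro x y)
       (n : pro x' y') (a : cell f g m n) =>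
       glue_cell (snd f) (snd g) (snd m) (snd n) (fst a);
     ltens := fun (x y z : DI) (m : pro x y) (n : pro y z) =>
       glue_tens (fst m) (fst n) (snd m) (snd n);
     lunit := fun x : DI => glue_unit (snd x) (fst x) |}.
End Glue.

Record module {D E : double_category} (F G : lax_functor D E) := {
  mpro :> forall {x y : D}, pro x y -> pro (F x) (G y);
  mcell : forall {x y x' y' : D} {f : hom x x'} {g : hom y y'} {m : pro x y} {n : pro x' y'},
    cell f g m n -> cell (lhom F f) (lhom G g) (mpro m) (mpro n);
  mactl : forall {x y z : D} (m : pro x y) (n : pro y z),
    cell (idh (F x)) (idh (G z)) (lpro F m ⊙ mpro n) (mpro (m ⊙ n));
  mactr : forall {x y z : D} (m : pro x y) (n : pro y z),
    cell (idh (F x)) (idh (G z)) (mpro m ⊙ lpro G n) (mpro (m ⊙ n));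
  mod_lax : lax_laws (glue F G (@mpro) (@mcell) (@mactl) (@mactr))
}.

Arguments mpro {D E F G} _ {x y} _.
Arguments mcell {D E F G} _ {x y x' y' f g m n} _.
Arguments mactl {D E F G} _ {x y z} m n.
Arguments mactr {D E F G} _ {x y z} m n.

(** * Families and lax products *)

(** The universe of the sets that index families. *)
Definition small := Type.

Record fam_ob (D : dbl_data) := { fidx : small; fobj :> fidx -> D }.
Arguments fidx {D} _.
Arguments fobj {D} _ _.

Record fam_hom {D : dbl_data} (X Y : fam_ob D) := {
  fh0 : fidx Y -> fidx X;
  fh1 : forall j, hom (X (fh0 j)) (Y j)
}.
Arguments Build_fam_hom {D X Y} _ _.
Arguments fh0 {D X Y} _ _.
Arguments fh1 {D X Y} _ _.

(** A span [A : I ⇸ J] is given by its fibres: [fp0 i j] is the set of the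
    [a : i ⇸ j].  The fibre of the pullback of [A] and [B] over [(i, k)] is then
    [{j & A i j * B j k}], and that of the identity span over [(i, j)] is [i = j]. *)
Record fam_pro {D : dbl_data} (X Y : fam_ob D) := {
  fp0 : fidx X -> fidx Y -> small;
  fp1 : forall i j, fp0 i j -> pro (X i) (Y j)
}.
Arguments Build_fam_pro {D X Y} _ _.
Arguments fp0 {D X Y} _ _ _.
Arguments fp1 {D X Y} _ {i j} _.

Record fam_cell {D : dbl_data} {X Y X' Y' : fam_ob D} (f : fam_hom X X') (g : fam_hom Y Y')
    (m : fam_pro X Y) (n : fam_pro X' Y') := {
  fc0 : forall k l, fp0 n k l -> fp0 m (fh0 f k) (fh0 g l);
  fc1 : forall k l (b : fp0 n k l), cell (fh1 f k) (fh1 g l) (fp1 m (fc0 k l b)) (fp1 n b)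
}.
Arguments Build_fam_cell {D X Y X' Y' f g m n} _ _.
Arguments fc0 {D X Y X' Y' f g m n} _ {k l} _.
Arguments fc1 {D X Y X' Y' f g m n} _ {k l} _.

Section Fam.
Context (D : double_category).

Definition fam_idh (X : fam_ob D) : fam_hom X X :=
  {| fh0 := fun i => i; fh1 := fun i => idh (X i) |}.

Definition fam_comph {X Y Z : fam_ob D} (g : fam_hom Y Z) (f : fam_hom X Y) : fam_hom X Z :=
  {| fh0 := fun k => fh0 f (fh0 g k); fh1 := fun k => fh1 g k ∘ fh1 f (fh0 g k) |}.

Definition fam_cid {X Y : fam_ob D} (m : fam_pro X Y) :
    fam_cell (fam_idh X) (fam_idh Y) m m :=
  @Build_fam_cell _ _ _ _ _ (fam_idh X) (fam_idh Y) m m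
    (fun _ _ a => a) (fun _ _ a => cid (fp1 m a)).

Definition fam_vcomp {X Y X' Y' X'' Y'' : fam_ob D} {f : fam_hom X X'} {g : fam_hom Y Y'}
    {f' : fam_hom X' X''} {g' : fam_hom Y' Y''}
    {m : fam_pro X Y} {n : fam_pro X' Y'} {p : fam_pro X'' Y''}
    (b : fam_cell f' g' n p) (a : fam_cell f g m n) :
    fam_cell (fam_comph f' f) (fam_comph g' g) m p :=
  @Build_fam_cell _ _ _ _ _ (fam_comph f' f) (fam_comph g' g) m p
    (fun _ _ c => fc0 a (fc0 b c)) (fun _ _ c => fc1 b c ∙ fc1 a (fc0 b c)).

Definition fam_punit (X : fam_ob D) : fam_pro X X :=
  {| fp0 := fun i j => i = j;
     fp1 := fun i j e => match e in _ = j return pro (X i) (X j) with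
                         | eq_refl => punit (X i) end |}.

Definition fam_cunit {X Y : fam_ob D} (f : fam_hom X Y) :
    fam_cell f f (fam_punit X) (fam_punit Y) :=
  @Build_fam_cell _ _ _ _ _ f f (fam_punit X) (fam_punit Y)
    (fun k l e => f_equal (fh0 f) e)
    (fun k l e => match e as e in _ = l
       return cell (fh1 f k) (fh1 f l) (fp1 (fam_punit X) (f_equal (fh0 f) e))
                (fp1 (fam_punit Y) e)
       with eq_refl => cunit (fh1 f k) end).

Definition fam_ptens {X Y Z : fam_ob D} (m : fam_pro X Y) (n : fam_pro Y Z) : fam_pro X Z :=
  {| fp0 := fun i k => {j : fidx Y & (fp0 m i j * fp0 n j k)%type};
     fp1 := fun i k c => fp1 m (fst (projT2 c)) ⊙ fp1 n (snd (projT2 c)) |}.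

Definition fam_ctens {X Y Z X' Y' Z' : fam_ob D}
    {f : fam_hom X X'} {g : fam_hom Y Y'} {h : fam_hom Z Z'}
    {m : fam_pro X Y} {n : fam_pro Y Z} {m' : fam_pro X' Y'} {n' : fam_pro Y' Z'}
    (a : fam_cell f g m m') (b : fam_cell g h n n') :
    fam_cell f h (fam_ptens m n) (fam_ptens m' n') :=
  @Build_fam_cell _ _ _ _ _ f h (fam_ptens m n) (fam_ptens m' n')
    (fun _ _ c => existT _ (fh0 g (projT1 c))
       (fc0 a (fst (projT2 c)), fc0 b (snd (projT2 c))))
    (fun _ _ c => fc1 a (fst (projT2 c)) ⊗ fc1 b (snd (projT2 c))).

Definition fam_assoc {X Y Z W : fam_ob D}
    (m : fam_pro X Y) (n : fam_pro Y Z) (p : fam_pro Z W) :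
    fam_cell (fam_idh X) (fam_idh W)
      (fam_ptens (fam_ptens m n) p) (fam_ptens m (fam_ptens n p)) :=
  @Build_fam_cell _ _ _ _ _ (fam_idh X) (fam_idh W)
    (fam_ptens (fam_ptens m n) p) (fam_ptens m (fam_ptens n p))
    (fun _ _ c => existT _ (projT1 (snd (projT2 c)))
       (existT _ (projT1 c) (fst (projT2 c), fst (projT2 (snd (projT2 c)))),
        snd (projT2 (snd (projT2 c)))))
    (fun _ _ c => assoc (fp1 m (fst (projT2 c))) (fp1 n (fst (projT2 (snd (projT2 c)))))
       (fp1 p (snd (projT2 (snd (projT2 c)))))).

Definition fam_associ {X Y Z W : fam_ob D}
    (m : fam_pro X Y) (n : fam_pro Y Z) (p : fam_pro Z W) :
    fam_cell (fam_idh X) (fam_idh W)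
      (fam_ptens m (fam_ptens n p)) (fam_ptens (fam_ptens m n) p) :=
  @Build_fam_cell _ _ _ _ _ (fam_idh X) (fam_idh W)
    (fam_ptens m (fam_ptens n p)) (fam_ptens (fam_ptens m n) p)
    (fun _ _ c => existT _ (projT1 (fst (projT2 c)))
       (fst (projT2 (fst (projT2 c))),
        existT _ (projT1 c) (snd (projT2 (fst (projT2 c))), snd (projT2 c))))
    (fun _ _ c => associ (fp1 m (fst (projT2 (fst (projT2 c)))))
       (fp1 n (snd (projT2 (fst (projT2 c))))) (fp1 p (snd (projT2 c)))).

Definition fam_lun {X Y : fam_ob D} (m : fam_pro X Y) :
    fam_cell (fam_idh X) (fam_idh Y) (fam_ptens (fam_punit X) m) m :=
  @Build_fam_cell _ _ _ _ _ (fam_idh X) (fam_idh Y) (fam_ptens (fam_punit X) m) m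
    (fun i _ a => existT _ i (eq_refl, a)) (fun _ _ a => lun (fp1 m a)).

Definition fam_run {X Y : fam_ob D} (m : fam_pro X Y) :
    fam_cell (fam_idh X) (fam_idh Y) (fam_ptens m (fam_punit Y)) m :=
  @Build_fam_cell _ _ _ _ _ (fam_idh X) (fam_idh Y) (fam_ptens m (fam_punit Y)) m
    (fun _ j a => existT _ j (a, eq_refl)) (fun _ _ a => run (fp1 m a)).

Definition fam_luni {X Y : fam_ob D} (m : fam_pro X Y) :
    fam_cell (fam_idh X) (fam_idh Y) m (fam_ptens (fam_punit X) m).
Proof.
  unshelve refine (@Build_fam_cell _ _ _ _ _ (fam_idh X) (fam_idh Y) m
    (fam_ptens (fam_punit X) m) _ _).
  - exact (fun i j c => match fst (projT2 c) in _ = i' return fp0 m i' j -> fp0 m i j with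
                        | eq_refl => fun a => a end (snd (projT2 c))).
  - intros i j [i' [e a]]; revert a; destruct e; intros a; exact (luni (fp1 m a)).
Defined.

Definition fam_runi {X Y : fam_ob D} (m : fam_pro X Y) :
    fam_cell (fam_idh X) (fam_idh Y) m (fam_ptens m (fam_punit Y)).
Proof.
  unshelve refine (@Build_fam_cell _ _ _ _ _ (fam_idh X) (fam_idh Y) m
    (fam_ptens m (fam_punit Y)) _ _).
  - exact (fun i j c => match snd (projT2 c) in _ = j' return fp0 m i j' with
                        | eq_refl => fst (projT2 c) end).
  - intros i j [j' [a e]]; destruct e; exact (runi (fp1 m a)).
Defined.

Definition fam_data : dbl_data :=
  {| ob := fam_ob D;
     hom := fam_hom;
     idh := fam_idh;
     comph := @fam_comph;
     pro := fam_pro;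
     cell := @fam_cell D;
     cid := @fam_cid;
     vcomp := @fam_vcomp;
     punit := fam_punit;
     cunit := @fam_cunit;
     ptens := @fam_ptens;
     ctens := @fam_ctens;
     assoc := @fam_assoc;
     associ := @fam_associ;
     lun := @fam_lun;
     luni := @fam_luni;
     run := @fam_run;
     runi := @fam_runi |}.

(** Components of cells of families, with their source proarrow and their
    boundary arrows allowed to vary along equalities. *)
Inductive fceq {X Y : fam_ob D} {m : fam_pro X Y} {x' y' : D} {n : pro x' y'}
    {i j} {u : hom (X i) x'} {v : hom (Y j) y'} {a : fp0 m i j} (c : cell u v (fp1 m a) n) :
    forall {i' j'} {u' : hom (X i') x'} {v' : hom (Y j') y'} {a' : fp0 m i' j'},
      cell u' v' (fp1 m a') n -> Prop :=
  fceq_refl : fceq c c.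

Lemma fceq_inv {X Y : fam_ob D} {m : fam_pro X Y} {x' y' : D} {n : pro x' y'}
    {i j} {u u' : hom (X i) x'} {v v' : hom (Y j) y'} {a a' : fp0 m i j}
    (c : cell u v (fp1 m a) n) (c' : cell u' v' (fp1 m a') n) :
  fceq c c' ->
  exists (eu : u = u') (ev : v = v') (ea : a = a'),
    eq_rect a (fun a => cell u' v' (fp1 m a) n) (ccast eu ev c) a' ea = c'.
Proof.
  intros H.
  pose (T i j := {u : hom (X i) x' & {v : hom (Y j) y' &
    {a : fp0 m i j & cell u v (fp1 m a) n}}}).
  pose (tot i j (u : hom (X i) x') (v : hom (Y j) y') (a : fp0 m i j)
    (c : cell u v (fp1 m a) n) :=
    existT _ i (existT _ j (existT _ u (existT _ v (existT _ a c)))) : {i & {j & T i j}}).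
  assert (E : tot _ _ _ _ _ c = tot _ _ _ _ _ c') by (destruct H; reflexivity).
  apply inj_pair2, inj_pair2 in E.
  assert (K : forall s t : T i j, s = t ->
    exists (eu : projT1 s = projT1 t) (ev : projT1 (projT2 s) = projT1 (projT2 t))
      (ea : projT1 (projT2 (projT2 s)) = projT1 (projT2 (projT2 t))),
    eq_rect _ (fun a => cell _ _ (fp1 m a) n)
      (ccast eu ev (projT2 (projT2 (projT2 s)))) _ ea = projT2 (projT2 (projT2 t))).
  { intros s _ <-; exists eq_refl, eq_refl, eq_refl; reflexivity. }
  exact (K _ _ E).
Qed.

Lemma fceq_of_ceq {X Y : fam_ob D} {m : fam_pro X Y} {x' y' : D} {n : pro x' y'}
    {i j} {u u' : hom (X i) x'} {v v' : hom (Y j) y'} {a : fp0 m i j}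
    (c : cell u v (fp1 m a) n) (c' : cell u' v' (fp1 m a) n) : c ≈ c' -> fceq c c'.
Proof. intros []; constructor. Qed.

Lemma fam_hom_eq {X Y : fam_ob D} (h : fidx Y -> fidx X)
    (u v : forall j, hom (X (h j)) (Y j)) :
  (forall j, u j = v j) -> Build_fam_hom h u = Build_fam_hom h v.
Proof. intros H; f_equal; extensionality j; apply H. Qed.

Lemma fam_cell_eq {X Y X' Y' : fam_ob D} {m : fam_pro X Y} {n : fam_pro X' Y'}
    {f f' : fam_hom X X'} {g g' : fam_hom Y Y'}
    (c : fam_cell f g m n) (c' : fam_cell f' g' m n) :
  f = f' -> g = g' -> (forall k l (b : fp0 n k l), fceq (fc1 c b) (fc1 c' b)) ->
  @ceq fam_data X Y X' Y' m n f g c f' g' c'.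
Proof.
  intros <- <- H.
  destruct c as [c0 c1], c' as [c0' c1']; cbn in H.
  assert (E : c0 = c0').
  { extensionality k; extensionality l; extensionality b.
    destruct (fceq_inv _ _ (H k l b)) as (_ & _ & ea & _); exact ea. }
  subst c0'.
  assert (E : c1 = c1').
  { extensionality k; extensionality l; extensionality b.
    destruct (fceq_inv _ _ (H k l b)) as (eu & ev & ea & K).
    rewrite (proof_irrelevance _ eu eq_refl), (proof_irrelevance _ ev eq_refl),
      (proof_irrelevance _ ea eq_refl) in K; exact K. }
  subst c1'; constructor.
Qed.

Lemma fam_laws : dbl_laws fam_data.
Proof.
  pose proof (dc_laws D) as HD.
  assert (IL : forall (X Y : fam_ob D) (f : fam_hom X Y), fam_comph (fam_idh Y) f = f).
  { intros X Y [f0 f1]; apply fam_hom_eq; intros j; apply (comph_id_l HD). }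
  assert (IR : forall (X Y : fam_ob D) (f : fam_hom X Y), fam_comph f (fam_idh X) = f).
  { intros X Y [f0 f1]; apply fam_hom_eq; intros j; apply (comph_id_r HD). }
  assert (AS : forall (X Y Z W : fam_ob D) (h : fam_hom Z W) (g : fam_hom Y Z)
    (f : fam_hom X Y), fam_comph h (fam_comph g f) = fam_comph (fam_comph h g) f).
  { intros X Y Z W [] [] []; apply fam_hom_eq; intros j; apply (comph_assoc HD). }
  constructor; cbn; intros;
    [apply IL | apply IR | apply AS | ..];
    try apply (@eq_of_ceq fam_data);
    (apply fam_cell_eq;
      [rewrite ?IL, ?IR; (reflexivity || apply AS)
      | rewrite ?IL, ?IR; (reflexivity || apply AS) | intros i0 j0 t; cbn in t]).
  all: repeat match goal with
    | t : sigT _ |- _ => destruct t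
    | t : (_ * _)%type |- _ => destruct t
    | t : _ = _ |- _ => destruct t
    end; cbn; apply fceq_of_ceq.
  - apply (vcomp_id_l _ HD).
  - apply (vcomp_id_r _ HD).
  - apply (vcomp_assoc _ HD).
  - apply ceq_of_eq, (cunit_id _ HD).
  - apply ceq_of_eq, (cunit_comp _ HD).
  - apply ceq_of_eq, (ctens_id _ HD).
  - apply ceq_of_eq, (ctens_comp _ HD).
  - apply (assoc_nat _ HD).
  - apply (lun_nat _ HD).
  - apply (run_nat _ HD).
  - apply (assoc_associ _ HD).
  - apply (associ_assoc _ HD).
  - apply (lun_luni _ HD).
  - apply (luni_lun _ HD).
  - apply (run_runi _ HD).
  - apply (runi_run _ HD).
  - apply (triangle _ HD).
  - apply (pentagon _ HD).
Qed.

Definition Fam : double_category := {| dc_data := fam_data; dc_laws := fam_laws |}.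
End Fam.

(** The double functor [Δ] sending everything to singleton families. *)
Section Delta.
Context (D : double_category).

Definition delta_ob (x : D) : fam_ob D := {| fidx := unit; fobj := fun _ => x |}.
Definition delta_hom {x y : D} (f : hom x y) : fam_hom (delta_ob x) (delta_ob y) :=
  @Build_fam_hom _ (delta_ob x) (delta_ob y) (fun i => i) (fun _ => f).
Definition delta_pro {x y : D} (m : pro x y) : fam_pro (delta_ob x) (delta_ob y) :=
  @Build_fam_pro _ (delta_ob x) (delta_ob y) (fun _ _ => unit) (fun _ _ _ => m).
Definition delta_cell {x y x' y' : D} {f : hom x x'} {g : hom y y'}
    {m : pro x y} {n : pro x' y'} (a : cell f g m n) :
    fam_cell (delta_hom f) (delta_hom g) (delta_pro m) (delta_pro n) :=
  @Build_fam_cell _ _ _ _ _ (delta_hom f) (delta_hom g) (delta_pro m) (delta_pro n)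
    (fun _ _ b => b) (fun _ _ _ => a).

Definition delta_tens {x y z : D} (m : pro x y) (n : pro y z) :
    fam_cell (fam_idh D (delta_ob x)) (fam_idh D (delta_ob z))
      (fam_ptens D (delta_pro m) (delta_pro n)) (delta_pro (m ⊙ n)) :=
  @Build_fam_cell _ _ _ _ _ (fam_idh D (delta_ob x)) (fam_idh D (delta_ob z))
    (fam_ptens D (delta_pro m) (delta_pro n)) (delta_pro (m ⊙ n))
    (fun _ _ _ => existT _ tt (tt, tt)) (fun _ _ _ => cid (m ⊙ n)).

Definition delta_unit (x : D) :
    fam_cell (fam_idh D (delta_ob x)) (fam_idh D (delta_ob x))
      (fam_punit D (delta_ob x)) (delta_pro (punit x)) :=
  @Build_fam_cell _ _ _ _ _ (fam_idh D (delta_ob x)) (fam_idh D (delta_ob x))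
    (fam_punit D (delta_ob x)) (delta_pro (punit x))
    (fun i j _ => match i, j with tt, tt => eq_refl end)
    (fun i j _ => match i, j with tt, tt => cid (punit x) end).

Definition delta_data : lax_data D (Fam D) :=
  {| lob := delta_ob : D -> Fam D;
     lhom := fun x y f => delta_hom f;
     lpro := fun x y m => delta_pro m;
     lcell := fun _ _ _ _ _ _ _ _ a => delta_cell a;
     ltens := fun _ _ _ m n => delta_tens m n;
     lunit := delta_unit |}.

Lemma delta_laws : lax_laws delta_data.
Proof.
  pose proof (dc_laws D) as HD; pose proof (dc_laws (Fam D)) as HF.
  constructor; cbn; intros; try reflexivity; try constructor;
    (apply fam_cell_eq;
      [apply fam_hom_eq; intros; cbn;
        rewrite ?(comph_id_l HD), ?(comph_id_r HD); reflexivity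
      |apply fam_hom_eq; intros; cbn;
        rewrite ?(comph_id_l HD), ?(comph_id_r HD); reflexivity
      |intros [] [] t; cbn in t;
       repeat match goal with t : sigT _ |- _ => destruct t | t : (_ * _)%type |- _ => destruct t
         | t : unit |- _ => destruct t | t : _ = _ |- _ => destruct t end; cbn; apply fceq_of_ceq, ceq_of_sq;
       cbn; rewrite ?to_sq_comp, ?(ctens_id _ HD), ?(sq_comp_idl HD), ?(sq_comp_idr HD);
       reflexivity]).
Qed.

Definition Delta : lax_functor D (Fam D) :=
  {| lf_data := delta_data; lf_laws := delta_laws |}.
End Delta.

(** * Transformations *)

(** [G_{n,id} ∙ (- ⊗ -)] and [G_{id,n} ∙ (- ⊗ -)] followed by the unitor: the right
    and left external pasting of a cell with a comparison cell, as cells [m -> G n]. *)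
Definition paste_r {D : dbl_data} {E : dbl_data} (G : lax_data D E) {w z : D} {n : pro w z}
    {x y : E} {m : pro x y} {f : hom x (G w)} {g h : hom y (G z)}
    (a : cell f g m (lpro G n)) (b : cell g h (punit y) (lpro G (punit z))) :=
  lcell G (run n) ∙ ltens G n (punit z) ∙ (a ⊗ b) ∙ runi m.

Definition paste_l {D : dbl_data} {E : dbl_data} (G : lax_data D E) {w z : D} {n : pro w z}
    {x y : E} {m : pro x y} {f g : hom x (G w)} {h : hom y (G z)}
    (b : cell f g (punit x) (lpro G (punit w))) (a : cell g h m (lpro G n)) :=
  lcell G (lun n) ∙ ltens G (punit w) n ∙ (b ⊗ a) ∙ luni m.

(** The composite [G_{id,id} ∙ (b ⊗ c)] of two comparison cells whose common
    boundary arrows are identified by [e]. *)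
Definition paste_cmp {D : dbl_data} {E : dbl_data} (G : lax_data D E) {z : D}
    {x : E} {f g g' h : hom x (G z)} (e : g = g')
    (b : cell f g (punit x) (lpro G (punit z))) (c : cell g' h (punit x) (lpro G (punit z))) :=
  lcell G (lun (punit z)) ∙ ltens G (punit z) (punit z) ∙ ctens_along e b c ∙ luni (punit x).

(** Object and proarrow components, which lax and oplax transformations share. *)
Record trans {D E : double_category} (F G : lax_functor D E) := {
  tob :> forall x : D, hom (F x) (G x);
  tpro : forall {x y : D} (m : pro x y), cell (tob x) (tob y) (lpro F m) (lpro G m);
  tpro_tens : forall (x y z : D) (m : pro x y) (n : pro y z),
    tpro (m ⊙ n) ∙ ltens F m n ≈ ltens G m n ∙ (tpro m ⊗ tpro n);
  tpro_unit : forall x : D, tpro (punit x) ∙ lunit F x ≈ lunit G x ∙ cunit (tob x)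
}.
Arguments tob {D E F G} _ x.
Arguments tpro {D E F G} _ {x y} m.

Record lax_trans {D E : double_category} (F G : lax_functor D E) := {
  lt_trans :> trans F G;
  lt_cmp : forall {x y : D} (f : hom x y),
    cell (lhom G f ∘ lt_trans x) (lt_trans y ∘ lhom F f) (punit (F x)) (lpro G (punit y));
  lt_cmp_id : forall x : D, lt_cmp (idh x) ≈ lunit G x ∙ cunit (lt_trans x);
  lt_cmp_comp : forall (x y z : D) (g : hom y z) (f : hom x y),
    lt_cmp (g ∘ f)
    ≈ paste_cmp G (comph_assoc (dc_laws E) _ _ _)
        (lcell G (cunit g) ∙ lt_cmp f) (lt_cmp g ∙ cunit (lhom F f));
  lt_cmp_cell : forall (x y w z : D) (f : hom x w) (g : hom y z) m n (c : cell f g m n),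
    paste_r G (lcell G c ∙ tpro lt_trans m) (lt_cmp g)
    ≈ paste_l G (lt_cmp f) (tpro lt_trans n ∙ lcell F c)
}.
Arguments lt_trans {D E F G} _.
Arguments lt_cmp {D E F G} _ {x y} f.

Record oplax_trans {D E : double_category} (F G : lax_functor D E) := {
  ot_trans :> trans F G;
  ot_cmp : forall {x y : D} (f : hom x y),
    cell (ot_trans y ∘ lhom F f) (lhom G f ∘ ot_trans x) (punit (F x)) (lpro G (punit y));
  ot_cmp_id : forall x : D, ot_cmp (idh x) ≈ lunit G x ∙ cunit (ot_trans x);
  ot_cmp_comp : forall (x y z : D) (g : hom y z) (f : hom x y),
    ot_cmp (g ∘ f)
    ≈ paste_cmp G (eq_sym (comph_assoc (dc_laws E) _ _ _))
        (ot_cmp g ∙ cunit (lhom F f)) (lcell G (cunit g) ∙ ot_cmp f);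
  ot_cmp_cell : forall (x y w z : D) (f : hom x w) (g : hom y z) m n (c : cell f g m n),
    paste_l G (ot_cmp f) (lcell G c ∙ tpro ot_trans m)
    ≈ paste_r G (tpro ot_trans n ∙ lcell F c) (ot_cmp g)
}.
Arguments ot_trans {D E F G} _.
Arguments ot_cmp {D E F G} _ {x y} f.

Definition is_strict {D E : double_category} {F G : lax_functor D E}
    (α : lax_trans F G) : Prop :=
  forall (x y : D) (f : hom x y),
    lhom G f ∘ α x = α y ∘ lhom F f /\
    lt_cmp α f ≈ lunit G y ∙ cunit (α y ∘ lhom F f).

Definition is_pseudo {D E : double_category} {F G : lax_functor D E}
    (α : lax_trans F G) : Prop :=
  forall (x y : D) (f : hom x y),
  exists β : cell (α y ∘ lhom F f) (lhom G f ∘ α x) (punit (F x)) (lpro G (punit y)),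
    paste_cmp G eq_refl (lt_cmp α f) β ≈ lunit G y ∙ cunit (lhom G f ∘ α x) /\
    paste_cmp G eq_refl β (lt_cmp α f) ≈ lunit G y ∙ cunit (α y ∘ lhom F f).

Definition strict_trans {D E : double_category} (F G : lax_functor D E) :=
  {α : lax_trans F G | is_strict α}.
Definition strict_core {D E : double_category} {F G : lax_functor D E}
    (α : strict_trans F G) : trans F G := proj1_sig α.
Coercion strict_core : strict_trans >-> trans.

(** * Lax products *)

(** Right adjoints in the 2-category of double categories, lax functors and
    (strict) natural transformations. *)
Record right_adjoint {D C : double_category} (L : lax_functor D C) := {
  radj :> lax_functor C D;
  adj_unit : strict_trans (lax_id D) (lax_comp radj L);
  adj_counit : strict_trans (lax_comp L radj) (lax_id C);
  adj_tri_l : forall x : D, adj_counit (L x) ∘ lhom L (adj_unit x) = idh (L x);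
  adj_tri_l_pro : forall (x y : D) (m : pro x y),
    tpro adj_counit (lpro L m) ∙ lcell L (tpro adj_unit m) ≈ cid (lpro L m);
  adj_tri_r : forall X : C, lhom radj (adj_counit X) ∘ adj_unit (radj X) = idh (radj X);
  adj_tri_r_pro : forall (X Y : C) (M : pro X Y),
    lcell radj (tpro adj_counit M) ∙ tpro adj_unit (lpro radj M) ≈ cid (lpro radj M)
}.
Arguments radj {D C L} _.
Arguments adj_unit {D C L} _.
Arguments adj_counit {D C L} _.

Definition lax_products (D : double_category) := right_adjoint (Delta D).

Section LaxProducts.
Context {D : double_category} (P : lax_products D).

Definition prodo (X : fam_ob D) : D := radj P X.
Definition prodp {X Y : fam_ob D} (M : fam_pro X Y) : pro (prodo X) (prodo Y) :=
  @lpro (Fam D) D (radj P) X Y M.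

Definition proj (X : fam_ob D) (i : fidx X) : hom (prodo X) (X i) :=
  fh1 (adj_counit P X : fam_hom (delta_ob D (prodo X)) X) i.

Definition projp {X Y : fam_ob D} (M : fam_pro X Y) {i : fidx X} {j : fidx Y}
    (a : fp0 M i j) : cell (proj X i) (proj Y j) (prodp M) (fp1 M a) :=
  fc1 (tpro (adj_counit P) M :
    @fam_cell D (delta_ob D (prodo X)) (delta_ob D (prodo Y)) X Y
      (adj_counit P X) (adj_counit P Y) (delta_pro D (prodp M)) M) a.

(** Transposition along [Δ ⊣ Π] of a cone of arrows, and of a cone of cells. *)
Definition tuple {z : D} {X : fam_ob D} (f : forall i, hom z (X i)) : hom z (prodo X) :=
  @lhom (Fam D) D (radj P) (delta_ob D z) X
    (@Build_fam_hom D (delta_ob D z) X (fun _ => tt) f) ∘ adj_unit P z.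

Definition tuplep {z w : D} {X Y : fam_ob D} {f : forall i, hom z (X i)}
    {g : forall j, hom w (Y j)} {m : pro z w} {M : fam_pro X Y}
    (c : forall i j (a : fp0 M i j), cell (f i) (g j) m (fp1 M a)) :
    cell (tuple f) (tuple g) m (prodp M) :=
  @lcell (Fam D) D (radj P) (delta_ob D z) (delta_ob D w) X Y
    (@Build_fam_hom D (delta_ob D z) X (fun _ => tt) f)
    (@Build_fam_hom D (delta_ob D w) Y (fun _ => tt) g)
    (delta_pro D m) M
    (@Build_fam_cell D (delta_ob D z) (delta_ob D w) X Y
       (@Build_fam_hom D (delta_ob D z) X (fun _ => tt) f)
       (@Build_fam_hom D (delta_ob D w) Y (fun _ => tt) g)
       (delta_pro D m) M (fun _ _ _ => tt) c)
  ∙ tpro (adj_unit P) m.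
End LaxProducts.

(** * Preservation of products *)

Section Preservation.
Context {D E : double_category} (PD : lax_products D) (PE : lax_products E).

Definition fam_map (F : lax_functor D E) (X : fam_ob D) : fam_ob E :=
  {| fidx := fidx X; fobj := fun i => F (X i) |}.

Definition fam_map_pro {F G : lax_functor D E}
    (M : forall x y : D, pro x y -> pro (F x) (G y)) {X Y : fam_ob D} (m : fam_pro X Y) :
    fam_pro (fam_map F X) (fam_map G Y) :=
  @Build_fam_pro E (fam_map F X) (fam_map G Y) (fp0 m) (fun i j a => M _ _ (fp1 m a)).

Definition comparison (F : lax_functor D E) (X : fam_ob D) :
    hom (F (prodo PD X)) (prodo PE (fam_map F X)) :=
  tuple PE (X := fam_map F X) (fun i => lhom F (proj PD X i)).

Definition comparison_pro (F : lax_functor D E) {X Y : fam_ob D} (m : fam_pro X Y) :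
    cell (comparison F X) (comparison F Y) (lpro F (prodp PD m))
      (prodp PE (fam_map_pro (fun x y => @lpro _ _ F x y) m)) :=
  tuplep PE (M := fam_map_pro (fun x y => @lpro _ _ F x y) m)
    (fun i j a => lcell F (projp PD m a)).

Definition comparison_mod {F G : lax_functor D E} (M : module F G) {X Y : fam_ob D}
    (m : fam_pro X Y) :
    cell (comparison F X) (comparison G Y) (mpro M (prodp PD m))
      (prodp PE (fam_map_pro (fun x y => @mpro _ _ _ _ M x y) m)) :=
  tuplep PE (M := fam_map_pro (fun x y => @mpro _ _ _ _ M x y) m)
    (fun i j a => mcell M (projp PD m a)).

(** Product-preserving lax functors and modules. *)
Record pp_lax := {
  pl_lax :> lax_functor D E;
  pl_ob : forall X : fam_ob D, is_iso (comparison pl_lax X);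
  pl_pro : forall (X Y : fam_ob D) (m : fam_pro X Y), is_iso_cell (comparison_pro pl_lax m)
}.

Record pp_module (F G : pp_lax) := {
  pm_mod :> module F G;
  pm_pro : forall (X Y : fam_ob D) (m : fam_pro X Y), is_iso_cell (comparison_mod pm_mod m)
}.

Definition lax_preserves {F G : lax_functor D E} (α : lax_trans F G) : Prop :=
  forall (X : fam_ob D) (i : fidx X),
    lhom G (proj PD X i) ∘ α (prodo PD X) = α (X i) ∘ lhom F (proj PD X i) /\
    lt_cmp α (proj PD X i) ≈ lunit G (X i) ∙ cunit (α (X i) ∘ lhom F (proj PD X i)).

Definition oplax_preserves {F G : lax_functor D E} (α : oplax_trans F G) : Prop :=
  forall (X : fam_ob D) (i : fidx X),
    lhom G (proj PD X i) ∘ α (prodo PD X) = α (X i) ∘ lhom F (proj PD X i) /\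
    ot_cmp α (proj PD X i) ≈ lunit G (X i) ∙ cunit (α (X i) ∘ lhom F (proj PD X i)).

(** * The four kinds of arrows *)

Inductive trans_kind := Strict | Pseudo | Lax | Oplax.

Definition pp_trans (k : trans_kind) (F G : pp_lax) : Type :=
  match k with
  | Strict => strict_trans F G
  | Pseudo => {α : lax_trans F G | is_pseudo α /\ lax_preserves α}
  | Lax => {α : lax_trans F G | lax_preserves α}
  | Oplax => {α : oplax_trans F G | oplax_preserves α}
  end.

Definition pt_core {k : trans_kind} {F G : pp_lax} : pp_trans k F G -> trans F G :=
  match k with
  | Strict | Pseudo | Lax => fun α => lt_trans (proj1_sig α)
  | Oplax => fun α => ot_trans (proj1_sig α)
  end.

(** ** Composition of transformations *)

Definition lax_comp_cmp {F G H : lax_functor D E} (β : lax_trans G H) (α : lax_trans F G)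
    {x y : D} (f : hom x y) :=
  paste_cmp H (eq_sym (comph_assoc (dc_laws E) _ _ _))
    (lt_cmp β f ∙ cunit (α x)) (tpro β (punit y) ∙ lt_cmp α f).

Definition oplax_comp_cmp {F G H : lax_functor D E} (β : oplax_trans G H)
    (α : oplax_trans F G) {x y : D} (f : hom x y) :=
  paste_cmp H (comph_assoc (dc_laws E) _ _ _)
    (tpro β (punit y) ∙ ot_cmp α f) (ot_cmp β f ∙ cunit (α x)).

Definition is_composite_core {F G H : lax_functor D E}
    (γ : trans F H) (β : trans G H) (α : trans F G) : Prop :=
  (forall x : D, γ x = β x ∘ α x) /\
  (forall (x y : D) (m : pro x y), tpro γ m ≈ tpro β m ∙ tpro α m).

Definition is_lax_composite {F G H : lax_functor D E}
    (γ : lax_trans F H) (β : lax_trans G H) (α : lax_trans F G) : Prop :=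
  is_composite_core γ β α /\
  (forall (x y : D) (f : hom x y), lt_cmp γ f ≈ lax_comp_cmp β α f).

Definition is_oplax_composite {F G H : lax_functor D E}
    (γ : oplax_trans F H) (β : oplax_trans G H) (α : oplax_trans F G) : Prop :=
  is_composite_core γ β α /\
  (forall (x y : D) (f : hom x y), ot_cmp γ f ≈ oplax_comp_cmp β α f).

Definition is_composite {k : trans_kind} {F G H : pp_lax} :
    pp_trans k F H -> pp_trans k G H -> pp_trans k F G -> Prop :=
  match k with
  | Strict | Pseudo | Lax => fun γ β α =>
      is_lax_composite (proj1_sig γ) (proj1_sig β) (proj1_sig α)
  | Oplax => fun γ β α =>
      is_oplax_composite (proj1_sig γ) (proj1_sig β) (proj1_sig α)
  end.
End Preservation.

Arguments pl_lax {D E PD PE} _.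
Arguments pm_mod {D E PD PE F G} _.

(** * Virtual double categories *)

Inductive path {O : Type} (P : O -> O -> Type) : O -> O -> Type :=
| pnil : forall F, path P F F
| pcons : forall {F G H}, P F G -> path P G H -> path P F H.
Arguments pnil {O P} F.
Arguments pcons {O P F G H} _ _.

Fixpoint papp {O : Type} {P : O -> O -> Type} {F G H : O} (p : path P F G) :
    path P G H -> path P F H :=
  match p with
  | pnil _ => fun q => q
  | pcons M p => fun q => pcons M (papp p q)
  end.

Section VDC.
Context {O : Type} {A P : O -> O -> Type}.
Context (C : forall F G F' G' : O, path P F G -> P F' G' -> A F F' -> A G G' -> Type).
Arguments C {F G F' G'} _ _ _ _.

(** Equality of multicells whose source paths or boundary arrows may be equal
    without being convertible. *)
Inductive mceq {F G F' G'} {p : path P F G} {N : P F' G'} {f : A F F'} {g : A G G'}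
    (c : C p N f g) :
    forall {p' : path P F G} {f' : A F F'} {g' : A G G'}, C p' N f' g' -> Prop :=
| mceq_refl : mceq c c.

(** Horizontally composable multicells into the successive proarrows of a path,
    together with the concatenation of their sources. *)
Inductive mcells : forall {F' G' : O} (q : path P F' G') {F G : O},
    A F F' -> A G G' -> Type :=
| mnil : forall {F F'} (f : A F F'), mcells (pnil F') f f
| mcons : forall {F F' G G' H H'} {p : path P F G} {N : P F' G'}
    {f : A F F'} {g : A G G'} {q : path P G' H'} {h : A H H'},
    C p N f g -> mcells q g h -> mcells (pcons N q) f h.

Fixpoint msource {F' G'} {q : path P F' G'} {F G} {f : A F F'} {g : A G G'}
    (μs : mcells q f g) : path P F G :=
  match μs with
  | mnil _ => pnil _
  | @mcons _ _ _ _ _ _ p _ _ _ _ _ _ μs => papp p (msource μs)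
  end.

Fixpoint mapp {F' G'} {q : path P F' G'} {F G} {f : A F F'} {g : A G G'}
    (μs : mcells q f g) :
    forall {H' H} {r : path P G' H'} {h : A H H'}, mcells r g h -> mcells (papp q r) f h :=
  match μs with
  | mnil _ => fun _ _ _ _ νs => νs
  | mcons μ μs => fun _ _ _ _ νs => mcons μ (mapp μs νs)
  end.

Record vdc_data := {
  aid : forall F, A F F;
  acomp : forall {F G H}, A G H -> A F G -> A F H;
  mid : forall {F G} (N : P F G), C (pcons N (pnil G)) N (aid F) (aid G);
  mcomp : forall {F G F' G' F'' G''} {q : path P F' G'} {N : P F'' G''}
    {f : A F F'} {g : A G G'} {u : A F' F''} {v : A G' G''},
    C q N u v -> forall μs : mcells q f g, C (msource μs) N (acomp u f) (acomp v g)
}.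

(** Two composable layers of multicells over a path [r]: a row of multicells [ν]
    into the proarrows of [r], and for each of these a row of multicells into the
    source of [ν]. *)
Inductive mtree : forall {F'' G''} (r : path P F'' G'') {F' G'} (u : A F' F'') (v : A G' G'')
    {F G} (f : A F F') (g : A G G'), Type :=
| tnil : forall {F F' F''} (u : A F' F'') (f : A F F'), mtree (pnil F'') u u f f
| tcons : forall {F F' F'' G G' G'' H H' H''} {R : P F'' G''} {q : path P F' G'}
    {r : path P G'' H''} {u : A F' F''} {v : A G' G''} {w : A H' H''}
    {f : A F F'} {g : A G G'} {h : A H H'},
    C q R u v -> mcells q f g -> mtree r v w g h -> mtree (pcons R r) u w f h.

Fixpoint outer {F'' G''} {r : path P F'' G''} {F' G'} {u : A F' F''} {v : A G' G''}
    {F G} {f : A F F'} {g : A G G'} (t : mtree r u v f g) : mcells r u v :=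
  match t with
  | tnil u _ => mnil u
  | tcons ν _ t => mcons ν (outer t)
  end.

Fixpoint inner {F'' G''} {r : path P F'' G''} {F' G'} {u : A F' F''} {v : A G' G''}
    {F G} {f : A F F'} {g : A G G'} (t : mtree r u v f g) : mcells (msource (outer t)) f g :=
  match t with
  | tnil _ f => mnil f
  | tcons _ μs t => mapp μs (inner t)
  end.

Fixpoint layer_comp (V : vdc_data) {F'' G''} {r : path P F'' G''} {F' G'}
    {u : A F' F''} {v : A G' G''} {F G} {f : A F F'} {g : A G G'} (t : mtree r u v f g) :
    mcells r (acomp V u f) (acomp V v g) :=
  match t with
  | tnil u f => mnil (acomp V u f)
  | tcons ν μs t => mcons (mcomp V ν μs) (layer_comp V t)
  end.

Fixpoint mids (V : vdc_data) {F G} (p : path P F G) : mcells p (aid V F) (aid V G) :=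
  match p with
  | pnil F => mnil (aid V F)
  | pcons N p => mcons (mid V N) (mids V p)
  end.

Record vdc_laws (V : vdc_data) : Prop := {
  acomp_id_l : forall F G (f : A F G), acomp V (aid V G) f = f;
  acomp_id_r : forall F G (f : A F G), acomp V f (aid V F) = f;
  acomp_assoc : forall F G H K (h : A H K) (g : A G H) (f : A F G),
    acomp V h (acomp V g f) = acomp V (acomp V h g) f;
  mcomp_id_l : forall F G F' G' (p : path P F G) (N : P F' G') (f : A F F') (g : A G G')
    (μ : C p N f g), mceq (mcomp V (mid V N) (mcons μ (mnil g))) μ;
  mcomp_id_r : forall F G F' G' (p : path P F G) (N : P F' G') (f : A F F') (g : A G G')
    (μ : C p N f g), mceq (mcomp V μ (mids V p)) μ;
  mcomp_assoc : forall F G F' G' F'' G'' F3 G3 (r : path P F'' G'') (S : P F3 G3)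
    (u : A F' F'') (v : A G' G'') (f : A F F') (g : A G G') (a : A F'' F3) (b : A G'' G3)
    (ρ : C r S a b) (t : mtree r u v f g),
    mceq (mcomp V ρ (layer_comp V t)) (mcomp V (mcomp V ρ (outer t)) (inner t))
}.

(** The virtual double categories with objects [O], arrows [A], proarrows [P] and
    multicells [C]. *)
Record virtual_double_category := {
  vdc_ops :> vdc_data;
  vdc_ax : vdc_laws vdc_ops
}.

(** Composing with [mids p, η, mids q] is, up to [mceq], a map from multicells with
    source [p, U, q] to multicells with source [p, q]. *)
Definition has_units (V : virtual_double_category) : Prop :=
  forall F : O, exists (U : P F F) (η : C (pnil F) U (aid V F) (aid V F)),
  forall G H G' H' (p : path P G F) (q : path P F H) (N : P G' H') (f : A G G') (g : A H H')
    (σ : C (papp p q) N f g),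
  exists! ρ : C (papp p (pcons U q)) N f g,
    mceq (mcomp V ρ (mapp (mids V p) (mcons η (mids V q)))) σ.
End VDC.
Arguments virtual_double_category {O A P} C.
Arguments has_units {O A P C} V.

(** * Multimodulations *)

Section Multimodulations.
Context {D E : double_category} (PD : lax_products D) (PE : lax_products E).

Notation Fun := (pp_lax PD PE).
Notation Mod := (pp_module PD PE).
Notation mod_path := (path Mod).

(** A path of proarrows in [D], one for each module of the path [Ms]. *)
Inductive dpath : forall {F G : Fun} (Ms : mod_path F G) (x y : D), Type :=
| dnil : forall {F : Fun} (x : D), dpath (pnil F) x x
| dcons : forall {F G H : Fun} {M : Mod F G} {Ms : mod_path G H} {x y z : D},
    pro x y -> dpath Ms y z -> dpath (pcons M Ms) x z.

(** External composites are bracketed to the right and end with an external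
    identity: [msrc] is [M_1 m_1 ⊙ (M_2 m_2 ⊙ (... ⊙ id))] and [mtot] is
    [m_1 ⊙ (m_2 ⊙ (... ⊙ id))]. *)
Fixpoint msrc {F G : Fun} {Ms : mod_path F G} {x y : D} (ms : dpath Ms x y) :
    pro (F x) (G y) :=
  match ms with
  | @dnil F x => punit (F x)
  | @dcons _ _ _ M _ _ _ _ m ms => mpro M m ⊙ msrc ms
  end.

Fixpoint mtot {F G : Fun} {Ms : mod_path F G} {x y : D} (ms : dpath Ms x y) : pro x y :=
  match ms with
  | dnil x => punit x
  | dcons m ms => m ⊙ mtot ms
  end.

(** Externally composable cells [γ_i : m_i -> n_i] of [D]. *)
Inductive dcells : forall {F G : Fun} {Ms : mod_path F G} {x y x' y' : D}
    (ms : dpath Ms x y) (ns : dpath Ms x' y') (f : hom x x') (g : hom y y'), Type :=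
| dcnil : forall {F : Fun} {x x' : D} (f : hom x x'), dcells (@dnil F x) (@dnil F x') f f
| dccons : forall {F G H : Fun} {M : Mod F G} {Ms : mod_path G H} {x y z x' y' z' : D}
    {m : pro x y} {m' : pro x' y'} {ms : dpath Ms y z} {ns : dpath Ms y' z'}
    {f : hom x x'} {g : hom y y'} {h : hom z z'},
    cell f g m m' -> dcells ms ns g h ->
    dcells (@dcons F G H M Ms x y z m ms) (@dcons F G H M Ms x' y' z' m' ns) f h.

Fixpoint msrc_cell {F G : Fun} {Ms : mod_path F G} {x y x' y' : D}
    {ms : dpath Ms x y} {ns : dpath Ms x' y'} {f : hom x x'} {g : hom y y'}
    (γs : dcells ms ns f g) : cell (lhom F f) (lhom G g) (msrc ms) (msrc ns) :=
  match γs with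
  | @dcnil F _ _ f => cunit (lhom F f)
  | @dccons _ _ _ M _ _ _ _ _ _ _ _ _ _ _ _ _ _ γ γs => mcell M γ ⊗ msrc_cell γs
  end.

Fixpoint mtot_cell {F G : Fun} {Ms : mod_path F G} {x y x' y' : D}
    {ms : dpath Ms x y} {ns : dpath Ms x' y'} {f : hom x x'} {g : hom y y'}
    (γs : dcells ms ns f g) : cell f g (mtot ms) (mtot ns) :=
  match γs with
  | dcnil f => cunit f
  | dccons γ γs => γ ⊗ mtot_cell γs
  end.

(** ** Naturality *)

Definition mpaste_r {F G : lax_functor D E} (N : module F G) {w z : D} {n : pro w z}
    {x y : E} {m : pro x y} {f : hom x (F w)} {g h : hom y (G z)}
    (a : cell f g m (mpro N n)) (b : cell g h (punit y) (lpro G (punit z))) :=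
  mcell N (run n) ∙ mactr N n (punit z) ∙ (a ⊗ b) ∙ runi m.

Definition mpaste_l {F G : lax_functor D E} (N : module F G) {w z : D} {n : pro w z}
    {x y : E} {m : pro x y} {f g : hom x (F w)} {h : hom y (G z)}
    (b : cell f g (punit x) (lpro F (punit w))) (a : cell g h m (mpro N n)) :=
  mcell N (lun n) ∙ mactl N (punit w) n ∙ (b ⊗ a) ∙ luni m.

(** The families of cells that are the components of a multimodulation. *)
Definition components {F F' G H : Fun} (Ms : mod_path F F') (N : Mod G H)
    (α : trans F G) (β : trans F' H) : Type :=
  forall (x y : D) (ms : dpath Ms x y), cell (α x) (β y) (msrc ms) (mpro N (mtot ms)).

Definition lax_natural {F F' G H : Fun} {Ms : mod_path F F'} {N : Mod G H}
    (α : lax_trans F G) (β : lax_trans F' H) (μ : components Ms N α β) : Prop :=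
  forall (x y x' y' : D) (ms : dpath Ms x y) (ns : dpath Ms x' y') (f : hom x x')
    (g : hom y y') (γs : dcells ms ns f g),
  mpaste_r N (mcell N (mtot_cell γs) ∙ μ _ _ ms) (lt_cmp β g)
  ≈ mpaste_l N (lt_cmp α f) (μ _ _ ns ∙ msrc_cell γs).

Definition oplax_natural {F F' G H : Fun} {Ms : mod_path F F'} {N : Mod G H}
    (α : oplax_trans F G) (β : oplax_trans F' H) (μ : components Ms N α β) : Prop :=
  forall (x y x' y' : D) (ms : dpath Ms x y) (ns : dpath Ms x' y') (f : hom x x')
    (g : hom y y') (γs : dcells ms ns f g),
  mpaste_l N (ot_cmp α f) (mcell N (mtot_cell γs) ∙ μ _ _ ms)
  ≈ mpaste_r N (μ _ _ ns ∙ msrc_cell γs) (ot_cmp β g).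

Definition natural {k : trans_kind} {F F' G H : Fun} {Ms : mod_path F F'} {N : Mod G H} :
    forall (α : pp_trans PD PE k F G) (β : pp_trans PD PE k F' H),
    components Ms N (pt_core PD PE α) (pt_core PD PE β) -> Prop :=
  match k with
  | Strict | Pseudo | Lax => fun α β μ => lax_natural (proj1_sig α) (proj1_sig β) μ
  | Oplax => fun α β μ => oplax_natural (proj1_sig α) (proj1_sig β) μ
  end.

(** ** Outer equivariance *)

Definition left_equivariant {F F' G H : Fun} {Ms : mod_path F F'} {N : Mod G H}
    (α : trans F G) (β : trans F' H) : components Ms N α β -> Prop :=
  match Ms as Ms in path _ F F' return
    forall (α : trans F G) (β : trans F' H), components Ms N α β -> Prop
  with
  | pnil _ => fun _ _ _ => True
  | @pcons _ _ F F1 F' M Ms => fun α β μ =>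
      forall (w x y z : D) (p : pro w x) (m : pro x y) (ms : dpath Ms y z),
      mcell N (assoc p m (mtot ms)) ∙ μ w z (dcons (p ⊙ m) ms)
        ∙ (mactl M p m ⊗ cid (msrc ms)) ∙ associ (lpro F p) (mpro M m) (msrc ms)
      ≈ mactl N p (m ⊙ mtot ms) ∙ (tpro α p ⊗ μ x z (dcons m ms))
  end α β.

(** Non-empty paths of proarrows; [snoc ms p] replaces the last proarrow [m_k] of
    [ms] by [m_k ⊙ p]. *)
Inductive npath : forall {F G : Fun} (Ms : mod_path F G) (x y : D), Type :=
| nlast : forall {F G : Fun} {M : Mod F G} {x y : D}, pro x y -> npath (pcons M (pnil G)) x y
| ncons : forall {F G H : Fun} {M : Mod F G} {Ms : mod_path G H} {x y z : D},
    pro x y -> npath Ms y z -> npath (pcons M Ms) x z.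

Fixpoint npath_dpath {F G : Fun} {Ms : mod_path F G} {x y : D} (ms : npath Ms x y) :
    dpath Ms x y :=
  match ms with
  | nlast m => dcons m (dnil _)
  | ncons m ms => dcons m (npath_dpath ms)
  end.

Fixpoint snoc {F G : Fun} {Ms : mod_path F G} {x y z : D} (ms : npath Ms x y) :
    pro y z -> dpath Ms x z :=
  match ms with
  | nlast m => fun p => dcons (m ⊙ p) (dnil _)
  | ncons m ms => fun p => dcons m (snoc ms p)
  end.

(** [1 ⊗ (M_k)^r : (M_1 m_1 ⊙ ... ⊙ M_k m_k) ⊙ F_k p -> M_1 m_1 ⊙ ... ⊙ M_k (m_k ⊙ p)]. *)
Fixpoint snoc_src {F G : Fun} {Ms : mod_path F G} {x y z : D} (ms : npath Ms x y) :
    forall p : pro y z,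
    cell (idh (F x)) (idh (G z)) (msrc (npath_dpath ms) ⊙ lpro G p) (msrc (snoc ms p)) :=
  match ms with
  | @nlast F G M x y m => fun p =>
      gcomp (runi (mpro M (m ⊙ p)))
        (gcomp (mactr M m p) (run (mpro M m) ⊗ cid (lpro G p)))
  | @ncons F G H M Ms x y _ m ms => fun p =>
      gcomp (cid (mpro M m) ⊗ snoc_src ms p)
        (assoc (mpro M m) (msrc (npath_dpath ms)) (lpro H p))
  end.

(** The coherence isomorphism [(m_1 ⊙ ... ⊙ m_k) ⊙ p -> m_1 ⊙ ... ⊙ (m_k ⊙ p)]. *)
Fixpoint snoc_tot {F G : Fun} {Ms : mod_path F G} {x y z : D} (ms : npath Ms x y) :
    forall p : pro y z,
    cell (idh x) (idh z) (mtot (npath_dpath ms) ⊙ p) (mtot (snoc ms p)) :=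
  match ms with
  | @nlast F G M x y m => fun p => gcomp (runi (m ⊙ p)) (run m ⊗ cid p)
  | @ncons F G H M Ms x y _ m ms => fun p =>
      gcomp (cid m ⊗ snoc_tot ms p) (assoc m (mtot (npath_dpath ms)) p)
  end.

Definition right_equivariant {F F' G H : Fun} {Ms : mod_path F F'} {N : Mod G H}
    {α : trans F G} {β : trans F' H} (μ : components Ms N α β) : Prop :=
  forall (x y z : D) (ms : npath Ms x y) (p : pro y z),
  μ x z (snoc ms p) ∙ snoc_src ms p
  ≈ mcell N (snoc_tot ms p) ∙ mactr N (mtot (npath_dpath ms)) p
      ∙ (μ x y (npath_dpath ms) ⊗ tpro β p).

Definition nullary_equivariant {F F' G H : Fun} {Ms : mod_path F F'} {N : Mod G H}
    (α : trans F G) (β : trans F' H) : components Ms N α β -> Prop :=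
  match Ms as Ms in path _ F F' return
    forall (α : trans F G) (β : trans F' H), components Ms N α β -> Prop
  with
  | pnil F => fun α β μ =>
      forall (x y : D) (p : pro x y),
      mcell N (run p) ∙ mactl N p (punit y) ∙ (tpro α p ⊗ μ y y (dnil y))
        ∙ runi (lpro F p)
      ≈ mcell N (lun p) ∙ mactr N (punit x) p ∙ (μ x x (dnil x) ⊗ tpro β p)
          ∙ luni (lpro F p)
  | pcons _ _ => fun _ _ _ => True
  end α β.

(** ** Inner equivariance *)

(** A path [m_1, ..., m_i, p, m_(i+1), ..., m_k] with a proarrow [p] inserted
    between two consecutive members of a path of proarrows. *)
Inductive ipath : forall {F G : Fun} (Ms : mod_path F G) (x y : D), Type :=
| ihere : forall {F G H K : Fun} {M : Mod F G} {M' : Mod G H} {Ms : mod_path H K}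
    {x y z w v : D}, pro x y -> pro y z -> pro z w -> dpath Ms w v ->
    ipath (pcons M (pcons M' Ms)) x v
| ithere : forall {F G H : Fun} {M : Mod F G} {Ms : mod_path G H} {x y z : D},
    pro x y -> ipath Ms y z -> ipath (pcons M Ms) x z.

(** The paths with [m_i ⊙ p], respectively [p ⊙ m_(i+1)], as a member. *)
Fixpoint absorb_l {F G : Fun} {Ms : mod_path F G} {x y : D} (s : ipath Ms x y) :
    dpath Ms x y :=
  match s with
  | ihere m p m' ms => dcons (m ⊙ p) (dcons m' ms)
  | ithere m s => dcons m (absorb_l s)
  end.

Fixpoint absorb_r {F G : Fun} {Ms : mod_path F G} {x y : D} (s : ipath Ms x y) :
    dpath Ms x y :=
  match s with
  | ihere m p m' ms => dcons m (dcons (p ⊙ m') ms)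
  | ithere m s => dcons m (absorb_r s)
  end.

(** [M_1 m_1 ⊙ ... ⊙ M_i m_i ⊙ F_i p ⊙ M_(i+1) m_(i+1) ⊙ ... ⊙ M_k m_k]. *)
Fixpoint isrc {F G : Fun} {Ms : mod_path F G} {x y : D} (s : ipath Ms x y) :
    pro (F x) (G y) :=
  match s with
  | @ihere _ G _ _ M M' _ _ _ _ _ _ m p m' ms =>
      mpro M m ⊙ (lpro G p ⊙ (mpro M' m' ⊙ msrc ms))
  | @ithere _ _ _ M _ _ _ _ m s => mpro M m ⊙ isrc s
  end.

Fixpoint isrc_l {F G : Fun} {Ms : mod_path F G} {x y : D} (s : ipath Ms x y) :
    cell (idh (F x)) (idh (G y)) (isrc s) (msrc (absorb_l s)) :=
  match s with
  | @ihere _ G _ _ M M' _ _ _ _ _ _ m p m' ms =>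
      gcomp (mactr M m p ⊗ cid (mpro M' m' ⊙ msrc ms))
        (associ (mpro M m) (lpro G p) (mpro M' m' ⊙ msrc ms))
  | @ithere _ _ _ M _ _ _ _ m s => cid (mpro M m) ⊗ isrc_l s
  end.

Fixpoint isrc_r {F G : Fun} {Ms : mod_path F G} {x y : D} (s : ipath Ms x y) :
    cell (idh (F x)) (idh (G y)) (isrc s) (msrc (absorb_r s)) :=
  match s with
  | @ihere _ G _ _ M M' _ _ _ _ _ _ m p m' ms =>
      cid (mpro M m) ⊗ gcomp (mactl M' p m' ⊗ cid (msrc ms))
        (associ (lpro G p) (mpro M' m') (msrc ms))
  | @ithere _ _ _ M _ _ _ _ m s => cid (mpro M m) ⊗ isrc_r s
  end.

(** The coherence isomorphism between the composites of the two paths. *)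
Fixpoint itot {F G : Fun} {Ms : mod_path F G} {x y : D} (s : ipath Ms x y) :
    cell (idh x) (idh y) (mtot (absorb_l s)) (mtot (absorb_r s)) :=
  match s with
  | ihere m p m' ms =>
      gcomp (cid m ⊗ associ p m' (mtot ms)) (assoc m p (m' ⊙ mtot ms))
  | ithere m s => cid m ⊗ itot s
  end.

Definition inner_equivariant {F F' G H : Fun} {Ms : mod_path F F'} {N : Mod G H}
    {α : trans F G} {β : trans F' H} (μ : components Ms N α β) : Prop :=
  forall (x y : D) (s : ipath Ms x y),
  mcell N (itot s) ∙ μ x y (absorb_l s) ∙ isrc_l s ≈ μ x y (absorb_r s) ∙ isrc_r s.

Record multimodulation (k : trans_kind) (F F' G H : Fun) (Ms : mod_path F F') (N : Mod G H)
    (α : pp_trans PD PE k F G) (β : pp_trans PD PE k F' H) := {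
  mm_cell : components Ms N (pt_core PD PE α) (pt_core PD PE β);
  mm_nat : natural α β mm_cell;
  mm_left : left_equivariant _ _ mm_cell;
  mm_right : right_equivariant mm_cell;
  mm_nullary : nullary_equivariant _ _ mm_cell;
  mm_inner : inner_equivariant mm_cell
}.
Arguments mm_cell {k F F' G H Ms N α β} _ {x y} ms.

(** ** Composition *)

Fixpoint dapp {F G H : Fun} {Ms : mod_path F G} {Ns : mod_path G H} {x y z : D}
    (ms : dpath Ms x y) : dpath Ns y z -> dpath (papp Ms Ns) x z :=
  match ms in @dpath F G Ms x y return
    forall Ns : mod_path G H, dpath Ns y z -> dpath (papp Ms Ns) x z
  with
  | dnil _ => fun _ ns => ns
  | dcons m ms => fun _ ns => dcons m (dapp ms ns)
  end Ns.

(** Coherence isomorphisms for concatenation. *)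
Fixpoint msrc_app {F G H : Fun} {Ms : mod_path F G} {Ns : mod_path G H} {x y z : D}
    (ms : dpath Ms x y) : forall ns : dpath Ns y z,
    cell (idh (F x)) (idh (H z)) (msrc (dapp ms ns)) (msrc ms ⊙ msrc ns) :=
  match ms in @dpath F G Ms x y return
    forall (Ns : mod_path G H) (ns : dpath Ns y z),
    cell (idh (F x)) (idh (H z)) (msrc (dapp ms ns)) (msrc ms ⊙ msrc ns)
  with
  | dnil _ => fun _ ns => luni (msrc ns)
  | @dcons _ _ _ M _ _ _ _ m ms => fun _ ns =>
      gcomp (associ (mpro M m) (msrc ms) (msrc ns)) (cid (mpro M m) ⊗ msrc_app ms ns)
  end Ns.

Fixpoint mtot_app {F G H : Fun} {Ms : mod_path F G} {Ns : mod_path G H} {x y z : D}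
    (ms : dpath Ms x y) : forall ns : dpath Ns y z,
    cell (idh x) (idh z) (mtot ms ⊙ mtot ns) (mtot (dapp ms ns)) :=
  match ms in @dpath F G Ms x y return
    forall (Ns : mod_path G H) (ns : dpath Ns y z),
    cell (idh x) (idh z) (mtot ms ⊙ mtot ns) (mtot (dapp ms ns))
  with
  | dnil _ => fun _ ns => lun (mtot ns)
  | @dcons _ _ _ _ _ _ _ _ m ms => fun _ ns =>
      gcomp (cid m ⊗ mtot_app ms ns) (assoc m (mtot ms) (mtot ns))
  end Ns.

Section Blocks.
Context {k : trans_kind}.
Notation row := (mcells (multimodulation k)).

(** Blocks of proarrows of [D], one for each multimodulation of a row. *)
Inductive blocks : forall {F' G' : Fun} {q : mod_path F' G'} {F G : Fun}
    {f : pp_trans PD PE k F F'} {g : pp_trans PD PE k G G'} (μs : row q f g) (x y : D), Type :=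
| bnil : forall {F F' : Fun} (f : pp_trans PD PE k F F') (x : D), blocks (mnil _ f) x x
| bcons : forall {F F' G G' H H' : Fun} {p : mod_path F G} {N : Mod F' G'}
    {f : pp_trans PD PE k F F'} {g : pp_trans PD PE k G G'} {q : mod_path G' H'}
    {h : pp_trans PD PE k H H'} (μ : multimodulation k F G F' G' p N f g) {μs : row q g h}
    {x y z : D}, dpath p x y -> blocks μs y z -> blocks (mcons _ μ μs) x z.

(** The concatenation of the blocks. *)
Fixpoint bflat {F' G' : Fun} {q : mod_path F' G'} {F G : Fun}
    {f : pp_trans PD PE k F F'} {g : pp_trans PD PE k G G'} {μs : row q f g} {x y : D}
    (bs : blocks μs x y) : dpath (msource _ μs) x y :=
  match bs with
  | bnil _ x => dnil x
  | bcons _ ms bs => dapp ms (bflat bs)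
  end.

(** The path of the composites of the blocks. *)
Fixpoint bouter {F' G' : Fun} {q : mod_path F' G'} {F G : Fun}
    {f : pp_trans PD PE k F F'} {g : pp_trans PD PE k G G'} {μs : row q f g} {x y : D}
    (bs : blocks μs x y) : dpath q x y :=
  match bs with
  | bnil _ x => dnil x
  | bcons _ ms bs => dcons (mtot ms) (bouter bs)
  end.

Fixpoint bsrc {F' G' : Fun} {q : mod_path F' G'} {F G : Fun}
    {f : pp_trans PD PE k F F'} {g : pp_trans PD PE k G G'} {μs : row q f g} {x y : D}
    (bs : blocks μs x y) : pro (F x) (G y) :=
  match bs with
  | @bnil F _ _ x => punit (F x)
  | bcons _ ms bs => msrc ms ⊙ bsrc bs
  end.

(** The external composite of the components of a row at the blocks. *)
Fixpoint btens {F' G' : Fun} {q : mod_path F' G'} {F G : Fun}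
    {f : pp_trans PD PE k F F'} {g : pp_trans PD PE k G G'} {μs : row q f g} {x y : D}
    (bs : blocks μs x y) :
    cell (pt_core PD PE f x) (pt_core PD PE g y) (bsrc bs) (msrc (bouter bs)) :=
  match bs with
  | bnil f x => cunit (pt_core PD PE f x)
  | bcons μ ms bs => mm_cell μ ms ⊗ btens bs
  end.

(** Coherence isomorphisms between bracketings by blocks and bracketings to the
    right. *)
Fixpoint bsplit {F' G' : Fun} {q : mod_path F' G'} {F G : Fun}
    {f : pp_trans PD PE k F F'} {g : pp_trans PD PE k G G'} {μs : row q f g} {x y : D}
    (bs : blocks μs x y) :
    cell (idh (F x)) (idh (G y)) (msrc (bflat bs)) (bsrc bs) :=
  match bs with
  | @bnil F _ _ x => cid (punit (F x))
  | bcons _ ms bs => gcomp (cid (msrc ms) ⊗ bsplit bs) (msrc_app ms (bflat bs))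
  end.

Fixpoint bjoin {F' G' : Fun} {q : mod_path F' G'} {F G : Fun}
    {f : pp_trans PD PE k F F'} {g : pp_trans PD PE k G G'} {μs : row q f g} {x y : D}
    (bs : blocks μs x y) : cell (idh x) (idh y) (mtot (bouter bs)) (mtot (bflat bs)) :=
  match bs with
  | bnil _ x => cid (punit x)
  | bcons _ ms bs => gcomp (mtot_app ms (bflat bs)) (cid (mtot ms) ⊗ bjoin bs)
  end.

Definition is_pasting {F G F' G' F'' G'' : Fun} {q : mod_path F' G'} {N : Mod F'' G''}
    {f : pp_trans PD PE k F F'} {g : pp_trans PD PE k G G'}
    {u : pp_trans PD PE k F' F''} {v : pp_trans PD PE k G' G''}
    {uf : pp_trans PD PE k F F''} {vg : pp_trans PD PE k G G''} {μs : row q f g}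
    (κ : multimodulation k F G F'' G'' (msource _ μs) N uf vg)
    (ν : multimodulation k F' G' F'' G'' q N u v) : Prop :=
  forall (x y : D) (bs : blocks μs x y),
  mm_cell κ (bflat bs)
  ≈ mcell N (bjoin bs) ∙ mm_cell ν (bouter bs) ∙ btens bs ∙ bsplit bs.
End Blocks.
End Multimodulations.

(** Both compositions of a virtual double category of product-preserving functors,
    transformations, modules and multimodulations are the intended ones.  Identity
    arrows and identity multicells are then determined by the unit laws. *)
Definition has_pasting_composition {D E : double_category} {PD : lax_products D}
    {PE : lax_products E} {k : trans_kind}
    (V : virtual_double_category (multimodulation PD PE k)) : Prop :=
  (forall (F G H : pp_lax PD PE) (β : pp_trans PD PE k G H) (α : pp_trans PD PE k F G),
     is_composite PD PE (acomp _ V β α) β α) /\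
  (forall F G F' G' F'' G'' (q : path (pp_module PD PE) F' G') (N : pp_module PD PE F'' G'')
     (f : pp_trans PD PE k F F') (g : pp_trans PD PE k G G')
     (u : pp_trans PD PE k F' F'') (v : pp_trans PD PE k G' G'')
     (ν : multimodulation PD PE k F' G' F'' G'' q N u v)
     (μs : mcells (multimodulation PD PE k) q f g),
     is_pasting PD PE (mcomp _ V ν μs) ν).

(* Main.v *)
From Stdlib Require Import FunctionalExtensionality ProofIrrelevance ClassicalEpsilon.
Require Import Defs.

(** A multimodulation is a family of cells, and the laws of a virtual double category equate
    pastings of such families.  In a pseudo double category these pastings have different
    bracketings.  The idea is to do the bookkeeping of bracketings once and to argue afterwards as
    if everything were strict.

    Coherence.  A term of [fl m] presents the proarrow [m] as the external composite of a list, and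
    [coh A B a] says that [a] is the isomorphism induced by two presentations with the same list.
    There is at most one such [a] ([coh_unique]), and associators, unitors, composites and external
    composites are of this kind.

    Entries.  For a module [N], an entry in [ent N f g] is a cell into a proarrow [N n] of which the
    source and the index [n] are presented, and [≃] identifies entries that differ by the induced
    isomorphisms.  Up to [≃], functors act on entries on both sides associatively and unitally
    ([lact_lact], [lact_ract], [ract_ract]).  Comparison cells of transformations are entries
    as well, and the axioms of lax and oplax transformations become short equations between entries.
    Hence transformations of each kind compose and form a category; product preservation and
    invertibility of the comparison cells pass to composites because comparison entries compose.

    Words.  For a path [q] of modules, a word has one entry for each member of [q], in order, and
    entries of functors anywhere in between; [wsim] lets an entry of a functor be absorbed by either
    neighbour.  Equivariance and naturality with respect to globular cells say that a family of cells
    has a well-defined value on words ([wev_sim]).  Conversely a functional on words that respects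
    the relation and both outer actions, is natural, and is represented by cells comes from a unique
    multimodulation ([multimodulation_of], [mm_eq]).  So multimodulations are functionals on words.

    Composition.  A word over a concatenated path can be cut into words over the pieces, uniquely up
    to moving an entry across the cuts ([wsplit_sim]).  A row of multimodulations evaluates each
    piece and gives a word over the outer path ([rw]), and the composite with [ν] is [ν] after [rw].
    In terms of cells this is pasting ([pasting_ev]).  The unit and associativity laws are then the
    behaviour of [rw] under concatenation of rows ([rw_mapp]).  Naturality with respect to arbitrary
    cells holds because comparison entries slide through a row one multimodulation at a time
    ([row_lax], [row_oplax]).

    Units.  The unit of [F] is [F] itself, acting on itself; it preserves products since [F] does.
    Its entries are entries of [F], so a word over [p, U, q] is a word over [p, q] once the entry of
    [U] is read as an entry of a functor ([erase]).  Evaluating [σ] after this erasure extends [σ]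
    along the unit ([unit_extension_exists]).  The extension is unique, since up to [wsim] every word
    over [p, U, q] has a trivial entry at [U] ([unit_insert]). *)

(** * Globular cells *)

Notation "m ⟹ n" := (cell (idh _) (idh _) m n) (at level 70) : dbl_scope.

Notation "⟦ a ⟧" := (to_sq a) (at level 0, a at level 200, format "⟦ a ⟧") : dbl_scope.
Infix "⋆" := sq_comp (at level 40, left associativity) : dbl_scope.

Section Globular.
Context {D : double_category}.
Let HD := dc_laws D.

Definition gpost {x y x' y' : D} {f : hom x x'} {g : hom y y'} {m : pro x y}
    {n p : pro x' y'} (b : n ⟹ p) (a : cell f g m n) : cell f g m p :=
  ccast (comph_id_l HD f) (comph_id_l HD g) (b ∙ a).

Definition gpre {x y x' y' : D} {f : hom x x'} {g : hom y y'} {m n : pro x y}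
    {p : pro x' y'} (a : cell f g n p) (b : m ⟹ n) : cell f g m p :=
  ccast (comph_id_r HD f) (comph_id_r HD g) (a ∙ b).

Lemma sq_gpost {x y x' y' : D} {f : hom x x'} {g : hom y y'} {m : pro x y}
    {n p : pro x' y'} (b : n ⟹ p) (a : cell f g m n) :
  ⟦gpost b a⟧ = ⟦b⟧ ⋆ ⟦a⟧.
Proof. exact (sq_cast _ _ _). Qed.

Lemma sq_gpre {x y x' y' : D} {f : hom x x'} {g : hom y y'} {m n : pro x y}
    {p : pro x' y'} (a : cell f g n p) (b : m ⟹ n) :
  ⟦gpre a b⟧ = ⟦a⟧ ⋆ ⟦b⟧.
Proof. exact (sq_cast _ _ _). Qed.

Lemma sq_gcomp {x y : D} {m n p : pro x y} (b : n ⟹ p)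
    (a : m ⟹ n) :
  ⟦gcomp b a⟧ = ⟦b⟧ ⋆ ⟦a⟧.
Proof. exact (sq_cast _ _ _). Qed.

Lemma sq_inj {x y x' y' : D} {m : pro x y} {n : pro x' y'} {f : hom x x'} {g : hom y y'}
    {a b : cell f g m n} : ⟦a⟧ = ⟦b⟧ -> a = b.
Proof. intros H; apply eq_of_ceq, ceq_of_sq, H. Qed.

Lemma gcomp_assoc {x y : D} {m n p q : pro x y} (c : p ⟹ q)
    (b : n ⟹ p) (a : m ⟹ n) :
  gcomp c (gcomp b a) = gcomp (gcomp c b) a.
Proof. apply sq_inj; rewrite !sq_gcomp; apply (sq_comp_assoc HD). Qed.

Lemma gcomp_idl {x y : D} {m n : pro x y} (a : m ⟹ n) :
  gcomp (cid n) a = a.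
Proof. apply sq_inj; rewrite !sq_gcomp; apply (sq_comp_idl HD). Qed.

Lemma gcomp_idr {x y : D} {m n : pro x y} (a : m ⟹ n) :
  gcomp a (cid m) = a.
Proof. apply sq_inj; rewrite !sq_gcomp; apply (sq_comp_idr HD). Qed.

Lemma gpost_tens {x y z x' y' z' : D} {f : hom x x'} {g : hom y y'} {h : hom z z'}
    {m : pro x y} {n p : pro x' y'} {m' : pro y z} {n' p' : pro y' z'}
    (b : n ⟹ p) (a : cell f g m n)
    (b' : n' ⟹ p') (a' : cell g h m' n') :
  gpost b a ⊗ gpost b' a' = gpost (b ⊗ b') (a ⊗ a').
Proof.
  apply sq_inj; rewrite sq_gpost, <- to_sq_comp, <- (ctens_comp _ HD).
  apply sq_ctens; apply sq_gpost.
Qed.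

Lemma gcomp_tens {x y z : D} {m n p : pro x y} {m' n' p' : pro y z}
    (b : n ⟹ p) (a : m ⟹ n)
    (b' : n' ⟹ p') (a' : m' ⟹ n') :
  gcomp b a ⊗ gcomp b' a' = gcomp (b ⊗ b') (a ⊗ a').
Proof. exact (gpost_tens _ _ _ _). Qed.

Lemma gtens_l {x y z : D} {m n p : pro x y} {q : pro y z}
    (b : n ⟹ p) (a : m ⟹ n) :
  gcomp b a ⊗ cid q = gcomp (b ⊗ cid q) (a ⊗ cid q).
Proof. rewrite <- gcomp_tens, gcomp_idl; reflexivity. Qed.

Lemma gtens_r {x y z : D} {m n p : pro y z} {q : pro x y}
    (b : n ⟹ p) (a : m ⟹ n) :
  cid q ⊗ gcomp b a = gcomp (cid q ⊗ b) (cid q ⊗ a).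
Proof. rewrite <- gcomp_tens, gcomp_idl; reflexivity. Qed.

Lemma g_of_ceq {x y : D} {m n p n' : pro x y} {b : n ⟹ p}
    {a : m ⟹ n} {b' : n' ⟹ p}
    {a' : m ⟹ n'} :
  b ∙ a ≈ b' ∙ a' -> gcomp b a = gcomp b' a'.
Proof. intros H; apply sq_inj; rewrite !sq_gcomp; exact (sq_of_ceq H). Qed.

Lemma g_of_ceq1 {x y : D} {m n p : pro x y} {b : n ⟹ p}
    {a : m ⟹ n} {c : m ⟹ p} :
  b ∙ a ≈ c -> gcomp b a = c.
Proof. intros H; apply sq_inj; rewrite !sq_gcomp; exact (sq_of_ceq H). Qed.

Lemma g_assoc_nat {x y z w : D} {m m' : pro x y} {n n' : pro y z} {p p' : pro z w}
    (a : m ⟹ m') (b : n ⟹ n')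
    (c : p ⟹ p') :
  gcomp (assoc m' n' p') ((a ⊗ b) ⊗ c) = gcomp (a ⊗ (b ⊗ c)) (assoc m n p).
Proof. apply g_of_ceq, (assoc_nat _ HD). Qed.

Lemma g_lun_nat {x y : D} {m n : pro x y} (a : m ⟹ n) :
  gcomp (lun n) (cid (punit x) ⊗ a) = gcomp a (lun m).
Proof. rewrite <- (cunit_id _ HD); apply g_of_ceq, (lun_nat _ HD). Qed.

Lemma g_run_nat {x y : D} {m n : pro x y} (a : m ⟹ n) :
  gcomp (run n) (a ⊗ cid (punit y)) = gcomp a (run m).
Proof. rewrite <- (cunit_id _ HD); apply g_of_ceq, (run_nat _ HD). Qed.

Lemma g_assoc_associ {x y z w : D} (m : pro x y) (n : pro y z) (p : pro z w) :
  gcomp (assoc m n p) (associ m n p) = cid _.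
Proof. apply g_of_ceq1, (assoc_associ _ HD). Qed.
Lemma g_associ_assoc {x y z w : D} (m : pro x y) (n : pro y z) (p : pro z w) :
  gcomp (associ m n p) (assoc m n p) = cid _.
Proof. apply g_of_ceq1, (associ_assoc _ HD). Qed.
Lemma g_lun_luni {x y : D} (m : pro x y) : gcomp (lun m) (luni m) = cid _.
Proof. apply g_of_ceq1, (lun_luni _ HD). Qed.
Lemma g_luni_lun {x y : D} (m : pro x y) : gcomp (luni m) (lun m) = cid _.
Proof. apply g_of_ceq1, (luni_lun _ HD). Qed.
Lemma g_run_runi {x y : D} (m : pro x y) : gcomp (run m) (runi m) = cid _.
Proof. apply g_of_ceq1, (run_runi _ HD). Qed.
Lemma g_runi_run {x y : D} (m : pro x y) : gcomp (runi m) (run m) = cid _.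
Proof. apply g_of_ceq1, (runi_run _ HD). Qed.
Lemma g_triangle {x y z : D} (m : pro x y) (n : pro y z) :
  gcomp (cid m ⊗ lun n) (assoc m (punit y) n) = run m ⊗ cid n.
Proof. apply g_of_ceq1, (triangle _ HD). Qed.
Lemma g_pentagon {x y z w v : D} (m : pro x y) (n : pro y z) (p : pro z w) (q : pro w v) :
  gcomp (assoc m n (p ⊙ q)) (assoc (m ⊙ n) p q)
  = gcomp (cid m ⊗ assoc n p q) (gcomp (assoc m (n ⊙ p) q) (assoc m n p ⊗ cid q)).
Proof.
  apply sq_inj; rewrite !sq_gcomp; exact (sq_of_ceq (pentagon _ HD _ _ _ _ _ m n p q)).
Qed.

Definition giso {x y : D} {m n : pro x y} (a : m ⟹ n) : Prop :=
  exists b : n ⟹ m, gcomp b a = cid m /\ gcomp a b = cid n.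

Lemma giso_mono {x y : D} {m n p : pro x y} {a : m ⟹ n}
    {b c : p ⟹ m} : giso a -> gcomp a b = gcomp a c -> b = c.
Proof.
  intros [i [H _]] E.
  rewrite <- (gcomp_idl b), <- (gcomp_idl c), <- H, <- !gcomp_assoc, E; reflexivity.
Qed.

Lemma giso_epi {x y : D} {m n p : pro x y} {a : m ⟹ n}
    {b c : n ⟹ p} : giso a -> gcomp b a = gcomp c a -> b = c.
Proof.
  intros [i [_ H]] E.
  rewrite <- (gcomp_idr b), <- (gcomp_idr c), <- H, !gcomp_assoc, E; reflexivity.
Qed.

Lemma giso_cid {x y : D} (m : pro x y) : giso (cid m).
Proof. exists (cid m); split; apply gcomp_idl. Qed.
Lemma giso_assoc {x y z w : D} (m : pro x y) (n : pro y z) (p : pro z w) : giso (assoc m n p).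
Proof. exists (associ m n p); split; [apply g_associ_assoc | apply g_assoc_associ]. Qed.
Lemma giso_associ {x y z w : D} (m : pro x y) (n : pro y z) (p : pro z w) : giso (associ m n p).
Proof. exists (assoc m n p); split; [apply g_assoc_associ | apply g_associ_assoc]. Qed.
Lemma giso_lun {x y : D} (m : pro x y) : giso (lun m).
Proof. exists (luni m); split; [apply g_luni_lun | apply g_lun_luni]. Qed.
Lemma giso_luni {x y : D} (m : pro x y) : giso (luni m).
Proof. exists (lun m); split; [apply g_lun_luni | apply g_luni_lun]. Qed.
Lemma giso_run {x y : D} (m : pro x y) : giso (run m).
Proof. exists (runi m); split; [apply g_runi_run | apply g_run_runi]. Qed.
Lemma giso_runi {x y : D} (m : pro x y) : giso (runi m).
Proof. exists (run m); split; [apply g_run_runi | apply g_runi_run]. Qed.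

Lemma giso_tens {x y z : D} {m n : pro x y} {m' n' : pro y z}
    {a : m ⟹ n} {a' : m' ⟹ n'} :
  giso a -> giso a' -> giso (a ⊗ a').
Proof.
  intros [b [H1 H2]] [b' [H1' H2']]; exists (b ⊗ b').
  rewrite <- !gcomp_tens, H1, H2, H1', H2'; split; apply (ctens_id _ HD).
Qed.

Lemma giso_comp {x y : D} {m n p : pro x y} {b : n ⟹ p}
    {a : m ⟹ n} : giso b -> giso a -> giso (gcomp b a).
Proof.
  intros [b' [H1 H2]] [a' [H1' H2']]; exists (gcomp a' b'); split.
  - rewrite <- gcomp_assoc, (gcomp_assoc b'), H1, gcomp_idl; exact H1'.
  - rewrite <- gcomp_assoc, (gcomp_assoc a), H2', gcomp_idl; exact H2.
Qed.

(** The left unitor is a natural isomorphism, so tensoring with the unit reflects equality.  This is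
    how Kelly derives the remaining triangles from the pentagon and the middle triangle. *)
Lemma unit_tens_faithful {x y : D} {m n : pro x y} {a b : m ⟹ n} :
  cid (punit x) ⊗ a = cid (punit x) ⊗ b -> a = b.
Proof.
  intros H; apply (giso_epi (giso_lun m)); rewrite <- !g_lun_nat, H; reflexivity.
Qed.

Lemma tens_unit_faithful {x y : D} {m n : pro x y} {a b : m ⟹ n} :
  a ⊗ cid (punit y) = b ⊗ cid (punit y) -> a = b.
Proof.
  intros H; apply (giso_epi (giso_run m)); rewrite <- !g_run_nat, H; reflexivity.
Qed.

(** Kelly's argument: after tensoring with one more unit, both sides can be compared by the pentagon
    and two instances of the middle triangle. *)
Lemma lun_tens {x y z : D} (m : pro x y) (n : pro y z) :
  gcomp (lun (m ⊙ n)) (assoc (punit x) m n) = lun m ⊗ cid n.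
Proof.
  apply unit_tens_faithful.
  apply (giso_epi (giso_comp (giso_assoc (punit x) (punit x ⊙ m) n)
    (giso_tens (giso_assoc (punit x) (punit x) m) (giso_cid n)))).
  rewrite gtens_r, <- gcomp_assoc, <- g_pentagon, gcomp_assoc, g_triangle.
  rewrite <- (ctens_id _ HD), <- g_assoc_nat, gcomp_assoc, <- g_assoc_nat,
    <- gcomp_assoc, <- gtens_l, g_triangle; reflexivity.
Qed.

Lemma run_tens {x y z : D} (m : pro x y) (n : pro y z) :
  gcomp (cid m ⊗ run n) (assoc m n (punit z)) = run (m ⊙ n).
Proof.
  apply tens_unit_faithful.
  apply (giso_mono (giso_assoc m n (punit z))).
  rewrite <- g_triangle, (gcomp_assoc (assoc _ _ _) (cid (m ⊙ n) ⊗ _)),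
    <- (ctens_id _ HD), g_assoc_nat, <- gcomp_assoc, g_pentagon, (gcomp_assoc (_ ⊗ (_ ⊗ lun _))),
    <- gtens_r, g_triangle, gtens_l, (gcomp_assoc (assoc _ _ _)), g_assoc_nat, <- gcomp_assoc.
  reflexivity.
Qed.

Lemma lun_punit (x : D) : lun (punit x) = run (punit x).
Proof.
  assert (E : lun (punit x ⊙ punit x) = cid (punit x) ⊗ lun (punit x)).
  { apply (giso_mono (giso_lun (punit x))); symmetry; apply g_lun_nat. }
  apply tens_unit_faithful.
  rewrite <- g_triangle, <- lun_tens, E; reflexivity.
Qed.

End Globular.

Notation "b • a" := (gcomp b a) (at level 40, left associativity) : dbl_scope.

(** * Coherence *)

Section Coherence.
Context {D : double_category}.
Let HD := dc_laws D.
Notation plist := (path (@pro D)).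

Fixpoint lcomp {x y : D} (l : plist x y) : pro x y :=
  match l with
  | pnil x => punit x
  | pcons m l => m ⊙ lcomp l
  end.

Fixpoint lapp {x y z : D} (l : plist x y) :
    forall l' : plist y z, lcomp l ⊙ lcomp l' ⟹ lcomp (papp l l') :=
  match l with
  | pnil x => fun l' => lun (lcomp l')
  | pcons m l => fun l' => (cid m ⊗ lapp l l') • assoc m (lcomp l) (lcomp l')
  end.

Lemma papp_nil_r {O : Type} {P : O -> O -> Type} {F G : O} (p : path P F G) :
  papp p (pnil G) = p.
Proof. induction p as [|F G H M p IH]; cbn; [|rewrite IH]; reflexivity. Qed.

Lemma papp_assoc {O : Type} {P : O -> O -> Type} {F G H K : O} (p : path P F G)
    (q : path P G H) (r : path P H K) : papp (papp p q) r = papp p (papp q r).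
Proof. induction p as [|F G H' M p IH]; cbn; [|rewrite IH]; reflexivity. Qed.

(** Equal lists have equal composites; the identity cell is transported along the equality, so that
    lists need to agree only propositionally. *)
Definition tr {x y : D} {l l' : plist x y} (e : l = l') :
    lcomp l ⟹ lcomp l' :=
  match e in _ = l' return lcomp l ⟹ lcomp l' with
  | eq_refl => cid (lcomp l)
  end.

Lemma tr_refl {x y : D} {l : plist x y} (e : l = l) : tr e = cid (lcomp l).
Proof. rewrite (proof_irrelevance _ e eq_refl); reflexivity. Qed.

Lemma tr_tr {x y : D} {l l' l'' : plist x y} (e : l = l') (e' : l' = l'') (e'' : l = l'') :
  tr e' • tr e = tr e''.
Proof. destruct e, e'; rewrite !tr_refl; apply gcomp_idl. Qed.

Lemma tr_cons {x y z : D} (m : pro x y) {l l' : plist y z} (e : l = l')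
    (e' : pcons m l = pcons m l') : tr e' = cid m ⊗ tr e.
Proof. destruct e; rewrite tr_refl; symmetry; apply (ctens_id _ HD). Qed.

Lemma giso_lapp {x y z : D} (l : plist x y) (l' : plist y z) : giso (lapp l l').
Proof.
  induction l as [x|x x1 y m l IH]; cbn.
  - apply giso_lun.
  - apply giso_comp; [apply giso_tens; [apply giso_cid | apply IH] | apply giso_assoc].
Qed.

(** The inductive step is the pentagon and the base case is [lun_tens]. *)
Lemma lapp_assoc {x y z w : D} (l : plist x y) (l' : plist y z) (l'' : plist z w)
    (e : papp (papp l l') l'' = papp l (papp l' l'')) :
  tr e • (lapp (papp l l') l'' • (lapp l l' ⊗ cid (lcomp l'')))
  = lapp l (papp l' l'') • ((cid (lcomp l) ⊗ lapp l' l'') • assoc (lcomp l) (lcomp l') (lcomp l'')).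
Proof.
  induction l as [x|x x1 y m l IH]; cbn in *.
  - rewrite tr_refl, gcomp_idl, <- lun_tens, gcomp_assoc, <- g_lun_nat, <- gcomp_assoc; reflexivity.
  - assert (e0 : papp (papp l l') l'' = papp l (papp l' l'')) by apply papp_assoc.
    rewrite (tr_cons m e0 e), gtens_l.
    rewrite <- (gcomp_assoc (cid m ⊗ lapp (papp l l') l'')),
      (gcomp_assoc (assoc m _ _) ((cid m ⊗ lapp l l') ⊗ _)), g_assoc_nat,
      <- (gcomp_assoc (cid m ⊗ (lapp l l' ⊗ _))), (gcomp_assoc (cid m ⊗ lapp (papp l l') l'')),
      <- gtens_r, (gcomp_assoc (cid m ⊗ tr e0)), <- gtens_r, (IH l' e0).
    rewrite !gtens_r, <- !gcomp_assoc.
    f_equal.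
    rewrite <- g_pentagon, <- (ctens_id _ HD), (gcomp_assoc (assoc m (lcomp l) _)), g_assoc_nat,
      <- gcomp_assoc; reflexivity.
Qed.

Lemma lapp_nil {x y : D} (l : plist x y) (e : papp l (pnil y) = l) :
  tr e • lapp l (pnil y) = run (lcomp l).
Proof.
  induction l as [x|x x1 y m l IH]; cbn in *.
  - rewrite tr_refl, gcomp_idl; apply lun_punit.
  - pose proof (papp_nil_r l) as e0.
    rewrite (tr_cons m e0 e), gcomp_assoc, <- gtens_r, (IH e0); apply run_tens.
Qed.

Lemma lapp_tr {x y z : D} {l1 l1' : plist x y} {l2 l2' : plist y z}
    (e1 : l1 = l1') (e2 : l2 = l2') (e : papp l1 l2 = papp l1' l2') :
  lapp l1' l2' • (tr e1 ⊗ tr e2) = tr e • lapp l1 l2.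
Proof.
  destruct e1, e2; rewrite !tr_refl.
  rewrite (ctens_id _ HD), gcomp_idl, gcomp_idr; reflexivity.
Qed.

(** A flattening of [m]: a list whose right-bracketed composite is isomorphic to [m]. *)
Record fl {x y : D} (m : pro x y) := Fl {
  fl_list : plist x y;
  fl_cell : m ⟹ lcomp fl_list;
  fl_giso : giso fl_cell
}.
Arguments Fl {x y m} _ _ _.
Arguments fl_list {x y m} _.
Arguments fl_cell {x y m} _.
Arguments fl_giso {x y m} _.

Definition fl_atom {x y : D} (m : pro x y) : fl m :=
  @Fl x y m (pcons m (pnil y)) (runi m) (giso_runi m).

Definition fl_unit (x : D) : fl (punit x) :=
  @Fl x x (punit x) (pnil x) (cid (punit x)) (giso_cid _).

Definition fl_tens {x y z : D} {m : pro x y} {n : pro y z} (A : fl m) (B : fl n) : fl (m ⊙ n) :=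
  @Fl x z (m ⊙ n) (papp (fl_list A) (fl_list B))
    (lapp (fl_list A) (fl_list B) • (fl_cell A ⊗ fl_cell B))
    (giso_comp (giso_lapp _ _) (giso_tens (fl_giso A) (fl_giso B))).

(** The isomorphism from [m] to [n] induced by flattenings with the same list. *)
Definition coh {x y : D} {m n : pro x y} (A : fl m) (B : fl n)
    (a : m ⟹ n) : Prop :=
  exists e : fl_list A = fl_list B, fl_cell B • a = tr e • fl_cell A.

(** Coherence in the form in which it is used: two isomorphisms that are both compatible with the
    flattenings are equal, whatever they are made of. *)
Lemma coh_unique {x y : D} {m n : pro x y} {A : fl m} {B : fl n}
    {a b : m ⟹ n} : coh A B a -> coh A B b -> a = b.
Proof.
  intros [e H] [e' H']; apply (giso_mono (fl_giso B)).
  rewrite H, H', (proof_irrelevance _ e e'); reflexivity.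
Qed.

Lemma coh_id {x y : D} {m : pro x y} (A : fl m) : coh A A (cid m).
Proof. exists eq_refl; cbn; rewrite gcomp_idl, gcomp_idr; reflexivity. Qed.

Lemma coh_comp {x y : D} {m n p : pro x y} {A : fl m} {B : fl n} {C : fl p}
    {b : n ⟹ p} {a : m ⟹ n} :
  coh B C b -> coh A B a -> coh A C (b • a).
Proof.
  intros [e H] [e' H']; exists (eq_trans e' e).
  rewrite gcomp_assoc, H, <- gcomp_assoc, H', gcomp_assoc, (tr_tr _ _ (eq_trans e' e)).
  reflexivity.
Qed.

Lemma coh_tens {x y z : D} {m n : pro x y} {m' n' : pro y z} {A : fl m} {B : fl n}
    {A' : fl m'} {B' : fl n'}
    {a : m ⟹ n} {a' : m' ⟹ n'} :
  coh A B a -> coh A' B' a' -> coh (fl_tens A A') (fl_tens B B') (a ⊗ a').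
Proof.
  intros [e H] [e' H'].
  assert (E : papp (fl_list A) (fl_list A') = papp (fl_list B) (fl_list B'))
    by (rewrite e, e'; reflexivity).
  exists E; cbn.
  rewrite <- gcomp_assoc, <- gcomp_tens, H, H', gcomp_tens, gcomp_assoc, (lapp_tr _ _ E),
    gcomp_assoc; reflexivity.
Qed.

Lemma coh_exists {x y : D} {m n : pro x y} (A : fl m) (B : fl n) :
  fl_list A = fl_list B -> exists a, coh A B a.
Proof.
  intros e; destruct (fl_giso B) as [b [H1 H2]].
  exists (b • (tr e • fl_cell A)), e.
  rewrite gcomp_assoc, H2, gcomp_idl; reflexivity.
Qed.

Lemma coh_inv {x y : D} {m n : pro x y} {A : fl m} {B : fl n}
    {a : m ⟹ n} : coh A B a ->
  exists b, coh B A b /\ b • a = cid m /\ a • b = cid n.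
Proof.
  intros H; destruct (H) as [e _].
  destruct (coh_exists B A (eq_sym e)) as [b Hb].
  exists b; split; [exact Hb|]; split.
  - exact (coh_unique (coh_comp Hb H) (coh_id A)).
  - exact (coh_unique (coh_comp H Hb) (coh_id B)).
Qed.

Lemma coh_sym {x y : D} {m n : pro x y} {A : fl m} {B : fl n}
    {a : m ⟹ n} {b : n ⟹ m} :
  coh A B a -> a • b = cid n -> coh B A b.
Proof.
  intros H E; destruct (coh_inv H) as (c & Hc & H1 & H2).
  replace b with c; [exact Hc|].
  rewrite <- (gcomp_idr c), <- E, gcomp_assoc, H1, gcomp_idl; reflexivity.
Qed.

Lemma coh_assoc {x y z w : D} {m : pro x y} {n : pro y z} {p : pro z w}
    (A : fl m) (B : fl n) (C : fl p) :
  coh (fl_tens (fl_tens A B) C) (fl_tens A (fl_tens B C)) (assoc m n p).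
Proof.
  exists (papp_assoc _ _ _); cbn.
  rewrite <- (gcomp_idl (fl_cell A)) at 1; rewrite <- (gcomp_idl (fl_cell C)) at 2.
  rewrite !gcomp_tens, <- !gcomp_assoc.
  rewrite <- g_assoc_nat, (gcomp_assoc (cid _ ⊗ lapp _ _)), (gcomp_assoc (lapp _ (papp _ _))),
    <- (lapp_assoc _ _ _ (papp_assoc _ _ _)), <- !gcomp_assoc.
  reflexivity.
Qed.

Lemma coh_associ {x y z w : D} {m : pro x y} {n : pro y z} {p : pro z w}
    (A : fl m) (B : fl n) (C : fl p) :
  coh (fl_tens A (fl_tens B C)) (fl_tens (fl_tens A B) C) (associ m n p).
Proof. exact (coh_sym (coh_assoc A B C) (g_assoc_associ _ _ _)). Qed.

Lemma coh_lun {x y : D} {m : pro x y} (A : fl m) : coh (fl_tens (fl_unit x) A) A (lun m).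
Proof. exists eq_refl; cbn; rewrite gcomp_idl; symmetry; apply g_lun_nat. Qed.

Lemma coh_luni {x y : D} {m : pro x y} (A : fl m) : coh A (fl_tens (fl_unit x) A) (luni m).
Proof. exact (coh_sym (coh_lun A) (g_lun_luni _)). Qed.

Lemma coh_run {x y : D} {m : pro x y} (A : fl m) : coh (fl_tens A (fl_unit y)) A (run m).
Proof.
  exists (papp_nil_r _); cbn.
  rewrite gcomp_assoc; etransitivity; [symmetry; apply g_run_nat|].
  f_equal; symmetry; apply lapp_nil.
Qed.

Lemma coh_runi {x y : D} {m : pro x y} (A : fl m) : coh A (fl_tens A (fl_unit y)) (runi m).
Proof. exact (coh_sym (coh_run A) (g_run_runi _)). Qed.

End Coherence.
Arguments Fl {D x y m} _ _ _.
Arguments fl_list {D x y m} _.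
Arguments fl_cell {D x y m} _.
Arguments fl_giso {D x y m} _.

(** * Modules *)
Section Modules.
Context {D E : double_category}.
Let HD := dc_laws D.
Let HE := dc_laws E.

Section Laws.
Context {F G : lax_functor D E} (N : module F G).
Let HN := mod_lax _ _ N.

Lemma mcell_id {x y : D} (m : pro x y) : mcell N (cid m) ≈ cid (mpro N m).
Proof. exact (lcell_id _ HN (x, zero) (y, one) (m, tt)). Qed.

Lemma sq_mcell_comp {x y x1 y1 x2 y2 : D} {f1 : hom x x1} {g1 : hom y y1}
    {f2 : hom x1 x2} {g2 : hom y1 y2} {m m1 m2}
    (b : cell f2 g2 m1 m2) (a : cell f1 g1 m m1) :
  ⟦mcell N (b ∙ a)⟧ = ⟦mcell N b⟧ ⋆ ⟦mcell N a⟧.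
Proof.
  exact (sq_of_ceq (lcell_comp _ HN (x, zero) (y, one) (x1, zero) (y1, one) (x2, zero) (y2, one)
    (f1, tt) (g1, tt) (f2, tt) (g2, tt) (m, tt) (m1, tt) (m2, tt) (b, tt) (a, tt))).
Qed.

Lemma sq_mactl_nat {x y z x' y' z' : D} {f : hom x x'} {g : hom y y'} {h : hom z z'}
    {m n m' n'} (a : cell f g m m') (b : cell g h n n') :
  ⟦mcell N (a ⊗ b)⟧ ⋆ ⟦mactl N m n⟧
  = ⟦mactl N m' n'⟧ ⋆ ⟦lcell F a ⊗ mcell N b⟧.
Proof.
  exact (sq_of_ceq (ltens_nat _ HN (x, zero) (y, zero) (z, one) (x', zero) (y', zero) (z', one)
    (f, tt) (g, tt) (h, tt) (m, tt) (n, tt) (m', tt) (n', tt) (a, tt) (b, tt))).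
Qed.

Lemma sq_mactr_nat {x y z x' y' z' : D} {f : hom x x'} {g : hom y y'} {h : hom z z'}
    {m n m' n'} (a : cell f g m m') (b : cell g h n n') :
  ⟦mcell N (a ⊗ b)⟧ ⋆ ⟦mactr N m n⟧
  = ⟦mactr N m' n'⟧ ⋆ ⟦mcell N a ⊗ lcell G b⟧.
Proof.
  exact (sq_of_ceq (ltens_nat _ HN (x, zero) (y, one) (z, one) (x', zero) (y', one) (z', one)
    (f, tt) (g, tt) (h, tt) (m, tt) (n, tt) (m', tt) (n', tt) (a, tt) (b, tt))).
Qed.

Lemma sq_act_ll {x y z w : D} (m : pro x y) (n : pro y z) (p : pro z w) :
  ⟦mcell N (assoc m n p)⟧ ⋆
    (⟦mactl N (m ⊙ n) p⟧ ⋆ ⟦ltens F m n ⊗ cid (mpro N p)⟧)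
  = ⟦mactl N m (n ⊙ p)⟧ ⋆
      (⟦cid (lpro F m) ⊗ mactl N n p⟧ ⋆
         ⟦assoc (lpro F m) (lpro F n) (mpro N p)⟧).
Proof.
  exact (sq_of_ceq (ltens_assoc _ HN (x, zero) (y, zero) (z, zero) (w, one)
    (m, tt) (n, tt) (p, tt))).
Qed.

Lemma sq_act_lr {x y z w : D} (m : pro x y) (n : pro y z) (p : pro z w) :
  ⟦mcell N (assoc m n p)⟧ ⋆
    (⟦mactr N (m ⊙ n) p⟧ ⋆ ⟦mactl N m n ⊗ cid (lpro G p)⟧)
  = ⟦mactl N m (n ⊙ p)⟧ ⋆
      (⟦cid (lpro F m) ⊗ mactr N n p⟧ ⋆
         ⟦assoc (lpro F m) (mpro N n) (lpro G p)⟧).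
Proof.
  exact (sq_of_ceq (ltens_assoc _ HN (x, zero) (y, zero) (z, one) (w, one)
    (m, tt) (n, tt) (p, tt))).
Qed.

Lemma sq_act_rr {x y z w : D} (m : pro x y) (n : pro y z) (p : pro z w) :
  ⟦mcell N (assoc m n p)⟧ ⋆
    (⟦mactr N (m ⊙ n) p⟧ ⋆ ⟦mactr N m n ⊗ cid (lpro G p)⟧)
  = ⟦mactr N m (n ⊙ p)⟧ ⋆
      (⟦cid (mpro N m) ⊗ ltens G n p⟧ ⋆
         ⟦assoc (mpro N m) (lpro G n) (lpro G p)⟧).
Proof.
  exact (sq_of_ceq (ltens_assoc _ HN (x, zero) (y, one) (z, one) (w, one)
    (m, tt) (n, tt) (p, tt))).
Qed.

Lemma sq_act_lun {x y : D} (m : pro x y) :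
  ⟦mcell N (lun m)⟧ ⋆
    (⟦mactl N (punit x) m⟧ ⋆ ⟦lunit F x ⊗ cid (mpro N m)⟧)
  = ⟦lun (mpro N m)⟧.
Proof. exact (sq_of_ceq (ltens_lun _ HN (x, zero) (y, one) (m, tt))). Qed.

Lemma sq_act_run {x y : D} (m : pro x y) :
  ⟦mcell N (run m)⟧ ⋆
    (⟦mactr N m (punit y)⟧ ⋆ ⟦cid (mpro N m) ⊗ lunit G y⟧)
  = ⟦run (mpro N m)⟧.
Proof. exact (sq_of_ceq (ltens_run _ HN (x, zero) (y, one) (m, tt))). Qed.
End Laws.

(** Every law of a module, seen as a lax functor on the product with the walking proarrow, becomes a law
    of [F] when both functors and the module are [F]. *)
Lemma umod_laws (F : lax_functor D E) :
  lax_laws (glue F F (@lpro _ _ F) (@lcell _ _ F) (@ltens _ _ F) (@ltens _ _ F)).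
Proof.
  pose proof (lf_laws _ _ F) as HF.
  constructor; intros;
    cbn in *; destruct_pairs; cbn in *; destruct_pairs;
    repeat match goal with t : two |- _ => destruct t end; cbn in *;
    try match goal with e : Empty_set |- _ => destruct e end.
  all: solve [apply (lhom_id _ HF) | apply (lhom_comp _ HF) | apply (lcell_id _ HF)
    | apply (lcell_comp _ HF) | apply (ltens_nat _ HF) | apply (lunit_nat _ HF)
    | apply (ltens_assoc _ HF) | apply (ltens_lun _ HF) | apply (ltens_run _ HF)].
Qed.

(** The module of [F] over itself.  Its entries are the entries of the functor [F], and both actions are
    laxators, so that all lemmas on actions also apply to composition of functor entries. *)
Definition umod (F : lax_functor D E) : module F F :=
  {| mpro := @lpro _ _ F; mcell := @lcell _ _ F; mactl := @ltens _ _ F; mactr := @ltens _ _ F;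
     mod_lax := umod_laws F |}.
End Modules.

(** * Entries *)
Section SqLemmas.
Context {D : double_category}.
Let HD := dc_laws D.

Lemma gpost_id {x y x' y' : D} {f : hom x x'} {g : hom y y'} {m : pro x y} {n : pro x' y'}
    (a : cell f g m n) : gpost (cid n) a = a.
Proof. apply sq_inj; rewrite sq_gpost; apply (sq_comp_idl HD). Qed.

Lemma gpost_tens_l {x y z x' y' z' : D} {f : hom x x'} {g : hom y y'} {h : hom z z'}
    {m : pro x y} {n p : pro x' y'} {m' : pro y z} {n' : pro y' z'}
    (b : n ⟹ p) (a : cell f g m n) (a' : cell g h m' n') :
  gpost b a ⊗ a' = gpost (b ⊗ cid n') (a ⊗ a').
Proof. rewrite <- gpost_tens, gpost_id; reflexivity. Qed.

Lemma gpost_tens_r {x y z x' y' z' : D} {f : hom x x'} {g : hom y y'} {h : hom z z'}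
    {m : pro x y} {n : pro x' y'} {m' : pro y z} {n' p' : pro y' z'}
    (b : n' ⟹ p') (a : cell f g m n) (a' : cell g h m' n') :
  a ⊗ gpost b a' = gpost (cid n ⊗ b) (a ⊗ a').
Proof. rewrite <- gpost_tens, gpost_id; reflexivity. Qed.

Lemma sq_assoc_nat {x y z w x' y' z' w' : D}
    {f : hom x x'} {g : hom y y'} {h : hom z z'} {k : hom w w'}
    {m n p m' n' p'} (a : cell f g m m') (b : cell g h n n') (c : cell h k p p') :
  ⟦assoc m' n' p'⟧ ⋆ ⟦(a ⊗ b) ⊗ c⟧
  = ⟦a ⊗ (b ⊗ c)⟧ ⋆ ⟦assoc m n p⟧.
Proof. exact (sq_of_ceq (assoc_nat _ HD _ _ _ _ _ _ _ _ _ _ _ _ _ _ _ _ _ _ a b c)). Qed.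

Lemma sq_lun_nat {x y x' y' : D} {f : hom x x'} {g : hom y y'} {m n} (a : cell f g m n) :
  ⟦lun n⟧ ⋆ ⟦cunit f ⊗ a⟧ = ⟦a⟧ ⋆ ⟦lun m⟧.
Proof. exact (sq_of_ceq (lun_nat _ HD _ _ _ _ _ _ _ _ a)). Qed.

Lemma sq_run_nat {x y x' y' : D} {f : hom x x'} {g : hom y y'} {m n} (a : cell f g m n) :
  ⟦run n⟧ ⋆ ⟦a ⊗ cunit g⟧ = ⟦a⟧ ⋆ ⟦run m⟧.
Proof. exact (sq_of_ceq (run_nat _ HD _ _ _ _ _ _ _ _ a)). Qed.

Lemma sq_tens_comp {x y z x1 y1 z1 x2 y2 z2 : D}
    {f1 : hom x x1} {g1 : hom y y1} {h1 : hom z z1}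
    {f2 : hom x1 x2} {g2 : hom y1 y2} {h2 : hom z1 z2} {m n m1 n1 m2 n2}
    (a : cell f1 g1 m m1) (a' : cell g1 h1 n n1)
    (b : cell f2 g2 m1 m2) (b' : cell g2 h2 n1 n2) :
  ⟦b ⊗ b'⟧ ⋆ ⟦a ⊗ a'⟧ = ⟦(b ∙ a) ⊗ (b' ∙ a')⟧.
Proof. rewrite (ctens_comp _ HD); reflexivity. Qed.

Lemma sq_comp_cong {x y x1 y1 x2 y2 : D} {m : pro x y} {m1 : pro x1 y1} {m2 : pro x2 y2}
    {b b' : sq m1 m2} {a a' : sq m m1} : b = b' -> a = a' -> b ⋆ a = b' ⋆ a'.
Proof. intros -> ->; reflexivity. Qed.
End SqLemmas.

Section Entries.
Context {D E : double_category}.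
Let HD := dc_laws D.
Let HE := dc_laws E.

(** An entry of a module: a cell with presented source [eX] and presented index [en] in [D].  The arrows
    [f] and [g] play the role of the objects between which the entry is composable. *)
Record ent {F G : lax_functor D E} (N : module F G) {x y : E} {z w : D}
    (f : hom x (F z)) (g : hom y (G w)) := Ent {
  eX : pro x y;
  en : pro z w;
  eA : fl eX;
  eB : fl en;
  ec : cell f g eX (mpro N en)
}.
Arguments Ent {F G N x y z w f g} _ _ _ _ _.
Arguments eX {F G N x y z w f g} _.
Arguments en {F G N x y z w f g} _.
Arguments eA {F G N x y z w f g} _.
Arguments eB {F G N x y z w f g} _.
Arguments ec {F G N x y z w f g} _.

(** The coherence isomorphism of the source acts by precomposition and that of the index through [N].
    The arrows at the sides may be different terms; they are equal by [esim_bd]. *)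
Definition esim {F G : lax_functor D E} {N : module F G} {x y : E} {z w : D}
    {f f' : hom x (F z)} {g g' : hom y (G w)} (a : ent N f g) (b : ent N f' g') : Prop :=
  exists φ ψ, coh (eA a) (eA b) φ /\ coh (eB a) (eB b) ψ /\
    ⟦mcell N ψ⟧ ⋆ ⟦ec a⟧ = ⟦ec b⟧ ⋆ ⟦φ⟧.
Infix "≃" := esim (at level 70).

Section Equiv.
Context {F G : lax_functor D E} {N : module F G} {x y : E} {z w : D}.

Lemma sq_mcell_id (m : pro z w) : ⟦mcell N (cid m)⟧ = ⟦cid (mpro N m)⟧.
Proof. exact (sq_of_ceq (mcell_id N m)). Qed.

Lemma sq_mcell_cong {x1 y1 x2 y2 : D} {m : pro x1 y1} {n : pro x2 y2}
    {f f' : hom x1 x2} {g g' : hom y1 y2} {a : cell f g m n} {b : cell f' g' m n} :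
  ⟦a⟧ = ⟦b⟧ -> ⟦mcell N a⟧ = ⟦mcell N b⟧.
Proof. intros H; apply ceq_of_sq in H; destruct H; reflexivity. Qed.

Lemma sq_mcell_gcomp {m n p : pro z w} (b : n ⟹ p)
    (a : m ⟹ n) :
  ⟦mcell N (b • a)⟧ = ⟦mcell N b⟧ ⋆ ⟦mcell N a⟧.
Proof.
  rewrite <- sq_mcell_comp; apply sq_mcell_cong, sq_gcomp.
Qed.

Lemma esim_refl {f : hom x (F z)} {g : hom y (G w)} (a : ent N f g) : a ≃ a.
Proof.
  exists (cid _), (cid _); split; [apply coh_id | split; [apply coh_id|]].
  rewrite sq_mcell_id, (sq_comp_idl HE), (sq_comp_idr HE); reflexivity.
Qed.

Lemma esim_trans {f f' f'' : hom x (F z)} {g g' g'' : hom y (G w)} {a : ent N f g}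
    {b : ent N f' g'} {c : ent N f'' g''} : a ≃ b -> b ≃ c -> a ≃ c.
Proof.
  intros (φ & ψ & H1 & H2 & H3) (φ' & ψ' & H1' & H2' & H3').
  exists (φ' • φ), (ψ' • ψ); split; [exact (coh_comp H1' H1)|].
  split; [exact (coh_comp H2' H2)|].
  rewrite sq_mcell_gcomp, sq_gcomp, <- (sq_comp_assoc HE), H3, (sq_comp_assoc HE), H3',
    <- (sq_comp_assoc HE); reflexivity.
Qed.

Lemma esim_sym {f f' : hom x (F z)} {g g' : hom y (G w)} {a : ent N f g}
    {b : ent N f' g'} : a ≃ b -> b ≃ a.
Proof.
  intros (φ & ψ & H1 & H2 & H3).
  destruct (coh_inv H1) as (φ' & K1 & K2 & K3), (coh_inv H2) as (ψ' & L1 & L2 & L3).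
  exists φ', ψ'; split; [exact K1|]; split; [exact L1|].
  rewrite <- (sq_comp_idr HE ⟦ec b⟧), <- K3, sq_gcomp, (sq_comp_assoc HE ⟦ec b⟧),
    <- H3, !(sq_comp_assoc HE), <- sq_mcell_gcomp, L2, sq_mcell_id, (sq_comp_idl HE).
  reflexivity.
Qed.

(** For equal presentations the relating isomorphisms are identities by [coh_unique].  This is how an
    equation between entries gives back an equation between cells. *)
Lemma esim_sq {f f' : hom x (F z)} {g g' : hom y (G w)} {X : pro x y} {n : pro z w}
    {A : fl X} {B : fl n} {a : cell f g X (mpro N n)} {b : cell f' g' X (mpro N n)} :
  Ent X n A B a ≃ Ent X n A B b -> ⟦a⟧ = ⟦b⟧.
Proof.
  intros (φ & ψ & H1 & H2 & H3); cbn in *.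
  pose proof (coh_unique H1 (coh_id A)) as ->; pose proof (coh_unique H2 (coh_id B)) as ->.
  rewrite sq_mcell_id, (sq_comp_idl HE), (sq_comp_idr HE) in H3; exact H3.
Qed.

Lemma esim_of_sq {f f' : hom x (F z)} {g g' : hom y (G w)} {X : pro x y} {n : pro z w}
    {A : fl X} {B : fl n} {a : cell f g X (mpro N n)} {b : cell f' g' X (mpro N n)} :
  ⟦a⟧ = ⟦b⟧ -> Ent X n A B a ≃ Ent X n A B b.
Proof.
  intros H; exists (cid _), (cid _); split; [apply coh_id | split; [apply coh_id|]]; cbn.
  rewrite sq_mcell_id, (sq_comp_idl HE), (sq_comp_idr HE); exact H.
Qed.
End Equiv.

Definition lact {F G : lax_functor D E} {N : module F G} {x y t : E} {z w s : D}
    {f : hom x (F z)} {g : hom y (F w)} {h : hom t (G s)}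
    (p : ent (umod F) f g) (e : ent N g h) : ent N f h :=
  Ent (eX p ⊙ eX e) (en p ⊙ en e) (fl_tens (eA p) (eA e)) (fl_tens (eB p) (eB e))
    (gpost (mactl N (en p) (en e)) (ec p ⊗ ec e)).

Definition ract {F G : lax_functor D E} {N : module F G} {x y t : E} {z w s : D}
    {f : hom x (F z)} {g : hom y (G w)} {h : hom t (G s)}
    (e : ent N f g) (p : ent (umod G) g h) : ent N f h :=
  Ent (eX e ⊙ eX p) (en e ⊙ en p) (fl_tens (eA e) (eA p)) (fl_tens (eB e) (eB p))
    (gpost (mactr N (en e) (en p)) (ec e ⊗ ec p)).

Definition one (F : lax_functor D E) {x : E} {z : D} (f : hom x (F z)) : ent (umod F) f f :=
  @Ent F F (umod F) x x z z f f (punit x) (punit z) (fl_unit x) (fl_unit z)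
    (gpost (lunit F z) (cunit f)).

Section Act.
Context {F G : lax_functor D E} {N : module F G}.

Lemma lact_cong {x y t : E} {z w s : D}
    {f f' : hom x (F z)} {g g' : hom y (F w)} {h h' : hom t (G s)}
    {p : ent (umod F) f g} {e : ent N g h} {p' : ent (umod F) f' g'} {e' : ent N g' h'} :
  p ≃ p' -> e ≃ e' -> lact p e ≃ lact p' e'.
Proof.
  intros (φ & ψ & H1 & H2 & H3) (φ' & ψ' & H1' & H2' & H3').
  exists (φ ⊗ φ'), (ψ ⊗ ψ'); split; [exact (coh_tens H1 H1')|].
  split; [exact (coh_tens H2 H2')|]; cbn.
  rewrite !sq_gpost, (sq_comp_assoc HE), (sq_mactl_nat N), <- !(sq_comp_assoc HE), !sq_tens_comp.
  f_equal; apply sq_ctens; assumption.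
Qed.

Lemma ract_cong {x y t : E} {z w s : D}
    {f f' : hom x (F z)} {g g' : hom y (G w)} {h h' : hom t (G s)}
    {e : ent N f g} {p : ent (umod G) g h} {e' : ent N f' g'} {p' : ent (umod G) g' h'} :
  e ≃ e' -> p ≃ p' -> ract e p ≃ ract e' p'.
Proof.
  intros (φ & ψ & H1 & H2 & H3) (φ' & ψ' & H1' & H2' & H3').
  exists (φ ⊗ φ'), (ψ ⊗ ψ'); split; [exact (coh_tens H1 H1')|].
  split; [exact (coh_tens H2 H2')|]; cbn.
  rewrite !sq_gpost, (sq_comp_assoc HE), (sq_mactr_nat N), <- !(sq_comp_assoc HE), !sq_tens_comp.
  f_equal; apply sq_ctens; assumption.
Qed.

(** The relating isomorphisms are associators; the equation is the associativity axiom of the module.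
    The same holds for the two lemmas that follow. *)
Lemma lact_lact {x y t r : E} {z w s v : D}
    {f : hom x (F z)} {g : hom y (F w)} {h : hom t (F s)} {k : hom r (G v)}
    (p : ent (umod F) f g) (q : ent (umod F) g h) (e : ent N h k) :
  lact (lact p q) e ≃ lact p (lact q e).
Proof.
  exists (assoc _ _ _), (assoc _ _ _); split; [apply coh_assoc | split; [apply coh_assoc|]].
  cbn; rewrite (gpost_tens_l (ltens F _ _)), (gpost_tens_r (mactl N _ _)), !sq_gpost.
  rewrite <- !(sq_comp_assoc HE), <- sq_assoc_nat, !(sq_comp_assoc HE).
  rewrite <- (sq_comp_assoc HE ⟦mcell N _⟧), (sq_act_ll N), !(sq_comp_assoc HE).
  reflexivity.
Qed.

Lemma lact_ract {x y t r : E} {z w s v : D}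
    {f : hom x (F z)} {g : hom y (F w)} {h : hom t (G s)} {k : hom r (G v)}
    (p : ent (umod F) f g) (e : ent N g h) (q : ent (umod G) h k) :
  ract (lact p e) q ≃ lact p (ract e q).
Proof.
  exists (assoc _ _ _), (assoc _ _ _); split; [apply coh_assoc | split; [apply coh_assoc|]].
  cbn; rewrite (gpost_tens_l (mactl N _ _)), (gpost_tens_r (mactr N _ _)), !sq_gpost.
  rewrite <- !(sq_comp_assoc HE), <- sq_assoc_nat, !(sq_comp_assoc HE).
  rewrite <- (sq_comp_assoc HE ⟦mcell N _⟧), (sq_act_lr N), !(sq_comp_assoc HE).
  reflexivity.
Qed.

Lemma ract_ract {x y t r : E} {z w s v : D}
    {f : hom x (F z)} {g : hom y (G w)} {h : hom t (G s)} {k : hom r (G v)}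
    (e : ent N f g) (p : ent (umod G) g h) (q : ent (umod G) h k) :
  ract (ract e p) q ≃ ract e (lact p q).
Proof.
  exists (assoc _ _ _), (assoc _ _ _); split; [apply coh_assoc | split; [apply coh_assoc|]].
  cbn; rewrite (gpost_tens_l (mactr N _ _)), (gpost_tens_r (ltens G _ _)), !sq_gpost.
  rewrite <- !(sq_comp_assoc HE), <- sq_assoc_nat, !(sq_comp_assoc HE).
  rewrite <- (sq_comp_assoc HE ⟦mcell N _⟧), (sq_act_rr N), !(sq_comp_assoc HE).
  reflexivity.
Qed.

Lemma one_lact {x y : E} {z w : D} {f : hom x (F z)} {g : hom y (G w)} (e : ent N f g) :
  lact (one F f) e ≃ e.
Proof.
  exists (lun _), (lun _); split; [apply coh_lun | split; [apply coh_lun|]].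
  cbn; rewrite (gpost_tens_l (lunit F _)), !sq_gpost, !(sq_comp_assoc HE).
  rewrite <- (sq_comp_assoc HE ⟦mcell N _⟧), (sq_act_lun N); apply sq_lun_nat.
Qed.

Lemma ract_one {x y : E} {z w : D} {f : hom x (F z)} {g : hom y (G w)} (e : ent N f g) :
  ract e (one G g) ≃ e.
Proof.
  exists (run _), (run _); split; [apply coh_run | split; [apply coh_run|]].
  cbn; rewrite (gpost_tens_r (lunit G _)), !sq_gpost, !(sq_comp_assoc HE).
  rewrite <- (sq_comp_assoc HE ⟦mcell N _⟧), (sq_act_run N); apply sq_run_nat.
Qed.
End Act.

Lemma one_cong {F : lax_functor D E} {x : E} {z : D} {f f' : hom x (F z)} :
  f = f' -> one F f ≃ one F f'.
Proof. intros <-; apply esim_refl. Qed.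

(** [B] is an argument since a cell of [D] does not provide a presentation of its target. *)
Definition vp {F G : lax_functor D E} {N : module F G} {x y : E} {z w z' w' : D}
    {f : hom x (F z)} {g : hom y (G w)} {u : hom z z'} {v : hom w w'} (e : ent N f g)
    {n : pro z' w'} (B : fl n) (γ : cell u v (en e) n) :
    ent N (lhom F u ∘ f) (lhom G v ∘ g) :=
  Ent (eX e) n (eA e) B (mcell N γ ∙ ec e).

(** The hypothesis is stated for all [ψ] because [≃] does not name its isomorphisms; there is only one
    by [coh_unique]. *)
Lemma vp_cong {F G : lax_functor D E} {N : module F G} {x y : E} {z w z' w' : D}
    {f f' : hom x (F z)} {g g' : hom y (G w)} {u : hom z z'} {v : hom w w'}
    {e : ent N f g} {e' : ent N f' g'} {n n' : pro z' w'} (B : fl n) (B' : fl n')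
    (γ : cell u v (en e) n) (γ' : cell u v (en e') n') :
  e ≃ e' ->
  (forall ψ, coh (eB e) (eB e') ψ -> exists ψ', coh B B' ψ' /\
     ⟦ψ'⟧ ⋆ ⟦γ⟧ = ⟦γ'⟧ ⋆ ⟦ψ⟧) ->
  vp e B γ ≃ vp e' B' γ'.
Proof.
  intros (φ & ψ & H1 & H2 & H3) K; destruct (K _ H2) as (ψ' & K1 & K2).
  exists φ, ψ'; split; [exact H1|]; split; [exact K1|]; cbn.
  rewrite !to_sq_comp, (sq_comp_assoc HE), <- (sq_mcell_comp N), <- (sq_comp_assoc HE), <- H3,
    (sq_comp_assoc HE), <- (sq_mcell_comp N).
  f_equal; apply sq_mcell_cong, K2.
Qed.

Lemma vp_lact {F G : lax_functor D E} {N : module F G} {x y t : E} {z w s z' w' s' : D}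
    {f : hom x (F z)} {g : hom y (F w)} {h : hom t (G s)}
    {u : hom z z'} {v : hom w w'} {r : hom s s'}
    (p : ent (umod F) f g) (e : ent N g h) {n n'} (B : fl n) (B' : fl n')
    (γ : cell u v (en p) n) (γ' : cell v r (en e) n') :
  vp (lact p e) (fl_tens B B') (γ ⊗ γ') ≃ lact (vp p B γ) (vp e B' γ').
Proof.
  apply esim_of_sq; cbn.
  rewrite to_sq_comp, !sq_gpost, (sq_comp_assoc HE), (sq_mactl_nat N), <- (sq_comp_assoc HE),
    sq_tens_comp; reflexivity.
Qed.

Lemma vp_ract {F G : lax_functor D E} {N : module F G} {x y t : E} {z w s z' w' s' : D}
    {f : hom x (F z)} {g : hom y (G w)} {h : hom t (G s)}
    {u : hom z z'} {v : hom w w'} {r : hom s s'}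
    (e : ent N f g) (p : ent (umod G) g h) {n n'} (B : fl n) (B' : fl n')
    (γ : cell u v (en e) n) (γ' : cell v r (en p) n') :
  vp (ract e p) (fl_tens B B') (γ ⊗ γ') ≃ ract (vp e B γ) (vp p B' γ').
Proof.
  apply esim_of_sq; cbn.
  rewrite to_sq_comp, !sq_gpost, (sq_comp_assoc HE), (sq_mactr_nat N), <- (sq_comp_assoc HE),
    sq_tens_comp; reflexivity.
Qed.

Lemma vp_one {F : lax_functor D E} {x : E} {z z' : D} (f : hom x (F z)) (u : hom z z') :
  vp (one F f) (fl_unit z') (cunit u) ≃ one F (lhom F u ∘ f).
Proof.
  apply esim_of_sq; cbn.
  rewrite to_sq_comp, !sq_gpost, (sq_comp_assoc HE).
  rewrite (sq_of_ceq (lunit_nat _ (lf_laws _ _ F) _ _ u) :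
    ⟦lcell F (cunit u)⟧ ⋆ ⟦lunit F z⟧ = _).
  rewrite (cunit_comp _ HE), !to_sq_comp, (sq_comp_assoc HE); reflexivity.
Qed.

(** Restriction along cells of [E] extends equations from generic entries to all entries. *)
Definition ep {F G : lax_functor D E} {N : module F G} {x y x' y' : E} {z w : D}
    {f : hom x (F z)} {g : hom y (G w)} {s : hom x' x} {t : hom y' y} (e : ent N f g)
    {X : pro x' y'} (A : fl X) (ξ : cell s t X (eX e)) : ent N (f ∘ s) (g ∘ t) :=
  Ent X (en e) A (eB e) (ec e ∙ ξ).
End Entries.

Arguments Ent {D E F G N x y z w f g} _ _ _ _ _.
Arguments eX {D E F G N x y z w f g} _.
Arguments en {D E F G N x y z w f g} _.
Arguments eA {D E F G N x y z w f g} _.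
Arguments eB {D E F G N x y z w f g} _.
Arguments ec {D E F G N x y z w f g} _.
Infix "≃" := esim (at level 70) : dbl_scope.

Arguments ccast : simpl never.

(** * Comparison cells as entries *)
Section Pasting.
Context {D E : double_category}.
Let HD := dc_laws D.
Let HE := dc_laws E.

Lemma sq_luni_nat {x y x' y' : E} {f : hom x x'} {g : hom y y'} {m n} (a : cell f g m n) :
  ⟦luni n⟧ ⋆ ⟦a⟧ = ⟦cunit f ⊗ a⟧ ⋆ ⟦luni m⟧.
Proof.
  rewrite <- (sq_comp_idr HE ⟦a⟧), <- (g_lun_luni m), sq_gcomp, !(sq_comp_assoc HE).
  rewrite <- (sq_comp_assoc HE ⟦luni n⟧), <- sq_lun_nat, (sq_comp_assoc HE),
    <- sq_gcomp, g_luni_lun, (sq_comp_idl HE); reflexivity.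
Qed.

Lemma sq_runi_nat {x y x' y' : E} {f : hom x x'} {g : hom y y'} {m n} (a : cell f g m n) :
  ⟦runi n⟧ ⋆ ⟦a⟧ = ⟦a ⊗ cunit g⟧ ⋆ ⟦runi m⟧.
Proof.
  rewrite <- (sq_comp_idr HE ⟦a⟧), <- (g_run_runi m), sq_gcomp, !(sq_comp_assoc HE).
  rewrite <- (sq_comp_assoc HE ⟦runi n⟧), <- sq_run_nat, (sq_comp_assoc HE),
    <- sq_gcomp, g_runi_run, (sq_comp_idl HE); reflexivity.
Qed.

(** The external identities at both ends are presented by empty lists, so the action of such an entry
    changes other entries without changing their lists. *)
Definition pent {G : lax_functor D E} {x : E} {z : D} {f g : hom x (G z)}
    (κ : cell f g (punit x) (lpro G (punit z))) : ent (umod G) f g :=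
  @Ent D E G G (umod G) x x z z f g (punit x) (punit z) (fl_unit x) (fl_unit z) κ.

Section Modules.
Context {F G : lax_functor D E} {N : module F G}.

(** The unitors in the definition of the pasting are coherence isomorphisms, so they disappear on
    entries. *)
Lemma mpaste_r_esim {w z : D} {n : pro w z} {x y : E} {m : pro x y} {f : hom x (F w)}
    {g h : hom y (G z)} (A : fl m) (B : fl n)
    (a : cell f g m (mpro N n)) (b : cell g h (punit y) (lpro G (punit z))) :
  Ent m n A B (mpaste_r N a b) ≃ ract (Ent m n A B a) (pent b).
Proof.
  exists (runi m), (runi n); split; [apply coh_runi|]; split; [apply coh_runi|].
  unfold mpaste_r; cbn; rewrite !to_sq_comp, !sq_gpost, !(sq_comp_assoc HE).
  rewrite <- (sq_mcell_gcomp (runi n)), g_runi_run, sq_mcell_id, (sq_comp_idl HE); reflexivity.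
Qed.

Lemma mpaste_l_esim {w z : D} {n : pro w z} {x y : E} {m : pro x y} {f g : hom x (F w)}
    {h : hom y (G z)} (A : fl m) (B : fl n)
    (b : cell f g (punit x) (lpro F (punit w))) (a : cell g h m (mpro N n)) :
  Ent m n A B (mpaste_l N b a) ≃ lact (pent b) (Ent m n A B a).
Proof.
  exists (luni m), (luni n); split; [apply coh_luni|]; split; [apply coh_luni|].
  unfold mpaste_l; cbn; rewrite !to_sq_comp, !sq_gpost, !(sq_comp_assoc HE).
  rewrite <- (sq_mcell_gcomp (luni n)), g_luni_lun, sq_mcell_id, (sq_comp_idl HE); reflexivity.
Qed.

Lemma ep_cong {x y x' y' : E} {z w : D} {f f' : hom x (F z)} {g g' : hom y (G w)}
    {s : hom x' x} {t : hom y' y} {e : ent N f g} {e' : ent N f' g'} {X X' : pro x' y'}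
    (A : fl X) (A' : fl X') (ξ : cell s t X (eX e)) (ξ' : cell s t X' (eX e')) :
  e ≃ e' ->
  (forall φ, coh (eA e) (eA e') φ -> exists φ', coh A A' φ' /\
     ⟦φ⟧ ⋆ ⟦ξ⟧ = ⟦ξ'⟧ ⋆ ⟦φ'⟧) ->
  ep e A ξ ≃ ep e' A' ξ'.
Proof.
  intros (φ & ψ & H1 & H2 & H3) K; destruct (K _ H1) as (φ' & K1 & K2).
  exists φ', ψ; split; [exact K1|]; split; [exact H2|]; cbn.
  rewrite !to_sq_comp, (sq_comp_assoc HE), H3, <- !(sq_comp_assoc HE), K2; reflexivity.
Qed.

Lemma ep_lact {x y t x' y' t' : E} {z w s : D}
    {f : hom x (F z)} {g : hom y (F w)} {h : hom t (G s)}
    {u : hom x' x} {v : hom y' y} {r : hom t' t}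
    (p : ent (umod F) f g) (e : ent N g h) {X : pro x' y'} {Y : pro y' t'} (A : fl X) (A' : fl Y)
    (ξ : cell u v X (eX p)) (ξ' : cell v r Y (eX e)) :
  ep (lact p e) (fl_tens A A') (ξ ⊗ ξ') ≃ lact (ep p A ξ) (ep e A' ξ').
Proof.
  apply esim_of_sq; cbn; rewrite to_sq_comp, !sq_gpost, <- (sq_comp_assoc HE), sq_tens_comp.
  reflexivity.
Qed.

Lemma ep_ract {x y t x' y' t' : E} {z w s : D}
    {f : hom x (F z)} {g : hom y (G w)} {h : hom t (G s)}
    {u : hom x' x} {v : hom y' y} {r : hom t' t}
    (e : ent N f g) (p : ent (umod G) g h) {X : pro x' y'} {Y : pro y' t'} (A : fl X) (A' : fl Y)
    (ξ : cell u v X (eX e)) (ξ' : cell v r Y (eX p)) :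
  ep (ract e p) (fl_tens A A') (ξ ⊗ ξ') ≃ ract (ep e A ξ) (ep p A' ξ').
Proof.
  apply esim_of_sq; cbn; rewrite to_sq_comp, !sq_gpost, <- (sq_comp_assoc HE), sq_tens_comp.
  reflexivity.
Qed.
End Modules.

Lemma paste_cmp_esim {G : lax_functor D E} {z : D} {x : E} {f g g' h : hom x (G z)} (e : g = g')
    (b : cell f g (punit x) (lpro G (punit z))) (c : cell g' h (punit x) (lpro G (punit z))) :
  pent (paste_cmp G e b c) ≃ lact (pent (ccast eq_refl e b)) (pent c).
Proof. exact (mpaste_l_esim (N := umod G) _ _ _ _). Qed.

Lemma pent_of_sq {G : lax_functor D E} {z : D} {x : E} {f g f' g' : hom x (G z)}
    {κ : cell f g (punit x) (lpro G (punit z))} {κ' : cell f' g' (punit x) (lpro G (punit z))} :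
  ⟦κ⟧ = ⟦κ'⟧ -> pent κ ≃ pent κ'.
Proof. exact (esim_of_sq (N := umod G)). Qed.

Lemma pent_lact_restrict {G : lax_functor D E} {z : D} {x x' : E} {f f' g h h' : hom x (G z)}
    (s : hom x' x) {a : cell f h (punit x) (lpro G (punit z))} {b : cell f' g (punit x) (lpro G (punit z))}
    {c : cell g h' (punit x) (lpro G (punit z))} :
  pent a ≃ lact (pent b) (pent c) ->
  pent (a ∙ cunit s) ≃ lact (pent (b ∙ cunit s)) (pent (c ∙ cunit s)).
Proof.
  intros H.
  refine (esim_trans (ep_cong (e := pent a) (e' := lact (pent b) (pent c)) (fl_unit x') (fl_tens (fl_unit x') (fl_unit x'))
    (cunit s) (cunit s ⊗ cunit s) H _) _).
  - intros φ Hφ; exists (luni (punit x')); split; [apply coh_luni|].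
    rewrite (coh_unique Hφ (coh_luni _)); apply sq_luni_nat.
  - exact (ep_lact (pent b) (pent c) (fl_unit x') (fl_unit x') (cunit s) (cunit s)).
Qed.
End Pasting.

(** * Axioms of transformations on entries *)
Section Trans.
Context {D E : double_category}.
Let HD := dc_laws D.
Let HE := dc_laws E.

(** Naturality of the cells of a transformation with respect to globular cells.  It holds for lax and for
    oplax transformations and is what makes [tm] compatible with [≃]. *)
Definition gnat {F G : lax_functor D E} (α : trans F G) : Prop :=
  forall (x y : D) (m n : pro x y) (c : m ⟹ n),
    ⟦lcell G c⟧ ⋆ ⟦tpro α m⟧
    = ⟦tpro α n⟧ ⋆ ⟦lcell F c⟧.

Definition tm {F G : lax_functor D E} (α : trans F G) {x y : E} {z w : D}
    {f : hom x (F z)} {g : hom y (F w)} (p : ent (umod F) f g) :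
    ent (umod G) (α z ∘ f) (α w ∘ g) :=
  @Ent D E G G (umod G) x y z w (α z ∘ f) (α w ∘ g) (eX p) (en p) (eA p) (eB p)
    (tpro α (en p) ∙ ec p).

Section One.
Context {F G : lax_functor D E} (α : trans F G).

Lemma tm_cong (Hα : gnat α) {x y : E} {z w : D} {f f' : hom x (F z)} {g g' : hom y (F w)}
    {p : ent (umod F) f g} {p' : ent (umod F) f' g'} : p ≃ p' -> tm α p ≃ tm α p'.
Proof.
  intros (φ & ψ & H1 & H2 & H3); exists φ, ψ; split; [exact H1|]; split; [exact H2|].
  cbn in *; rewrite !to_sq_comp, (sq_comp_assoc HE), Hα, <- !(sq_comp_assoc HE), H3; reflexivity.
Qed.

Lemma tm_lact {x y t : E} {z w s : D} {f : hom x (F z)} {g : hom y (F w)} {h : hom t (F s)}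
    (p : ent (umod F) f g) (q : ent (umod F) g h) : tm α (lact p q) ≃ lact (tm α p) (tm α q).
Proof.
  apply esim_of_sq; cbn.
  rewrite to_sq_comp, !sq_gpost, (sq_comp_assoc HE).
  rewrite (sq_of_ceq (tpro_tens _ _ α _ _ _ (en p) (en q)) :
    ⟦_⟧ ⋆ ⟦ltens F _ _⟧ = ⟦ltens G _ _⟧ ⋆ ⟦_⟧).
  rewrite <- (sq_comp_assoc HE), sq_tens_comp; reflexivity.
Qed.

Lemma tm_one {x : E} {z : D} (f : hom x (F z)) : tm α (one F f) ≃ one G (α z ∘ f).
Proof.
  apply esim_of_sq; cbn.
  rewrite to_sq_comp, !sq_gpost, (sq_comp_assoc HE).
  rewrite (sq_of_ceq (tpro_unit _ _ α z) :
    ⟦_⟧ ⋆ ⟦lunit F _⟧ = ⟦lunit G _⟧ ⋆ ⟦_⟧).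
  rewrite (cunit_comp _ HE), !to_sq_comp, (sq_comp_assoc HE); reflexivity.
Qed.
End One.

(** The generic entry at [m].  Laws on entries specialise to laws on cells at entries of this form. *)
Definition inj {F G : lax_functor D E} (N : module F G) {z w : D} (m : pro z w) :
    ent N (idh (F z)) (idh (G w)) :=
  Ent (mpro N m) m (fl_atom _) (fl_atom _) (cid (mpro N m)).

Section Lax.
Context {F G : lax_functor D E} (α : trans F G).
Context (κ : forall (x y : D) (f : hom x y),
  cell (lhom G f ∘ α x) (α y ∘ lhom F f) (punit (F x)) (lpro G (punit y))).

(** The cast reassociates the boundary arrows, so that the entry is composable with those obtained by
    [vp] and [tm]. *)
Definition cml {x : E} {z w : D} (u : hom z w) (f : hom x (F z)) :
    ent (umod G) (lhom G u ∘ (α z ∘ f)) (α w ∘ (lhom F u ∘ f)) :=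
  pent (ccast (eq_sym (comph_assoc HE _ _ _)) (eq_sym (comph_assoc HE _ _ _))
    (κ z w u ∙ cunit f)).

Lemma cml_esim {x : E} {z w : D} (u : hom z w) (f : hom x (F z)) :
  cml u f ≃ pent (κ z w u ∙ cunit f).
Proof. apply esim_of_sq, sq_cast. Qed.

Lemma cml_id {z w : D} (u : hom z w) : pent (κ z w u) ≃ cml u (idh (F z)).
Proof.
  refine (esim_trans _ (esim_sym (cml_esim _ _))); apply esim_of_sq.
  rewrite (cunit_id _ HE), to_sq_comp, (sq_comp_idr HE); reflexivity.
Qed.

Definition lax_id_law := forall x : D, κ x x (idh x) ≈ lunit G x ∙ cunit (α x).
Definition lax_comp_law := forall (x y z : D) (g : hom y z) (f : hom x y),
    κ x z (g ∘ f)
    ≈ paste_cmp G (comph_assoc HE _ _ _)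
        (lcell G (cunit g) ∙ κ x y f) (κ y z g ∙ cunit (lhom F f)).
Definition lax_cell_law := forall (x y w z : D) (f : hom x w) (g : hom y z) m n
    (c : cell f g m n),
    paste_r G (lcell G c ∙ tpro α m) (κ y z g) ≈ paste_l G (κ x w f) (tpro α n ∙ lcell F c).

Definition lax_id_ent := forall (x : E) (z : D) (f : hom x (F z)),
  cml (idh z) f ≃ one G (α z ∘ f).
Definition lax_comp_ent := forall (x : E) (z w v : D) (f : hom x (F z)) (u : hom z w) (u' : hom w v),
  cml (u' ∘ u) f ≃ lact (vp (cml u f) (fl_unit v) (cunit u')) (cml u' (lhom F u ∘ f)).
Definition lax_cell_ent := forall (x y : E) (z w z' w' : D) (f : hom x (F z)) (g : hom y (F w))
  (u : hom z z') (v : hom w w') (p : ent (umod F) f g) (n : pro z' w') (B : fl n)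
  (γ : cell u v (en p) n),
  ract (vp (tm α p) B γ) (cml v g) ≃ lact (cml u f) (tm α (vp p B γ)).

Lemma lax_id_iff : lax_id_law <-> lax_id_ent.
Proof.
  split; intros H.
  - intros x z f; refine (esim_trans (cml_esim _ _) _); apply esim_of_sq.
    cbn; rewrite to_sq_comp, (sq_of_ceq (H z)), sq_gpost, (cunit_comp _ HE), !to_sq_comp,
      (sq_comp_assoc HE); reflexivity.
  - intros x; pose proof (esim_trans (cml_id (idh x)) (H _ _ (idh _))) as K.
    apply esim_sq in K; apply ceq_of_sq; cbn in K; rewrite K, sq_gpost, to_sq_comp.
    rewrite (comph_id_r HE); reflexivity.
Qed.

Lemma lax_comp_iff : lax_comp_law <-> lax_comp_ent.
Proof.
  split; intros H.
  - intros x z w v f u u'.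
    refine (esim_trans (cml_esim _ _) _).
    refine (esim_trans (pent_lact_restrict f (esim_trans (pent_of_sq (sq_of_ceq (H _ _ _ u' u)))
      (paste_cmp_esim _ _ _))) _).
    apply lact_cong; apply esim_of_sq; cbn; rewrite ?sq_cast, !to_sq_comp, ?sq_cast, ?to_sq_comp.
    + apply eq_sym, (sq_comp_assoc HE).
    + rewrite (cunit_comp _ HE), to_sq_comp, (sq_comp_assoc HE); reflexivity.
  - intros x y z g f.
    pose proof (esim_trans (cml_id (g ∘ f)) (H _ _ _ _ (idh _) f g)) as K.
    apply ceq_of_sq.
    refine (esim_sq (N := umod G) (A := fl_unit _) (B := fl_unit _) (esim_trans K
      (esim_sym (esim_trans (paste_cmp_esim (comph_assoc HE _ _ _) _ _) _)))).
    apply lact_cong; apply esim_of_sq; cbn; rewrite ?sq_cast, !to_sq_comp, ?sq_cast, ?to_sq_comp.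
    + rewrite (cunit_id _ HE), (sq_comp_idr HE); reflexivity.
    + rewrite (comph_id_r HE); reflexivity.
Qed.

(** An entry is the restriction of a generic entry along its own cell.  Hence the axiom gives the equation
    for all entries, and the equation for generic entries gives back the axiom. *)
Lemma lax_cell_iff : lax_cell_law <-> lax_cell_ent.
Proof.
  split; intros H.
  - intros x y z w z' w' f g u v p n B γ.
    pose proof (sq_of_ceq (H _ _ _ _ u v (en p) n γ)) as K.
    pose proof (esim_trans (esim_sym (mpaste_r_esim (N := umod G) (fl_atom _) B _ _))
      (esim_trans (esim_of_sq (N := umod G) (A := fl_atom _) (B := B) K)
        (mpaste_l_esim (N := umod G) (fl_atom _) B _ _))) as L; clear K.
    match type of L with ?a ≃ ?b =>
      pose proof (ep_cong (e := a) (e' := b) (fl_tens (eA p) (fl_unit y))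
        (fl_tens (fl_unit x) (eA p)) (ec p ⊗ cunit g) (cunit f ⊗ ec p) L) as M
    end; clear L.
    refine (esim_trans _ (esim_trans (M _) _)); clear M.
    + refine (esim_trans _ (esim_sym (ep_ract _ _ _ _ _ _))).
      apply ract_cong; apply esim_of_sq; cbn; rewrite ?sq_cast, !to_sq_comp.
      * apply (sq_comp_assoc HE).
      * reflexivity.
    + intros φ Hφ.
      pose proof (coh_unique Hφ (coh_comp (coh_luni _) (coh_run _))) as ->; clear Hφ.
      exists (luni (eX p) • run (eX p)); split; [exact (coh_comp (coh_luni _) (coh_run _))|].
      cbn; rewrite !sq_gcomp, <- (sq_comp_assoc HE), sq_run_nat, (sq_comp_assoc HE), sq_luni_nat,
        <- (sq_comp_assoc HE); reflexivity.
    + refine (esim_trans (ep_lact _ _ _ _ _ _) _).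
      apply lact_cong; apply esim_of_sq; cbn; rewrite ?sq_cast, !to_sq_comp.
      * reflexivity.
      * apply eq_sym, (sq_comp_assoc HE).
  - intros x y w z f g m n c.
    pose proof (H _ _ _ _ _ _ (idh _) (idh _) f g (inj (umod F) m) n (fl_atom n) c) as K.
    apply ceq_of_sq.
    refine (esim_sq (N := umod G) (A := fl_atom _) (B := fl_atom n) (esim_trans
      (mpaste_r_esim (N := umod G) _ _ _ _) (esim_trans (esim_trans _ (esim_trans K _))
      (esim_sym (mpaste_l_esim (N := umod G) _ _ _ _))))); clear K.
    + apply ract_cong; [|apply cml_id]; apply esim_of_sq; cbn; rewrite !to_sq_comp.
      rewrite (sq_comp_idr HE); reflexivity.
    + apply lact_cong; [apply esim_sym, cml_id|]; apply esim_of_sq; cbn; rewrite !to_sq_comp.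
      rewrite (sq_comp_idr HE); reflexivity.
Qed.
End Lax.

Section Oplax.
Context {F G : lax_functor D E} (α : trans F G).
Context (κ : forall (x y : D) (f : hom x y),
  cell (α y ∘ lhom F f) (lhom G f ∘ α x) (punit (F x)) (lpro G (punit y))).

Definition cmo {x : E} {z w : D} (u : hom z w) (f : hom x (F z)) :
    ent (umod G) (α w ∘ (lhom F u ∘ f)) (lhom G u ∘ (α z ∘ f)) :=
  pent (ccast (eq_sym (comph_assoc HE _ _ _)) (eq_sym (comph_assoc HE _ _ _))
    (κ z w u ∙ cunit f)).

Lemma cmo_esim {x : E} {z w : D} (u : hom z w) (f : hom x (F z)) :
  cmo u f ≃ pent (κ z w u ∙ cunit f).
Proof. apply esim_of_sq, sq_cast. Qed.

Lemma cmo_id {z w : D} (u : hom z w) : pent (κ z w u) ≃ cmo u (idh (F z)).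
Proof.
  refine (esim_trans _ (esim_sym (cmo_esim _ _))); apply esim_of_sq.
  rewrite (cunit_id _ HE), to_sq_comp, (sq_comp_idr HE); reflexivity.
Qed.

Definition oplax_id_law := forall x : D, κ x x (idh x) ≈ lunit G x ∙ cunit (α x).
Definition oplax_comp_law := forall (x y z : D) (g : hom y z) (f : hom x y),
    κ x z (g ∘ f)
    ≈ paste_cmp G (eq_sym (comph_assoc HE _ _ _))
        (κ y z g ∙ cunit (lhom F f)) (lcell G (cunit g) ∙ κ x y f).
Definition oplax_cell_law := forall (x y w z : D) (f : hom x w) (g : hom y z) m n
    (c : cell f g m n),
    paste_l G (κ x w f) (lcell G c ∙ tpro α m) ≈ paste_r G (tpro α n ∙ lcell F c) (κ y z g).

Definition oplax_id_ent := forall (x : E) (z : D) (f : hom x (F z)),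
  cmo (idh z) f ≃ one G (α z ∘ f).
Definition oplax_comp_ent := forall (x : E) (z w v : D) (f : hom x (F z)) (u : hom z w) (u' : hom w v),
  cmo (u' ∘ u) f ≃ lact (cmo u' (lhom F u ∘ f)) (vp (cmo u f) (fl_unit v) (cunit u')).
Definition oplax_cell_ent := forall (x y : E) (z w z' w' : D) (f : hom x (F z)) (g : hom y (F w))
  (u : hom z z') (v : hom w w') (p : ent (umod F) f g) (n : pro z' w') (B : fl n)
  (γ : cell u v (en p) n),
  lact (cmo u f) (vp (tm α p) B γ) ≃ ract (tm α (vp p B γ)) (cmo v g).

Lemma oplax_id_iff : oplax_id_law <-> oplax_id_ent.
Proof.
  split; intros H.
  - intros x z f; refine (esim_trans (cmo_esim _ _) _); apply esim_of_sq.
    cbn; rewrite to_sq_comp, (sq_of_ceq (H z)), sq_gpost, (cunit_comp _ HE), !to_sq_comp,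
      (sq_comp_assoc HE); reflexivity.
  - intros x; pose proof (esim_trans (cmo_id (idh x)) (H _ _ (idh _))) as K.
    apply esim_sq in K; apply ceq_of_sq; cbn in K; rewrite K, sq_gpost, to_sq_comp.
    rewrite (comph_id_r HE); reflexivity.
Qed.

Lemma oplax_comp_iff : oplax_comp_law <-> oplax_comp_ent.
Proof.
  split; intros H.
  - intros x z w v f u u'.
    refine (esim_trans (cmo_esim _ _) _).
    refine (esim_trans (pent_lact_restrict f (esim_trans (pent_of_sq (sq_of_ceq (H _ _ _ u' u)))
      (paste_cmp_esim _ _ _))) _).
    apply lact_cong; apply esim_of_sq; cbn; rewrite ?sq_cast, !to_sq_comp, ?sq_cast, ?to_sq_comp.
    + rewrite (cunit_comp _ HE), to_sq_comp, (sq_comp_assoc HE); reflexivity.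
    + apply eq_sym, (sq_comp_assoc HE).
  - intros x y z g f.
    pose proof (esim_trans (cmo_id (g ∘ f)) (H _ _ _ _ (idh _) f g)) as K.
    apply ceq_of_sq.
    refine (esim_sq (N := umod G) (A := fl_unit _) (B := fl_unit _) (esim_trans K
      (esim_sym (esim_trans (paste_cmp_esim (eq_sym (comph_assoc HE _ _ _)) _ _) _)))).
    apply lact_cong; apply esim_of_sq; cbn; rewrite ?sq_cast, !to_sq_comp, ?sq_cast, ?to_sq_comp.
    + rewrite (comph_id_r HE); reflexivity.
    + rewrite (cunit_id _ HE), (sq_comp_idr HE); reflexivity.
Qed.

Lemma oplax_cell_iff : oplax_cell_law <-> oplax_cell_ent.
Proof.
  split; intros H.
  - intros x y z w z' w' f g u v p n B γ.
    pose proof (sq_of_ceq (H _ _ _ _ u v (en p) n γ)) as K.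
    pose proof (esim_trans (esim_sym (mpaste_l_esim (N := umod G) (fl_atom _) B _ _))
      (esim_trans (esim_of_sq (N := umod G) (A := fl_atom _) (B := B) K)
        (mpaste_r_esim (N := umod G) (fl_atom _) B _ _))) as L; clear K.
    match type of L with ?a ≃ ?b =>
      pose proof (ep_cong (e := a) (e' := b) (fl_tens (fl_unit x) (eA p))
        (fl_tens (eA p) (fl_unit y)) (cunit f ⊗ ec p) (ec p ⊗ cunit g) L) as M
    end; clear L.
    refine (esim_trans _ (esim_trans (M _) _)); clear M.
    + refine (esim_trans _ (esim_sym (ep_lact _ _ _ _ _ _))).
      apply lact_cong; apply esim_of_sq; cbn; rewrite ?sq_cast, !to_sq_comp.
      * reflexivity.
      * apply (sq_comp_assoc HE).
    + intros φ Hφ.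
      pose proof (coh_unique Hφ (coh_comp (coh_runi _) (coh_lun _))) as ->; clear Hφ.
      exists (runi (eX p) • lun (eX p)); split; [exact (coh_comp (coh_runi _) (coh_lun _))|].
      cbn; rewrite !sq_gcomp, <- (sq_comp_assoc HE), sq_lun_nat, (sq_comp_assoc HE), sq_runi_nat,
        <- (sq_comp_assoc HE); reflexivity.
    + refine (esim_trans (ep_ract _ _ _ _ _ _) _).
      apply ract_cong; apply esim_of_sq; cbn; rewrite ?sq_cast, !to_sq_comp.
      * apply eq_sym, (sq_comp_assoc HE).
      * reflexivity.
  - intros x y w z f g m n c.
    pose proof (H _ _ _ _ _ _ (idh _) (idh _) f g (inj (umod F) m) n (fl_atom n) c) as K.
    apply ceq_of_sq.
    refine (esim_sq (N := umod G) (A := fl_atom _) (B := fl_atom n) (esim_trans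
      (mpaste_l_esim (N := umod G) _ _ _ _) (esim_trans (esim_trans _ (esim_trans K _))
      (esim_sym (mpaste_r_esim (N := umod G) _ _ _ _))))); clear K.
    + apply lact_cong; [apply cmo_id|]; apply esim_of_sq; cbn; rewrite !to_sq_comp.
      rewrite (sq_comp_idr HE); reflexivity.
    + apply ract_cong; [|apply esim_sym, cmo_id]; apply esim_of_sq; cbn; rewrite !to_sq_comp.
      rewrite (sq_comp_idr HE); reflexivity.
Qed.
End Oplax.
End Trans.

(** * Composition of lax transformations *)
Section TransCat.
Context {D E : double_category}.
Let HD := dc_laws D.
Let HE := dc_laws E.

Definition trans_id (F : lax_functor D E) : trans F F.
Proof.
  refine {| tob := fun x => idh (F x); tpro := fun x y m => cid (lpro F m) |}.
  - intros x y z m n; apply ceq_of_sq.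
    rewrite !to_sq_comp, (sq_comp_idl HE), (ctens_id _ HE), (sq_comp_idr HE); reflexivity.
  - intros x; apply ceq_of_sq.
    rewrite !to_sq_comp, (sq_comp_idl HE), (cunit_id _ HE), (sq_comp_idr HE); reflexivity.
Defined.

Definition trans_comp {F G H : lax_functor D E} (β : trans G H) (α : trans F G) : trans F H.
Proof.
  refine {| tob := fun x => β x ∘ α x; tpro := fun x y m => tpro β m ∙ tpro α m |}.
  - intros x y z m n; apply ceq_of_sq.
    rewrite !to_sq_comp, <- (sq_comp_assoc HE).
    rewrite (sq_of_ceq (tpro_tens _ _ α _ _ _ m n) :
      ⟦_⟧ ⋆ ⟦ltens F _ _⟧ = ⟦ltens G _ _⟧ ⋆ ⟦_⟧).
    rewrite (sq_comp_assoc HE).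
    rewrite (sq_of_ceq (tpro_tens _ _ β _ _ _ m n) :
      ⟦_⟧ ⋆ ⟦ltens G _ _⟧ = ⟦ltens H _ _⟧ ⋆ ⟦_⟧).
    rewrite <- (sq_comp_assoc HE), sq_tens_comp; reflexivity.
  - intros x; apply ceq_of_sq.
    rewrite !to_sq_comp, <- (sq_comp_assoc HE).
    rewrite (sq_of_ceq (tpro_unit _ _ α x) :
      ⟦_⟧ ⋆ ⟦lunit F _⟧ = ⟦lunit G _⟧ ⋆ ⟦_⟧).
    rewrite (sq_comp_assoc HE).
    rewrite (sq_of_ceq (tpro_unit _ _ β x) :
      ⟦_⟧ ⋆ ⟦lunit G _⟧ = ⟦lunit H _⟧ ⋆ ⟦_⟧).
    rewrite <- (sq_comp_assoc HE), <- to_sq_comp, (cunit_comp _ HE); reflexivity.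
Defined.

Lemma tm_id {F : lax_functor D E} {x y : E} {z w : D} {f : hom x (F z)} {g : hom y (F w)}
    (p : ent (umod F) f g) : tm (trans_id F) p ≃ p.
Proof. destruct p; apply esim_of_sq; cbn; rewrite to_sq_comp; apply (sq_comp_idl HE). Qed.

Lemma tm_comp {F G H : lax_functor D E} (β : trans G H) (α : trans F G)
    {x y : E} {z w : D} {f : hom x (F z)} {g : hom y (F w)} (p : ent (umod F) f g) :
  tm (trans_comp β α) p ≃ tm β (tm α p).
Proof. apply esim_of_sq; cbn; rewrite !to_sq_comp, (sq_comp_assoc HE); reflexivity. Qed.

Lemma one_cell {G : lax_functor D E} {x : E} {z : D} (f : hom x (G z)) :
  one G f ≃ pent (lunit G z ∙ cunit f).
Proof. apply esim_of_sq; cbn; rewrite sq_gpost; reflexivity. Qed.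

Lemma vp_cong_same {F G : lax_functor D E} {N : module F G} {x y : E} {z w z' w' : D}
    {f f' : hom x (F z)} {g g' : hom y (G w)} {u : hom z z'} {v : hom w w'}
    {X X' : pro x y} {m : pro z w} {A : fl X} {A' : fl X'} {C : fl m}
    {a : cell f g X (mpro N m)} {a' : cell f' g' X' (mpro N m)}
    {n : pro z' w'} (B : fl n) (γ : cell u v m n) :
  Ent X m A C a ≃ Ent X' m A' C a' -> vp (Ent X m A C a) B γ ≃ vp (Ent X' m A' C a') B γ.
Proof.
  intros H; apply (vp_cong (e := Ent X m A C a) (e' := Ent X' m A' C a') B B γ γ H).
  cbn; intros ψ Hψ; rewrite (coh_unique Hψ (coh_id C)); exists (cid n); split; [apply coh_id|].
  rewrite (sq_comp_idl HD), (sq_comp_idr HD); reflexivity.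
Qed.

(** Coherence isomorphisms have identities as boundary arrows, which lax functors preserve. *)
Lemma esim_bd {F G : lax_functor D E} {N : module F G} {x y : E} {z w : D}
    {f f' : hom x (F z)} {g g' : hom y (G w)} {a : ent N f g} {b : ent N f' g'} :
  a ≃ b -> f = f' /\ g = g'.
Proof.
  intros (φ & ψ & _ & _ & H); split.
  - pose proof (f_equal (fun s => projT1 s) H) as K; cbn in K.
    rewrite (lhom_id _ (lf_laws _ _ F)), (comph_id_l HE), (comph_id_r HE) in K; exact K.
  - pose proof (f_equal (fun s => projT1 (projT2 s)) H) as K; cbn in K.
    rewrite (lhom_id _ (lf_laws _ _ G)), (comph_id_l HE), (comph_id_r HE) in K; exact K.
Qed.

Lemma lact_unit {F G : lax_functor D E} {N : module F G} {x y : E} {z w : D}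
    {f g k : hom x (F z)} {h : hom y (G w)} {p : ent (umod F) f g} (e : ent N g h) :
  p ≃ one F k -> lact p e ≃ e.
Proof.
  intros H; destruct (esim_bd H) as [H1 H2]; subst f k.
  exact (esim_trans (lact_cong H (esim_refl e)) (one_lact e)).
Qed.

Lemma ract_unit {F G : lax_functor D E} {N : module F G} {x y : E} {z w : D}
    {h : hom x (F z)} {f g k : hom y (G w)} {p : ent (umod G) f g} (e : ent N h f) :
  p ≃ one G k -> ract e p ≃ e.
Proof.
  intros H; destruct (esim_bd H) as [H1 H2]; subst f g.
  exact (esim_trans (ract_cong (esim_refl e) H) (ract_one e)).
Qed.

Section Lax.

Definition cmL {F G : lax_functor D E} (α : lax_trans F G) {x : E} {z w : D} (u : hom z w)
    (f : hom x (F z)) := cml α (fun x y f => lt_cmp α f) u f.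

Lemma cmL_id {F G : lax_functor D E} (α : lax_trans F G) : lax_id_ent α (fun x y f => lt_cmp α f).
Proof. apply lax_id_iff; exact (lt_cmp_id _ _ α). Qed.
Lemma cmL_comp {F G : lax_functor D E} (α : lax_trans F G) : lax_comp_ent α (fun x y f => lt_cmp α f).
Proof. apply lax_comp_iff; exact (lt_cmp_comp _ _ α). Qed.
Lemma cmL_cell {F G : lax_functor D E} (α : lax_trans F G) : lax_cell_ent α (fun x y f => lt_cmp α f).
Proof. apply lax_cell_iff; exact (lt_cmp_cell _ _ α). Qed.

Lemma cml_cong {F G : lax_functor D E} (α α' : trans F G) κ κ'
    (H : forall x y f, ⟦κ x y f⟧ = ⟦κ' x y f⟧) {x : E} {z w : D} (u : hom z w)
    {f f' : hom x (F z)} : f = f' -> cml α κ u f ≃ cml α' κ' u f'.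
Proof.
  intros <-; refine (esim_trans (cml_esim _ _ _ _) (esim_trans _ (esim_sym (cml_esim _ _ _ _)))).
  apply pent_of_sq; rewrite !to_sq_comp; f_equal; apply H.
Qed.

(** At identity arrows both comparison entries are trivial, so the law for cells reduces to naturality. *)
Lemma lax_gnat {F G : lax_functor D E} (α : lax_trans F G) : gnat α.
Proof.
  intros x y m n c.
  pose proof (cmL_cell α _ _ _ _ _ _ (idh _) (idh _) (idh x) (idh y) (inj (umod F) m) n
    (fl_atom n) c) as H.
  assert (K : vp (tm α (inj (umod F) m)) (fl_atom n) c ≃ tm α (vp (inj (umod F) m) (fl_atom n) c)).
  { refine (esim_trans (esim_sym (ract_unit _ (cmL_id α _ _ _))) (esim_trans H _)).
    exact (lact_unit _ (cmL_id α _ _ _)). }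
  unfold vp, tm in K; cbn in K.
  assert (L := esim_sq (N := umod G) K); clear K H.
  rewrite !to_sq_comp, !(sq_comp_idr HE) in L; exact L.
Qed.

Lemma vp_pent {G : lax_functor D E} {z z' : D} {x : E} {f f' g h h' : hom x (G z)}
    (u : hom z z') {a : cell f h (punit x) (lpro G (punit z))}
    {b : cell f' g (punit x) (lpro G (punit z))} {c : cell g h' (punit x) (lpro G (punit z))} :
  pent a ≃ lact (pent b) (pent c) ->
  vp (pent a) (fl_unit z') (cunit u)
  ≃ lact (vp (pent b) (fl_unit z') (cunit u)) (vp (pent c) (fl_unit z') (cunit u)).
Proof.
  intros H.
  refine (esim_trans (vp_cong (e := pent a) (e' := lact (pent b) (pent c)) (fl_unit z')
    (fl_tens (fl_unit z') (fl_unit z')) (cunit u) (cunit u ⊗ cunit u) H _) _).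
  - intros φ Hφ; exists (luni (punit z')); split; [apply coh_luni|].
    rewrite (coh_unique Hφ (coh_luni _)); apply (sq_luni_nat (E := D)).
  - exact (vp_lact (pent b) (pent c) (fl_unit z') (fl_unit z') (cunit u) (cunit u)).
Qed.

Section Comp.
Context {F G H : lax_functor D E} (β : lax_trans G H) (α : lax_trans F G).

Lemma paste_bd {x : E} {y : D} (f : hom x (H y)) :
  lhom H (idh y) ∘ idh (H y) ∘ f ∘ idh x = f.
Proof.
  rewrite (comph_id_r HE), (lhom_id _ (lf_laws _ _ H)), !(comph_id_l HE); reflexivity.
Qed.

(** The casts are needed since the two parts have equal but not identical boundary arrows. *)
Definition lcc (x y : D) (f : hom x y) :
    cell (lhom H f ∘ trans_comp β α x) (trans_comp β α y ∘ lhom F f)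
      (punit (F x)) (lpro H (punit y)) :=
  ccast (eq_trans (paste_bd _) (eq_sym (comph_assoc HE _ _ _)))
    (eq_trans (paste_bd _) (comph_assoc HE _ _ _)) (lax_comp_cmp β α f).

(** With this formula the laws of a composite transformation follow from those of its factors, by sliding
    comparison entries past the others. *)
Lemma cml_composite {x : E} {z w : D} (u : hom z w) (f : hom x (F z)) :
  cml (trans_comp β α) lcc u f ≃ lact (cmL β u (α z ∘ f)) (tm β (cmL α u f)).
Proof.
  refine (esim_trans (cml_esim _ _ _ _) _).
  refine (esim_trans (pent_lact_restrict f (esim_trans (pent_of_sq (sq_cast _ _ _))
    (paste_cmp_esim _ _ _))) _).
  apply lact_cong; apply esim_of_sq; cbn; rewrite ?sq_cast, !to_sq_comp, ?sq_cast, ?to_sq_comp.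
  - rewrite (cunit_comp _ HE), to_sq_comp, (sq_comp_assoc HE); reflexivity.
  - apply eq_sym, (sq_comp_assoc HE).
Qed.

Lemma lax_comp_id_ent : lax_id_ent (trans_comp β α) lcc.
Proof.
  intros x z f; refine (esim_trans (cml_composite _ _) _).
  refine (esim_trans (lact_unit _ (cmL_id β _ _ _)) _).
  refine (esim_trans (tm_cong β (lax_gnat β) (cmL_id α _ _ _)) _).
  refine (esim_trans (tm_one _ _) (one_cong _)); apply (comph_assoc HE).
Qed.

Lemma lax_comp_cell_ent : lax_cell_ent (trans_comp β α) lcc.
Proof.
  intros x y z w z' w' f g u v p n B γ.
  refine (esim_trans (ract_cong (e' := vp (tm β (tm α p)) B γ) _ (cml_composite v g)) _).
  { apply esim_of_sq; cbn; rewrite !to_sq_comp, !(sq_comp_assoc HE); reflexivity. }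
  refine (esim_trans (esim_sym (ract_ract _ _ _)) _).
  refine (esim_trans (ract_cong (cmL_cell β _ _ _ _ _ _ _ _ u v (tm α p) n B γ) (esim_refl _)) _).
  refine (esim_trans (lact_ract _ _ _) _).
  refine (esim_trans (lact_cong (esim_refl _) (esim_sym (tm_lact β _ _))) _).
  refine (esim_trans (lact_cong (esim_refl _)
    (tm_cong β (lax_gnat β) (cmL_cell α _ _ _ _ _ _ _ _ u v p n B γ))) _).
  refine (esim_trans (lact_cong (esim_refl _) (tm_lact β _ _)) _).
  refine (esim_trans (esim_sym (lact_lact _ _ _)) _).
  exact (lact_cong (esim_sym (cml_composite u f)) (esim_sym (tm_comp β α _))).
Qed.

Lemma lax_comp_comp_ent : lax_comp_ent (trans_comp β α) lcc.
Proof.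
  intros x z w v f u u'.
  refine (esim_trans (cml_composite _ _) _).
  refine (esim_trans (lact_cong (cmL_comp β _ _ _ _ _ u u')
    (tm_cong β (lax_gnat β) (cmL_comp α _ _ _ _ f u u'))) _).
  refine (esim_trans (lact_cong (esim_refl _) (tm_lact β _ _)) _).
  refine (esim_trans (lact_lact _ _ _) _).
  refine (esim_trans (lact_cong (esim_refl _) (esim_sym (lact_lact _ _ _))) _).
  refine (esim_trans (lact_cong (esim_refl _) (lact_cong (esim_sym
    (cmL_cell β _ _ _ _ _ _ _ _ u' u' (cmL α u f) _ (fl_unit v) (cunit u'))) (esim_refl _))) _).
  refine (esim_trans (lact_cong (esim_refl _) (lact_lact _ _ _)) _).
  refine (esim_trans (esim_sym (lact_lact _ _ _)) _).
  refine (lact_cong (esim_sym (vp_pent u' (cml_composite u f))) (esim_sym (cml_composite u' _))).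
Qed.

Definition lax_comp_trans : lax_trans F H :=
  {| lt_trans := trans_comp β α; lt_cmp := lcc;
     lt_cmp_id := proj2 (lax_id_iff _ _) lax_comp_id_ent;
     lt_cmp_comp := proj2 (lax_comp_iff _ _) lax_comp_comp_ent;
     lt_cmp_cell := proj2 (lax_cell_iff _ _) lax_comp_cell_ent |}.
End Comp.

Lemma trans_eq {F G : lax_functor D E} (α α' : trans F G) :
  (forall x, α x = α' x) -> (forall x y (m : pro x y), tpro α m ≈ tpro α' m) -> α = α'.
Proof.
  destruct α as [a p pt pu], α' as [a' p' pt' pu']; cbn; intros Ha Hp.
  assert (e : a = a') by (extensionality x; apply Ha); subst a'.
  assert (e : p = p').
  { extensionality x; extensionality y; extensionality m; apply eq_of_ceq, Hp. }
  subst p'; f_equal; apply proof_irrelevance.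
Qed.

Lemma lax_trans_eq {F G : lax_functor D E} (α α' : lax_trans F G) :
  (forall x, α x = α' x) -> (forall x y (m : pro x y), tpro α m ≈ tpro α' m) ->
  (forall x y (f : hom x y), lt_cmp α f ≈ lt_cmp α' f) -> α = α'.
Proof.
  intros Ha Hp Hc; pose proof (trans_eq α α' Ha Hp) as e; clear Ha Hp.
  destruct α as [a κ k1 k2 k3], α' as [a' κ' k1' k2' k3']; cbn in *; subst a'.
  assert (e : κ = κ').
  { extensionality x; extensionality y; extensionality f; apply eq_of_ceq, Hc. }
  subst κ'; f_equal; apply proof_irrelevance.
Qed.

Lemma cmp_of_cml {F G : lax_functor D E} (α α' : lax_trans F G) {z w : D} (u : hom z w) :
  cmL α u (idh (F z)) ≃ cmL α' u (idh (F z)) -> lt_cmp α u ≈ lt_cmp α' u.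
Proof.
  intros H; apply ceq_of_sq; refine (esim_sq (N := umod G) (A := fl_unit _) (B := fl_unit _) _).
  exact (esim_trans (cml_id α (fun x y f => lt_cmp α f) u)
    (esim_trans H (esim_sym (cml_id α' (fun x y f => lt_cmp α' f) u)))).
Qed.

Definition idc (F : lax_functor D E) (x y : D) (f : hom x y) :
    cell (lhom F f ∘ trans_id F x) (trans_id F y ∘ lhom F f) (punit (F x)) (lpro F (punit y)) :=
  ccast (eq_sym (comph_id_r HE _)) (eq_sym (comph_id_l HE _)) (gpost (lunit F y) (cunit (lhom F f))).

Lemma cml_idc (F : lax_functor D E) {x : E} {z w : D} (u : hom z w) (f : hom x (F z)) :
  cml (trans_id F) (idc F) u f ≃ one F (lhom F u ∘ f).
Proof.
  refine (esim_trans (cml_esim _ _ _ _) _); apply esim_of_sq; cbn.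
  rewrite to_sq_comp; unfold idc; rewrite sq_cast, !sq_gpost, (cunit_comp _ HE), to_sq_comp,
    (sq_comp_assoc HE); reflexivity.
Qed.

Definition lax_trans_id (F : lax_functor D E) : lax_trans F F.
Proof.
  refine {| lt_trans := trans_id F; lt_cmp := idc F |}.
  - apply (lax_id_iff (trans_id F) (idc F)); intros x z f.
    refine (esim_trans (cml_idc F _ _) (one_cong _)); cbn.
    rewrite (lhom_id _ (lf_laws _ _ F)); reflexivity.
  - apply (lax_comp_iff (trans_id F) (idc F)); intros x z w v f u u'.
    assert (K : vp (cml (trans_id F) (idc F) u f) (fl_unit v) (cunit u')
      ≃ vp (one F (lhom F u ∘ f)) (fl_unit v) (cunit u')).
    { exact (vp_cong_same (A := fl_unit _) (A' := fl_unit _) (fl_unit v) (cunit u')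
        (a' := ec (one F _)) (cml_idc F u f)). }
    refine (esim_trans (cml_idc F _ _) (esim_sym (esim_trans
      (lact_unit _ (esim_trans K (vp_one _ _))) _))).
    refine (esim_trans (cml_idc F _ _) (one_cong _)).
    rewrite (lhom_comp _ (lf_laws _ _ F)), (comph_assoc HE); reflexivity.
  - apply (lax_cell_iff (trans_id F) (idc F)); intros x y z w z' w' f g u v p n B γ.
    refine (esim_trans (ract_unit _ (cml_idc F v g)) (esim_sym
      (esim_trans (lact_unit _ (cml_idc F u f)) _))).
    apply esim_of_sq; cbn; rewrite !to_sq_comp, !(sq_comp_idl HE); reflexivity.
Defined.

Lemma lax_comp_idl {F G : lax_functor D E} (α : lax_trans F G) :
  lax_comp_trans (lax_trans_id G) α = α.
Proof.
  apply lax_trans_eq.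
  - intros x; apply (comph_id_l HE).
  - intros x y m; apply (vcomp_id_l _ HE).
  - intros x y f; apply cmp_of_cml.
    refine (esim_trans (cml_composite _ _ _ _) _).
    refine (esim_trans (lact_unit _ (cml_idc G _ _)) _).
    exact (tm_id _).
Qed.

Lemma lax_comp_idr {F G : lax_functor D E} (α : lax_trans F G) :
  lax_comp_trans α (lax_trans_id F) = α.
Proof.
  apply lax_trans_eq.
  - intros x; apply (comph_id_r HE).
  - intros x y m; apply (vcomp_id_r _ HE).
  - intros x y f; apply cmp_of_cml.
    refine (esim_trans (cml_composite _ _ _ _) _).
    refine (esim_trans (ract_unit (N := umod G) _ (esim_trans
      (tm_cong α (lax_gnat α) (cml_idc F _ _)) (tm_one _ _))) _).
    apply cml_cong; [reflexivity | apply (comph_id_l HE)].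
Qed.

Lemma lax_comp_assoc {F G H K : lax_functor D E} (γ : lax_trans H K) (β : lax_trans G H)
    (α : lax_trans F G) :
  lax_comp_trans γ (lax_comp_trans β α) = lax_comp_trans (lax_comp_trans γ β) α.
Proof.
  apply lax_trans_eq.
  - intros x; apply (comph_assoc HE).
  - intros x y m; apply (vcomp_assoc _ HE).
  - intros x y f; apply cmp_of_cml.
    refine (esim_trans (cml_composite _ _ _ _) _).
    refine (esim_trans (lact_cong (cml_cong _ _ _ _ (fun _ _ _ => eq_refl) f (eq_sym (comph_assoc HE _ _ _)))
      (tm_cong γ (lax_gnat γ) (cml_composite β α f (idh (F x))))) _).
    refine (esim_trans (lact_cong (esim_refl _) (tm_lact γ _ _)) _).
    refine (esim_trans (esim_sym (lact_lact _ _ _)) _).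
    refine (esim_sym (esim_trans (cml_composite _ _ _ _) _)).
    exact (lact_cong (cml_composite γ β f (α x ∘ idh (F x))) (tm_comp γ β _)).
Qed.

(** The comparison cell at [u] is the trivial one.  Strictness is this for all [u], and preservation of
    products is this for all projections. *)
Definition unital {F G : lax_functor D E} (α : lax_trans F G) {z w : D} (u : hom z w) : Prop :=
  lhom G u ∘ α z = α w ∘ lhom F u /\ lt_cmp α u ≈ lunit G w ∙ cunit (α w ∘ lhom F u).

Lemma unital_iff {F G : lax_functor D E} (α : lax_trans F G) {z w : D} (u : hom z w) :
  unital α u <-> pent (lt_cmp α u) ≃ one G (α w ∘ lhom F u).
Proof.
  split.
  - intros [_ H]; refine (esim_trans (pent_of_sq (sq_of_ceq H)) (esim_sym (one_cell _))).
  - intros H; split; [exact (proj1 (esim_bd H))|].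
    apply ceq_of_sq; exact (esim_sq (N := umod G) (A := fl_unit _) (B := fl_unit _)
      (esim_trans H (one_cell _))).
Qed.

Lemma unital_cml {F G : lax_functor D E} (α : lax_trans F G) {z w : D} (u : hom z w) :
  unital α u -> forall (x : E) (f : hom x (F z)), cmL α u f ≃ one G (α w ∘ (lhom F u ∘ f)).
Proof.
  intros [_ H] x f; refine (esim_trans (cml_esim _ _ _ _) _); apply esim_of_sq; cbn.
  rewrite to_sq_comp, (sq_of_ceq H), to_sq_comp, sq_gpost, (comph_assoc HE), (cunit_comp _ HE _ _ _ _ f),
    to_sq_comp, (sq_comp_assoc HE); reflexivity.
Qed.

Lemma unital_comp {F G H : lax_functor D E} (β : lax_trans G H) (α : lax_trans F G)
    {z w : D} (u : hom z w) : unital β u -> unital α u -> unital (lax_comp_trans β α) u.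
Proof.
  intros Hβ Hα; apply unital_iff.
  refine (esim_trans (cml_id _ _ _) (esim_trans (cml_composite _ _ _ _) _)).
  refine (esim_trans (lact_unit _ (unital_cml β u Hβ _ _)) _).
  refine (esim_trans (tm_cong β (lax_gnat β) (unital_cml α u Hα _ _)) _).
  refine (esim_trans (tm_one _ _) (one_cong _)).
  rewrite (comph_id_r HE); apply (comph_assoc HE).
Qed.

Lemma unital_id {F : lax_functor D E} {z w : D} (u : hom z w) : unital (lax_trans_id F) u.
Proof.
  apply unital_iff; refine (esim_trans (cml_id _ _ _) (esim_trans (cml_idc F _ _) (one_cong _))).
  cbn; rewrite (comph_id_r HE), (comph_id_l HE); reflexivity.
Qed.

Lemma paste_inverse {G : lax_functor D E} {z : D} {x : E} {f g : hom x (G z)}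
    (κ : cell f g (punit x) (lpro G (punit z))) (b : cell g f (punit x) (lpro G (punit z))) :
  paste_cmp G eq_refl κ b ≈ lunit G z ∙ cunit f <-> lact (pent κ) (pent b) ≃ one G f.
Proof.
  split; intros H.
  - refine (esim_trans (esim_sym (paste_cmp_esim eq_refl κ b))
      (esim_trans (pent_of_sq (sq_of_ceq H)) (esim_sym (one_cell _)))).
  - apply ceq_of_sq; exact (esim_sq (N := umod G) (A := fl_unit _) (B := fl_unit _)
      (esim_trans (paste_cmp_esim eq_refl κ b) (esim_trans H (one_cell _)))).
Qed.

Lemma restrict_inverse {G : lax_functor D E} {z : D} {x x' : E} {f g : hom x (G z)}
    (s : hom x' x) {κ : cell f g (punit x) (lpro G (punit z))}
    {b : cell g f (punit x) (lpro G (punit z))} :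
  lact (pent κ) (pent b) ≃ one G f ->
  lact (pent (κ ∙ cunit s)) (pent (b ∙ cunit s)) ≃ one G (f ∘ s).
Proof.
  intros H; refine (esim_trans (esim_sym (pent_lact_restrict s (esim_trans
    (esim_sym (one_cell f)) (esim_sym H)))) _).
  apply esim_of_sq; cbn; rewrite sq_gpost, (cunit_comp _ HE), !to_sq_comp, (sq_comp_assoc HE).
  reflexivity.
Qed.

(** Comparison entries compose, and the inverse of a product is the product of the inverses in the
    opposite order. *)
Lemma pseudo_comp {F G H : lax_functor D E} (β : lax_trans G H) (α : lax_trans F G) :
  is_pseudo β -> is_pseudo α -> is_pseudo (lax_comp_trans β α).
Proof.
  intros Hβ Hα z w u.
  destruct (Hβ _ _ u) as (b & B1 & B2), (Hα _ _ u) as (a & A1 & A2).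
  apply paste_inverse in B1; apply paste_inverse in B2.
  apply paste_inverse in A1; apply paste_inverse in A2.
  apply (restrict_inverse (α z)) in B1; apply (restrict_inverse (α z)) in B2.
  pose proof (esim_trans (esim_sym (tm_lact β _ _)) (esim_trans (tm_cong β (lax_gnat β) A1)
    (tm_one _ _))) as A1'.
  pose proof (esim_trans (esim_sym (tm_lact β _ _)) (esim_trans (tm_cong β (lax_gnat β) A2)
    (tm_one _ _))) as A2'.
  clear A1 A2.
  (* The comparison of the composite is the product of κ1 and κ2; b1 and a2 are their inverses. *)
pose (κ1 := ccast (eq_refl) (eq_sym (comph_assoc HE _ _ _)) (lt_cmp β u ∙ cunit (α z))).
  pose (b1 := ccast (eq_sym (comph_assoc HE _ _ _)) eq_refl (b ∙ cunit (α z))).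
  pose (κ2 := tpro β (punit w) ∙ lt_cmp α u).
  pose (a2 := tpro β (punit w) ∙ a).
  assert (C1 : lact (pent κ1) (pent b1) ≃ one H (lhom H u ∘ β z ∘ α z)).
  { refine (esim_trans (lact_cong _ _) B1); apply pent_of_sq, sq_cast. }
  assert (C2 : lact (pent b1) (pent κ1) ≃ one H (β w ∘ lhom G u ∘ α z)).
  { refine (esim_trans (lact_cong _ _) B2); apply pent_of_sq, sq_cast. }
  pose (c := ccast (eq_trans (paste_bd (H := H) _) (comph_assoc HE _ _ _))
    (eq_trans (paste_bd (H := H) _) (eq_sym (comph_assoc HE _ _ _)))
    (paste_cmp H (eq_refl) a2 b1)).
  assert (Hc : pent c ≃ lact (pent a2) (pent b1)).
  { exact (esim_trans (pent_of_sq (sq_cast _ _ _)) (paste_cmp_esim eq_refl _ _)). }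
  assert (Hk : pent (lt_cmp (lax_comp_trans β α) u) ≃ lact (pent κ1) (pent κ2)).
  { exact (esim_trans (pent_of_sq (sq_cast _ _ _)) (paste_cmp_esim _ _ _)). }
  exists c; split; apply paste_inverse.
  - refine (esim_trans (lact_cong Hk Hc) _).
    refine (esim_trans (lact_lact _ _ _) _).
    refine (esim_trans (lact_cong (esim_refl _) (esim_sym (lact_lact _ _ _))) _).
    refine (esim_trans (lact_cong (esim_refl _) (lact_unit _ A1')) _).
    refine (esim_trans C1 (one_cong _)); symmetry; apply (comph_assoc HE).
  - refine (esim_trans (lact_cong Hc Hk) _).
    refine (esim_trans (lact_lact _ _ _) _).
    refine (esim_trans (lact_cong (esim_refl _) (esim_sym (lact_lact _ _ _))) _).
    refine (esim_trans (lact_cong (esim_refl _) (lact_unit _ C2)) _).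
    refine (esim_trans A2' (one_cong _)); apply (comph_assoc HE).
Qed.

(** A trivial comparison cell is its own inverse, up to casts.  So the identity transformation is pseudo. *)
Lemma unital_inverse {F G : lax_functor D E} (α : lax_trans F G) {z w : D} (u : hom z w) :
  unital α u ->
  exists b : cell (α w ∘ lhom F u) (lhom G u ∘ α z) (punit (F z)) (lpro G (punit w)),
    paste_cmp G eq_refl (lt_cmp α u) b ≈ lunit G w ∙ cunit (lhom G u ∘ α z) /\
    paste_cmp G eq_refl b (lt_cmp α u) ≈ lunit G w ∙ cunit (α w ∘ lhom F u).
Proof.
  intros H; pose proof (proj1 (unital_iff α u) H) as K; destruct H as [e _].
  exists (ccast eq_refl (eq_sym e) (ec (one G (α w ∘ lhom F u)))).
  split; apply paste_inverse.
  - refine (esim_trans (lact_unit _ K) _).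
    refine (esim_trans (pent_of_sq (sq_cast _ _ _)) (one_cong (eq_sym e))).
  - refine (esim_trans (ract_unit (N := umod G) _ K) _).
    exact (pent_of_sq (sq_cast _ _ _)).
Qed.
End Lax.
End TransCat.

(** * Composition of oplax transformations *)
Section OplaxTransCat.
Context {D E : double_category}.
Let HD := dc_laws D.
Let HE := dc_laws E.

Definition cmO {F G : lax_functor D E} (α : oplax_trans F G) {x : E} {z w : D} (u : hom z w)
    (f : hom x (F z)) := cmo α (fun x y f => ot_cmp α f) u f.

Lemma cmO_id {F G : lax_functor D E} (α : oplax_trans F G) : oplax_id_ent α (fun x y f => ot_cmp α f).
Proof. apply oplax_id_iff; exact (ot_cmp_id _ _ α). Qed.
Lemma cmO_comp {F G : lax_functor D E} (α : oplax_trans F G) : oplax_comp_ent α (fun x y f => ot_cmp α f).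
Proof. apply oplax_comp_iff; exact (ot_cmp_comp _ _ α). Qed.
Lemma cmO_cell {F G : lax_functor D E} (α : oplax_trans F G) : oplax_cell_ent α (fun x y f => ot_cmp α f).
Proof. apply oplax_cell_iff; exact (ot_cmp_cell _ _ α). Qed.

Lemma cmo_cong {F G : lax_functor D E} (α α' : trans F G) κ κ'
    (H : forall x y f, ⟦κ x y f⟧ = ⟦κ' x y f⟧) {x : E} {z w : D} (u : hom z w)
    {f f' : hom x (F z)} : f = f' -> cmo α κ u f ≃ cmo α' κ' u f'.
Proof.
  intros <-; refine (esim_trans (cmo_esim _ _ _ _) (esim_trans _ (esim_sym (cmo_esim _ _ _ _)))).
  apply pent_of_sq; rewrite !to_sq_comp; f_equal; apply H.
Qed.

Lemma oplax_gnat {F G : lax_functor D E} (α : oplax_trans F G) : gnat α.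
Proof.
  intros x y m n c.
  pose proof (cmO_cell α _ _ _ _ _ _ (idh _) (idh _) (idh x) (idh y) (inj (umod F) m) n
    (fl_atom n) c) as H.
  assert (K : vp (tm α (inj (umod F) m)) (fl_atom n) c ≃ tm α (vp (inj (umod F) m) (fl_atom n) c)).
  { refine (esim_trans (esim_sym (lact_unit _ (cmO_id α _ _ _))) (esim_trans H _)).
    exact (ract_unit (N := umod G) _ (cmO_id α _ _ _)). }
  unfold vp, tm in K; cbn in K.
  assert (L := esim_sq (N := umod G) K); clear K H.
  rewrite !to_sq_comp, !(sq_comp_idr HE) in L; exact L.
Qed.

Section Comp.
Context {F G H : lax_functor D E} (β : oplax_trans G H) (α : oplax_trans F G).

Definition occ (x y : D) (f : hom x y) :
    cell (trans_comp β α y ∘ lhom F f) (lhom H f ∘ trans_comp β α x)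
      (punit (F x)) (lpro H (punit y)) :=
  ccast (eq_trans (paste_bd _) (comph_assoc HE _ _ _))
    (eq_trans (paste_bd _) (eq_sym (comph_assoc HE _ _ _))) (oplax_comp_cmp β α f).

Lemma cmo_composite {x : E} {z w : D} (u : hom z w) (f : hom x (F z)) :
  cmo (trans_comp β α) occ u f ≃ lact (tm β (cmO α u f)) (cmO β u (α z ∘ f)).
Proof.
  refine (esim_trans (cmo_esim _ _ _ _) _).
  refine (esim_trans (pent_lact_restrict f (esim_trans (pent_of_sq (sq_cast _ _ _))
    (paste_cmp_esim _ _ _))) _).
  apply lact_cong; apply esim_of_sq; cbn; rewrite ?sq_cast, !to_sq_comp, ?sq_cast, ?to_sq_comp.
  - apply eq_sym, (sq_comp_assoc HE).
  - rewrite (cunit_comp _ HE), to_sq_comp, (sq_comp_assoc HE); reflexivity.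
Qed.

Lemma oplax_comp_id_ent : oplax_id_ent (trans_comp β α) occ.
Proof.
  intros x z f; refine (esim_trans (cmo_composite _ _) _).
  refine (esim_trans (ract_unit (N := umod H) _ (cmO_id β _ _ _)) _).
  refine (esim_trans (tm_cong β (oplax_gnat β) (cmO_id α _ _ _)) _).
  refine (esim_trans (tm_one _ _) (one_cong _)); apply (comph_assoc HE).
Qed.

Lemma oplax_comp_cell_ent : oplax_cell_ent (trans_comp β α) occ.
Proof.
  intros x y z w z' w' f g u v p n B γ.
  refine (esim_trans (lact_cong (e' := vp (tm β (tm α p)) B γ) (cmo_composite u f) _) _).
  { apply esim_of_sq; cbn; rewrite !to_sq_comp, !(sq_comp_assoc HE); reflexivity. }
  refine (esim_trans (lact_lact _ _ _) _).
  refine (esim_trans (lact_cong (esim_refl _) (cmO_cell β _ _ _ _ _ _ _ _ u v (tm α p) n B γ)) _).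
  refine (esim_trans (esim_sym (lact_ract _ _ _)) _).
  refine (esim_trans (ract_cong (esim_sym (tm_lact β _ _)) (esim_refl _)) _).
  refine (esim_trans (ract_cong
    (tm_cong β (oplax_gnat β) (cmO_cell α _ _ _ _ _ _ _ _ u v p n B γ)) (esim_refl _)) _).
  refine (esim_trans (ract_cong (tm_lact β _ _) (esim_refl _)) _).
  refine (esim_trans (ract_ract _ _ _) _).
  exact (ract_cong (esim_sym (tm_comp β α _)) (esim_sym (cmo_composite v g))).
Qed.

Lemma oplax_comp_comp_ent : oplax_comp_ent (trans_comp β α) occ.
Proof.
  intros x z w v f u u'.
  refine (esim_trans (cmo_composite _ _) _).
  refine (esim_trans (lact_cong (tm_cong β (oplax_gnat β) (cmO_comp α _ _ _ _ f u u'))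
    (cmO_comp β _ _ _ _ _ u u')) _).
  refine (esim_trans (lact_cong (tm_lact β _ _) (esim_refl _)) _).
  refine (esim_trans (lact_lact _ _ _) _).
  refine (esim_trans (lact_cong (esim_refl _) (esim_sym (lact_lact _ _ _))) _).
  refine (esim_trans (lact_cong (esim_refl _) (lact_cong (esim_sym
    (cmO_cell β _ _ _ _ _ _ _ _ u' u' (cmO α u f) _ (fl_unit v) (cunit u'))) (esim_refl _))) _).
  refine (esim_trans (lact_cong (esim_refl _) (lact_lact _ _ _)) _).
  refine (esim_trans (esim_sym (lact_lact _ _ _)) _).
  refine (lact_cong (esim_sym (cmo_composite u' _)) (esim_sym (vp_pent u' (cmo_composite u f)))).
Qed.

Definition oplax_comp_trans : oplax_trans F H :=
  {| ot_trans := trans_comp β α; ot_cmp := occ;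
     ot_cmp_id := proj2 (oplax_id_iff _ _) oplax_comp_id_ent;
     ot_cmp_comp := proj2 (oplax_comp_iff _ _) oplax_comp_comp_ent;
     ot_cmp_cell := proj2 (oplax_cell_iff _ _) oplax_comp_cell_ent |}.
End Comp.

Lemma oplax_trans_eq {F G : lax_functor D E} (α α' : oplax_trans F G) :
  (forall x, α x = α' x) -> (forall x y (m : pro x y), tpro α m ≈ tpro α' m) ->
  (forall x y (f : hom x y), ot_cmp α f ≈ ot_cmp α' f) -> α = α'.
Proof.
  intros Ha Hp Hc; pose proof (trans_eq α α' Ha Hp) as e; clear Ha Hp.
  destruct α as [a κ k1 k2 k3], α' as [a' κ' k1' k2' k3']; cbn in *; subst a'.
  assert (e : κ = κ').
  { extensionality x; extensionality y; extensionality f; apply eq_of_ceq, Hc. }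
  subst κ'; f_equal; apply proof_irrelevance.
Qed.

Lemma cmp_of_cmo {F G : lax_functor D E} (α α' : oplax_trans F G) {z w : D} (u : hom z w) :
  cmO α u (idh (F z)) ≃ cmO α' u (idh (F z)) -> ot_cmp α u ≈ ot_cmp α' u.
Proof.
  intros H; apply ceq_of_sq; refine (esim_sq (N := umod G) (A := fl_unit _) (B := fl_unit _) _).
  exact (esim_trans (cmo_id α (fun x y f => ot_cmp α f) u)
    (esim_trans H (esim_sym (cmo_id α' (fun x y f => ot_cmp α' f) u)))).
Qed.

Definition oidc (F : lax_functor D E) (x y : D) (f : hom x y) :
    cell (trans_id F y ∘ lhom F f) (lhom F f ∘ trans_id F x) (punit (F x)) (lpro F (punit y)) :=
  ccast (eq_sym (comph_id_l HE _)) (eq_sym (comph_id_r HE _)) (gpost (lunit F y) (cunit (lhom F f))).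

Lemma cmo_oidc (F : lax_functor D E) {x : E} {z w : D} (u : hom z w) (f : hom x (F z)) :
  cmo (trans_id F) (oidc F) u f ≃ one F (lhom F u ∘ f).
Proof.
  refine (esim_trans (cmo_esim _ _ _ _) _); apply esim_of_sq; cbn.
  rewrite to_sq_comp; unfold oidc; rewrite sq_cast, !sq_gpost, (cunit_comp _ HE), to_sq_comp,
    (sq_comp_assoc HE); reflexivity.
Qed.

Definition oplax_trans_id (F : lax_functor D E) : oplax_trans F F.
Proof.
  refine {| ot_trans := trans_id F; ot_cmp := oidc F |}.
  - apply (oplax_id_iff (trans_id F) (oidc F)); intros x z f.
    refine (esim_trans (cmo_oidc F _ _) (one_cong _)); cbn.
    rewrite (lhom_id _ (lf_laws _ _ F)); reflexivity.
  - apply (oplax_comp_iff (trans_id F) (oidc F)); intros x z w v f u u'.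
    assert (K : vp (cmo (trans_id F) (oidc F) u f) (fl_unit v) (cunit u')
      ≃ vp (one F (lhom F u ∘ f)) (fl_unit v) (cunit u')).
    { exact (vp_cong_same (A := fl_unit _) (A' := fl_unit _) (fl_unit v) (cunit u')
        (a' := ec (one F _)) (cmo_oidc F u f)). }
    refine (esim_trans (cmo_oidc F _ _) (esim_sym (esim_trans
      (ract_unit (N := umod F) _ (esim_trans K (vp_one _ _))) _))).
    refine (esim_trans (cmo_oidc F _ _) (one_cong _)).
    rewrite (lhom_comp _ (lf_laws _ _ F)), (comph_assoc HE); reflexivity.
  - apply (oplax_cell_iff (trans_id F) (oidc F)); intros x y z w z' w' f g u v p n B γ.
    refine (esim_trans (lact_unit _ (cmo_oidc F u f)) (esim_sym
      (esim_trans (ract_unit (N := umod F) _ (cmo_oidc F v g)) _))).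
    apply esim_of_sq; cbn; rewrite !to_sq_comp, !(sq_comp_idl HE); reflexivity.
Defined.

Lemma oplax_comp_idl {F G : lax_functor D E} (α : oplax_trans F G) :
  oplax_comp_trans (oplax_trans_id G) α = α.
Proof.
  apply oplax_trans_eq.
  - intros x; apply (comph_id_l HE).
  - intros x y m; apply (vcomp_id_l _ HE).
  - intros x y f; apply cmp_of_cmo.
    refine (esim_trans (cmo_composite _ _ _ _) _).
    refine (esim_trans (ract_unit (N := umod G) _ (cmo_oidc G _ _)) _).
    exact (tm_id _).
Qed.

Lemma oplax_comp_idr {F G : lax_functor D E} (α : oplax_trans F G) :
  oplax_comp_trans α (oplax_trans_id F) = α.
Proof.
  apply oplax_trans_eq.
  - intros x; apply (comph_id_r HE).
  - intros x y m; apply (vcomp_id_r _ HE).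
  - intros x y f; apply cmp_of_cmo.
    refine (esim_trans (cmo_composite _ _ _ _) _).
    refine (esim_trans (lact_unit _ (esim_trans
      (tm_cong α (oplax_gnat α) (cmo_oidc F _ _)) (tm_one _ _))) _).
    apply cmo_cong; [reflexivity | apply (comph_id_l HE)].
Qed.

Lemma oplax_comp_assoc {F G H K : lax_functor D E} (γ : oplax_trans H K) (β : oplax_trans G H)
    (α : oplax_trans F G) :
  oplax_comp_trans γ (oplax_comp_trans β α) = oplax_comp_trans (oplax_comp_trans γ β) α.
Proof.
  apply oplax_trans_eq.
  - intros x; apply (comph_assoc HE).
  - intros x y m; apply (vcomp_assoc _ HE).
  - intros x y f; apply cmp_of_cmo.
    refine (esim_trans (cmo_composite _ _ _ _) _).
    refine (esim_trans (lact_cong (tm_cong γ (oplax_gnat γ) (cmo_composite β α f (idh (F x))))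
      (cmo_cong _ _ _ _ (fun _ _ _ => eq_refl) f (eq_sym (comph_assoc HE _ _ _)))) _).
    refine (esim_trans (lact_cong (tm_lact γ _ _) (esim_refl _)) _).
    refine (esim_trans (lact_lact _ _ _) _).
    refine (esim_sym (esim_trans (cmo_composite _ _ _ _) _)).
    exact (lact_cong (tm_comp γ β _) (cmo_composite γ β f (α x ∘ idh (F x)))).
Qed.

Definition ounital {F G : lax_functor D E} (α : oplax_trans F G) {z w : D} (u : hom z w) : Prop :=
  lhom G u ∘ α z = α w ∘ lhom F u /\ ot_cmp α u ≈ lunit G w ∙ cunit (α w ∘ lhom F u).

Lemma ounital_iff {F G : lax_functor D E} (α : oplax_trans F G) {z w : D} (u : hom z w) :
  ounital α u <-> pent (ot_cmp α u) ≃ one G (α w ∘ lhom F u).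
Proof.
  split.
  - intros [_ H]; refine (esim_trans (pent_of_sq (sq_of_ceq H)) (esim_sym (one_cell _))).
  - intros H; split; [exact (proj2 (esim_bd H))|].
    apply ceq_of_sq; exact (esim_sq (N := umod G) (A := fl_unit _) (B := fl_unit _)
      (esim_trans H (one_cell _))).
Qed.

Lemma ounital_cmo {F G : lax_functor D E} (α : oplax_trans F G) {z w : D} (u : hom z w) :
  ounital α u -> forall (x : E) (f : hom x (F z)), cmO α u f ≃ one G (α w ∘ (lhom F u ∘ f)).
Proof.
  intros [_ H] x f; refine (esim_trans (cmo_esim _ _ _ _) _); apply esim_of_sq; cbn.
  rewrite to_sq_comp, (sq_of_ceq H), to_sq_comp, sq_gpost, (comph_assoc HE), (cunit_comp _ HE _ _ _ _ f),
    to_sq_comp, (sq_comp_assoc HE); reflexivity.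
Qed.

Lemma ounital_comp {F G H : lax_functor D E} (β : oplax_trans G H) (α : oplax_trans F G)
    {z w : D} (u : hom z w) : ounital β u -> ounital α u -> ounital (oplax_comp_trans β α) u.
Proof.
  intros Hβ Hα; apply ounital_iff.
  refine (esim_trans (cmo_id _ _ _) (esim_trans (cmo_composite _ _ _ _) _)).
  refine (esim_trans (ract_unit (N := umod H) _ (ounital_cmo β u Hβ _ _)) _).
  refine (esim_trans (tm_cong β (oplax_gnat β) (ounital_cmo α u Hα _ _)) _).
  refine (esim_trans (tm_one _ _) (one_cong _)).
  rewrite (comph_id_r HE); apply (comph_assoc HE).
Qed.

Lemma ounital_id {F : lax_functor D E} {z w : D} (u : hom z w) : ounital (oplax_trans_id F) u.
Proof.
  apply ounital_iff; refine (esim_trans (cmo_id _ _ _) (esim_trans (cmo_oidc F _ _) (one_cong _))).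
  cbn; rewrite (comph_id_r HE), (comph_id_l HE); reflexivity.
Qed.
End OplaxTransCat.

(** * Pasting with coherence isomorphisms *)

Lemma coh_giso {C : double_category} {x y : C} {m n : pro x y} {A : fl m} {B : fl n}
    {a : m ⟹ n} : coh A B a -> giso a.
Proof. intros H; destruct (coh_inv H) as (b & _ & H1 & H2); exists b; split; assumption. Qed.

Lemma sq_epi {C : double_category} {x y x' y' : C} {m n : pro x y} {p : pro x' y'}
    {i : m ⟹ n} (Hi : giso i) {a b : sq n p} :
  a ⋆ ⟦i⟧ = b ⋆ ⟦i⟧ -> a = b.
Proof.
  intros H; destruct Hi as (j & _ & Hj).
  rewrite <- (sq_comp_idr (dc_laws C) a), <- (sq_comp_idr (dc_laws C) b), <- Hj, sq_gcomp,
    !(sq_comp_assoc (dc_laws C)), H; reflexivity.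
Qed.

Lemma sq_epi_eq {C : double_category} {x y x' y' : C} {m n : pro x y} {p : pro x' y'}
    {i : m ⟹ n} (Hi : giso i) {a b : sq n p} :
  a ⋆ ⟦i⟧ = b ⋆ ⟦i⟧ <-> a = b.
Proof. split; [apply (sq_epi Hi) | intros ->; reflexivity]. Qed.

Lemma sq_cid_swap {C : double_category} {x y x' y' : C} {f : hom x x'} {g : hom y y'}
    {m : pro x y} {n : pro x' y'} (a : cell f g m n) : ⟦cid n ∙ a⟧ = ⟦a ∙ cid m⟧.
Proof.
  rewrite !to_sq_comp, (sq_comp_idl (dc_laws C)), (sq_comp_idr (dc_laws C)); reflexivity.
Qed.

Lemma sq_run_tens {C : double_category} {x y z x' y' z' : C} {f : hom x x'} {g : hom y y'}
    {h : hom z z'} {m : pro x y} {n : pro y z} {m' : pro x' y'} {n' : pro y' z'}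
    (a : cell f g m m') (r : cell g h n n') :
  ⟦run m' ⊗ cid n'⟧ ⋆ ⟦(a ⊗ cunit g) ⊗ r⟧
  = ⟦a ⊗ r⟧ ⋆ ⟦run m ⊗ cid n⟧.
Proof.
  rewrite !sq_tens_comp; apply sq_ctens; [|apply sq_cid_swap].
  rewrite !to_sq_comp; apply sq_run_nat.
Qed.

Lemma snoc_cons_tens {C : double_category} {x y z w x' y' z' w' : C} {f : hom x x'} {g : hom y y'}
    {h : hom z z'} {k : hom w w'} {m : pro x y} {n : pro y z} {r : pro z w} {s : pro y w}
    {m' : pro x' y'} {n' : pro y' z'} {r' : pro z' w'} {s' : pro y' w'} {a : cell f g m m'}
    {b : cell g h n n'} {c : cell h k r r'} {d : cell g k s s'}
    {i : n ⊙ r ⟹ s} {j : n' ⊙ r' ⟹ s'} :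
  ⟦j⟧ ⋆ ⟦b ⊗ c⟧ = ⟦d⟧ ⋆ ⟦i⟧ ->
  ⟦(cid m' ⊗ j) • assoc m' n' r'⟧ ⋆ ⟦(a ⊗ b) ⊗ c⟧
  = ⟦a ⊗ d⟧ ⋆ ⟦(cid m ⊗ i) • assoc m n r⟧.
Proof.
  intros H; rewrite !sq_gcomp, <- (sq_comp_assoc (dc_laws C)), sq_assoc_nat,
    (sq_comp_assoc (dc_laws C)), sq_tens_comp.
  rewrite (sq_ctens (a := cid m' ∙ a) (b := j ∙ (b ⊗ c)) (a1 := a ∙ cid m) (b1 := d ∙ i)
    (sq_cid_swap _) H), <- sq_tens_comp,
    (sq_comp_assoc (dc_laws C)); reflexivity.
Qed.

Lemma sq_associ_nat {C : double_category} {x y z w x' y' z' w' : C} {f : hom x x'}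
    {g : hom y y'} {h : hom z z'} {k : hom w w'} {m : pro x y} {n : pro y z} {r : pro z w}
    {m' : pro x' y'} {n' : pro y' z'} {r' : pro z' w'} (a : cell f g m m') (b : cell g h n n')
    (c : cell h k r r') :
  ⟦associ m' n' r'⟧ ⋆ ⟦a ⊗ (b ⊗ c)⟧
  = ⟦(a ⊗ b) ⊗ c⟧ ⋆ ⟦associ m n r⟧.
Proof.
  pose proof (dc_laws C) as HC.
  apply (sq_epi (giso_assoc m n r)).
  rewrite <- !(sq_comp_assoc HC), <- (sq_gcomp (associ _ _ _) (assoc _ _ _)), g_associ_assoc,
    (sq_comp_idr HC), <- sq_assoc_nat, (sq_comp_assoc HC), <- sq_gcomp, g_associ_assoc,
    (sq_comp_idl HC); reflexivity.
Qed.

Lemma absorb_tens {C : double_category} {x y z w x' y' z' w' : C} {f : hom x x'}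
    {g : hom y y'} {h : hom z z'} {k : hom w w'} {m : pro x y} {n : pro y z} {r : pro z w}
    {m' : pro x' y'} {n' : pro y' z'} {r' : pro z' w'} {s : pro x' z'} (a : cell f g m m')
    (b : cell g h n n') (c : cell h k r r') (i : m' ⊙ n' ⟹ s) :
  ⟦(i ⊗ cid r') • associ m' n' r'⟧ ⋆ ⟦a ⊗ (b ⊗ c)⟧
  = ⟦gpost i (a ⊗ b) ⊗ c⟧ ⋆ ⟦associ m n r⟧.
Proof.
  rewrite sq_gcomp, <- (sq_comp_assoc (dc_laws C)), sq_associ_nat, (sq_comp_assoc (dc_laws C)),
    gpost_tens_l, sq_gpost; reflexivity.
Qed.

Lemma cid_tens_square {C : double_category} {x y z x' y' z' : C} {f : hom x x'} {g : hom y y'}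
    {h : hom z z'} {m : pro x y} {n r : pro y z} {m' : pro x' y'} {n' r' : pro y' z'}
    {a : cell f g m m'} {b : cell g h n n'} {c : cell g h r r'}
    {i : n ⟹ r} {j : n' ⟹ r'} :
  ⟦j⟧ ⋆ ⟦b⟧ = ⟦c⟧ ⋆ ⟦i⟧ ->
  ⟦cid m' ⊗ j⟧ ⋆ ⟦a ⊗ b⟧ = ⟦a ⊗ c⟧ ⋆ ⟦cid m ⊗ i⟧.
Proof.
  intros H; rewrite !sq_tens_comp; apply sq_ctens; [apply sq_cid_swap | exact H].
Qed.

Lemma sq_app_cons {C : double_category} {x y z w x' y' z' w' : C} {f : hom x x'} {g : hom y y'}
    {h : hom z z'} {k : hom w w'} {m : pro x y} {m' : pro x' y'} {n : pro y w} {n' : pro y' w'}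
    {p : pro y z} {p' : pro y' z'} {q : pro z w} {q' : pro z' w'}
    {a : cell f g m m'} {t : cell g k n n'} {ta : cell g h p p'} {tb : cell h k q q'}
    {σ : n' ⟹ p' ⊙ q'} {φ : n ⟹ p ⊙ q} :
  ⟦σ⟧ ⋆ ⟦t⟧ = ⟦ta ⊗ tb⟧ ⋆ ⟦φ⟧ ->
  ⟦associ m' p' q' • (cid m' ⊗ σ)⟧ ⋆ ⟦a ⊗ t⟧
  = ⟦(a ⊗ ta) ⊗ tb⟧ ⋆ ⟦associ m p q • (cid m ⊗ φ)⟧.
Proof.
  intros H; rewrite !sq_gcomp, <- (sq_comp_assoc (dc_laws C)), (cid_tens_square H),
    !(sq_comp_assoc (dc_laws C)), sq_associ_nat; reflexivity.
Qed.

Lemma sq_block {C : double_category} {x y z x' y' z' x'' y'' z'' : C}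
    {f : hom x x'} {g : hom y y'} {h : hom z z'} {f' : hom x' x''} {g' : hom y' y''} {h' : hom z' z''}
    {m0 : pro x z} {m : pro x y} {n r : pro y z} {m1 : pro x' y'} {n1 s : pro y' z'}
    {r0 : pro x' z'} {m2 : pro x'' y''} {n2 : pro y'' z''}
    {μ : cell f' g' m1 m2} {β : cell g' h' s n2} {σ : n1 ⟹ s}
    {α : r0 ⟹ m1 ⊙ n1} {t : cell f h m0 r0}
    {a : cell f g m m1} {b : cell g h n n1} {φ : m0 ⟹ m ⊙ n}
    {c : cell (g' ∘ g) (h' ∘ h) r n2} {ξ : n ⟹ r} :
  ⟦α⟧ ⋆ ⟦t⟧ = ⟦a ⊗ b⟧ ⋆ ⟦φ⟧ ->
  ⟦β⟧ ⋆ (⟦σ⟧ ⋆ ⟦b⟧) = ⟦c⟧ ⋆ ⟦ξ⟧ ->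
  ⟦μ ⊗ β⟧ ⋆ (⟦(cid m1 ⊗ σ) • α⟧ ⋆ ⟦t⟧)
  = ⟦(μ ∙ a) ⊗ c⟧ ⋆ ⟦(cid m ⊗ ξ) • φ⟧.
Proof.
  pose proof (dc_laws C) as HC; intros H1 H2.
  rewrite !sq_gcomp, <- (sq_comp_assoc HC), H1, !(sq_comp_assoc HC); f_equal.
  rewrite <- (sq_comp_assoc HC), !sq_tens_comp; apply sq_ctens.
  - rewrite !to_sq_comp, (sq_comp_idl HC), (sq_comp_idr HC); reflexivity.
  - rewrite !to_sq_comp; exact H2.
Qed.

Lemma sq_conjugate {C : double_category} {x y x' y' : C} {m n : pro x y} {m' n' : pro x' y'}
    {φ : m ⟹ n} {ζ : n ⟹ m}
    {κ : n' ⟹ m'} {μ : m' ⟹ n'} {R : sq m m'} {S : sq n n'} :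
  φ • ζ = cid n -> κ • μ = cid m' ->
  ⟦μ⟧ ⋆ R = S ⋆ ⟦φ⟧ -> ⟦κ⟧ ⋆ S = R ⋆ ⟦ζ⟧.
Proof.
  pose proof (dc_laws C) as HC; intros Hφ Hκ H.
  rewrite <- (sq_comp_idr HC S), <- Hφ, sq_gcomp, (sq_comp_assoc HC S), <- H,
    !(sq_comp_assoc HC), <- sq_gcomp, Hκ, (sq_comp_idl HC); reflexivity.
Qed.

(** The case of three factors in which the first two are merged by [σ]; the other cells are the
    coherence isomorphisms before and after merging. *)
Lemma sq_merge {C : double_category} {x y z w x' y' z' w' : C} {f : hom x x'} {g : hom y y'}
    {h : hom z z'} {k : hom w w'} {m1 m1' m2 m2' m3 m3' t t' s s' r r'}
    {μ1 : t' ⟹ m1' ⊙ (m2' ⊙ m3')} {T : cell f k t t'}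
    {n : cell f g m1 m1'} {a : cell g h m2 m2'} {b : cell h k m3 m3'}
    {φ1 : t ⟹ m1 ⊙ (m2 ⊙ m3)} {σ : m1' ⊙ m2' ⟹ s'}
    {n' : cell f h s s'} {φ2 : m1 ⊙ m2 ⟹ s} {R : cell f k r r'}
    {μ3 : r' ⟹ s' ⊙ m3'} {κ3 : s' ⊙ m3' ⟹ r'}
    {φ3 : r ⟹ s ⊙ m3} {ζ3 : s ⊙ m3 ⟹ r} :
  ⟦μ1⟧ ⋆ ⟦T⟧ = ⟦n ⊗ (a ⊗ b)⟧ ⋆ ⟦φ1⟧ ->
  ⟦σ⟧ ⋆ ⟦n ⊗ a⟧ = ⟦n'⟧ ⋆ ⟦φ2⟧ ->
  ⟦μ3⟧ ⋆ ⟦R⟧ = ⟦n' ⊗ b⟧ ⋆ ⟦φ3⟧ ->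
  κ3 • μ3 = cid r' -> φ3 • ζ3 = cid (s ⊙ m3) ->
  ⟦κ3 • ((σ ⊗ cid m3') • (associ m1' m2' m3' • μ1))⟧ ⋆ ⟦T⟧
  = ⟦R⟧ ⋆ ⟦ζ3 • ((φ2 ⊗ cid m3) • (associ m1 m2 m3 • φ1))⟧.
Proof.
  pose proof (dc_laws C) as HC; intros H1 H2 H3 K3 Z3.
  pose proof (sq_conjugate Z3 K3 H3) as H4.
  assert (H5 : ⟦σ ⊗ cid m3'⟧ ⋆ ⟦(n ⊗ a) ⊗ b⟧
    = ⟦n' ⊗ b⟧ ⋆ ⟦φ2 ⊗ cid m3⟧).
  { rewrite !sq_tens_comp; apply sq_ctens; [exact H2 | apply sq_cid_swap]. }
  rewrite !sq_gcomp, <- !(sq_comp_assoc HC), H1.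
  rewrite (sq_comp_assoc HC ⟦associ _ _ _⟧ ⟦n ⊗ (a ⊗ b)⟧), sq_associ_nat.
  rewrite <- (sq_comp_assoc HC _ ⟦associ m1 m2 m3⟧), (sq_comp_assoc HC ⟦σ ⊗ _⟧), H5.
  rewrite <- (sq_comp_assoc HC ⟦n' ⊗ b⟧), (sq_comp_assoc HC ⟦κ3⟧), H4,
    <- (sq_comp_assoc HC); reflexivity.
Qed.

Section Restrict.
Context {D E : double_category}.
Let HD := dc_laws D.
Let HE := dc_laws E.
Context {F G : lax_functor D E} {N : module F G}.

(** Both sides of a naturality equation can be restricted along a cell of [E].  With a generic cell in place
    of [ξ] the equation for components gives the one for entries; with its inverse it gives the
    converse. *)
Lemma restrict_rl {x y x' y' : E} {z w : D} {n : pro z w} {m : pro x y} {X : pro x' y'}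
    {l l' : hom x (F z)} {r r' : hom y (G w)} {s : hom x' x} {t : hom y' y}
    {A : fl m} (A' : fl X) {B : fl n} {a : cell l r m (mpro N n)} {b : cell l' r' m (mpro N n)}
    {κ : cell l l' (punit x) (lpro F (punit z))} {κ' : cell r r' (punit y) (lpro G (punit w))}
    (ξ : cell s t X m) :
  ract (Ent m n A B a) (pent κ') ≃ lact (pent κ) (Ent m n A B b) ->
  ract (Ent X n A' B (a ∙ ξ)) (pent (κ' ∙ cunit t)) ≃
  lact (pent (κ ∙ cunit s)) (Ent X n A' B (b ∙ ξ)).
Proof.
  intros L.
  match type of L with ?a ≃ ?b =>
    pose proof (ep_cong (e := a) (e' := b) (fl_tens A' (fl_unit y'))
      (fl_tens (fl_unit x') A') (ξ ⊗ cunit t) (cunit s ⊗ ξ) L) as M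
  end.
  refine (esim_trans (esim_sym (ep_ract (Ent m n A B a) (pent κ') A' (fl_unit y') ξ (cunit t)))
    (esim_trans (M _) (ep_lact (pent κ) (Ent m n A B b) (fl_unit x') A' (cunit s) ξ))).
  intros φ Hφ.
  pose proof (coh_unique Hφ (coh_comp (coh_luni _) (coh_run _))) as ->.
  exists (luni X • run X); split; [exact (coh_comp (coh_luni _) (coh_run _))|].
  cbn; rewrite !sq_gcomp, <- (sq_comp_assoc HE), sq_run_nat, (sq_comp_assoc HE), sq_luni_nat,
    <- (sq_comp_assoc HE); reflexivity.
Qed.

Lemma restrict_lr {x y x' y' : E} {z w : D} {n : pro z w} {m : pro x y} {X : pro x' y'}
    {l l' : hom x (F z)} {r r' : hom y (G w)} {s : hom x' x} {t : hom y' y}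
    {A : fl m} (A' : fl X) {B : fl n} {a : cell l r m (mpro N n)} {b : cell l' r' m (mpro N n)}
    {κ : cell l' l (punit x) (lpro F (punit z))} {κ' : cell r' r (punit y) (lpro G (punit w))}
    (ξ : cell s t X m) :
  lact (pent κ) (Ent m n A B a) ≃ ract (Ent m n A B b) (pent κ') ->
  lact (pent (κ ∙ cunit s)) (Ent X n A' B (a ∙ ξ)) ≃
  ract (Ent X n A' B (b ∙ ξ)) (pent (κ' ∙ cunit t)).
Proof.
  intros L.
  match type of L with ?a ≃ ?b =>
    pose proof (ep_cong (e := a) (e' := b) (fl_tens (fl_unit x') A') (fl_tens A' (fl_unit y'))
       (cunit s ⊗ ξ) (ξ ⊗ cunit t) L) as M
  end.
  refine (esim_trans (esim_sym (ep_lact (pent κ) (Ent m n A B a) (fl_unit x') A' (cunit s) ξ))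
    (esim_trans (M _) (ep_ract (Ent m n A B b) (pent κ') A' (fl_unit y') ξ (cunit t)))).
  intros φ Hφ.
  pose proof (coh_unique Hφ (coh_comp (coh_runi _) (coh_lun _))) as ->.
  exists (runi X • lun X); split; [exact (coh_comp (coh_runi _) (coh_lun _))|].
  cbn; rewrite !sq_gcomp, <- (sq_comp_assoc HE), sq_lun_nat, (sq_comp_assoc HE), sq_runi_nat,
    <- (sq_comp_assoc HE); reflexivity.
Qed.
End Restrict.

(** Cells of [D] that differ by coherence isomorphisms between their boundaries.  Unlike for entries the
    arrows at the sides are the same on both. *)
Definition vsim {D : double_category} {x y x' y' : D} {c : hom x x'} {e : hom y y'}
    {m : pro x y} {n : pro x' y'} (A : fl m) (B : fl n) (γ : cell c e m n)
    {m1 : pro x y} {n1 : pro x' y'} (A1 : fl m1) (B1 : fl n1) (γ1 : cell c e m1 n1) : Prop :=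
  exists i j, coh A A1 i /\ coh B B1 j /\
    ⟦j⟧ ⋆ ⟦γ⟧ = ⟦γ1⟧ ⋆ ⟦i⟧.

Section Vsim.
Context {D : double_category}.
Let HD := dc_laws D.

Lemma vsim_refl {x y x' y' : D} {c : hom x x'} {e : hom y y'} {m : pro x y} {n : pro x' y'}
    (A : fl m) (B : fl n) (γ : cell c e m n) : vsim A B γ A B γ.
Proof.
  exists (cid m), (cid n); split; [apply coh_id|]; split; [apply coh_id|].
  rewrite (sq_comp_idl HD), (sq_comp_idr HD); reflexivity.
Qed.

Lemma vsim_trans {x y x' y' : D} {c : hom x x'} {e : hom y y'} {m m1 m2 : pro x y}
    {n n1 n2 : pro x' y'} {A : fl m} {B : fl n} {γ : cell c e m n} {A1 : fl m1} {B1 : fl n1}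
    {γ1 : cell c e m1 n1} {A2 : fl m2} {B2 : fl n2} {γ2 : cell c e m2 n2} :
  vsim A B γ A1 B1 γ1 -> vsim A1 B1 γ1 A2 B2 γ2 -> vsim A B γ A2 B2 γ2.
Proof.
  intros (i & j & H1 & H2 & H3) (k & l & K1 & K2 & K3).
  exists (k • i), (l • j); split; [exact (coh_comp K1 H1)|]; split; [exact (coh_comp K2 H2)|].
  rewrite !sq_gcomp, <- (sq_comp_assoc HD), H3, !(sq_comp_assoc HD), K3; reflexivity.
Qed.

Lemma vsim_sym {x y x' y' : D} {c : hom x x'} {e : hom y y'} {m m1 : pro x y}
    {n n1 : pro x' y'} {A : fl m} {B : fl n} {γ : cell c e m n} {A1 : fl m1} {B1 : fl n1}
    {γ1 : cell c e m1 n1} : vsim A B γ A1 B1 γ1 -> vsim A1 B1 γ1 A B γ.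
Proof.
  intros (i & j & H1 & H2 & H3).
  destruct (coh_inv H1) as (k & K1 & K2 & K3), (coh_inv H2) as (l & L1 & L2 & L3).
  exists k, l; split; [exact K1|]; split; [exact L1|].
  rewrite <- (sq_comp_idr HD ⟦γ1⟧), <- K3, sq_gcomp, (sq_comp_assoc HD ⟦γ1⟧), <- H3,
    !(sq_comp_assoc HD), <- (sq_gcomp l), L2, (sq_comp_idl HD); reflexivity.
Qed.

Lemma vsim_tens {x y z x' y' z' : D} {c : hom x x'} {d : hom y y'} {e : hom z z'}
    {m m1 : pro x y} {n n1 : pro x' y'} {p p1 : pro y z} {q q1 : pro y' z'}
    {A : fl m} {B : fl n} {γ : cell c d m n} {A1 : fl m1} {B1 : fl n1} {γ1 : cell c d m1 n1}
    {A' : fl p} {B' : fl q} {δ : cell d e p q} {A1' : fl p1} {B1' : fl q1} {δ1 : cell d e p1 q1} :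
  vsim A B γ A1 B1 γ1 -> vsim A' B' δ A1' B1' δ1 ->
  vsim (fl_tens A A') (fl_tens B B') (γ ⊗ δ) (fl_tens A1 A1') (fl_tens B1 B1') (γ1 ⊗ δ1).
Proof.
  intros (i & j & H1 & H2 & H3) (k & l & K1 & K2 & K3).
  exists (i ⊗ k), (j ⊗ l); split; [exact (coh_tens H1 K1)|]; split; [exact (coh_tens H2 K2)|].
  rewrite !sq_tens_comp; apply sq_ctens; assumption.
Qed.

Lemma vsim_assoc {x y z w x' y' z' w' : D} {c : hom x x'} {d : hom y y'} {e : hom z z'} {f : hom w w'}
    {m n p m' n' p'} {A : fl m} {B : fl n} {C : fl p} {A' : fl m'} {B' : fl n'} {C' : fl p'}
    (γ : cell c d m m') (δ : cell d e n n') (ε : cell e f p p') :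
  vsim (fl_tens (fl_tens A B) C) (fl_tens (fl_tens A' B') C') ((γ ⊗ δ) ⊗ ε)
    (fl_tens A (fl_tens B C)) (fl_tens A' (fl_tens B' C')) (γ ⊗ (δ ⊗ ε)).
Proof.
  exists (assoc m n p), (assoc m' n' p'); split; [apply coh_assoc|]; split; [apply coh_assoc|].
  apply sq_assoc_nat.
Qed.

Lemma vsim_run {x y x' y' : D} {c : hom x x'} {d : hom y y'} {m m'} {A : fl m} {A' : fl m'}
    (γ : cell c d m m') :
  vsim (fl_tens A (fl_unit y)) (fl_tens A' (fl_unit y')) (γ ⊗ cunit d) A A' γ.
Proof.
  exists (run m), (run m'); split; [apply coh_run|]; split; [apply coh_run | apply sq_run_nat].
Qed.
End Vsim.

Lemma vp_vsim {D E : double_category} {F G : lax_functor D E} {N : module F G} {x y : E}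
    {z w z' w' : D} {f f' : hom x (F z)} {g g' : hom y (G w)} {u : hom z z'} {v : hom w w'}
    {e : ent N f g} {e' : ent N f' g'} {n n' : pro z' w'} {B : fl n} {B' : fl n'}
    {γ : cell u v (en e) n} {γ' : cell u v (en e') n'} :
  e ≃ e' -> vsim (eB e) B γ (eB e') B' γ' -> vp e B γ ≃ vp e' B' γ'.
Proof.
  intros He (i & j & H1 & H2 & H3); apply (vp_cong B B' γ γ' He).
  intros ψ Hψ; rewrite (coh_unique Hψ H1); exists j; split; assumption.
Qed.

Section Multimodulations.
Context {D E : double_category} {PD : lax_products D} {PE : lax_products E}.
Notation HD := (dc_laws D).
Notation HE := (dc_laws E).
Notation Fun := (pp_lax PD PE).
Notation Mod := (pp_module PD PE).
Notation mpath := (path Mod).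
Notation Tr k := (pp_trans PD PE k).
Arguments multimodulation {D E PD PE} k F F' G H Ms N α β.
Arguments dpath {D E PD PE F G} Ms x y.
Arguments dcons {D E PD PE F G H M Ms x y z} _ _.
Arguments dnil {D E PD PE F} x.
Arguments msrc {D E PD PE F G Ms x y} ms.
Arguments mtot {D E PD PE F G Ms x y} ms.
Arguments components {D E PD PE F F' G H} Ms N α β.
Arguments dcells {D E PD PE F G Ms x y x' y'} ms ns f g.
Arguments dcnil {D E PD PE F x x'} f.
Arguments dccons {D E PD PE F G H M Ms x y z x' y' z' m m' ms ns f g h} _ _.
Arguments msrc_cell {D E PD PE F G Ms x y x' y' ms ns f g} γs.
Arguments mtot_cell {D E PD PE F G Ms x y x' y' ms ns f g} γs.
Arguments npath {D E PD PE F G} Ms x y.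
Arguments nlast {D E PD PE F G M x y} _.
Arguments ncons {D E PD PE F G H M Ms x y z} _ _.
Arguments npath_dpath {D E PD PE F G Ms x y} ms.
Arguments snoc {D E PD PE F G Ms x y z} ms p.
Arguments snoc_src {D E PD PE F G Ms x y z} ms p.
Arguments snoc_tot {D E PD PE F G Ms x y z} ms p.
Arguments ipath {D E PD PE F G} Ms x y.
Arguments ihere {D E PD PE F G H K M M' Ms x y z w v} _ _ _ _.
Arguments ithere {D E PD PE F G H M Ms x y z} _ _.
Arguments absorb_l {D E PD PE F G Ms x y} s.
Arguments absorb_r {D E PD PE F G Ms x y} s.
Arguments isrc {D E PD PE F G Ms x y} s.
Arguments isrc_l {D E PD PE F G Ms x y} s.
Arguments isrc_r {D E PD PE F G Ms x y} s.
Arguments itot {D E PD PE F G Ms x y} s.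
Arguments lax_natural {D E PD PE F F' G H Ms N} α β μ.
Arguments oplax_natural {D E PD PE F F' G H Ms N} α β μ.
Arguments left_equivariant {D E PD PE F F' G H Ms N} α β μ.
Arguments right_equivariant {D E PD PE F F' G H Ms N α β} μ.
Arguments nullary_equivariant {D E PD PE F F' G H Ms N} α β μ.
Arguments inner_equivariant {D E PD PE F F' G H Ms N α β} μ.
Arguments natural {D E PD PE k F F' G H Ms N} α β μ.
Arguments dapp {D E PD PE F G H Ms Ns x y z} ms _.
Arguments mm_cell {D E PD PE k F F' G H Ms N α β} _ {x y} ms.
Arguments pt_core {D E PD PE k F G} _.
Arguments msrc_app {D E PD PE F G H Ms Ns x y z} ms ns.
Arguments mtot_app {D E PD PE F G H Ms Ns x y z} ms ns.
Arguments blocks {D E PD PE k F' G' q F G f g} μs x y.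
Arguments bnil {D E PD PE k F F'} f x.
Arguments bcons {D E PD PE k F F' G G' H H' p N f g q h} μ {μs x y z} _ _.
Arguments bflat {D E PD PE k F' G' q F G f g μs x y} bs.
Arguments bouter {D E PD PE k F' G' q F G f g μs x y} bs.
Arguments bsrc {D E PD PE k F' G' q F G f g μs x y} bs.
Arguments btens {D E PD PE k F' G' q F G f g μs x y} bs.
Arguments bsplit {D E PD PE k F' G' q F G f g μs x y} bs.
Arguments bjoin {D E PD PE k F' G' q F G f g μs x y} bs.
Arguments is_pasting {D E PD PE k F G F' G' F'' G'' q N f g u v uf vg μs} κ ν.

(** * Composable entries *)

Inductive qc : forall {F G : Fun} {q : mpath F G} {z w : D} (ms : dpath q z w) {x y : E}
    (f : hom x (F z)) (g : hom y (G w)), Type :=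
| qnil : forall {F : Fun} {z : D} {x : E} (f : hom x (F z)), qc (@dnil D E PD PE F z) f f
| qcons : forall {F G H : Fun} {M : Mod F G} {q : mpath G H} {z w v : D} {ms : dpath q w v}
    {x y t : E} {f : hom x (F z)} {g : hom y (G w)} {h : hom t (H v)} (a : ent M f g),
    qc ms g h -> qc (dcons (M := M) (en a) ms) f h.

Fixpoint qsrc {F G : Fun} {q : mpath F G} {z w : D} {ms : dpath q z w} {x y : E}
    {f : hom x (F z)} {g : hom y (G w)} (as_ : qc ms f g) : pro x y :=
  match as_ with
  | @qnil _ _ x _ => punit x
  | qcons a as_ => eX a ⊙ qsrc as_
  end.

Fixpoint qfl {F G : Fun} {q : mpath F G} {z w : D} {ms : dpath q z w} {x y : E}
    {f : hom x (F z)} {g : hom y (G w)} (as_ : qc ms f g) : fl (qsrc as_) :=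
  match as_ with
  | @qnil _ _ x _ => fl_unit x
  | qcons a as_ => fl_tens (eA a) (qfl as_)
  end.

Fixpoint qtfl {F G : Fun} {q : mpath F G} {z w : D} {ms : dpath q z w} {x y : E}
    {f : hom x (F z)} {g : hom y (G w)} (as_ : qc ms f g) : fl (mtot ms) :=
  match as_ with
  | @qnil _ z _ _ => fl_unit z
  | qcons a as_ => fl_tens (eB a) (qtfl as_)
  end.

Fixpoint tens {F G : Fun} {q : mpath F G} {z w : D} {ms : dpath q z w} {x y : E}
    {f : hom x (F z)} {g : hom y (G w)} (as_ : qc ms f g) : cell f g (qsrc as_) (msrc ms) :=
  match as_ with
  | qnil f => cunit f
  | qcons a as_ => ec a ⊗ tens as_
  end.

(** At the generic entries this is the component itself ([ev_ids]). *)
Definition ev {F F' G H : Fun} {Ms : mpath F F'} {N : Mod G H} {α : trans F G} {β : trans F' H}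
    (μ : components Ms N α β) {z w : D} {ms : dpath Ms z w} {x y : E}
    {f : hom x (F z)} {g : hom y (F' w)} (as_ : qc ms f g) : ent N (α z ∘ f) (β w ∘ g) :=
  Ent (qsrc as_) (mtot ms) (qfl as_) (qtfl as_) (μ z w ms ∙ tens as_).

Fixpoint ids {F G : Fun} {q : mpath F G} {z w : D} (ms : dpath q z w) :
    qc ms (idh (F z)) (idh (G w)) :=
  match ms with
  | @dnil _ _ _ _ F x => qnil (idh (F x))
  | @dcons _ _ _ _ _ _ _ M _ _ _ _ m ms => qcons (inj M m) (ids ms)
  end.

Fixpoint mfl {F G : Fun} {q : mpath F G} {z w : D} (ms : dpath q z w) : fl (msrc ms) :=
  match ms with
  | @dnil _ _ _ _ F x => fl_unit (F x)
  | dcons m ms => fl_tens (fl_atom _) (mfl ms)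
  end.

Fixpoint tfl {F G : Fun} {q : mpath F G} {z w : D} (ms : dpath q z w) : fl (mtot ms) :=
  match ms with
  | dnil x => fl_unit x
  | dcons m ms => fl_tens (fl_atom _) (tfl ms)
  end.

Lemma tens_ids {F G : Fun} {q : mpath F G} {z w : D} (ms : dpath q z w) :
  coh (qfl (ids ms)) (mfl ms) (tens (ids ms)).
Proof.
  induction ms; cbn.
  - rewrite (cunit_id _ HE); apply coh_id.
  - apply coh_tens; [apply coh_id | assumption].
Qed.

Lemma qtfl_ids {F G : Fun} {q : mpath F G} {z w : D} (ms : dpath q z w) :
  coh (qtfl (ids ms)) (tfl ms) (cid (mtot ms)).
Proof.
  induction ms; cbn.
  - apply coh_id.
  - rewrite <- (ctens_id _ HD); apply coh_tens; [apply coh_id | assumption].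
Qed.

(** Evaluation of a single cell, defined for arbitrary boundary arrows because those of a composite
    family are equal, but not identical, to the arrows of the composite transformation. *)
Definition cev {F F' G H : Fun} {p : mpath F F'} {N : Mod G H} {z w : D} {ms : dpath p z w}
    {a : hom (F z) (G z)} {b : hom (F' w) (H w)} (c : cell a b (msrc ms) (mpro N (mtot ms)))
    {x y : E} {f : hom x (F z)} {g : hom y (F' w)} (as_ : qc ms f g) : ent N (a ∘ f) (b ∘ g) :=
  Ent (qsrc as_) (mtot ms) (qfl as_) (qtfl as_) (c ∙ tens as_).

Lemma cev_ids {F F' G H : Fun} {p : mpath F F'} {N : Mod G H} {z w : D} (ms : dpath p z w)
    {a : hom (F z) (G z)} {b : hom (F' w) (H w)} (c : cell a b (msrc ms) (mpro N (mtot ms))) :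
  cev c (ids ms) ≃ Ent (msrc ms) (mtot ms) (mfl ms) (tfl ms) c.
Proof.
  exists (tens (ids ms)), (cid (mtot ms)); split; [apply tens_ids|]; split; [apply qtfl_ids|].
  cbn; rewrite sq_mcell_id, (sq_comp_idl HE); reflexivity.
Qed.

Lemma ev_ids {F F' G H : Fun} {Ms : mpath F F'} {N : Mod G H} {α : trans F G} {β : trans F' H}
    (μ : components Ms N α β) {z w : D} (ms : dpath Ms z w) :
  ev μ (ids ms) ≃ Ent (msrc ms) (mtot ms) (mfl ms) (tfl ms) (μ z w ms).
Proof. exact (cev_ids ms (μ z w ms)). Qed.

Inductive qsim : forall {F G : Fun} {q : mpath F G} {z w : D} {x y : E}
    {ms ms' : dpath q z w} {f f' : hom x (F z)} {g g' : hom y (G w)},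
    qc ms f g -> qc ms' f' g' -> Prop :=
| qs_nil : forall {F : Fun} {z : D} {x : E} {f f' : hom x (F z)}, f = f' ->
    qsim (qnil f) (qnil f')
| qs_cons : forall {F G H : Fun} {M : Mod F G} {q : mpath G H} {z w v : D} {ms ms' : dpath q w v}
    {x y t : E} {f f' : hom x (F z)} {g g' : hom y (G w)} {h h' : hom t (H v)}
    {a : ent M f g} {a' : ent M f' g'} {as_ : qc ms g h} {as' : qc ms' g' h'},
    a ≃ a' -> qsim as_ as' -> qsim (qcons a as_) (qcons a' as').

Lemma qsim_refl {F G : Fun} {q : mpath F G} {z w : D} {ms : dpath q z w} {x y : E}
    {f : hom x (F z)} {g : hom y (G w)} (as_ : qc ms f g) : qsim as_ as_.
Proof. induction as_; constructor; [reflexivity | apply esim_refl | assumption]. Qed.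

(** The part of naturality that all kinds of transformations share.  It makes evaluation compatible with
    [≃]. *)
Definition globular {F F' G H : Fun} {Ms : mpath F F'} {N : Mod G H} {α : trans F G}
    {β : trans F' H} (μ : components Ms N α β) : Prop :=
  forall (z w : D) (ms ns : dpath Ms z w) (γs : dcells ms ns (idh z) (idh w)),
    ⟦mcell N (mtot_cell γs)⟧ ⋆ ⟦μ z w ms⟧
    = ⟦μ z w ns⟧ ⋆ ⟦msrc_cell γs⟧.

(** Related entries are related by globular cells between their indices, to which [globular] applies. *)
Lemma qsim_cells {F G : Fun} {q : mpath F G} {z w : D} {x y : E}
    {ms ms' : dpath q z w} {f f' : hom x (F z)} {g g' : hom y (G w)}
    {as_ : qc ms f g} {as' : qc ms' f' g'} :
  qsim as_ as' ->
  exists (γs : dcells ms ms' (idh z) (idh w)) φ,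
    coh (qfl as_) (qfl as') φ /\ coh (qtfl as_) (qtfl as') (mtot_cell γs) /\
    ⟦msrc_cell γs⟧ ⋆ ⟦tens as_⟧ = ⟦tens as'⟧ ⋆ ⟦φ⟧.
Proof.
  induction 1 as [F z x f f' e | F G H M q z w v ms ms' x y t f f' g g' h h' a a' as_ as'
    (φ & ψ & H1 & H2 & H3) _ (γs & φ' & H1' & H2' & H3')].
  - subst f'; exists (dcnil (idh z)), (cid (punit x)); cbn.
    rewrite (cunit_id _ HD); split; [apply coh_id|]; split; [apply coh_id|].
    rewrite (lhom_id _ (lf_laws _ _ F)), (cunit_id _ HE), (sq_comp_idl HE), (sq_comp_idr HE).
    reflexivity.
  - exists (dccons ψ γs), (φ ⊗ φ'); cbn; split; [exact (coh_tens H1 H1')|].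
    split; [exact (coh_tens H2 H2')|].
    rewrite !sq_tens_comp; apply sq_ctens; assumption.
Qed.

Lemma ev_cong {F F' G H : Fun} {Ms : mpath F F'} {N : Mod G H} {α : trans F G} {β : trans F' H}
    {μ : components Ms N α β} (Hμ : globular μ) {z w : D} {x y : E} {ms ms' : dpath Ms z w}
    {f f' : hom x (F z)} {g g' : hom y (F' w)} {as_ : qc ms f g} {as' : qc ms' f' g'} :
  qsim as_ as' -> ev μ as_ ≃ ev μ as'.
Proof.
  intros K; destruct (qsim_cells K) as (γs & φ & H1 & H2 & H3).
  exists φ, (mtot_cell γs); split; [exact H1|]; split; [exact H2|]; cbn.
  rewrite !to_sq_comp, (sq_comp_assoc HE), Hμ, <- !(sq_comp_assoc HE), H3; reflexivity.
Qed.

(** Absorption of an entry of a functor is a relation, since it changes the path of indices and is not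
    defined for the empty path. *)
Inductive labs : forall {F G : Fun} {q : mpath F G} {z z' w : D} {x x' y : E}
    {ms : dpath q z' w} {ms' : dpath q z w}
    {f : hom x (F z)} {f' : hom x' (F z')} {g : hom y (G w)}
    (p : ent (umod F) f f'), qc ms f' g -> qc ms' f g -> Prop :=
| labs_c : forall {F G H : Fun} {M : Mod F G} {q : mpath G H} {z z' w v : D} {ms : dpath q w v}
    {x x' y t : E} {f : hom x (F z)} {f' : hom x' (F z')} {g : hom y (G w)} {h : hom t (H v)}
    (p : ent (umod F) f f') (a : ent M f' g) (as_ : qc ms g h),
    labs p (qcons a as_) (qcons (lact p a) as_).

(** With no module entries there is nothing to absorb [p]; it can only be placed on either side. *)
Inductive nabs : forall {F G : Fun} {q : mpath F G} {z w z' w' : D} {x y x' y' : E}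
    {ms : dpath q z w} {ms' : dpath q z' w'}
    {f : hom x (F z)} {g : hom x' (F z')} {f' : hom y (G w)} {g' : hom y' (G w')}
    (p : ent (umod F) f g) (p' : ent (umod G) f' g'), qc ms f f' -> qc ms' g g' -> Prop :=
| nabs_c : forall {F : Fun} {z z' : D} {x x' : E} {f : hom x (F z)} {g : hom x' (F z')}
    (p : ent (umod F) f g), nabs p p (qnil f) (qnil g).

(** Composable entries over a path that has a last member by construction, as needed for absorption from
    the right. *)
Inductive nqc : forall {F G : Fun} {q : mpath F G} {z w : D} (ms : npath q z w) {x y : E}
    (f : hom x (F z)) (g : hom y (G w)), Type :=
| nqlast : forall {F G : Fun} {M : Mod F G} {z w : D} {x y : E} {f : hom x (F z)}
    {g : hom y (G w)} (a : ent M f g), nqc (nlast (M := M) (en a)) f g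
| nqcons : forall {F G H : Fun} {M : Mod F G} {q : mpath G H} {z w v : D} {ms : npath q w v}
    {x y t : E} {f : hom x (F z)} {g : hom y (G w)} {h : hom t (H v)} (a : ent M f g),
    nqc ms g h -> nqc (ncons (M := M) (en a) ms) f h.

Fixpoint nqc_qc {F G : Fun} {q : mpath F G} {z w : D} {ms : npath q z w} {x y : E}
    {f : hom x (F z)} {g : hom y (G w)} (as_ : nqc ms f g) : qc (npath_dpath ms) f g :=
  match as_ with
  | @nqlast _ _ _ _ _ _ _ _ g a => qcons a (qnil g)
  | nqcons a as_ => qcons a (nqc_qc as_)
  end.

Fixpoint nqc_snoc {F G : Fun} {q : mpath F G} {z w v : D} {ms : npath q z w} {x y t : E}
    {f : hom x (F z)} {g : hom y (G w)} {h : hom t (G v)} (as_ : nqc ms f g) :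
    forall r : ent (umod G) g h, qc (snoc ms (en r)) f h :=
  match as_ in @nqc F G q z w ms x y f g return
    forall (h : hom t (G v)) (r : ent (umod G) g h), qc (snoc ms (en r)) f h
  with
  | nqlast a => fun h r => qcons (ract a r) (qnil h)
  | nqcons a as_ => fun h r => qcons a (nqc_snoc as_ r)
  end h.

Inductive rabs {F G : Fun} {q : mpath F G} {z w v : D} {x y t : E} {f : hom x (F z)}
    {g : hom y (G w)} {h : hom t (G v)} (r : ent (umod G) g h) :
    forall {ms : dpath q z w} {ms' : dpath q z v}, qc ms f g -> qc ms' f h -> Prop :=
| rabs_c : forall (ns : npath q z w) (as_ : nqc ns f g), rabs r (nqc_qc as_) (nqc_snoc as_ r).

Lemma rabs_last {F G : Fun} {M : Mod F G} {z w v : D} {x y t : E} {f : hom x (F z)}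
    {g : hom y (G w)} {h : hom t (G v)} (a : ent M f g) (r : ent (umod G) g h) :
  rabs r (qcons a (qnil g)) (qcons (ract a r) (qnil h)).
Proof. exact (rabs_c r _ (nqlast a)). Qed.

Lemma rabs_cons {F G H : Fun} {M : Mod F G} {q : mpath G H} {z w v u : D} {x y t s : E}
    {f : hom x (F z)} {g : hom y (G w)} {h : hom t (H v)} {k : hom s (H u)}
    {ms : dpath q w v} {ms' : dpath q w u} (a : ent M f g) (r : ent (umod H) h k)
    {as_ : qc ms g h} {as' : qc ms' g k} :
  rabs r as_ as' -> rabs r (qcons a as_) (qcons a as').
Proof. intros [ns nas]; exact (rabs_c r _ (nqcons a nas)). Qed.

Inductive iqc : forall {F G : Fun} {q : mpath F G} {z w : D} (s : ipath q z w) {x y : E}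
    (f : hom x (F z)) (g : hom y (G w)), Type :=
| iqhere : forall {F G H K : Fun} {M : Mod F G} {M' : Mod G H} {q : mpath H K}
    {z z' w w' v : D} {ms : dpath q w' v} {x y y' t s : E} {f : hom x (F z)} {g : hom y (G z')}
    {g' : hom y' (G w)} {h : hom t (H w')} {k : hom s (K v)}
    (a : ent M f g) (p : ent (umod G) g g') (a' : ent M' g' h),
    qc ms h k -> iqc (ihere (M := M) (M' := M') (en a) (en p) (en a') ms) f k
| iqthere : forall {F G H : Fun} {M : Mod F G} {q : mpath G H} {z w v : D} {s : ipath q w v}
    {x y t : E} {f : hom x (F z)} {g : hom y (G w)} {h : hom t (H v)} (a : ent M f g),
    iqc s g h -> iqc (ithere (M := M) (en a) s) f h.

Fixpoint iqc_l {F G : Fun} {q : mpath F G} {z w : D} {s : ipath q z w} {x y : E}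
    {f : hom x (F z)} {g : hom y (G w)} (as_ : iqc s f g) : qc (absorb_l s) f g :=
  match as_ with
  | iqhere a p a' as_ => qcons (ract a p) (qcons a' as_)
  | iqthere a as_ => qcons a (iqc_l as_)
  end.

Fixpoint iqc_r {F G : Fun} {q : mpath F G} {z w : D} {s : ipath q z w} {x y : E}
    {f : hom x (F z)} {g : hom y (G w)} (as_ : iqc s f g) : qc (absorb_r s) f g :=
  match as_ with
  | iqhere a p a' as_ => qcons a (qcons (lact p a') as_)
  | iqthere a as_ => qcons a (iqc_r as_)
  end.

Inductive iabs {F G : Fun} {q : mpath F G} {z w : D} {x y : E} {f : hom x (F z)}
    {g : hom y (G w)} : forall {ms ms' : dpath q z w}, qc ms f g -> qc ms' f g -> Prop :=
| iabs_c : forall (s : ipath q z w) (as_ : iqc s f g), iabs (iqc_l as_) (iqc_r as_).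

Lemma iabs_cons {F G H : Fun} {M : Mod F G} {q : mpath G H} {z w v : D} {x y t : E}
    {f : hom x (F z)} {g : hom y (G w)} {h : hom t (H v)}
    {ms ms' : dpath q w v} (a : ent M f g) {as_ : qc ms g h} {as' : qc ms' g h} :
  iabs as_ as' -> iabs (qcons a as_) (qcons a as').
Proof. intros [s ias]; exact (iabs_c _ (iqthere a ias)). Qed.

(** * Equivariance on entries *)

Ltac ecbn := cbn [eX en eA eB ec ev lact ract tm vp inj pent tens qsrc ids msrc mtot umod mpro mcell mactl mactr].
Tactic Notation "ecbn" "in" hyp(H) := cbn [eX en eA eB ec ev lact ract tm vp inj pent tens qsrc ids msrc mtot umod mpro mcell mactl mactr] in H.

Section Defs.
Context {F F' G H : Fun} {Ms : mpath F F'} {N : Mod G H} {α : trans F G} {β : trans F' H}.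

(** The equivariance axioms with generic entries replaced by arbitrary ones and without any bracketing.
    The lemmas [left_iff], [right_iff], [inner_iff] and [nullary_iff] show that this is no more than the
    axioms for components. *)
Definition eq_left (μ : components Ms N α β) : Prop :=
  forall (z z' w : D) (x x' y : E) (ms : dpath Ms z' w) (ms' : dpath Ms z w)
    (f : hom x (F z)) (f' : hom x' (F z')) (g : hom y (F' w)) (p : ent (umod F) f f')
    (as_ : qc ms f' g) (as' : qc ms' f g),
  labs p as_ as' -> ev μ as' ≃ lact (tm α p) (ev μ as_).

Definition eq_right (μ : components Ms N α β) : Prop :=
  forall (z w v : D) (x y t : E) (ms : dpath Ms z w) (ms' : dpath Ms z v)
    (f : hom x (F z)) (g : hom y (F' w)) (h : hom t (F' v)) (r : ent (umod F') g h)
    (as_ : qc ms f g) (as' : qc ms' f h),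
  rabs r as_ as' -> ev μ as' ≃ ract (ev μ as_) (tm β r).

Definition eq_nullary (μ : components Ms N α β) : Prop :=
  forall (z w z' w' : D) (x y x' y' : E) (ms : dpath Ms z w) (ms' : dpath Ms z' w')
    (f : hom x (F z)) (g : hom x' (F z')) (f' : hom y (F' w)) (g' : hom y' (F' w'))
    (p : ent (umod F) f g) (p' : ent (umod F') f' g') (as_ : qc ms f f') (as' : qc ms' g g'),
  nabs p p' as_ as' -> lact (tm α p) (ev μ as') ≃ ract (ev μ as_) (tm β p').

Definition eq_inner (μ : components Ms N α β) : Prop :=
  forall (z w : D) (x y : E) (ms ms' : dpath Ms z w) (f : hom x (F z)) (g : hom y (F' w))
    (as_ : qc ms f g) (as' : qc ms' f g),
  iabs as_ as' -> ev μ as_ ≃ ev μ as'.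
End Defs.

(** One direction restricts the axiom along the cells of the entries.  The other specialises to generic
    entries, whose external composite is invertible and can be cancelled. *)
Lemma left_iff {F F' G H : Fun} {Ms : mpath F F'} {N : Mod G H} {α : trans F G} {β : trans F' H}
    (μ : components Ms N α β) : left_equivariant α β μ <-> eq_left μ.
Proof.
  split.
  - intros K z z' w x x' y ms ms' f f' g p as_ as' L; revert α β μ K; destruct L; intros α β μ K.
    pose proof (sq_of_ceq (K _ _ _ _ (en p) (en a) ms)) as K1; clear K; ecbn in K1.
    exists (assoc _ _ (qsrc as_)), (assoc _ _ (mtot ms)); split; [apply coh_assoc|]; split; [apply coh_assoc|].
    ecbn; rewrite !to_sq_comp in K1; rewrite !to_sq_comp; rewrite (gpost_tens_l (mactl M _ _)), !sq_gpost.
    rewrite !(sq_comp_assoc HE).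
    match type of K1 with _ = ?R =>
      transitivity (R ⋆ (⟦assoc (lpro F (en p)) (mpro M (en a)) (msrc ms)⟧ ⋆ ⟦(ec p ⊗ ec a) ⊗ tens as_⟧)) end.
    + rewrite <- K1, <- !(sq_comp_assoc HE); do 3 f_equal.
      rewrite (sq_comp_assoc HE ⟦associ _ _ _⟧), <- sq_gcomp, g_associ_assoc,
        (sq_comp_idl HE); reflexivity.
    + rewrite sq_assoc_nat, <- !(sq_comp_assoc HE), (sq_comp_assoc HE ⟦tpro α _ ⊗ _⟧),
        sq_tens_comp; reflexivity.
  - destruct Ms as [F | F F1 F' M Ms]; intros K; [exact I|].
    intros w x y z p m ms; apply ceq_of_sq.
    destruct (K _ _ _ _ _ _ _ _ _ _ _ _ _ _
      (labs_c (inj (umod F) p) (inj M m) (ids ms))) as (φ & ψ & H1 & H2 & H3).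
    pose proof (coh_unique H1 (coh_assoc (m := lpro F p) (n := mpro M m) (p := qsrc (ids ms)) _ _ _)) as ->.
    pose proof (coh_unique H2 (coh_assoc (m := p) (n := m) (p := mtot ms) _ _ _)) as ->.
    clear H1 H2 K; ecbn in H3.
    rewrite (gpost_tens_l (mactl M _ _)), !sq_gpost, !to_sq_comp, !sq_gpost in H3.
    pose proof (coh_giso (tens_ids ms)) as I.
    apply (sq_epi_eq (giso_comp (giso_tens (giso_cid (lpro F p))
      (giso_tens (giso_cid (mpro M m)) I)) (giso_assoc _ _ _))).
    rewrite !to_sq_comp, sq_gcomp.
    rewrite <- ?(sq_comp_assoc HE) in H3; rewrite <- ?(sq_comp_assoc HE).
    rewrite <- (sq_assoc_nat (cid (lpro F p)) (cid (mpro M m)) (tens (ids ms))).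
    rewrite (sq_comp_assoc HE ⟦associ _ _ _⟧), <- sq_gcomp, g_associ_assoc,
        (sq_comp_idl HE).
    etransitivity; [exact H3|]; f_equal.
    rewrite (sq_assoc_nat (cid (lpro F p)) (cid (mpro M m)) (tens (ids ms))),
      !(sq_comp_assoc HE); f_equal.
    rewrite sq_tens_comp; reflexivity.
Qed.

Lemma snoc_last_tens {F G : lax_functor D E} (M : module F G) {x y t : E} {z w v : D}
    {f : hom x (F z)} {g : hom y (G w)} {h : hom t (G v)} {X : pro x y} {Y : pro y t}
    {m : pro z w} {n : pro w v} (a : cell f g X (mpro M m)) (r : cell g h Y (lpro G n)) :
  ⟦runi (mpro M (m ⊙ n)) • (mactr M m n • (run (mpro M m) ⊗ cid (lpro G n)))⟧ ⋆
    ⟦(a ⊗ cunit g) ⊗ r⟧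
  = ⟦gpost (mactr M m n) (a ⊗ r) ⊗ cunit h⟧ ⋆
      ⟦runi (X ⊙ Y) • (run X ⊗ cid Y)⟧.
Proof.
  rewrite !sq_gcomp, <- !(sq_comp_assoc HE), sq_run_tens.
  rewrite (sq_comp_assoc HE ⟦mactr M _ _⟧), <- sq_gpost,
    (sq_comp_assoc HE ⟦runi _⟧), sq_runi_nat, <- (sq_comp_assoc HE).
  reflexivity.
Qed.

(** The bracketing isomorphisms that occur in the axiom of right equivariance are coherence
    isomorphisms; so they match the flattenings of the entries before and after absorption. *)
Lemma snoc_tens {F G : Fun} {q : mpath F G} {z w v : D} {ns : npath q z w} {x y t : E}
    {f : hom x (F z)} {g : hom y (G w)} {h : hom t (G v)} (nas : nqc ns f g)
    (r : ent (umod G) g h) :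
  exists φ, coh (fl_tens (qfl (nqc_qc nas)) (eA r)) (qfl (nqc_snoc nas r)) φ /\
    coh (fl_tens (qtfl (nqc_qc nas)) (eB r)) (qtfl (nqc_snoc nas r)) (snoc_tot ns (en r)) /\
    ⟦snoc_src ns (en r)⟧ ⋆ ⟦tens (nqc_qc nas) ⊗ ec r⟧
    = ⟦tens (nqc_snoc nas r)⟧ ⋆ ⟦φ⟧.
Proof.
  revert t h r; induction nas as [F G M z w x y f g a | F G H M q z w u ms x y s f g k a nas IH];
    intros t h r.
  - exists (runi (eX a ⊙ eX r) • (run (eX a) ⊗ cid (eX r))); split; [|split].
    + exact (coh_comp (coh_runi _) (coh_tens (coh_run _) (coh_id _))).
    + exact (coh_comp (coh_runi _) (coh_tens (coh_run _) (coh_id _))).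
    + exact (snoc_last_tens M (ec a) (ec r)).
  - destruct (IH t h r) as (φ & H1 & H2 & H3).
    exists ((cid (eX a) ⊗ φ) • assoc (eX a) (qsrc (nqc_qc nas)) (eX r)); split; [|split].
    + exact (coh_comp (coh_tens (coh_id _) H1) (coh_assoc _ _ _)).
    + exact (coh_comp (coh_tens (coh_id _) H2) (coh_assoc _ _ _)).
    + exact (snoc_cons_tens H3).
Qed.

Fixpoint nids {F G : Fun} {q : mpath F G} {z w : D} (ms : npath q z w) :
    nqc ms (idh (F z)) (idh (G w)) :=
  match ms with
  | @nlast _ _ _ _ _ _ M _ _ m => nqlast (inj M m)
  | @ncons _ _ _ _ _ _ _ M _ _ _ _ m ms => nqcons (inj M m) (nids ms)
  end.

Lemma nids_ids {F G : Fun} {q : mpath F G} {z w : D} (ms : npath q z w) :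
  nqc_qc (nids ms) = ids (npath_dpath ms).
Proof.
  induction ms; [reflexivity|]; cbn [nqc_qc nids npath_dpath ids].
  rewrite <- IHms; reflexivity.
Qed.

Lemma right_iff {F F' G H : Fun} {Ms : mpath F F'} {N : Mod G H} {α : trans F G} {β : trans F' H}
    (μ : components Ms N α β) : right_equivariant μ <-> eq_right μ.
Proof.
  split.
  - intros K z w v x y t ms ms' f g h r as_ as' L; destruct L as [ns nas].
    pose proof (sq_of_ceq (K _ _ _ ns (en r))) as K1; clear K.
    destruct (snoc_tens nas r) as (φ & H1 & H2 & H3).
    apply esim_sym; exists φ, (snoc_tot ns (en r)); split; [exact H1|]; split; [exact H2|].
    rewrite !to_sq_comp in K1; ecbn.
    rewrite !to_sq_comp, !sq_gpost, <- !(sq_comp_assoc HE), <- H3, (sq_comp_assoc HE ⟦μ _ _ _⟧), K1.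
    rewrite <- !(sq_comp_assoc HE), sq_tens_comp; reflexivity.
  - intros K x y z ns p; apply ceq_of_sq.
    pose proof (K _ _ _ _ _ _ _ _ _ _ _ (inj (umod F') p) _ _ (rabs_c _ ns (nids ns))) as L.
    destruct (esim_sym L) as (φ & ψ & H1 & H2 & H3); clear L K.
    destruct (snoc_tens (nids ns) (inj (umod F') p)) as (φ' & H1' & H2' & H3').
    pose proof (coh_unique H1 H1') as ->; pose proof (coh_unique H2 H2') as ->.
    clear H1 H1' H2 H2'.
    assert (I : giso (tens (nqc_qc (nids ns)))).
    { rewrite nids_ids; exact (coh_giso (tens_ids _)). }
    apply (sq_epi_eq (giso_tens I (giso_cid (lpro F' p)))).
    ecbn in H3; ecbn in H3'; rewrite !to_sq_comp, sq_gpost in H3.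
    rewrite !to_sq_comp, <- !(sq_comp_assoc HE).
    etransitivity; [exact (sq_comp_cong eq_refl H3')|].
    rewrite <- (sq_comp_assoc HE) in H3; rewrite <- H3.
    rewrite sq_tens_comp; reflexivity.
Qed.

Fixpoint iqsrc {F G : Fun} {q : mpath F G} {z w : D} {s : ipath q z w} {x y : E}
    {f : hom x (F z)} {g : hom y (G w)} (as_ : iqc s f g) : pro x y :=
  match as_ with
  | iqhere a p a' as_ => eX a ⊙ (eX p ⊙ (eX a' ⊙ qsrc as_))
  | iqthere a as_ => eX a ⊙ iqsrc as_
  end.

Fixpoint iqfl {F G : Fun} {q : mpath F G} {z w : D} {s : ipath q z w} {x y : E}
    {f : hom x (F z)} {g : hom y (G w)} (as_ : iqc s f g) : fl (iqsrc as_) :=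
  match as_ with
  | iqhere a p a' as_ => fl_tens (eA a) (fl_tens (eA p) (fl_tens (eA a') (qfl as_)))
  | iqthere a as_ => fl_tens (eA a) (iqfl as_)
  end.

Fixpoint itens {F G : Fun} {q : mpath F G} {z w : D} {s : ipath q z w} {x y : E}
    {f : hom x (F z)} {g : hom y (G w)} (as_ : iqc s f g) : cell f g (iqsrc as_) (isrc s) :=
  match as_ with
  | iqhere a p a' as_ => ec a ⊗ (ec p ⊗ (ec a' ⊗ tens as_))
  | iqthere a as_ => ec a ⊗ itens as_
  end.

Lemma iqc_l_tens {F G : Fun} {q : mpath F G} {z w : D} {s : ipath q z w} {x y : E}
    {f : hom x (F z)} {g : hom y (G w)} (as_ : iqc s f g) :
  exists φ, coh (iqfl as_) (qfl (iqc_l as_)) φ /\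
    ⟦isrc_l s⟧ ⋆ ⟦itens as_⟧ = ⟦tens (iqc_l as_)⟧ ⋆ ⟦φ⟧.
Proof.
  induction as_ as [F G H K M M' q z z' w w' v ms x y y' t u f g g' h k a p a' as_
    | F G H M q z w v s x y t f g h a as_ (φ & H1 & H2)].
  - exists (associ (eX a) (eX p) (eX a' ⊙ qsrc as_)); split; [apply coh_associ|].
    exact (absorb_tens (ec a) (ec p) (ec a' ⊗ tens as_) (mactr M (en a) (en p))).
  - exists (cid (eX a) ⊗ φ); split; [exact (coh_tens (coh_id _) H1)|].
    exact (cid_tens_square H2).
Qed.

Lemma iqc_r_tens {F G : Fun} {q : mpath F G} {z w : D} {s : ipath q z w} {x y : E}
    {f : hom x (F z)} {g : hom y (G w)} (as_ : iqc s f g) :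
  exists φ, coh (iqfl as_) (qfl (iqc_r as_)) φ /\
    ⟦isrc_r s⟧ ⋆ ⟦itens as_⟧ = ⟦tens (iqc_r as_)⟧ ⋆ ⟦φ⟧.
Proof.
  induction as_ as [F G H K M M' q z z' w w' v ms x y y' t u f g g' h k a p a' as_
    | F G H M q z w v s x y t f g h a as_ (φ & H1 & H2)].
  - exists (cid (eX a) ⊗ associ (eX p) (eX a') (qsrc as_)); split.
    { exact (coh_tens (coh_id _) (coh_associ _ _ _)). }
    exact (cid_tens_square (absorb_tens (ec p) (ec a') (tens as_) (mactl M' (en p) (en a')))).
  - exists (cid (eX a) ⊗ φ); split; [exact (coh_tens (coh_id _) H1)|].
    exact (cid_tens_square H2).
Qed.

Lemma itot_coh {F G : Fun} {q : mpath F G} {z w : D} {s : ipath q z w} {x y : E}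
    {f : hom x (F z)} {g : hom y (G w)} (as_ : iqc s f g) :
  coh (qtfl (iqc_l as_)) (qtfl (iqc_r as_)) (itot s).
Proof.
  induction as_ as [F G H K M M' q z z' w w' v ms x y y' t u f g g' h k a p a' as_
    | F G H M q z w v s x y t f g h a as_ IH].
  - exact (coh_comp (coh_tens (coh_id _) (coh_associ _ _ _)) (coh_assoc _ _ _)).
  - exact (coh_tens (coh_id _) IH).
Qed.

Fixpoint iids {F G : Fun} {q : mpath F G} {z w : D} (s : ipath q z w) :
    iqc s (idh (F z)) (idh (G w)) :=
  match s with
  | @ihere _ _ _ _ _ G _ _ M M' _ _ _ _ _ _ m p m' ms =>
      iqhere (inj M m) (inj (umod G) p) (inj M' m') (ids ms)
  | @ithere _ _ _ _ _ _ _ M _ _ _ _ m s => iqthere (inj M m) (iids s)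
  end.

Lemma itens_iso {F G : Fun} {q : mpath F G} {z w : D} (s : ipath q z w) : giso (itens (iids s)).
Proof.
  induction s; cbn [itens iids isrc]; ecbn.
  - repeat apply giso_tens; try apply giso_cid; exact (coh_giso (tens_ids _)).
  - apply giso_tens; [apply giso_cid | assumption].
Qed.

Lemma inner_iff {F F' G H : Fun} {Ms : mpath F F'} {N : Mod G H} {α : trans F G} {β : trans F' H}
    (μ : components Ms N α β) : inner_equivariant μ <-> eq_inner μ.
Proof.
  split.
  - intros K z w x y ms ms' f g as_ as' L; destruct L as [s ias].
    pose proof (sq_of_ceq (K _ _ s)) as K1; clear K.
    destruct (iqc_l_tens ias) as (φ & H1 & H2), (iqc_r_tens ias) as (φ' & H1' & H2').
    destruct (coh_inv H1) as (χ & X1 & X2 & X3).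
    exists (φ' • χ), (itot s); split; [exact (coh_comp H1' X1)|]; split; [apply itot_coh|].
    apply (sq_epi (coh_giso H1)); ecbn.
    rewrite !to_sq_comp in K1; rewrite !to_sq_comp.
    rewrite sq_gcomp, <- !(sq_comp_assoc HE), <- H2, <- (sq_gcomp χ), X2, (sq_comp_idr HE), <- H2'.
    rewrite !(sq_comp_assoc HE), K1; reflexivity.
  - intros K x y s; apply ceq_of_sq.
    destruct (K _ _ _ _ _ _ _ _ _ _ (iabs_c s (iids s))) as (φ & ψ & H1 & H2 & H3); clear K.
    pose proof (coh_unique H2 (itot_coh (iids s))) as ->; clear H2.
    destruct (iqc_l_tens (iids s)) as (χ & L1 & L2), (iqc_r_tens (iids s)) as (χ' & L1' & L2').
    pose proof (coh_unique (coh_comp H1 L1) L1') as E1; clear H1 L1 L1'.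
    apply (sq_epi_eq (itens_iso s)).
    ecbn in H3; rewrite !to_sq_comp in H3; rewrite !to_sq_comp.
    rewrite <- !(sq_comp_assoc HE), L2, L2', <- E1, sq_gcomp, !(sq_comp_assoc HE).
    f_equal; rewrite <- !(sq_comp_assoc HE); rewrite <- (sq_comp_assoc HE) in H3; exact H3.
Qed.

(** The unitors around the external composite can be moved to the restricting cell, where they become part
    of the coherence isomorphism between the two sides. *)
Lemma nullary_square {F G H : lax_functor D E} {N : module G H} {z w : D} {p : pro z w}
    {a : hom (F z) (G z)} {a' : hom (F w) (G w)} {b : hom (F z) (H z)} {b' : hom (F w) (H w)}
    {tp : cell a a' (lpro F p) (lpro G p)} {tq : cell b b' (lpro F p) (lpro H p)}
    {μ : cell a b (punit (F z)) (mpro N (punit z))}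
    {μ' : cell a' b' (punit (F w)) (mpro N (punit w))}
    {x y : E} {f : hom x (F z)} {g : hom y (F w)} {X : pro x y} (c : cell f g X (lpro F p)) :
  ((⟦mcell N (run p)⟧ ⋆ ⟦mactl N p (punit w)⟧) ⋆
    ⟦tp ⊗ μ'⟧) ⋆ ⟦runi (lpro F p)⟧
  = ((⟦mcell N (lun p)⟧ ⋆ ⟦mactr N (punit z) p⟧) ⋆
    ⟦μ ⊗ tq⟧) ⋆ ⟦luni (lpro F p)⟧ ->
  ⟦mcell N (luni p • run p)⟧ ⋆
    ⟦gpost (mactl N p (punit w)) ((tp ∙ c) ⊗ (μ' ∙ cunit g))⟧
  = ⟦gpost (mactr N (punit z) p) ((μ ∙ cunit f) ⊗ (tq ∙ c))⟧ ⋆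
      ⟦luni X • run X⟧.
Proof.
  intros K.
  apply (sq_epi (giso_runi X)).
  rewrite sq_mcell_gcomp, sq_gcomp, !sq_gpost, <- !(sq_comp_assoc HE), <- (sq_gcomp (run _)),
    g_run_runi, (sq_comp_idr HE), <- !(sq_tens_comp c (cunit g)),
    <- !(sq_tens_comp (cunit f) c), <- !(sq_comp_assoc HE), <- sq_runi_nat, <- sq_luni_nat.
  assert (K' : forall t : sq X (lpro F p),
    ⟦mcell N (run p)⟧ ⋆ (⟦mactl N p (punit w)⟧ ⋆
      (⟦tp ⊗ μ'⟧ ⋆ (⟦runi (lpro F p)⟧ ⋆ t)))
    = ⟦mcell N (lun p)⟧ ⋆ (⟦mactr N (punit z) p⟧ ⋆
      (⟦μ ⊗ tq⟧ ⋆ (⟦luni (lpro F p)⟧ ⋆ t)))).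
  { intros t; rewrite !(sq_comp_assoc HE), K; reflexivity. }
  rewrite K', (sq_comp_assoc HE ⟦mcell N (luni _)⟧), <- sq_mcell_gcomp, g_luni_lun,
    sq_mcell_id, (sq_comp_idl HE); reflexivity.
Qed.

Lemma nullary_square_conv {F G H : lax_functor D E} {N : module G H} {z w : D} {p : pro z w}
    {a : hom (F z) (G z)} {a' : hom (F w) (G w)} {b : hom (F z) (H z)} {b' : hom (F w) (H w)}
    {tp : cell a a' (lpro F p) (lpro G p)} {tq : cell b b' (lpro F p) (lpro H p)}
    {μ : cell a b (punit (F z)) (mpro N (punit z))}
    {μ' : cell a' b' (punit (F w)) (mpro N (punit w))} :
  ⟦mcell N (luni p • run p)⟧ ⋆
    ⟦gpost (mactl N p (punit w)) ((tp ∙ cid (lpro F p)) ⊗ (μ' ∙ cunit (idh (F w))))⟧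
  = ⟦gpost (mactr N (punit z) p) ((μ ∙ cunit (idh (F z))) ⊗ (tq ∙ cid (lpro F p)))⟧ ⋆
      ⟦luni (lpro F p) • run (lpro F p)⟧ ->
  ((⟦mcell N (run p)⟧ ⋆ ⟦mactl N p (punit w)⟧) ⋆
    ⟦tp ⊗ μ'⟧) ⋆ ⟦runi (lpro F p)⟧
  = ((⟦mcell N (lun p)⟧ ⋆ ⟦mactr N (punit z) p⟧) ⋆
    ⟦μ ⊗ tq⟧) ⋆ ⟦luni (lpro F p)⟧.
Proof.
  rewrite !(cunit_id _ HE), sq_mcell_gcomp, sq_gcomp, !sq_gpost.
  rewrite <- !(sq_tens_comp (cid _) (cid _)), !(ctens_id _ HE), !(sq_comp_idr HE).
  intros K.
  apply (sq_epi_eq (giso_run (lpro F p))).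
  rewrite <- !(sq_comp_assoc HE), <- (sq_gcomp (runi _)), g_runi_run, (sq_comp_idr HE).
  rewrite <- !(sq_comp_assoc HE) in K.
  rewrite <- K, (sq_comp_assoc HE ⟦mcell N (lun p)⟧), <- sq_mcell_gcomp, g_lun_luni,
    sq_mcell_id, (sq_comp_idl HE); reflexivity.
Qed.

Lemma nullary_iff {F F' G H : Fun} {Ms : mpath F F'} {N : Mod G H} {α : trans F G} {β : trans F' H}
    (μ : components Ms N α β) : nullary_equivariant α β μ <-> eq_nullary μ.
Proof.
  split.
  - intros K z w z' w' x y x' y' ms ms' f g f' g' p p' as_ as' L; revert α β μ K.
    destruct L as [F z z' x x' f g p]; intros α β μ K.
    pose proof (sq_of_ceq (K _ _ (en p))) as K1; clear K.
    exists (luni (eX p) • run (eX p)), (luni (en p) • run (en p)).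
    split; [exact (coh_comp (coh_luni _) (coh_run _))|].
    split; [exact (coh_comp (coh_luni _) (coh_run _))|].
    rewrite !to_sq_comp in K1; exact (nullary_square (ec p) K1).
  - destruct Ms as [F | F F1 F' M Ms]; intros K; [|exact I].
    intros x y p; apply ceq_of_sq.
    destruct (K _ _ _ _ _ _ _ _ _ _ _ _ _ _ _ _ _ _ (nabs_c (inj (umod F) p)))
      as (φ & ψ & H1 & H2 & H3); clear K.
    pose proof (coh_unique H1 (coh_comp (coh_luni (m := lpro F p) _) (coh_run _))) as ->.
    pose proof (coh_unique H2 (coh_comp (coh_luni (m := p) _) (coh_run _))) as ->; clear H1 H2.
    rewrite !to_sq_comp; exact (nullary_square_conv H3).
Qed.

(** * Naturality on entries *)

(** A relation, since the presentations of the new indices are not determined by the cells. *)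
Inductive vqc : forall {F G : Fun} {q : mpath F G} {z w z' w' : D} {x y : E}
    {ms : dpath q z w} {ns : dpath q z' w'} {u : hom z z'} {v : hom w w'}
    {f : hom x (F z)} {g : hom y (G w)}, qc ms f g -> dcells ms ns u v ->
    qc ns (lhom F u ∘ f) (lhom G v ∘ g) -> Prop :=
| vq_nil : forall {F : Fun} {z z' : D} {x : E} (f : hom x (F z)) (u : hom z z'),
    vqc (qnil f) (dcnil u) (qnil (lhom F u ∘ f))
| vq_cons : forall {F G H : Fun} {M : Mod F G} {q : mpath G H} {z w v z' w' v' : D} {x y t : E}
    {ms : dpath q w v} {ns : dpath q w' v'} {c : hom z z'} {d : hom w w'} {e : hom v v'}
    {f : hom x (F z)} {g : hom y (G w)} {h : hom t (H v)} (a : ent M f g) {as_ : qc ms g h}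
    {γs : dcells ms ns d e} {as' : qc ns (lhom G d ∘ g) (lhom H e ∘ h)}
    {n : pro z' w'} (B : fl n) (γ : cell c d (en a) n),
    vqc as_ γs as' -> vqc (qcons a as_) (dccons γ γs) (qcons (vp a B γ) as').

Lemma vqc_tens {F G : Fun} {q : mpath F G} {z w z' w' : D} {x y : E}
    {ms : dpath q z w} {ns : dpath q z' w'} {u : hom z z'} {v : hom w w'}
    {f : hom x (F z)} {g : hom y (G w)} {as_ : qc ms f g} {γs : dcells ms ns u v}
    {as' : qc ns (lhom F u ∘ f) (lhom G v ∘ g)} :
  vqc as_ γs as' -> exists φ, coh (qfl as_) (qfl as') φ /\
    ⟦msrc_cell γs⟧ ⋆ ⟦tens as_⟧ = ⟦tens as'⟧ ⋆ ⟦φ⟧.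
Proof.
  induction 1 as [F z z' x f u | F G H M q z w v z' w' v' x y t ms ns c d e f g h a as_ γs as' n B γ
    _ (φ & H1 & H2)].
  - exists (cid (punit x)); split; [apply coh_id|]; cbn.
    rewrite (sq_comp_idr HE), <- to_sq_comp, <- (cunit_comp _ HE); reflexivity.
  - exists (cid (eX a) ⊗ φ); split; [exact (coh_tens (coh_id _) H1)|]; cbn.
    rewrite !sq_tens_comp; apply sq_ctens; [|exact H2].
    symmetry; rewrite to_sq_comp; apply (sq_comp_idr HE).
Qed.

Lemma vqc_ids {F G : Fun} {q : mpath F G} {z w z' w' : D} {ms : dpath q z w} {ns : dpath q z' w'}
    {u : hom z z'} {v : hom w w'} (γs : dcells ms ns u v) : exists as', vqc (ids ms) γs as'.
Proof.
  induction γs as [F z z' u | F G H M q z w v z' w' v' m m' ms ns c d e γ γs [as' IH]].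
  - eexists; apply vq_nil.
  - exact (ex_intro _ _ (vq_cons (inj M m) (fl_atom m') γ IH)).
Qed.

Section Lax.
Context {F F' G H : Fun} {Ms : mpath F F'} {N : Mod G H} {α : lax_trans F G} {β : lax_trans F' H}
  (μ : components Ms N α β).

Definition laxnat_at {z w z' w' : D} {ms : dpath Ms z w} {ns : dpath Ms z' w'}
    {u : hom z z'} {v : hom w w'} (γs : dcells ms ns u v) : Prop :=
  mpaste_r N (mcell N (mtot_cell γs) ∙ μ _ _ ms) (lt_cmp β v)
  ≈ mpaste_l N (lt_cmp α u) (μ _ _ ns ∙ msrc_cell γs).

Definition laxnat_ent {z w z' w' : D} {ms : dpath Ms z w} {ns : dpath Ms z' w'}
    {u : hom z z'} {v : hom w w'} (γs : dcells ms ns u v) {x y : E} {f : hom x (F z)}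
    {g : hom y (F' w)} (as_ : qc ms f g) (as' : qc ns (lhom F u ∘ f) (lhom F' v ∘ g)) : Prop :=
  ract (vp (ev μ as_) (qtfl as') (mtot_cell γs)) (cmL β v g) ≃ lact (cmL α u f) (ev μ as').

(** Both pastings are actions of comparison entries ([mpaste_r_esim], [mpaste_l_esim]), so the axiom is an
    equation of entries at the components; restrict it along the external composite of the entries. *)
Lemma laxnat_to {z w z' w' : D} {ms : dpath Ms z w} {ns : dpath Ms z' w'}
    {u : hom z z'} {v : hom w w'} {γs : dcells ms ns u v} {x y : E} {f : hom x (F z)}
    {g : hom y (F' w)} {as_ : qc ms f g} {as' : qc ns (lhom F u ∘ f) (lhom F' v ∘ g)} :
  laxnat_at γs -> vqc as_ γs as' -> laxnat_ent γs as_ as'.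
Proof.
  intros K V; destruct (vqc_tens V) as (φ & V1 & V2).
  pose proof (esim_trans (esim_sym (mpaste_r_esim (fl_atom _) (qtfl as') _ _))
    (esim_trans (esim_of_sq (A := fl_atom _) (B := qtfl as') (sq_of_ceq K))
      (mpaste_l_esim (fl_atom _) (qtfl as') _ _))) as L; clear K.
  apply (restrict_rl (qfl as_) (tens as_)) in L.
  refine (esim_trans (ract_cong _ (cml_esim _ _ v g)) (esim_trans L
    (lact_cong (esim_sym (cml_esim _ _ u f)) _))).
  - apply esim_of_sq; cbn; rewrite !to_sq_comp, !(sq_comp_assoc HE); reflexivity.
  - exists φ, (cid (mtot ns)); split; [exact V1|]; split; [apply coh_id|]; cbn.
    rewrite sq_mcell_id, (sq_comp_idl HE), !to_sq_comp, <- !(sq_comp_assoc HE), V2; reflexivity.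
Qed.

(** Restriction along the external composite of generic entries is invertible. *)
Lemma laxnat_from {z w z' w' : D} {ms : dpath Ms z w} {ns : dpath Ms z' w'}
    {u : hom z z'} {v : hom w w'} {γs : dcells ms ns u v} 
    {as_ : qc ms (idh (F z)) (idh (F' w))} {as' : qc ns (lhom F u ∘ idh (F z)) (lhom F' v ∘ idh (F' w))} :
  giso (tens as_) -> vqc as_ γs as' -> laxnat_ent γs as_ as' -> laxnat_at γs.
Proof.
  intros (j & J1 & J2) V K; destruct (vqc_tens V) as (φ & V1 & V2).
  assert (L : ract (Ent (qsrc as_) (mtot ns) (qfl as_) (qtfl as')
      (gpre (mcell N (mtot_cell γs) ∙ μ _ _ ms) (tens as_))) (pent (lt_cmp β v)) ≃
    lact (pent (lt_cmp α u)) (Ent (qsrc as_) (mtot ns) (qfl as_) (qtfl as')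
      (gpre (μ _ _ ns ∙ msrc_cell γs) (tens as_)))).
  { refine (esim_trans (ract_cong _ (cml_id _ (fun x y f => lt_cmp β f) v)) (esim_trans K
      (lact_cong (esim_sym (cml_id _ (fun x y f => lt_cmp α f) u)) (esim_sym _)))).
    - apply esim_of_sq; cbn; rewrite sq_gpre, !to_sq_comp, (sq_comp_assoc HE); reflexivity.
    - exists φ, (cid (mtot ns)); split; [exact V1|]; split; [apply coh_id|]; cbn.
      rewrite sq_mcell_id, (sq_comp_idl HE), sq_gpre, !to_sq_comp, <- !(sq_comp_assoc HE), V2; reflexivity. }
  clear K; apply (restrict_rl (mfl ms) j) in L.
  apply ceq_of_sq; refine (esim_sq (A := mfl ms) (B := qtfl as')
    (esim_trans (mpaste_r_esim _ _ _ _) (esim_trans (esim_trans (ract_cong _ _)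
      (esim_trans L (lact_cong _ _))) (esim_sym (mpaste_l_esim _ _ _ _)))));
    apply esim_of_sq; cbn; rewrite !to_sq_comp.
  - rewrite sq_gpre, !to_sq_comp, <- !(sq_comp_assoc HE), <- sq_gcomp, J2, (sq_comp_idr HE); reflexivity.
  - rewrite (cunit_id _ HE), (sq_comp_idr HE); reflexivity.
  - rewrite (cunit_id _ HE), (sq_comp_idr HE); reflexivity.
  - rewrite sq_gpre, !to_sq_comp, <- !(sq_comp_assoc HE), <- sq_gcomp, J2, (sq_comp_idr HE); reflexivity.
Qed.

Lemma lt_cmp_one {F1 G1 : lax_functor D E} (δ : lax_trans F1 G1) (z : D) :
  pent (lt_cmp δ (idh z)) ≃ one G1 (δ z).
Proof. exact (esim_trans (pent_of_sq (sq_of_ceq (lt_cmp_id _ _ δ z))) (esim_sym (one_cell _))). Qed.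

(** At identity arrows the comparison entries are trivial. *)
Lemma laxnat_globular : lax_natural α β μ -> globular μ.
Proof.
  intros K z w ms ns γs.
  pose proof (K _ _ _ _ ms ns (idh z) (idh w) γs) as K1; clear K.
  pose proof (esim_trans (esim_sym (mpaste_r_esim (mfl ms) (tfl ns) _ _))
    (esim_trans (esim_of_sq (A := mfl ms) (B := tfl ns) (sq_of_ceq K1))
      (mpaste_l_esim (mfl ms) (tfl ns) _ _))) as L; clear K1.
  rewrite <- !to_sq_comp; apply (esim_sq (A := mfl ms) (B := tfl ns)).
  refine (esim_trans (esim_sym (ract_unit _ (lt_cmp_one β w))) (esim_trans L _)).
  exact (lact_unit _ (lt_cmp_one α z)).
Qed.
End Lax.

Section Oplax.
Context {F F' G H : Fun} {Ms : mpath F F'} {N : Mod G H} {α : oplax_trans F G} {β : oplax_trans F' H}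
  (μ : components Ms N α β).

Definition oplaxnat_at {z w z' w' : D} {ms : dpath Ms z w} {ns : dpath Ms z' w'}
    {u : hom z z'} {v : hom w w'} (γs : dcells ms ns u v) : Prop :=
  mpaste_l N (ot_cmp α u) (mcell N (mtot_cell γs) ∙ μ _ _ ms)
  ≈ mpaste_r N (μ _ _ ns ∙ msrc_cell γs) (ot_cmp β v).

Definition oplaxnat_ent {z w z' w' : D} {ms : dpath Ms z w} {ns : dpath Ms z' w'}
    {u : hom z z'} {v : hom w w'} (γs : dcells ms ns u v) {x y : E} {f : hom x (F z)}
    {g : hom y (F' w)} (as_ : qc ms f g) (as' : qc ns (lhom F u ∘ f) (lhom F' v ∘ g)) : Prop :=
  lact (cmO α u f) (vp (ev μ as_) (qtfl as') (mtot_cell γs)) ≃ ract (ev μ as') (cmO β v g).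

Lemma oplaxnat_to {z w z' w' : D} {ms : dpath Ms z w} {ns : dpath Ms z' w'}
    {u : hom z z'} {v : hom w w'} {γs : dcells ms ns u v} {x y : E} {f : hom x (F z)}
    {g : hom y (F' w)} {as_ : qc ms f g} {as' : qc ns (lhom F u ∘ f) (lhom F' v ∘ g)} :
  oplaxnat_at γs -> vqc as_ γs as' -> oplaxnat_ent γs as_ as'.
Proof.
  intros K V; destruct (vqc_tens V) as (φ & V1 & V2).
  pose proof (esim_trans (esim_sym (mpaste_l_esim (fl_atom _) (qtfl as') _ _))
    (esim_trans (esim_of_sq (A := fl_atom _) (B := qtfl as') (sq_of_ceq K))
      (mpaste_r_esim (fl_atom _) (qtfl as') _ _))) as L; clear K.
  apply (restrict_lr (qfl as_) (tens as_)) in L.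
  refine (esim_trans (lact_cong (cmo_esim _ _ u f) _) (esim_trans L
    (ract_cong _ (esim_sym (cmo_esim _ _ v g))))).
  - apply esim_of_sq; cbn; rewrite !to_sq_comp, !(sq_comp_assoc HE); reflexivity.
  - exists φ, (cid (mtot ns)); split; [exact V1|]; split; [apply coh_id|]; cbn.
    rewrite sq_mcell_id, (sq_comp_idl HE), !to_sq_comp, <- !(sq_comp_assoc HE), V2; reflexivity.
Qed.

Lemma oplaxnat_from {z w z' w' : D} {ms : dpath Ms z w} {ns : dpath Ms z' w'}
    {u : hom z z'} {v : hom w w'} {γs : dcells ms ns u v} 
    {as_ : qc ms (idh (F z)) (idh (F' w))} {as' : qc ns (lhom F u ∘ idh (F z)) (lhom F' v ∘ idh (F' w))} :
  giso (tens as_) -> vqc as_ γs as' -> oplaxnat_ent γs as_ as' -> oplaxnat_at γs.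
Proof.
  intros (j & J1 & J2) V K; destruct (vqc_tens V) as (φ & V1 & V2).
  assert (L : lact (pent (ot_cmp α u)) (Ent (qsrc as_) (mtot ns) (qfl as_) (qtfl as')
      (gpre (mcell N (mtot_cell γs) ∙ μ _ _ ms) (tens as_)))  ≃
    ract (Ent (qsrc as_) (mtot ns) (qfl as_) (qtfl as')
      (gpre (μ _ _ ns ∙ msrc_cell γs) (tens as_))) (pent (ot_cmp β v))).
  { refine (esim_trans (lact_cong (cmo_id _ (fun x y f => ot_cmp α f) u) _) (esim_trans K
      (ract_cong (esim_sym _) (esim_sym (cmo_id _ (fun x y f => ot_cmp β f) v))))).
    - apply esim_of_sq; cbn; rewrite sq_gpre, !to_sq_comp, (sq_comp_assoc HE); reflexivity.
    - exists φ, (cid (mtot ns)); split; [exact V1|]; split; [apply coh_id|]; cbn.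
      rewrite sq_mcell_id, (sq_comp_idl HE), sq_gpre, !to_sq_comp, <- !(sq_comp_assoc HE), V2; reflexivity. }
  clear K; apply (restrict_lr (mfl ms) j) in L.
  apply ceq_of_sq; refine (esim_sq (A := mfl ms) (B := qtfl as')
    (esim_trans (mpaste_l_esim _ _ _ _) (esim_trans (esim_trans (lact_cong _ _)
      (esim_trans L (ract_cong _ _))) (esim_sym (mpaste_r_esim _ _ _ _)))));
    apply esim_of_sq; cbn; rewrite !to_sq_comp.
  - rewrite (cunit_id _ HE), (sq_comp_idr HE); reflexivity.
  - rewrite sq_gpre, !to_sq_comp, <- !(sq_comp_assoc HE), <- sq_gcomp, J2, (sq_comp_idr HE); reflexivity.
  - rewrite sq_gpre, !to_sq_comp, <- !(sq_comp_assoc HE), <- sq_gcomp, J2, (sq_comp_idr HE); reflexivity.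
  - rewrite (cunit_id _ HE), (sq_comp_idr HE); reflexivity.
Qed.

Lemma ot_cmp_one {F1 G1 : lax_functor D E} (δ : oplax_trans F1 G1) (z : D) :
  pent (ot_cmp δ (idh z)) ≃ one G1 (δ z).
Proof. exact (esim_trans (pent_of_sq (sq_of_ceq (ot_cmp_id _ _ δ z))) (esim_sym (one_cell _))). Qed.

Lemma oplaxnat_globular : oplax_natural α β μ -> globular μ.
Proof.
  intros K z w ms ns γs.
  pose proof (K _ _ _ _ ms ns (idh z) (idh w) γs) as K1; clear K.
  pose proof (esim_trans (esim_sym (mpaste_l_esim (mfl ms) (tfl ns) _ _))
    (esim_trans (esim_of_sq (A := mfl ms) (B := tfl ns) (sq_of_ceq K1))
      (mpaste_r_esim (mfl ms) (tfl ns) _ _))) as L; clear K1.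
  rewrite <- !to_sq_comp; apply (esim_sq (A := mfl ms) (B := tfl ns)).
  refine (esim_trans (esim_sym (lact_unit _ (ot_cmp_one α z))) (esim_trans L _)).
  exact (ract_unit _ (ot_cmp_one β w)).
Qed.
End Oplax.

(** * Words *)

(** What inner equivariance and [≃] generate on entries without a functor entry in between. *)
Inductive sim {F G : Fun} {q : mpath F G} {z w : D} {x y : E} {f : hom x (F z)} {g : hom y (G w)} :
    forall {ms ms' : dpath q z w}, qc ms f g -> qc ms' f g -> Prop :=
| sim_q : forall {ms ms' : dpath q z w} {as_ : qc ms f g} {as' : qc ms' f g},
    qsim as_ as' -> sim as_ as'
| sim_i : forall {ms ms' : dpath q z w} {as_ : qc ms f g} {as' : qc ms' f g},
    iabs as_ as' -> sim as_ as'
| sim_sym : forall {ms ms' : dpath q z w} {as_ : qc ms f g} {as' : qc ms' f g},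
    sim as_ as' -> sim as' as_
| sim_trans : forall {ms ms' ms'' : dpath q z w} {as_ : qc ms f g} {as' : qc ms' f g}
    {as'' : qc ms'' f g}, sim as_ as' -> sim as' as'' -> sim as_ as''.

Lemma sim_refl {F G : Fun} {q : mpath F G} {z w : D} {x y : E} {f : hom x (F z)}
    {g : hom y (G w)} {ms : dpath q z w} (as_ : qc ms f g) : sim as_ as_.
Proof. apply sim_q, qsim_refl. Qed.

Lemma sim_cons {F G H : Fun} {M : Mod F G} {q : mpath G H} {z w v : D} {x y t : E}
    {f : hom x (F z)} {g : hom y (G w)} {h : hom t (H v)} {ms ms' : dpath q w v}
    {a a' : ent M f g} {as_ : qc ms g h} {as' : qc ms' g h} :
  a ≃ a' -> sim as_ as' -> sim (qcons a as_) (qcons a' as').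
Proof.
  intros Ha Hs; apply (sim_trans (as' := qcons a as')).
  - clear a' Ha; induction Hs.
    + apply sim_q; constructor; [apply esim_refl | assumption].
    + apply sim_i, iabs_cons; assumption.
    + apply sim_sym; assumption.
    + eapply sim_trans; eassumption.
  - apply sim_q; constructor; [assumption | apply qsim_refl].
Qed.

Lemma ev_sim {F F' G H : Fun} {Ms : mpath F F'} {N : Mod G H} {α : trans F G} {β : trans F' H}
    {μ : components Ms N α β} (Hμ : globular μ) (Hi : eq_inner μ) {z w : D} {x y : E}
    {ms ms' : dpath Ms z w} {f : hom x (F z)} {g : hom y (F' w)}
    {as_ : qc ms f g} {as' : qc ms' f g} : sim as_ as' -> ev μ as_ ≃ ev μ as'.
Proof.
  induction 1.
  - apply ev_cong; assumption.
  - apply Hi; assumption.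
  - apply esim_sym; assumption.
  - eapply esim_trans; eassumption.
Qed.

(** Module entries with entries of functors interspersed.  Unlike composable entries, words are closed
    under inserting an entry of a functor at any place, and no choice of neighbour has to be made. *)
Inductive word : forall {F G : Fun} (q : mpath F G) {z w : D} {x y : E}
    (f : hom x (F z)) (g : hom y (G w)), Type :=
| wnil : forall {F : Fun} {z : D} {x : E} (f : hom x (F z)), word (pnil F) f f
| wfun : forall {F G : Fun} {q : mpath F G} {z z' w : D} {x x' y : E} {f : hom x (F z)}
    {f' : hom x' (F z')} {g : hom y (G w)} (p : ent (umod F) f f'), word q f' g -> word q f g
| wmod : forall {F G H : Fun} {M : Mod F G} {q : mpath G H} {z w v : D} {x y t : E}
    {f : hom x (F z)} {g : hom y (G w)} {h : hom t (H v)} (a : ent M f g),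
    word q g h -> word (pcons M q) f h.

(** The relation of an iterated tensor product: words modulo [wsim] are the elements of the tensor product
    of the modules over the functors between them, and multimodulations are maps out of it. *)
Inductive wsim : forall {F G : Fun} {q : mpath F G} {z w : D} {x y : E}
    {f : hom x (F z)} {g : hom y (G w)}, word q f g -> word q f g -> Prop :=
| ws_refl : forall {F G : Fun} {q : mpath F G} {z w : D} {x y : E} {f : hom x (F z)}
    {g : hom y (G w)} (u : word q f g), wsim u u
| ws_sym : forall {F G : Fun} {q : mpath F G} {z w : D} {x y : E} {f : hom x (F z)}
    {g : hom y (G w)} {u v : word q f g}, wsim u v -> wsim v u
| ws_trans : forall {F G : Fun} {q : mpath F G} {z w : D} {x y : E} {f : hom x (F z)}
    {g : hom y (G w)} {u v s : word q f g}, wsim u v -> wsim v s -> wsim u s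
| ws_fun : forall {F G : Fun} {q : mpath F G} {z z' w : D} {x x' y : E} {f : hom x (F z)}
    {f' : hom x' (F z')} {g : hom y (G w)} {p p' : ent (umod F) f f'} {u v : word q f' g},
    p ≃ p' -> wsim u v -> wsim (wfun p u) (wfun p' v)
| ws_mod : forall {F G H : Fun} {M : Mod F G} {q : mpath G H} {z w v : D} {x y t : E}
    {f : hom x (F z)} {g : hom y (G w)} {h : hom t (H v)} {a a' : ent M f g} {r s : word q g h},
    a ≃ a' -> wsim r s -> wsim (wmod a r) (wmod a' s)
| ws_ff : forall {F G : Fun} {q : mpath F G} {z z' z'' w : D} {x x' x'' y : E} {f : hom x (F z)}
    {f' : hom x' (F z')} {f'' : hom x'' (F z'')} {g : hom y (G w)} (p : ent (umod F) f f')
    (p' : ent (umod F) f' f'') (u : word q f'' g),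
    wsim (wfun p (wfun p' u)) (wfun (lact p p') u)
| ws_one : forall {F G : Fun} {q : mpath F G} {z w : D} {x y : E} {f : hom x (F z)}
    {g : hom y (G w)} (u : word q f g), wsim (wfun (one F f) u) u
| ws_fm : forall {F G H : Fun} {M : Mod F G} {q : mpath G H} {z z' w v : D} {x x' y t : E}
    {f : hom x (F z)} {f' : hom x' (F z')} {g : hom y (G w)} {h : hom t (H v)}
    (p : ent (umod F) f f') (a : ent M f' g) (u : word q g h),
    wsim (wfun p (wmod a u)) (wmod (lact p a) u)
| ws_mf : forall {F G H : Fun} {M : Mod F G} {q : mpath G H} {z w w' v : D} {x y y' t : E}
    {f : hom x (F z)} {g : hom y (G w)} {g' : hom y' (G w')} {h : hom t (H v)}
    (a : ent M f g) (p : ent (umod G) g g') (u : word q g' h),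
    wsim (wmod a (wfun p u)) (wmod (ract a p) u).

Fixpoint wsnoc {F G : Fun} {q : mpath F G} {z w v : D} {x y t : E} {f : hom x (F z)}
    {g : hom y (G w)} {h : hom t (G v)} (u : word q f g) : ent (umod G) g h -> word q f h :=
  match u in @word F G q z w x y f g return
    forall h : hom t (G v), ent (umod G) g h -> word q f h
  with
  | wnil f => fun h r => wfun r (wnil h)
  | wfun p u => fun h r => wfun p (wsnoc u r)
  | wmod a u => fun h r => wmod a (wsnoc u r)
  end h.

Fixpoint qword {F G : Fun} {q : mpath F G} {z w : D} {ms : dpath q z w} {x y : E}
    {f : hom x (F z)} {g : hom y (G w)} (as_ : qc ms f g) : word q f g :=
  match as_ with
  | qnil f => wnil f
  | qcons a as_ => wmod a (qword as_)
  end.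

(** Entries of functors are absorbed to the left; only those in front of the first module entry remain. *)
Lemma word_nf {F G : Fun} {q : mpath F G} {z w : D} {x y : E} {f : hom x (F z)} {g : hom y (G w)}
    (s : word q f g) :
  exists (z' : D) (x' : E) (f' : hom x' (F z')) (p : ent (umod F) f f') (ms : dpath q z' w)
    (as_ : qc ms f' g), wsim s (wfun p (qword as_)).
Proof.
  induction s as [F z x f | F G q z z' w x x' y f f' g p s (z1 & x1 & f1 & p1 & ms & as_ & H)
    | F G H M q z w v x y t f g h a s (z1 & x1 & f1 & p1 & ms & as_ & K)].
  - exists z, x, f, (one F f), (dnil z), (qnil f); apply ws_sym, ws_one.
  - exists z1, x1, f1, (lact p p1), ms, as_.
    exact (ws_trans (ws_fun (esim_refl _) H) (ws_ff _ _ _)).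
  - exists z, x, f, (one F f), (dcons (en (ract a p1)) ms), (qcons (ract a p1) as_).
    exact (ws_trans (ws_trans (ws_mod (esim_refl _) K) (ws_mf _ _ _)) (ws_sym (ws_one _))).
Qed.

Definition QC {F G : Fun} (q : mpath F G) {z w : D} {x y : E} (f : hom x (F z)) (g : hom y (G w)) :=
  {ms : dpath q z w & qc ms f g}.

Definition QCcons {F G H : Fun} {M : Mod F G} {q : mpath G H} {z w v : D} {x y t : E}
    {f : hom x (F z)} {g : hom y (G w)} {h : hom t (H v)} (a : ent M f g) (Q : QC q g h) :
    QC (pcons M q) f h :=
  existT _ (dcons (en a) (projT1 Q)) (qcons a (projT2 Q)).

(** The absorption to the left of [word_nf] as a function, with the entry that absorbs next as an argument. *)
Fixpoint sweep {F G : Fun} {q : mpath F G} {z w : D} {x y : E} {f : hom x (F z)} {g : hom y (G w)}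
    (u : word q f g) {C : Fun} {M : Mod C F} {c : D} {r : E} {k : hom r (C c)} :
    ent M k f -> QC (pcons M q) k g :=
  match u in @word F G q z w x y f g return
    forall M : Mod C F, ent M k f -> QC (pcons M q) k g
  with
  | wnil f => fun M b => QCcons b (existT _ (dnil _) (qnil f))
  | wfun p u => fun M b => sweep u (ract b p)
  | wmod a u => fun M b => QCcons b (sweep u a)
  end M.

Lemma sweep_cong {F G : Fun} {q : mpath F G} {z w : D} {x y : E} {f : hom x (F z)} {g : hom y (G w)}
    (u : word q f g) {C : Fun} {M : Mod C F} {c : D} {r : E} {k : hom r (C c)} (b b' : ent M k f) :
  b ≃ b' -> qsim (projT2 (sweep u b)) (projT2 (sweep u b')).
Proof.
  revert C M c r k b b'; induction u; intros C M0 c r k b b' Hb; cbn.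
  - constructor; [exact Hb | apply qsim_refl].
  - apply IHu, ract_cong; [exact Hb | apply esim_refl].
  - constructor; [exact Hb | apply qsim_refl].
Qed.

Lemma sweep_lact {F G : Fun} {q : mpath F G} {z w : D} {x y : E} {f : hom x (F z)} {g : hom y (G w)}
    (u : word q f g) {C : Fun} {M : Mod C F} {c c' : D} {r r' : E} {k : hom r (C c)}
    {k' : hom r' (C c')} (p : ent (umod C) k' k) (b : ent M k f) :
  exists (z' : D) (x' : E) (f' : hom x' (F z')) (b' : ent M k f') (ms : dpath q z' w)
    (as_ : qc ms f' g),
    sweep u b = existT _ (dcons (en b') ms) (qcons b' as_) /\
    sim (projT2 (sweep u (lact p b))) (qcons (lact p b') as_).
Proof.
  revert C M c r k b c' r' k' p; induction u; intros C M0 c r k b c' r' k' pp; cbn.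
  - do 6 eexists; split; [reflexivity | apply sim_refl].
  - destruct (IHu _ _ _ _ _ (ract b p) _ _ _ pp) as (z1 & x1 & f1 & b1 & ms & as_ & H1 & H2).
    do 6 eexists; split; [exact H1|].
    refine (sim_trans _ H2); apply sim_q, sweep_cong, lact_ract.
  - do 6 eexists; split; [reflexivity | apply sim_refl].
Qed.

(** Related words are swept to entries that inner equivariance identifies.  An entry of a functor in front
    of a module entry is the only case in which the sweep absorbs on the other side. *)
Lemma sweep_wsim {F G : Fun} {q : mpath F G} {z w : D} {x y : E} {f : hom x (F z)} {g : hom y (G w)}
    {u v : word q f g} : wsim u v ->
  forall {C : Fun} {M : Mod C F} {c : D} {r : E} {k : hom r (C c)} (b b' : ent M k f),
  b ≃ b' -> sim (projT2 (sweep u b)) (projT2 (sweep v b')).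
Proof.
  induction 1; intros C M0 c r' k b b' Hb.
  - apply sim_q, sweep_cong; exact Hb.
  - apply sim_sym, IHwsim, esim_sym, Hb.
  - exact (sim_trans (IHwsim1 _ _ _ _ _ b b' Hb) (IHwsim2 _ _ _ _ _ b' b' (esim_refl _))).
  - apply IHwsim, ract_cong; assumption.
  - cbn; apply sim_cons; [exact Hb | apply IHwsim; assumption].
  - cbn; apply sim_q, sweep_cong.
    refine (esim_trans (ract_ract _ _ _) (ract_cong Hb (esim_refl _))).
  - cbn; apply sim_q, sweep_cong; exact (esim_trans (ract_one _) Hb).
  - cbn.
    destruct (sweep_lact u p a) as (z1 & x1 & f1 & b1 & ms & as_ & H1 & H2).
    apply sim_sym; refine (sim_trans (sim_cons (esim_sym Hb) H2) _); rewrite H1; cbn.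
    apply sim_sym, sim_i; exact (iabs_c _ (iqhere b p b1 as_)).
  - cbn; apply sim_cons; [exact Hb | apply sim_refl].
Qed.

Lemma sweep_qword {F G : Fun} {q : mpath F G} {z w : D} {ms : dpath q z w} {x y : E}
    {f : hom x (F z)} {g : hom y (G w)} (as_ : qc ms f g) {C : Fun} {M : Mod C F} {c : D} {r : E}
    {k : hom r (C c)} (b : ent M k f) :
  sweep (qword as_) b = existT _ (dcons (en b) ms) (qcons b as_).
Proof.
  revert C M c r k b; induction as_; intros C M0 c r k b; cbn; [reflexivity|].
  rewrite IHas_; reflexivity.
Qed.

Lemma sweep_snoc {F G : Fun} {q : mpath F G} {z w v : D} {x y t : E} {f : hom x (F z)}
    {g : hom y (G w)} {h : hom t (G v)} (u : word q f g) (s : ent (umod G) g h) {C : Fun}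
    {M : Mod C F} {c : D} {r : E} {k : hom r (C c)} (b : ent M k f) :
  rabs s (projT2 (sweep u b)) (projT2 (sweep (wsnoc u s) b)).
Proof.
  revert C M c r k b h s; induction u; intros C M0 c r k b hh s; cbn.
  - apply rabs_last.
  - apply IHu.
  - apply rabs_cons, IHu.
Qed.

Section Eval.
Context {F F' G H : Fun} {Ms : mpath F F'} {N : Mod G H} {α : trans F G} {β : trans F' H}.

(** The second argument collects the entries of functors in front of the first module entry; it acts
    through [α] at the end. *)
Fixpoint wev0 {F F' : Fun} {Ms : mpath F F'} {z w : D} {x y : E} {f : hom x (F z)}
    {g : hom y (F' w)} (u : word Ms f g) :
    forall {α : trans F G} {β : trans F' H} (μ : components Ms N α β)
      {c : D} {r : E} {k : hom r (F c)}, ent (umod F) k f -> ent N (α c ∘ k) (β w ∘ g) :=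
  match u with
  | wnil f => fun α β μ c r k P => lact (tm α P) (ev μ (qnil f))
  | wfun p u => fun α β μ c r k P => wev0 u μ (lact P p)
  | wmod a u => fun α β μ c r k P => lact (tm α P) (ev μ (projT2 (sweep u a)))
  end.

Definition wev (μ : components Ms N α β) {z w : D} {x y : E} {f : hom x (F z)}
    {g : hom y (F' w)} (u : word Ms f g) : ent N (α z ∘ f) (β w ∘ g) := wev0 u μ (one F f).

Record equivariant (μ : components Ms N α β) : Prop := {
  eqv_glob : globular μ;
  eqv_src : gnat α;
  eqv_tgt : gnat β;
  eqv_left : eq_left μ;
  eqv_right : eq_right μ;
  eqv_nullary : eq_nullary μ;
  eqv_inner : eq_inner μ
}.
End Eval.

Section Base.
Context {G H : Fun} {N : Mod G H}.

Lemma wev0_cong {F F' : Fun} {Ms : mpath F F'} {α : trans F G} {β : trans F' H}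
    {μ : components Ms N α β} (Hα : gnat α) {z w : D} {x y : E} {f : hom x (F z)}
    {g : hom y (F' w)} (u : word Ms f g) {c : D} {r : E} {k : hom r (F c)}
    {P P' : ent (umod F) k f} : P ≃ P' -> wev0 u μ P ≃ wev0 u μ P'.
Proof.
  revert α β μ Hα c r k P P'; induction u; intros α β μ Hα c r k P P' HP; cbn [wev0].
  - exact (lact_cong (tm_cong α Hα HP) (esim_refl _)).
  - apply IHu; [exact Hα | exact (lact_cong HP (esim_refl _))].
  - exact (lact_cong (tm_cong α Hα HP) (esim_refl _)).
Qed.

Lemma wev0_lact {F F' : Fun} {Ms : mpath F F'} {α : trans F G} {β : trans F' H}
    {μ : components Ms N α β} (Hα : gnat α) {z w : D} {x y : E} {f : hom x (F z)}
    {g : hom y (F' w)} (u : word Ms f g) {c c' : D} {r r' : E} {k : hom r (F c)} {k' : hom r' (F c')}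
    (P : ent (umod F) k' k) (p : ent (umod F) k f) :
  wev0 u μ (lact P p) ≃ lact (tm α P) (wev0 u μ p).
Proof.
  revert α β μ Hα c r k P p; induction u; intros α β μ Hα c r k P p0; cbn [wev0].
  - exact (esim_trans (lact_cong (tm_lact α P p0) (esim_refl _)) (lact_lact _ _ _)).
  - exact (esim_trans (wev0_cong Hα u (lact_lact P p0 p)) (IHu _ _ _ _ Hα _ _ _ P (lact p0 p))).
  - exact (esim_trans (lact_cong (tm_lact α P p0) (esim_refl _)) (lact_lact _ _ _)).
Qed.

Lemma wev_fun {F F' : Fun} {Ms : mpath F F'} {α : trans F G} {β : trans F' H}
    {μ : components Ms N α β} (Hα : gnat α) {z z' w : D} {x x' y : E} {f : hom x (F z)}
    {f' : hom x' (F z')} {g : hom y (F' w)} (p : ent (umod F) f f') (u : word Ms f' g) :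
  wev μ (wfun p u) ≃ lact (tm α p) (wev μ u).
Proof.
  refine (esim_trans (wev0_cong Hα u (one_lact p)) _).
  exact (esim_trans (wev0_cong Hα u (esim_sym (ract_one p))) (wev0_lact Hα u p (one F f'))).
Qed.

Lemma wev0_sim {F F' : Fun} {Ms : mpath F F'} {z w : D} {x y : E} {f : hom x (F z)}
    {g : hom y (F' w)} {u v : word Ms f g} : wsim u v ->
  forall {α : trans F G} {β : trans F' H} {μ : components Ms N α β} (Hμ : equivariant μ)
    {c : D} {r : E} {k : hom r (F c)} {P P' : ent (umod F) k f},
  P ≃ P' -> wev0 u μ P ≃ wev0 v μ P'.
Proof.
  induction 1; intros α β μ Hμ c r' k P P' HP.
  - exact (wev0_cong (eqv_src _ Hμ) _ HP).
  - apply esim_sym, (IHwsim _ _ _ Hμ), esim_sym, HP.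
  - exact (esim_trans (IHwsim1 _ _ _ Hμ _ _ _ P P' HP) (IHwsim2 _ _ _ Hμ _ _ _ P' P' (esim_refl _))).
  - apply (IHwsim _ _ _ Hμ), lact_cong; assumption.
  - cbn [wev0]; apply lact_cong; [exact (tm_cong α (eqv_src _ Hμ) HP)|].
    exact (ev_sim (eqv_glob _ Hμ) (eqv_inner _ Hμ) (sweep_wsim H2 _ _ H1)).
  - cbn [wev0]; apply (wev0_cong (eqv_src _ Hμ)).
    exact (esim_trans (lact_lact _ _ _) (lact_cong HP (esim_refl _))).
  - cbn [wev0]; exact (wev0_cong (eqv_src _ Hμ) _ (esim_trans (ract_one _) HP)).
  - cbn [wev0].
    destruct (sweep_lact u p a) as (z1 & x1 & f1 & b1 & ms & as_ & H1 & H2).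
    apply esim_sym.
    refine (esim_trans (lact_cong (tm_cong α (eqv_src _ Hμ) (esim_sym HP))
      (ev_sim (eqv_glob _ Hμ) (eqv_inner _ Hμ) H2)) _).
    rewrite H1; cbn [projT2].
    refine (esim_trans (lact_cong (esim_refl _) (eqv_left _ Hμ _ _ _ _ _ _ _ _ _ _ _ _ _ _
      (labs_c p b1 as_))) _).
    refine (esim_trans (esim_sym (lact_lact _ _ _)) _).
    exact (lact_cong (esim_sym (tm_lact α P p)) (esim_refl _)).
  - cbn [wev0]; apply lact_cong; [exact (tm_cong α (eqv_src _ Hμ) HP)|].
    apply esim_refl.
Qed.

(** This is where all of equivariance is used: the value does not depend on the places to which entries of
    functors are moved. *)
Lemma wev_sim {F F' : Fun} {Ms : mpath F F'} {z w : D} {x y : E} {f : hom x (F z)}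
    {g : hom y (F' w)} {u v : word Ms f g} {α : trans F G} {β : trans F' H}
    {μ : components Ms N α β} (Hμ : equivariant μ) : wsim u v -> wev μ u ≃ wev μ v.
Proof. intros Hu; exact (wev0_sim Hu Hμ (esim_refl _)). Qed.

Lemma wev0_snoc {F F' : Fun} {Ms : mpath F F'} {z w v : D} {x y t : E} {f : hom x (F z)}
    {g : hom y (F' w)} {h : hom t (F' v)} (u : word Ms f g) (s : ent (umod F') g h)
    {α : trans F G} {β : trans F' H} {μ : components Ms N α β} (Hμ : equivariant μ)
    {c : D} {r : E} {k : hom r (F c)} (P : ent (umod F) k f) :
  wev0 (wsnoc u s) μ P ≃ ract (wev0 u μ P) (tm β s).
Proof.
  revert α β μ Hμ c r k P h s; induction u; intros α β μ Hμ c r k P hh s; cbn [wev0 wsnoc].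
  - refine (esim_trans (lact_cong (tm_lact α P s) (esim_refl _)) _).
    refine (esim_trans (lact_lact _ _ _) _).
    refine (esim_trans (lact_cong (esim_refl _)
      (eqv_nullary _ Hμ _ _ _ _ _ _ _ _ _ _ _ _ _ _ _ _ _ _ (nabs_c s))) _).
    exact (esim_sym (lact_ract _ _ _)).
  - apply IHu; exact Hμ.
  - refine (esim_trans (lact_cong (esim_refl _)
      (eqv_right _ Hμ _ _ _ _ _ _ _ _ _ _ _ _ _ _ (sweep_snoc u s a))) _).
    exact (esim_sym (lact_ract _ _ _)).
Qed.

Lemma wev_snoc {F F' : Fun} {Ms : mpath F F'} {z w v : D} {x y t : E} {f : hom x (F z)}
    {g : hom y (F' w)} {h : hom t (F' v)} (u : word Ms f g) (s : ent (umod F') g h)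
    {α : trans F G} {β : trans F' H} {μ : components Ms N α β} (Hμ : equivariant μ) :
  wev μ (wsnoc u s) ≃ ract (wev μ u) (tm β s).
Proof. exact (wev0_snoc u s Hμ _). Qed.

Lemma wev_qword {F F' : Fun} {Ms : mpath F F'} {z w : D} {ms : dpath Ms z w} {x y : E}
    {f : hom x (F z)} {g : hom y (F' w)} (as_ : qc ms f g)
    {α : trans F G} {β : trans F' H} (μ : components Ms N α β) : wev μ (qword as_) ≃ ev μ as_.
Proof.
  unfold wev; destruct as_; cbn [wev0 qword].
  - exact (lact_unit _ (tm_one α f)).
  - rewrite sweep_qword; exact (lact_unit _ (tm_one α f)).
Qed.

(** The converse of [wev_sim]: each kind of absorption relates two words, so a functional that
    respects the relation on words is equivariant. *)
Lemma equivariant_of {F F' : Fun} {Ms : mpath F F'} {α : trans F G} {β : trans F' H}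
    (μ : components Ms N α β)
    (e : forall (z w : D) (x y : E) (f : hom x (F z)) (g : hom y (F' w)),
      word Ms f g -> ent N (α z ∘ f) (β w ∘ g)) :
  (forall z w (ms : dpath Ms z w) x y (f : hom x (F z)) (g : hom y (F' w)) (as_ : qc ms f g),
    ev μ as_ ≃ e _ _ _ _ _ _ (qword as_)) ->
  (forall z w x y (f : hom x (F z)) (g : hom y (F' w)) (u v : word Ms f g),
    wsim u v -> e _ _ _ _ _ _ u ≃ e _ _ _ _ _ _ v) ->
  (forall z z' w x x' y (f : hom x (F z)) (f' : hom x' (F z')) (g : hom y (F' w))
    (p : ent (umod F) f f') (u : word Ms f' g),
    e _ _ _ _ _ _ (wfun p u) ≃ lact (tm α p) (e _ _ _ _ _ _ u)) ->
  (forall z w v x y t (f : hom x (F z)) (g : hom y (F' w)) (h : hom t (F' v)) (u : word Ms f g)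
    (s : ent (umod F') g h),
    e _ _ _ _ _ _ (wsnoc u s) ≃ ract (e _ _ _ _ _ _ u) (tm β s)) ->
  eq_left μ /\ eq_right μ /\ eq_nullary μ /\ eq_inner μ.
Proof.
  intros He Hsim Hfun Hsnoc; repeat split.
  - intros z z' w x x' y ms ms' f f' g p as_ as' L.
    refine (esim_trans (He _ _ _ _ _ _ _ _) (esim_trans (Hsim _ _ _ _ _ _ _ (wfun p (qword as_)) _)
      (esim_trans (Hfun _ _ _ _ _ _ _ _ _ _ _) (lact_cong (esim_refl _) (esim_sym (He _ _ _ _ _ _ _ _)))))).
    clear - L; destruct L; apply ws_sym, ws_fm.
  - intros z w v x y t ms ms' f g h r as_ as' L.
    refine (esim_trans (He _ _ _ _ _ _ _ _) (esim_trans (Hsim _ _ _ _ _ _ _ (wsnoc (qword as_) r) _)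
      (esim_trans (Hsnoc _ _ _ _ _ _ _ _ _ _ _) (ract_cong (esim_sym (He _ _ _ _ _ _ _ _)) (esim_refl _))))).
    clear - L; destruct L as [ns nas]; induction nas.
    + apply ws_sym, ws_mf.
    + apply ws_mod; [apply esim_refl | apply IHnas].
  - intros z w z' w' x y x' y' ms ms' f g f' g' p p' as_ as' L.
    refine (esim_trans (esim_trans (lact_cong (esim_refl _) (He _ _ _ _ _ _ _ _))
      (esim_sym (Hfun _ _ _ _ _ _ _ _ _ _ _))) (esim_trans (Hsim _ _ _ _ _ _ _ _ _)
      (esim_trans (Hsnoc _ _ _ _ _ _ _ _ _ _ _) (ract_cong (esim_sym (He _ _ _ _ _ _ _ _)) (esim_refl _))))).
    clear - L; destruct L; apply ws_refl.
  - intros z w x y ms ms' f g as_ as' L.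
    refine (esim_trans (He _ _ _ _ _ _ _ _) (esim_trans (Hsim _ _ _ _ _ _ _ _ _)
      (esim_sym (He _ _ _ _ _ _ _ _)))).
    clear - L; destruct L as [s ias]; induction ias.
    + exact (ws_trans (ws_sym (ws_mf _ _ _)) (ws_mod (esim_refl _) (ws_fm _ _ _))).
    + apply ws_mod; [apply esim_refl | assumption].
Qed.
End Base.

(** * Splitting words *)

Inductive head {F G H : Fun} (M : Mod F G) (q : mpath G H) {z v : D} {x t : E} (f : hom x (F z))
    (h : hom t (H v)) : Type :=
| hd : forall {w : D} {y : E} {g : hom y (G w)}, ent M f g -> word q g h -> head M q f h.
Arguments hd {F G H M q z v x t f h w y g} _ _.

(** A word over the empty path has no first module entry.  A family indexed by the path avoids partiality. *)
Definition hd_type {F G : Fun} (q : mpath F G) {z v : D} {x t : E} (f : hom x (F z))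
    (h : hom t (G v)) : Type :=
  match q in path _ F G return hom x (F z) -> hom t (G v) -> Type with
  | pnil _ => fun _ _ => unit
  | pcons M q => fun f h => head M q f h
  end f h.

Definition hd_lact {F G : Fun} {q : mpath F G} {z z' v : D} {x x' t : E} {f : hom x (F z)}
    {f' : hom x' (F z')} {h : hom t (G v)} :
    ent (umod F) f f' -> hd_type q f' h -> hd_type q f h :=
  match q in path _ F G return forall (f : hom x (F z)) (f' : hom x' (F z')) (h : hom t (G v)),
    ent (umod F) f f' -> hd_type q f' h -> hd_type q f h
  with
  | pnil _ => fun _ _ _ _ _ => tt
  | pcons M q => fun f f' h p s => match s with hd a u => hd (lact p a) u end
  end f f' h.

Fixpoint whead {F G : Fun} {q : mpath F G} {z v : D} {x t : E} {f : hom x (F z)}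
    {h : hom t (G v)} (u : word q f h) : hd_type q f h :=
  match u in @word F G q z v x t f h return hd_type q f h with
  | wnil f => tt
  | wfun p u => hd_lact p (whead u)
  | wmod a u => hd a u
  end.

Inductive hsim {F G H : Fun} {M : Mod F G} {q : mpath G H} {z v : D} {x t : E}
    {f : hom x (F z)} {h : hom t (H v)} : head M q f h -> head M q f h -> Prop :=
| hs_c : forall {w : D} {y : E} {g : hom y (G w)} {a a' : ent M f g} {u u' : word q g h},
    a ≃ a' -> wsim u u' -> hsim (hd a u) (hd a' u')
| hs_m : forall {w w' : D} {y y' : E} {g : hom y (G w)} {g' : hom y' (G w')} (a : ent M f g)
    (p : ent (umod G) g g') (u : word q g' h), hsim (hd (ract a p) u) (hd a (wfun p u))
| hs_sym : forall {s s' : head M q f h}, hsim s s' -> hsim s' s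
| hs_trans : forall {s s' s'' : head M q f h}, hsim s s' -> hsim s' s'' -> hsim s s''.

Definition hd_rel {F G : Fun} {q : mpath F G} {z v : D} {x t : E} {f : hom x (F z)}
    {h : hom t (G v)} : hd_type q f h -> hd_type q f h -> Prop :=
  match q in path _ F G return forall (f : hom x (F z)) (h : hom t (G v)),
    hd_type q f h -> hd_type q f h -> Prop
  with
  | pnil _ => fun _ _ _ _ => True
  | pcons M q => fun f h s s' => hsim s s'
  end f h.

Lemma hsim_lact {F G H : Fun} {M : Mod F G} {q : mpath G H} {z z' v : D} {x x' t : E}
    {f : hom x (F z)} {f' : hom x' (F z')} {h : hom t (H v)} {s s' : head M q f' h} :
  hsim s s' -> forall p p' : ent (umod F) f f', p ≃ p' ->
  hsim (hd_lact (q := pcons M q) p s) (hd_lact (q := pcons M q) p' s').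
Proof.
  induction 1; intros p1 p2 Hp; cbn [hd_lact].
  - apply hs_c; [apply lact_cong; assumption | assumption].
  - refine (hs_trans (hs_c (esim_sym (lact_ract _ _ _)) (ws_refl _)) (hs_trans (hs_m _ _ _) _)).
    apply hs_c; [exact (lact_cong Hp (esim_refl _)) | apply ws_refl].
  - apply hs_sym, IHhsim, esim_sym, Hp.
  - exact (hs_trans (IHhsim1 _ _ Hp) (IHhsim2 _ _ (esim_refl _))).
Qed.

Lemma hsim_refl {F G H : Fun} {M : Mod F G} {q : mpath G H} {z v : D} {x t : E}
    {f : hom x (F z)} {h : hom t (H v)} (s : head M q f h) : hsim s s.
Proof. destruct s; apply hs_c; [apply esim_refl | apply ws_refl]. Qed.

Lemma whead_sim {F G : Fun} {q : mpath F G} {z v : D} {x t : E} {f : hom x (F z)}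
    {h : hom t (G v)} {u u' : word q f h} : wsim u u' -> hd_rel (whead u) (whead u').
Proof.
  induction 1; cbn [whead].
  - destruct q; [exact I | apply hsim_refl].
  - destruct q; [exact I | apply hs_sym, IHwsim].
  - destruct q; [exact I | exact (hs_trans IHwsim1 IHwsim2)].
  - destruct q; [exact I | exact (hsim_lact IHwsim _ _ H)].
  - apply hs_c; assumption.
  - destruct q; [exact I | cbn; destruct (whead u); apply hs_c];
      [apply esim_sym, lact_lact | apply ws_refl].
  - destruct q; [exact I | cbn; destruct (whead u); apply hs_c];
      [apply one_lact | apply ws_refl].
  - apply hs_c; [apply esim_refl | apply ws_refl].
  - apply hs_sym, hs_m.
Qed.

(** The place of the cut is part of the data, since it is where the two words meet. *)
Inductive SP {F G H : Fun} (p1 : mpath F G) (p2 : mpath G H) {z v : D} {x t : E}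
    (f : hom x (F z)) (h : hom t (H v)) : Type :=
| sp : forall {w : D} {y : E} {g : hom y (G w)}, word p1 f g -> word p2 g h -> SP p1 p2 f h.
Arguments sp {F G H p1 p2 z v x t f h w y g} _ _.

Definition sp_mod {F G H K : Fun} {M : Mod F G} {p1 : mpath G H} {p2 : mpath H K} {z w v : D}
    {x y t : E} {f : hom x (F z)} {g : hom y (G w)} {h : hom t (K v)} (a : ent M f g)
    (s : SP p1 p2 g h) : SP (pcons M p1) p2 f h :=
  match s with sp u1 u2 => sp (wmod a u1) u2 end.

Definition sp_fun {F G H : Fun} {p1 : mpath F G} {p2 : mpath G H} {z z' v : D}
    {x x' t : E} {f : hom x (F z)} {f' : hom x' (F z')} {h : hom t (H v)} (p : ent (umod F) f f')
    (s : SP p1 p2 f' h) : SP p1 p2 f h :=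
  match s with sp u1 u2 => sp (wfun p u1) u2 end.

Definition sp_snoc {F G H : Fun} {p1 : mpath F G} {p2 : mpath G H} {z v v' : D}
    {x t t' : E} {f : hom x (F z)} {h : hom t (H v)} {h' : hom t' (H v')} (s : SP p1 p2 f h)
    (r : ent (umod H) h h') : SP p1 p2 f h' :=
  match s with sp u1 u2 => sp u1 (wsnoc u2 r) end.

(** At the cut, entries of functors are left to the second word.  By [psim] the choice does not matter. *)
Fixpoint wsplit {F G H : Fun} (p1 : mpath F G) {p2 : mpath G H} {z v : D} {x t : E}
    {f : hom x (F z)} {h : hom t (H v)} : word (papp p1 p2) f h -> SP p1 p2 f h :=
  match p1 in path _ F G return forall (p2 : mpath G H) (z : D) (x : E) (f : hom x (F z)),
    word (papp p1 p2) f h -> SP p1 p2 f h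
  with
  | pnil _ => fun p2 z x f u => sp (wnil f) u
  | pcons M p1 => fun p2 z x f u =>
      match (whead u : head M (papp p1 p2) f h) with
      | hd a u' => sp_mod a (wsplit p1 u')
      end
  end p2 z x f.

Inductive psim {F G H : Fun} {p1 : mpath F G} {p2 : mpath G H} {z v : D} {x t : E}
    {f : hom x (F z)} {h : hom t (H v)} : SP p1 p2 f h -> SP p1 p2 f h -> Prop :=
| ps_c : forall {w : D} {y : E} {g : hom y (G w)} {u1 u1' : word p1 f g} {u2 u2' : word p2 g h},
    wsim u1 u1' -> wsim u2 u2' -> psim (sp u1 u2) (sp u1' u2')
| ps_m : forall {w w' : D} {y y' : E} {g : hom y (G w)} {g' : hom y' (G w')}
    (u1 : word p1 f g) (r : ent (umod G) g g') (u2 : word p2 g' h),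
    psim (sp (wsnoc u1 r) u2) (sp u1 (wfun r u2))
| ps_sym : forall {s s' : SP p1 p2 f h}, psim s s' -> psim s' s
| ps_trans : forall {s s' s'' : SP p1 p2 f h}, psim s s' -> psim s' s'' -> psim s s''.

Lemma psim_refl {F G H : Fun} {p1 : mpath F G} {p2 : mpath G H} {z v : D} {x t : E}
    {f : hom x (F z)} {h : hom t (H v)} (s : SP p1 p2 f h) : psim s s.
Proof. destruct s as [w y g u1 u2]; apply (ps_c (ws_refl u1) (ws_refl u2)). Qed.

Lemma psim_mod {F G H K : Fun} {M : Mod F G} {p1 : mpath G H} {p2 : mpath H K} {z w v : D}
    {x y t : E} {f : hom x (F z)} {g : hom y (G w)} {h : hom t (K v)} {a a' : ent M f g}
    {s s' : SP p1 p2 g h} : a ≃ a' -> psim s s' -> psim (sp_mod a s) (sp_mod a' s').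
Proof.
  intros Ha Hs; revert a a' Ha; induction Hs; intros a a' Ha.
  - apply ps_c; [apply ws_mod |]; assumption.
  - refine (ps_trans (ps_m (wmod a u1) r u2) (ps_c (ws_mod Ha (ws_refl _)) (ws_refl _))).
  - apply ps_sym, IHHs, esim_sym, Ha.
  - exact (ps_trans (IHHs1 _ _ Ha) (IHHs2 _ _ (esim_refl _))).
Qed.

Lemma wsplit_fun {F G H : Fun} (p1 : mpath F G) {p2 : mpath G H} {z z' v : D} {x x' t : E}
    {f : hom x (F z)} {f' : hom x' (F z')} {h : hom t (H v)} (p : ent (umod F) f f')
    (u : word (papp p1 p2) f' h) : psim (wsplit p1 (wfun p u)) (sp_fun p (wsplit p1 u)).
Proof.
  destruct p1 as [F | F G1 G M p1].
  - apply ps_sym; exact (ps_m (wnil f) p u).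
  - cbn [papp] in u; cbn [wsplit papp whead hd_lact].
    destruct (whead u : head M (papp p1 p2) f' h) as [w y g a u'].
    destruct (wsplit p1 u') as [w' y' g' u1 u2].
    exact (ps_c (ws_sym (ws_fm p a u1)) (ws_refl u2)).
Qed.

(** Cutting respects the relation on words.  The only relation that involves both sides of the cut is
    absorption of an entry at the cut, which becomes a move across the cut. *)
Lemma wsplit_sim {F G H : Fun} (p1 : mpath F G) {p2 : mpath G H} {z v : D} {x t : E}
    {f : hom x (F z)} {h : hom t (H v)} {u u' : word (papp p1 p2) f h} :
  wsim u u' -> psim (wsplit p1 u) (wsplit p1 u').
Proof.
  revert z x f u u'; induction p1 as [F | F G1 G M p1 IH]; intros z x f u u' Hu.
  - exact (ps_c (ws_refl _) Hu).
  - apply whead_sim in Hu; cbn [papp] in u, u', Hu; cbn [wsplit papp]; cbn [hd_rel] in Hu.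
    set (s := whead u) in *; set (s' := whead u') in *; clearbody s s'; cbn [hd_type] in s, s'.
    clear u u'; induction Hu.
    + apply psim_mod; [assumption | apply IH; assumption].
    + apply ps_sym.
      refine (ps_trans (psim_mod (esim_refl _) (wsplit_fun p1 p u)) _).
      destruct (wsplit p1 u); refine (ps_c _ (ws_refl _)); apply ws_mf.
    + apply ps_sym; assumption.
    + eapply ps_trans; eassumption.
Qed.

Definition hd_snoc {F G : Fun} {q : mpath F G} {z v v' : D} {x t t' : E} {f : hom x (F z)}
    {h : hom t (G v)} {h' : hom t' (G v')} :
    hd_type q f h -> ent (umod G) h h' -> hd_type q f h' :=
  match q in path _ F G return forall (f : hom x (F z)) (h : hom t (G v)) (h' : hom t' (G v')),
    hd_type q f h -> ent (umod G) h h' -> hd_type q f h'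
  with
  | pnil _ => fun _ _ _ _ _ => tt
  | pcons M q => fun f h h' s r => match s with hd a u => hd a (wsnoc u r) end
  end f h h'.

Lemma whead_snoc {F G : Fun} {q : mpath F G} {z v v' : D} {x t t' : E} {f : hom x (F z)}
    {h : hom t (G v)} {h' : hom t' (G v')} (u : word q f h) (r : ent (umod G) h h') :
  whead (wsnoc u r) = hd_snoc (whead u) r.
Proof.
  induction u; cbn [wsnoc whead].
  - reflexivity.
  - rewrite IHu; destruct q; [reflexivity | cbn; destruct (whead u); reflexivity].
  - reflexivity.
Qed.

Lemma wsplit_snoc {F G H : Fun} (p1 : mpath F G) {p2 : mpath G H} {z v v' : D} {x t t' : E}
    {f : hom x (F z)} {h : hom t (H v)} {h' : hom t' (H v')} (u : word (papp p1 p2) f h)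
    (r : ent (umod H) h h') : wsplit p1 (wsnoc u r) = sp_snoc (wsplit p1 u) r.
Proof.
  revert z x f u; induction p1 as [F | F G1 G M p1 IH]; intros z x f u.
  - reflexivity.
  - cbn [papp] in u; cbn [wsplit papp].
    rewrite (whead_snoc u r); set (s := whead u); clearbody s; cbn [hd_type] in s.
    destruct s as [w y g a u']; cbn [hd_snoc].
    rewrite IH; destruct (wsplit p1 u'); reflexivity.
Qed.

(** Words over other paths have no product of this kind, hence a type that depends on the path. *)
Definition pr_type {F G : Fun} (q : mpath F G) {z v : D} {x t : E} (f : hom x (F z))
    (h : hom t (G v)) : Type :=
  match q in path _ F G return hom x (F z) -> hom t (G v) -> Type with
  | pnil F => fun f h => ent (umod F) f h
  | pcons _ _ => fun _ _ => unit
  end f h.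

Definition pr_lact {F G : Fun} {q : mpath F G} {z z' v : D} {x x' t : E} {f : hom x (F z)}
    {f' : hom x' (F z')} {h : hom t (G v)} :
    ent (umod F) f f' -> pr_type q f' h -> pr_type q f h :=
  match q in path _ F G return forall (f : hom x (F z)) (f' : hom x' (F z')) (h : hom t (G v)),
    ent (umod F) f f' -> pr_type q f' h -> pr_type q f h
  with
  | pnil _ => fun _ _ _ p s => lact p s
  | pcons M q => fun f f' h p s => tt
  end f f' h.

Fixpoint wprod {F G : Fun} {q : mpath F G} {z v : D} {x t : E} {f : hom x (F z)}
    {h : hom t (G v)} (u : word q f h) : pr_type q f h :=
  match u in @word F G q z v x t f h return pr_type q f h with
  | wnil f => one _ f
  | wfun p u => pr_lact p (wprod u)
  | wmod a u => tt
  end.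

Definition pr_rel {F G : Fun} {q : mpath F G} {z v : D} {x t : E} {f : hom x (F z)}
    {h : hom t (G v)} : pr_type q f h -> pr_type q f h -> Prop :=
  match q in path _ F G return forall (f : hom x (F z)) (h : hom t (G v)),
    pr_type q f h -> pr_type q f h -> Prop
  with
  | pnil _ => fun _ _ s s' => s ≃ s'
  | pcons M q => fun f h s s' => True
  end f h.

Lemma wprod_sim {F G : Fun} {q : mpath F G} {z v : D} {x t : E} {f : hom x (F z)}
    {h : hom t (G v)} {u u' : word q f h} : wsim u u' -> pr_rel (wprod u) (wprod u').
Proof.
  induction 1.
  - destruct q; [apply esim_refl | exact I].
  - destruct q; [apply esim_sym, IHwsim | exact I].
  - destruct q; [exact (esim_trans IHwsim1 IHwsim2) | exact I].
  - destruct q; [apply lact_cong; assumption | exact I].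
  - exact I.
  - destruct q; [apply esim_sym, lact_lact | exact I].
  - destruct q; [apply one_lact | exact I].
  - exact I.
  - exact I.
Qed.

Definition pr_snoc {F G : Fun} {q : mpath F G} {z v v' : D} {x t t' : E} {f : hom x (F z)}
    {h : hom t (G v)} {h' : hom t' (G v')} :
    pr_type q f h -> ent (umod G) h h' -> pr_type q f h' :=
  match q in path _ F G return forall (f : hom x (F z)) (h : hom t (G v)) (h' : hom t' (G v')),
    pr_type q f h -> ent (umod G) h h' -> pr_type q f h'
  with
  | pnil _ => fun _ _ _ s r => lact s r
  | pcons M q => fun f h h' s r => tt
  end f h h'.

Lemma wprod_snoc {F G : Fun} {q : mpath F G} {z v v' : D} {x t t' : E} {f : hom x (F z)}
    {h : hom t (G v)} {h' : hom t' (G v')} (u : word q f h) (r : ent (umod G) h h') :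
  pr_rel (wprod (wsnoc u r)) (pr_snoc (wprod u) r).
Proof.
  induction u; cbn [wsnoc wprod].
  - exact (esim_trans (ract_one _) (esim_sym (one_lact _))).
  - destruct q; [|exact I].
    exact (esim_trans (lact_cong (esim_refl _) (IHu _ r)) (esim_sym (lact_lact _ _ _))).
  - exact I.
Qed.

(** * Rows of multimodulations *)

Definition mmc {k : trans_kind} {F F' G H : Fun} {Ms : mpath F F'} {N : Mod G H}
    {α : Tr k F G} {β : Tr k F' H} (μ : multimodulation k F F' G H Ms N α β) :
    components Ms N (pt_core α) (pt_core β) := fun x y ms => mm_cell μ ms.

Lemma tr_gnat {k : trans_kind} {F G : Fun} (α : Tr k F G) : gnat (pt_core α).
Proof. destruct k; [apply lax_gnat .. | apply oplax_gnat]. Qed.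

Lemma mm_equivariant {k : trans_kind} {F F' G H : Fun} {Ms : mpath F F'} {N : Mod G H}
    {α : Tr k F G} {β : Tr k F' H} (μ : multimodulation k F F' G H Ms N α β) :
  equivariant (mmc μ).
Proof.
  destruct μ as [c K1 K2 K3 K4 K5].
  assert (Kg : globular c /\ gnat (pt_core α) /\ gnat (pt_core β)).
  { clear - K1; destruct k; cbn in K1.
    1-3: exact (conj (laxnat_globular c K1)
      (conj (lax_gnat (proj1_sig α)) (lax_gnat (proj1_sig β)))).
    exact (conj (oplaxnat_globular c K1)
      (conj (oplax_gnat (proj1_sig α)) (oplax_gnat (proj1_sig β)))). }
  destruct Kg as (Kg1 & Kg2 & Kg3).
  constructor; [exact Kg1 | exact Kg2 | exact Kg3 | exact (proj1 (left_iff _) K2)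
    | exact (proj1 (right_iff _) K3) | exact (proj1 (nullary_iff _) K4)
    | exact (proj1 (inner_iff _) K5)].
Qed.

Section Row.
Context {k : trans_kind}.
Notation row := (mcells (multimodulation k)).

(** A row without multicells is a transformation, which is applied to the product of the entries of
    functors. *)
Fixpoint rw {F' G' : Fun} {q : mpath F' G'} {F G : Fun} {f : Tr k F F'} {g : Tr k G G'}
    (μs : row q f g) : forall {z w : D} {x y : E} {φ : hom x (F z)} {ψ : hom y (G w)},
    word (msource _ μs) φ ψ -> word q (pt_core f z ∘ φ) (pt_core g w ∘ ψ) :=
  match μs in mcells _ q f g return forall (z w : D) (x y : E) (φ : hom x (_ z)) (ψ : hom y (_ w)),
    word (msource _ μs) φ ψ -> word q (pt_core f z ∘ φ) (pt_core g w ∘ ψ) with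
  | mnil _ f => fun z w x y φ ψ u =>
      wfun (tm (pt_core f) (wprod u : ent (umod _) φ ψ)) (wnil _)
  | mcons _ μ μs => fun z w x y φ ψ u =>
      match wsplit _ u with
      | sp u1 u2 => wmod (wev (mmc μ) u1) (rw μs u2)
      end
  end.

Definition rsp {F G F' G' H H' : Fun} {p : mpath F G} {N : Mod F' G'} {f : Tr k F F'}
    {g : Tr k G G'} {q : mpath G' H'} {h : Tr k H H'}
    (μ : multimodulation k F G F' G' p N f g) (μs : row q g h) {z w : D} {x y : E}
    {φ : hom x (F z)} {ψ : hom y (H w)} (s : SP p (msource _ μs) φ ψ) :
    word (pcons N q) (pt_core f z ∘ φ) (pt_core h w ∘ ψ) :=
  match s with sp u1 u2 => wmod (wev (mmc μ) u1) (rw μs u2) end.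

(** Moving an entry of a functor across a cut changes the value of the piece before by a right action, and
    that of the row after by an entry in front ([wev_snoc]); these are related as words. *)
Lemma rsp_sim {F G F' G' H H' : Fun} {p : mpath F G} {N : Mod F' G'} {f : Tr k F F'}
    {g : Tr k G G'} {q : mpath G' H'} {h : Tr k H H'}
    (μ : multimodulation k F G F' G' p N f g) (μs : row q g h) :
  (forall (z w : D) (x y : E) (φ : hom x (G z)) (ψ : hom y (H w)) (u v : word (msource _ μs) φ ψ),
     wsim u v -> wsim (rw μs u) (rw μs v)) ->
  (forall (z z' w : D) (x x' y : E) (φ : hom x (G z)) (φ' : hom x' (G z')) (ψ : hom y (H w))
     (p : ent (umod G) φ φ') (u : word (msource _ μs) φ' ψ),
     wsim (rw μs (wfun p u)) (wfun (tm (pt_core g) p) (rw μs u))) ->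
  forall {z w : D} {x y : E} {φ : hom x (F z)} {ψ : hom y (H w)} {s s' : SP p (msource _ μs) φ ψ},
  psim s s' -> wsim (rsp μ μs s) (rsp μ μs s').
Proof.
  intros IH1 IH2 z w x y φ ψ s s'; induction 1; cbn [rsp].
  - exact (ws_mod (wev_sim (mm_equivariant μ) H0) (IH1 _ _ _ _ _ _ _ _ H1)).
  - refine (ws_trans (ws_mod (wev_snoc u1 r (mm_equivariant μ)) (ws_refl _)) _).
    refine (ws_trans (ws_sym (ws_mf _ _ _)) (ws_mod (esim_refl _) _)).
    apply ws_sym, IH2.
  - apply ws_sym; assumption.
  - eapply ws_trans; eassumption.
Qed.

Lemma rw_sim_fun {F' G' : Fun} {q : mpath F' G'} {F G : Fun} {f : Tr k F F'} {g : Tr k G G'}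
    (μs : row q f g) :
  (forall (z w : D) (x y : E) (φ : hom x (F z)) (ψ : hom y (G w)) (u v : word (msource _ μs) φ ψ),
     wsim u v -> wsim (rw μs u) (rw μs v)) /\
  (forall (z z' w : D) (x x' y : E) (φ : hom x (F z)) (φ' : hom x' (F z')) (ψ : hom y (G w))
     (p : ent (umod F) φ φ') (u : word (msource _ μs) φ' ψ),
     wsim (rw μs (wfun p u)) (wfun (tm (pt_core f) p) (rw μs u))).
Proof.
  induction μs as [F F' f | F F' G G' H H' p N f g q h μ μs [IH1 IH2]].
  - pose proof (tr_gnat f) as Hf.
    split.
    + intros z w x y φ ψ u v Huv; exact (ws_fun (tm_cong _ Hf (wprod_sim Huv)) (ws_refl _)).
    + intros z z' w x x' y φ φ' ψ p u.
      refine (ws_trans (ws_fun (tm_lact (pt_core f) p (wprod u)) (ws_refl _)) (ws_sym (ws_ff _ _ _))).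
  - assert (K : forall (z w : D) (x y : E) (φ : hom x (F z)) (ψ : hom y (H w))
      (s s' : SP p (msource _ μs) φ ψ), psim s s' -> wsim (rsp μ μs s) (rsp μ μs s')).
    { intros z w x y φ ψ s s'; exact (rsp_sim μ μs IH1 IH2). }
    split.
    + intros z w x y φ ψ u v Huv; exact (K _ _ _ _ _ _ _ _ (wsplit_sim p Huv)).
    + intros z z' w x x' y φ φ' ψ r u.
      refine (ws_trans (K _ _ _ _ _ _ _ _ (wsplit_fun p r u)) _).
      cbn [rw]; set (s := wsplit p u); clearbody s; destruct s as [w' y' g' u1 u2]; cbn [rsp sp_fun].
      exact (ws_trans (ws_mod (wev_fun (eqv_src _ (mm_equivariant μ)) _ _) (ws_refl _))
        (ws_sym (ws_fm _ _ _))).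
Qed.

Lemma rw_sim {F' G' : Fun} {q : mpath F' G'} {F G : Fun} {f : Tr k F F'} {g : Tr k G G'}
    (μs : row q f g) {z w : D} {x y : E} {φ : hom x (F z)} {ψ : hom y (G w)}
    {u v : word (msource _ μs) φ ψ} : wsim u v -> wsim (rw μs u) (rw μs v).
Proof. apply rw_sim_fun. Qed.

Lemma rw_fun {F' G' : Fun} {q : mpath F' G'} {F G : Fun} {f : Tr k F F'} {g : Tr k G G'}
    (μs : row q f g) {z z' w : D} {x x' y : E} {φ : hom x (F z)} {φ' : hom x' (F z')}
    {ψ : hom y (G w)} (p : ent (umod F) φ φ') (u : word (msource _ μs) φ' ψ) :
  wsim (rw μs (wfun p u)) (wfun (tm (pt_core f) p) (rw μs u)).
Proof. apply rw_sim_fun. Qed.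

Lemma rw_snoc {F' G' : Fun} {q : mpath F' G'} {F G : Fun} {f : Tr k F F'} {g : Tr k G G'}
    (μs : row q f g) {z w v : D} {x y t : E} {φ : hom x (F z)} {ψ : hom y (G w)}
    {χ : hom t (G v)} (u : word (msource _ μs) φ ψ) (r : ent (umod G) ψ χ) :
  wsim (rw μs (wsnoc u r)) (wsnoc (rw μs u) (tm (pt_core g) r)).
Proof.
  revert z w v x y t φ ψ χ u r;
  induction μs as [F F' f | F F' G G' H H' p N f g q h μ μs IH]; intros z w v x y t φ ψ χ u r.
  - pose proof (tr_gnat f) as Hf.
    refine (ws_trans (ws_fun (tm_cong _ Hf (wprod_snoc u r)) (ws_refl _)) _).
    exact (ws_trans (ws_fun (tm_lact (pt_core f) (wprod u) r) (ws_refl _)) (ws_sym (ws_ff _ _ _))).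
  - cbn [msource] in u.
    change (wsim (rsp μ μs (wsplit p (wsnoc u r))) (wsnoc (rsp μ μs (wsplit p u)) (tm (pt_core h) r))).
    rewrite (wsplit_snoc p u r).
    destruct (wsplit p u) as [w' y' g' u1 u2]; cbn [sp_snoc wsnoc rsp].
    exact (ws_mod (esim_refl _) (IH _ _ _ _ _ _ _ _ _ u2 r)).
Qed.
End Row.

Definition ecast {F G : lax_functor D E} {N : module F G} {x y : E} {z w : D}
    {f f' : hom x (F z)} {g g' : hom y (G w)} (ef : f = f') (eg : g = g') (e : ent N f g) :
    ent N f' g' :=
  Ent (eX e) (en e) (eA e) (eB e) (ccast ef eg (ec e)).

Lemma ecast_esim {F G : lax_functor D E} {N : module F G} {x y : E} {z w : D}
    {f f' : hom x (F z)} {g g' : hom y (G w)} (ef : f = f') (eg : g = g') (e : ent N f g) :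
  ecast ef eg e ≃ e.
Proof. destruct ef, eg, e; apply esim_refl. Qed.

(** The value at entries has to come from a cell that depends on their indices only.  It is enough to
    compare with the generic entries of the same indices. *)
Definition represented {F F' G H : Fun} {p : mpath F F'} {N : Mod G H} {α : trans F G} {β : trans F' H}
    (e : forall (z w : D) (x y : E) (f : hom x (F z)) (g : hom y (F' w)), word p f g ->
      ent N (α z ∘ f) (β w ∘ g))
    {z w : D} {x y : E} {f : hom x (F z)} {g : hom y (F' w)} (Q : QC p f g) : Prop :=
  exists c : cell (α z) (β w) (msrc (projT1 Q)) (mpro N (mtot (projT1 Q))),
    cev c (ids (projT1 Q)) ≃ e _ _ _ _ _ _ (qword (ids (projT1 Q))) /\
    cev c (projT2 Q) ≃ e _ _ _ _ _ _ (qword (projT2 Q)).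

(** Components are chosen from the cells that represent the functional at generic entries; each of them
    represents it at all entries with the same indices.  Equivariance is [equivariant_of], and the
    value at a word is determined by the value at its normal form. *)
Lemma multimodulation_of {k : trans_kind} {F F' G H : Fun} {p : mpath F F'} {N : Mod G H} (α : Tr k F G)
    (β : Tr k F' H)
    (e : forall (z w : D) (x y : E) (f : hom x (F z)) (g : hom y (F' w)), word p f g ->
      ent N (pt_core α z ∘ f) (pt_core β w ∘ g)) :
  (forall z w x y (f : hom x (F z)) (g : hom y (F' w)) (Q : QC p f g), represented e Q) ->
  (forall z w x y (f : hom x (F z)) (g : hom y (F' w)) (s t : word p f g),
     wsim s t -> e _ _ _ _ _ _ s ≃ e _ _ _ _ _ _ t) ->
  (forall z z' w x x' y (f : hom x (F z)) (f' : hom x' (F z')) (g : hom y (F' w))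
     (a : ent (umod F) f f') (s : word p f' g),
     e _ _ _ _ _ _ (wfun a s) ≃ lact (tm (pt_core α) a) (e _ _ _ _ _ _ s)) ->
  (forall z w v x y t (f : hom x (F z)) (g : hom y (F' w)) (h : hom t (F' v)) (s : word p f g)
     (a : ent (umod F') g h),
     e _ _ _ _ _ _ (wsnoc s a) ≃ ract (e _ _ _ _ _ _ s) (tm (pt_core β) a)) ->
  (forall μ : components p N (pt_core α) (pt_core β),
     (forall z w x y (ms : dpath p z w) (f : hom x (F z)) (g : hom y (F' w)) (as_ : qc ms f g),
        ev μ as_ ≃ e _ _ _ _ _ _ (qword as_)) -> natural α β μ) ->
  exists μ : multimodulation k F F' G H p N α β,
    forall z w x y (f : hom x (F z)) (g : hom y (F' w)) (s : word p f g),
    wev (mmc μ) s ≃ e _ _ _ _ _ _ s.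
Proof.
  intros Hrep Hsim Hfun Hsnoc Hnat.
  (* The component at [ms] represents the functional at the generic entries of [ms]. *)
  pose (c := fun z w ms => proj1_sig (constructive_indefinite_description _ (Hrep z w _ _ _ _ (existT _ ms (ids ms))))).
  assert (Hc : forall z w x y (ms : dpath p z w) (f : hom x (F z)) (g : hom y (F' w)) (as_ : qc ms f g),
    ev (c : components p N (pt_core α) (pt_core β)) as_ ≃ e _ _ _ _ _ _ (qword as_)).
  { intros z w x y ms f g as_; destruct (Hrep z w _ _ _ _ (existT _ ms as_)) as (c0 & K1 & K2).
    refine (esim_trans (esim_of_sq _) K2); rewrite !to_sq_comp; f_equal.
    refine (esim_sq (A := mfl ms) (B := tfl ms) _).
    refine (esim_trans (esim_sym (cev_ids ms _)) (esim_trans _ (esim_trans (esim_sym K1) (cev_ids ms c0)))).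
    exact (proj1 (proj2_sig (constructive_indefinite_description _ (Hrep z w _ _ _ _ (existT _ ms (ids ms)))))). }
  destruct (equivariant_of c e (fun z w ms x y f g as_ => Hc z w x y ms f g as_) Hsim Hfun Hsnoc)
    as (K1 & K2 & K3 & K4).
  pose (μ := @Build_multimodulation D E PD PE k F F' G H p N α β c (Hnat c Hc)
    (proj2 (left_iff _) K1) (proj2 (right_iff _) K2) (proj2 (nullary_iff _) K3) (proj2 (inner_iff _) K4)).
  exists μ; intros z w x y f g s.
  destruct (word_nf s) as (z' & x' & f' & a & ms & as_ & K).
  refine (esim_trans (wev_sim (mm_equivariant μ) K) (esim_trans (wev_fun (tr_gnat α) _ _) _)).
  refine (esim_sym (esim_trans (Hsim _ _ _ _ _ _ _ _ K) (esim_trans (Hfun _ _ _ _ _ _ _ _ _ _ _) _))).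
  refine (lact_cong (esim_refl _) (esim_sym (esim_trans (wev_qword as_ (mmc μ)) (Hc _ _ _ _ _ _ _ as_)))).
Qed.

(** * Blocks *)

Fixpoint qapp {F G H : Fun} {p : mpath F G} {q : mpath G H} {z w v : D} {ms : dpath p z w}
    {ns : dpath q w v} {x y t : E} {f : hom x (F z)} {g : hom y (G w)} {h : hom t (H v)}
    (as_ : qc ms f g) : qc ns g h -> qc (dapp ms ns) f h :=
  match as_ in @qc F G p z w ms x y f g return
    forall (q : mpath G H) (ns : dpath q w v), qc ns g h -> qc (dapp ms ns) f h
  with
  | qnil f => fun q ns bs => bs
  | qcons a as_ => fun q ns bs => qcons a (qapp as_ bs)
  end q ns.

Lemma qapp_tens {F G H : Fun} {p : mpath F G} {q : mpath G H} {z w v : D} {ms : dpath p z w}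
    {ns : dpath q w v} {x y t : E} {f : hom x (F z)} {g : hom y (G w)} {h : hom t (H v)}
    (as_ : qc ms f g) (bs : qc ns g h) :
  exists φ, coh (qfl (qapp as_ bs)) (fl_tens (qfl as_) (qfl bs)) φ /\
    ⟦msrc_app ms ns⟧ ⋆ ⟦tens (qapp as_ bs)⟧
    = ⟦tens as_ ⊗ tens bs⟧ ⋆ ⟦φ⟧.
Proof.
  induction as_ as [F z x f | F G K M p z w u ms x y s f g k a as_ IH].
  - exists (luni (qsrc bs)); split; [apply coh_luni|].
    exact (sq_luni_nat (tens bs)).
  - destruct (IH _ _ bs) as (φ & H1 & H2).
    exists (associ (eX a) (qsrc as_) (qsrc bs) • (cid (eX a) ⊗ φ)); split.
    + exact (coh_comp (coh_associ _ _ _) (coh_tens (coh_id _) H1)).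
    + exact (sq_app_cons H2).
Qed.

Lemma qapp_qtfl {F G H : Fun} {p : mpath F G} {q : mpath G H} {z w v : D} {ms : dpath p z w}
    {ns : dpath q w v} {x y t : E} {f : hom x (F z)} {g : hom y (G w)} {h : hom t (H v)}
    (as_ : qc ms f g) (bs : qc ns g h) :
  coh (fl_tens (qtfl as_) (qtfl bs)) (qtfl (qapp as_ bs)) (mtot_app ms ns).
Proof.
  induction as_ as [F z x f | F G K M p z w u ms x y s f g k a as_ IH].
  - apply coh_lun.
  - exact (coh_comp (coh_tens (coh_id _) (IH _ _ bs)) (coh_assoc _ _ _)).
Qed.

Lemma ids_dapp {F G H : Fun} {p : mpath F G} {q : mpath G H} {z w v : D} (ms : dpath p z w)
    (ns : dpath q w v) : ids (dapp ms ns) = qapp (ids ms) (ids ns).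
Proof.
  induction ms; cbn [ids dapp qapp]; [reflexivity | rewrite IHms; reflexivity].
Qed.

(** Matching on composable entries is possible only over a variable path, so inversion is proved once for
    each shape of a path. *)
Definition qc_uncons {F G H : Fun} {M : Mod F G} {q : mpath G H} {z v : D} {x t : E}
    {f : hom x (F z)} {h : hom t (H v)} (Q : QC (pcons M q) f h) :
  exists (w : D) (y : E) (g : hom y (G w)) (a : ent M f g) (Q' : QC q g h), Q = QCcons a Q'.
Proof.
  destruct Q as [ms as_].
  refine (match as_ as as_ in @qc F G q z w ms x y f g return
    match q as q in path _ F G return forall (z w : D) (ms : dpath q z w) (x y : E)
      (f : hom x (F z)) (g : hom y (G w)), qc ms f g -> Prop
    with
    | pnil _ => fun _ _ _ _ _ _ _ _ => True
    | pcons M q => fun z w ms x y f g as_ => exists w' y' g' (a : ent M f g')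
        (Q' : QC q g' g), existT _ ms as_ = QCcons a Q'
    end z w ms x y f g as_
  with
  | qnil f => I
  | qcons a as_ => _
  end).
  exists _, _, _, a, (existT (fun ms => qc ms _ _) _ as_); reflexivity.
Qed.

Definition QCapp {F G H : Fun} {p : mpath F G} {q : mpath G H} {z w v : D}
    {x y t : E} {f : hom x (F z)} {g : hom y (G w)} {h : hom t (H v)} (Q : QC p f g)
    (Q' : QC q g h) : QC (papp p q) f h :=
  existT _ (dapp (projT1 Q) (projT1 Q')) (qapp (projT2 Q) (projT2 Q')).

Lemma qc_unapp {F G H : Fun} (p : mpath F G) {q : mpath G H} {z v : D} {x t : E}
    {f : hom x (F z)} {h : hom t (H v)} (Q : QC (papp p q) f h) :
  exists (w : D) (y : E) (g : hom y (G w)) (Q1 : QC p f g) (Q2 : QC q g h), Q = QCapp Q1 Q2.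
Proof.
  revert z x f Q; induction p as [F | F G1 G M p IH]; intros z x f Q.
  - exists _, _, f, (existT _ (dnil _) (qnil f)), Q; destruct Q; reflexivity.
  - destruct (qc_uncons Q) as (w & y & g & a & Q' & ->).
    destruct (IH _ _ _ _ Q') as (w' & y' & g' & Q1 & Q2 & ->).
    exists w', y', g', (QCcons a Q1), Q2; reflexivity.
Qed.

Lemma qc_nil_ind {F : Fun}
    (P : forall (z w : D) (x y : E) (f : hom x (F z)) (g : hom y (F w)), QC (pnil F) f g -> Prop) :
  (forall z x (f : hom x (F z)), P _ _ _ _ f f (existT _ (dnil z) (qnil f))) ->
  forall z w x y f g (Q : QC (pnil F) f g), P z w x y f g Q.
Proof.
  intros K z w x y f g [ms as_]; revert P K.
  refine (match as_ as as_ in @qc F G q z w ms x y f g return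
    match q as q in path _ F G return forall (z w : D) (ms : dpath q z w) (x y : E)
      (f : hom x (F z)) (g : hom y (G w)), qc ms f g -> Prop
    with
    | pnil F => fun z w ms x y f g as_ => forall
        (P : forall (z w : D) (x y : E) (f : hom x (F z)) (g : hom y (F w)),
          QC (pnil F) f g -> Prop),
        (forall z x (f : hom x (F z)), P _ _ _ _ f f (existT _ (dnil z) (qnil f))) ->
        P z w x y f g (existT _ ms as_)
    | pcons M q => fun z w ms x y f g as_ => True
    end z w ms x y f g as_
  with
  | qnil f => fun P K => K _ _ f
  | qcons a as_ => I
  end).
Qed.

Section Row.
Context {k : trans_kind}.
Notation row := (mcells (multimodulation k)).

Inductive qbl : forall {F' G' : Fun} {q : mpath F' G'} {F G : Fun} {f : Tr k F F'} {g : Tr k G G'}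
    {μs : row q f g} {z w : D} (bs : blocks μs z w) {x y : E} (φ : hom x (F z)) (ψ : hom y (G w)),
    Type :=
| qbnil : forall {F F' : Fun} (f : Tr k F F') {z : D} {x : E} (φ : hom x (F z)),
    qbl (bnil f z) φ φ
| qbcons : forall {F F' G G' H H' : Fun} {p : mpath F G} {N : Mod F' G'}
    {f : Tr k F F'} {g : Tr k G G'} {q : mpath G' H'}
    {h : Tr k H H'} (μ : multimodulation k F G F' G' p N f g) {μs : row q g h}
    {z w v : D} {ms : dpath p z w} {bs : blocks μs w v} {x y t : E} {φ : hom x (F z)}
    {ψ : hom y (G w)} {χ : hom t (H v)},
    qc ms φ ψ -> qbl bs ψ χ -> qbl (bcons μ ms bs) φ χ.

Fixpoint qbflat {F' G' : Fun} {q : mpath F' G'} {F G : Fun} {f : Tr k F F'} {g : Tr k G G'}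
    {μs : row q f g} {z w : D} {bs : blocks μs z w} {x y : E} {φ : hom x (F z)} {ψ : hom y (G w)}
    (qb : qbl bs φ ψ) : qc (bflat bs) φ ψ :=
  match qb with
  | qbnil f φ => qnil φ
  | qbcons μ as_ qb => qapp as_ (qbflat qb)
  end.

Fixpoint qbouter {F' G' : Fun} {q : mpath F' G'} {F G : Fun} {f : Tr k F F'} {g : Tr k G G'}
    {μs : row q f g} {z w : D} {bs : blocks μs z w} {x y : E} {φ : hom x (F z)} {ψ : hom y (G w)}
    (qb : qbl bs φ ψ) : qc (bouter bs) (pt_core f z ∘ φ) (pt_core g w ∘ ψ) :=
  match qb with
  | @qbnil F F' f z x φ => qnil (pt_core f z ∘ φ)
  | qbcons μ as_ qb => qcons (ev (mmc μ) as_) (qbouter qb)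
  end.

Lemma qb_tens {F' G' : Fun} {q : mpath F' G'} {F G : Fun} {f : Tr k F F'} {g : Tr k G G'}
    {μs : row q f g} {z w : D} {bs : blocks μs z w} {x y : E} {φ : hom x (F z)} {ψ : hom y (G w)}
    (qb : qbl bs φ ψ) :
  exists ξ, coh (qfl (qbflat qb)) (qfl (qbouter qb)) ξ /\
    ⟦btens bs⟧ ⋆ (⟦bsplit bs⟧ ⋆ ⟦tens (qbflat qb)⟧)
    = ⟦tens (qbouter qb)⟧ ⋆ ⟦ξ⟧.
Proof.
  induction qb as [F F' f z x φ | F F' G G' H H' p N f g q h μ μs z w v ms bs x y t φ ψ χ as_ qb
    (ξ & H1 & H2)].
  - exists (cid (punit x)); split; [apply coh_id|].
    cbn; rewrite (sq_comp_idl HE), (sq_comp_idr HE), <- to_sq_comp, <- (cunit_comp _ HE); reflexivity.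
  - destruct (qapp_tens as_ (qbflat qb)) as (ζ & K1 & K2).
    exists ((cid (qsrc as_) ⊗ ξ) • ζ); split.
    + exact (coh_comp (coh_tens (coh_id _) H1) K1).
    + exact (sq_block K2 H2).
Qed.

Lemma qb_qtfl {F' G' : Fun} {q : mpath F' G'} {F G : Fun} {f : Tr k F F'} {g : Tr k G G'}
    {μs : row q f g} {z w : D} {bs : blocks μs z w} {x y : E} {φ : hom x (F z)} {ψ : hom y (G w)}
    (qb : qbl bs φ ψ) : coh (qtfl (qbouter qb)) (qtfl (qbflat qb)) (bjoin bs).
Proof.
  induction qb.
  - apply coh_id.
  - exact (coh_comp (qapp_qtfl _ _) (coh_tens (coh_id _) IHqb)).
Qed.

(** The pasting formula for composites, evaluated at grouped entries: the coherence isomorphisms of the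
    formula match the flattenings, so what remains is to evaluate each block and then [ν]. *)
Lemma pasting_ev {F G F' G' F'' G'' : Fun} {q : mpath F' G'} {N : Mod F'' G''}
    {f : Tr k F F'} {g : Tr k G G'} {u : Tr k F' F''} {v : Tr k G' G''} {μs : row q f g}
    (ν : multimodulation k F' G' F'' G'' q N u v) {z w : D} {bs : blocks μs z w} {a : hom (F z) (F'' z)}
    {b : hom (G w) (G'' w)} (c : cell a b (msrc (bflat bs)) (mpro N (mtot (bflat bs))))
    {x y : E} {φ : hom x (F z)} {ψ : hom y (G w)} (qb : qbl bs φ ψ) :
  c ≈ mcell N (bjoin bs) ∙ mm_cell ν (bouter bs) ∙ btens bs ∙ bsplit bs ->
  cev c (qbflat qb) ≃ ev (mmc ν) (qbouter qb).
Proof.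
  intros K; destruct (qb_tens qb) as (ξ & H1 & H2).
  apply esim_sym; destruct (coh_inv H1) as (ζ & Z1 & Z2 & Z3).
  exists ζ, (bjoin bs); split; [exact Z1|]; split; [apply qb_qtfl|].
  assert (L : ⟦btens bs⟧ ⋆ (⟦bsplit bs⟧ ⋆
    (⟦tens (qbflat qb)⟧ ⋆ ⟦ζ⟧)) = ⟦tens (qbouter qb)⟧).
  { rewrite (sq_comp_assoc HE ⟦bsplit bs⟧), (sq_comp_assoc HE ⟦btens bs⟧), H2,
      <- (sq_comp_assoc HE), <- sq_gcomp, Z3, (sq_comp_idr HE); reflexivity. }
  cbn; rewrite !to_sq_comp, <- L, (sq_of_ceq K), !to_sq_comp, <- !(sq_comp_assoc HE); reflexivity.
Qed.

Lemma wsplit_qapp {F G H : Fun} {p : mpath F G} {q : mpath G H} {z w v : D} {ms : dpath p z w}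
    {ns : dpath q w v} {x y t : E} {f : hom x (F z)} {g : hom y (G w)} {h : hom t (H v)}
    (as_ : qc ms f g) (bs : qc ns g h) :
  wsplit p (qword (qapp as_ bs)) = sp (qword as_) (qword bs).
Proof.
  induction as_; [reflexivity|].
  cbn [qapp qword wsplit papp whead]; rewrite IHas_; reflexivity.
Qed.

Lemma rw_qb {F' G' : Fun} {q : mpath F' G'} {F G : Fun} {f : Tr k F F'} {g : Tr k G G'}
    {μs : row q f g} {z w : D} {bs : blocks μs z w} {x y : E} {φ : hom x (F z)} {ψ : hom y (G w)}
    (qb : qbl bs φ ψ) : wsim (rw μs (qword (qbflat qb))) (qword (qbouter qb)).
Proof.
  induction qb as [F F' f z x φ | F F' G G' H H' p N f g q h μ μs z w v ms bs x y t φ ψ χ as_ qb IH].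
  - pose proof (tr_gnat f) as Hf.
    exact (ws_trans (ws_fun (tm_one (pt_core f) φ) (ws_refl _)) (ws_one _)).
  - change (wsim (rsp μ μs (wsplit p (qword (qapp as_ (qbflat qb))))) (qword (qbouter (qbcons μ as_ qb)))).
    rewrite (wsplit_qapp as_ (qbflat qb)); exact (ws_mod (wev_qword as_ (mmc μ)) IH).
Qed.

Lemma qb_surj {F' G' : Fun} {q : mpath F' G'} {F G : Fun} {f : Tr k F F'} {g : Tr k G G'}
    (μs : row q f g) {z w : D} {x y : E} {φ : hom x (F z)} {ψ : hom y (G w)}
    (Q : QC (msource _ μs) φ ψ) :
  exists (bs : blocks μs z w) (qb : qbl bs φ ψ), Q = existT _ (bflat bs) (qbflat qb).
Proof.
  revert z w x y φ ψ Q; induction μs as [F F' f | F F' G G' H H' p N f g q h μ μs IH];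
    intros z w x y φ ψ Q.
  - revert z w x y φ ψ Q; apply (qc_nil_ind (fun z w x y φ ψ Q =>
      exists (bs : blocks (mnil _ f) z w) (qb : qbl bs φ ψ), Q = existT _ (bflat bs) (qbflat qb))).
    intros z x φ; exists (bnil f z), (qbnil f φ); reflexivity.
  - destruct (qc_unapp p Q) as (w' & y' & g' & [ms as_] & Q2 & ->).
    destruct (IH _ _ _ _ _ _ Q2) as (bs & qb & ->).
    exists (bcons μ ms bs), (qbcons μ as_ qb); reflexivity.
Qed.

Fixpoint qbids {F' G' : Fun} {q : mpath F' G'} {F G : Fun} {f : Tr k F F'} {g : Tr k G G'}
    {μs : row q f g} {z w : D} (bs : blocks μs z w) : qbl bs (idh (F z)) (idh (G w)) :=
  match bs with
  | @bnil _ _ _ _ _ F F' f z => qbnil f (idh (F z))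
  | bcons μ ms bs => qbcons μ (ids ms) (qbids bs)
  end.

Lemma qbflat_qbids {F' G' : Fun} {q : mpath F' G'} {F G : Fun} {f : Tr k F F'} {g : Tr k G G'}
    {μs : row q f g} {z w : D} (bs : blocks μs z w) : qbflat (qbids bs) = ids (bflat bs).
Proof.
  induction bs; [reflexivity|].
  cbn [qbids qbflat bflat]; rewrite IHbs; symmetry; apply ids_dapp.
Qed.
End Row.

(** * Naturality of composites *)

Fixpoint dcapp {F G H : Fun} {p : mpath F G} {q : mpath G H} {z w v z' w' v' : D}
    {ms1 : dpath p z w} {ns1 : dpath p z' w'} {ms2 : dpath q w v} {ns2 : dpath q w' v'}
    {c : hom z z'} {d : hom w w'} {e : hom v v'} (γ1 : dcells ms1 ns1 c d) :
    dcells ms2 ns2 d e -> dcells (dapp ms1 ms2) (dapp ns1 ns2) c e :=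
  match γ1 in @dcells _ _ _ _ F G p z w z' w' ms1 ns1 c d return
    forall (q : mpath G H) (ms2 : dpath q w v) (ns2 : dpath q w' v'),
    dcells ms2 ns2 d e -> dcells (dapp ms1 ms2) (dapp ns1 ns2) c e
  with
  | dcnil c => fun q ms2 ns2 γ2 => γ2
  | dccons γ γ1 => fun q ms2 ns2 γ2 => dccons γ (dcapp γ1 γ2)
  end q ms2 ns2.

Lemma vsim_dcapp {F G H : Fun} {p : mpath F G} {q : mpath G H} {z w v z' w' v' : D}
    {ms1 : dpath p z w} {ns1 : dpath p z' w'} {ms2 : dpath q w v} {ns2 : dpath q w' v'}
    {c : hom z z'} {d : hom w w'} {e : hom v v'} (γ1 : dcells ms1 ns1 c d) (γ2 : dcells ms2 ns2 d e)
    {x y t x' y' t' : E} {f g h f' g' h'} (as1 : qc ms1 (x := x) (y := y) f g)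
    (as2 : qc ms2 (y := t) g h) (as1' : qc ns1 (x := x') (y := y') f' g') (as2' : qc ns2 (y := t') g' h') :
  vsim (qtfl (qapp as1 as2)) (qtfl (qapp as1' as2')) (mtot_cell (dcapp γ1 γ2))
    (fl_tens (qtfl as1) (qtfl as2)) (fl_tens (qtfl as1') (qtfl as2')) (mtot_cell γ1 ⊗ mtot_cell γ2).
Proof.
  apply vsim_sym; exists (mtot_app ms1 ms2), (mtot_app ns1 ns2).
  split; [apply qapp_qtfl|]; split; [apply qapp_qtfl|].
  clear; induction γ1 as [F z z' c | F G K M p z w u z' w' u' m m' ms ns c d f γ γ1 IH].
  - apply sq_lun_nat.
  - exact (snoc_cons_tens (IH _ _ _ γ2)).
Qed.

Lemma vqc_uncons_ind {F G H : Fun} {M : Mod F G} {q : mpath G H} {z v z' v' : D} {x t : E}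
    {c : hom z z'} {e : hom v v'} {f : hom x (F z)} {h : hom t (H v)}
    (P : forall (ms : dpath (pcons M q) z v) (ns : dpath (pcons M q) z' v'),
      qc ms f h -> dcells ms ns c e -> qc ns (lhom F c ∘ f) (lhom H e ∘ h) -> Prop) :
  (forall (w w' : D) (y : E) (d : hom w w') (g : hom y (G w)) (a : ent M f g) (n : pro z' w') (B : fl n)
     (γ : cell c d (en a) n) (ms : dpath q w v) (ns : dpath q w' v') (as_ : qc ms g h)
     (γs : dcells ms ns d e) (as' : qc ns (lhom G d ∘ g) (lhom H e ∘ h)), vqc as_ γs as' ->
     P (dcons (en a) ms) (dcons n ns) (qcons a as_) (dccons γ γs) (qcons (vp a B γ) as')) ->
  forall ms ns as_ γs as', vqc as_ γs as' -> P ms ns as_ γs as'.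
Proof.
  intros K ms ns as_ γs as' V; revert P K.
  refine (match V in @vqc F G q z w z' w' x y ms ns u v f g as_ γs as' return
    match q as q in path _ F G return forall (z w z' w' : D) (x y : E) (ms : dpath q z w)
      (ns : dpath q z' w') (u : hom z z') (v : hom w w') (f : hom x (F z)) (g : hom y (G w))
      (as_ : qc ms f g) (γs : dcells ms ns u v) (as' : qc ns (lhom F u ∘ f) (lhom G v ∘ g)), Prop
    with
    | pnil _ => fun _ _ _ _ _ _ _ _ _ _ _ _ _ _ _ => True
    | @pcons _ _ F G H M q => fun z v z' v' x t ms ns c e f h as_ γs as' => forall
    (P : forall (ms : dpath (pcons M q) z v) (ns : dpath (pcons M q) z' v'),
      qc ms f h -> dcells ms ns c e -> qc ns (lhom F c ∘ f) (lhom H e ∘ h) -> Prop),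
  (forall (w w' : D) (y : E) (d : hom w w') (g : hom y (G w)) (a : ent M f g) (n : pro z' w') (B : fl n)
     (γ : cell c d (en a) n) (ms : dpath q w v) (ns : dpath q w' v') (as_ : qc ms g h)
     (γs : dcells ms ns d e) (as' : qc ns (lhom G d ∘ g) (lhom H e ∘ h)), vqc as_ γs as' ->
     P (dcons (en a) ms) (dcons n ns) (qcons a as_) (dccons γ γs) (qcons (vp a B γ) as')) ->
    P ms ns as_ γs as'
    end z w z' w' x y ms ns u v f g as_ γs as'
  with
  | vq_nil f u => I
  | vq_cons a B γ V => fun P K => K _ _ _ _ _ a _ B γ _ _ _ _ _ V
  end).
Qed.

Lemma vqc_nil_ind {F : Fun}
    (P : forall (z w z' w' : D) (x y : E) (ms : dpath (pnil F) z w) (ns : dpath (pnil F) z' w')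
      (c : hom z z') (e : hom w w') (f : hom x (F z)) (h : hom y (F w)),
      qc ms f h -> dcells ms ns c e -> qc ns (lhom F c ∘ f) (lhom F e ∘ h) -> Prop) :
  (forall (z z' : D) (x : E) (c : hom z z') (f : hom x (F z)),
    P _ _ _ _ _ _ _ _ c c f f (qnil f) (dcnil c) (qnil (lhom F c ∘ f))) ->
  forall z w z' w' x y ms ns c e f h as_ γs as', vqc as_ γs as' ->
    P z w z' w' x y ms ns c e f h as_ γs as'.
Proof.
  intros K z w z' w' x y ms ns c e f h as_ γs as' V; revert P K.
  refine (match V in @vqc F G q z w z' w' x y ms ns u v f g as_ γs as' return
    match q as q in path _ F G return forall (z w z' w' : D) (x y : E) (ms : dpath q z w)
      (ns : dpath q z' w') (u : hom z z') (v : hom w w') (f : hom x (F z)) (g : hom y (G w))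
      (as_ : qc ms f g) (γs : dcells ms ns u v) (as' : qc ns (lhom F u ∘ f) (lhom G v ∘ g)), Prop
    with
    | pnil F => fun z w z' w' x y ms ns c e f h as_ γs as' => forall
    (P : forall (z w z' w' : D) (x y : E) (ms : dpath (pnil F) z w) (ns : dpath (pnil F) z' w')
      (c : hom z z') (e : hom w w') (f : hom x (F z)) (h : hom y (F w)),
      qc ms f h -> dcells ms ns c e -> qc ns (lhom F c ∘ f) (lhom F e ∘ h) -> Prop),
  (forall (z z' : D) (x : E) (c : hom z z') (f : hom x (F z)),
    P _ _ _ _ _ _ _ _ c c f f (qnil f) (dcnil c) (qnil (lhom F c ∘ f))) ->
    P z w z' w' x y ms ns c e f h as_ γs as'
    | pcons M q => fun _ _ _ _ _ _ _ _ _ _ _ _ _ _ _ => True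
    end z w z' w' x y ms ns u v f g as_ γs as'
  with
  | vq_nil f u => fun P K => K _ _ _ u f
  | vq_cons a B γ V => I
  end).
Qed.

Lemma vqc_unapp_ind {F G H : Fun} (p : mpath F G) {q : mpath G H} {z v z' v' : D} {x t : E}
    {c : hom z z'} {e : hom v v'} {f : hom x (F z)} {h : hom t (H v)}
    (P : forall (ms : dpath (papp p q) z v) (ns : dpath (papp p q) z' v'),
      qc ms f h -> dcells ms ns c e -> qc ns (lhom F c ∘ f) (lhom H e ∘ h) -> Prop) :
  (forall (w w' : D) (y : E) (d : hom w w') (g : hom y (G w)) (ms1 : dpath p z w) (ns1 : dpath p z' w')
     (as1 : qc ms1 f g) (γ1 : dcells ms1 ns1 c d) (as1' : qc ns1 (lhom F c ∘ f) (lhom G d ∘ g))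
     (ms : dpath q w v) (ns : dpath q w' v') (as_ : qc ms g h)
     (γs : dcells ms ns d e) (as' : qc ns (lhom G d ∘ g) (lhom H e ∘ h)),
     vqc as1 γ1 as1' -> vqc as_ γs as' ->
     P (dapp ms1 ms) (dapp ns1 ns) (qapp as1 as_) (dcapp γ1 γs) (qapp as1' as')) ->
  forall ms ns as_ γs as', vqc as_ γs as' -> P ms ns as_ γs as'.
Proof.
  revert z z' x c f P; induction p as [F | F G1 G M p IH]; intros z z' x c f P K ms ns as_ γs as' V.
  - exact (K _ _ _ _ _ _ _ _ _ _ _ _ _ _ _ (vq_nil f c) V).
  - revert ms ns as_ γs as' V; apply (vqc_uncons_ind (q := papp p q)).
    intros w w' y d g a n B γ ms ns as_ γs as' V.
    refine (IH _ _ _ _ _ _ (fun ms ns as_ γs as' =>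
      P (dcons (en a) ms) (dcons n ns) (qcons a as_) (dccons γ γs) (qcons (vp a B γ) as'))
      _ _ _ _ _ _ V).
    intros; exact (K _ _ _ _ _ _ _ _ _ _ _ _ _ _ _ (vq_cons a B γ H0) H1).
Qed.

Section Row.
Context {k : trans_kind}.
Notation row := (mcells (multimodulation k)).

(** A cell acts on the entries of a word, and after evaluation of the row it acts on the entries of the outer
    word.  The two resulting families at the bottom, [s] and [b'], agree only up to comparison
    entries of the arrows. *)
Record outer_square {F' G' : Fun} {q : mpath F' G'} {F G : Fun} {f : Tr k F F'} {g : Tr k G G'}
    (μs : row q f g) {z w z' w' : D} {x y : E} {ms : dpath (msource _ μs) z w}
    {ns : dpath (msource _ μs) z' w'} {c : hom z z'} {e : hom w w'} {φ : hom x (F z)}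
    {ψ : hom y (G w)} (as_ : qc ms φ ψ) (γs : dcells ms ns c e)
    (as' : qc ns (lhom F c ∘ φ) (lhom G e ∘ ψ))
    {mo : dpath q z w} {no no' : dpath q z' w'}
    (b : qc mo (pt_core f z ∘ φ) (pt_core g w ∘ ψ)) (γo : dcells mo no c e)
    (s : qc no (lhom F' c ∘ (pt_core f z ∘ φ)) (lhom G' e ∘ (pt_core g w ∘ ψ)))
    (b' : qc no' (pt_core f z' ∘ (lhom F c ∘ φ)) (pt_core g w' ∘ (lhom G e ∘ ψ))) : Prop := {
  os_top : wsim (rw μs (qword as_)) (qword b);
  os_bot : wsim (rw μs (qword as')) (qword b');
  os_vqc : vqc b γo s;
  os_coh : vsim (qtfl as_) (qtfl as') (mtot_cell γs) (qtfl b) (qtfl s) (mtot_cell γo)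
}.

(** [sl] stands for the relation between the families [s] and [b'] of [outer_square]; it is built one
    multicell at a time. *)
Section Slide.
Context (sl : forall {F G F' G' : Fun} {q : mpath F' G'} (f : Tr k F F') (g : Tr k G G')
  {z w z' w' : D} {x y : E} (c : hom z z') (e : hom w w') (φ : hom x (F z)) (ψ : hom y (G w))
  {no no' : dpath q z' w'}, qc no (lhom F' c ∘ (pt_core f z ∘ φ)) (lhom G' e ∘ (pt_core g w ∘ ψ)) ->
  qc no' (pt_core f z' ∘ (lhom F c ∘ φ)) (pt_core g w' ∘ (lhom G e ∘ ψ)) -> Prop).
Context (sl_nil : forall {F F' : Fun} (f : Tr k F F') {z z' : D} {x : E} (c : hom z z')
  (φ : hom x (F z)), sl _ _ _ _ _ f f _ _ _ _ _ _ c c φ φ _ _ (qnil _) (qnil _)).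
Context (sl_cons : forall {F G H F' G' H' : Fun} {p : mpath F G} {N : Mod F' G'} {q : mpath G' H'}
  (f : Tr k F F') (g : Tr k G G') (h : Tr k H H') (μ : multimodulation k F G F' G' p N f g)
  {z w v z' w' v' : D} {x y t : E} (c : hom z z') (d : hom w w') (e : hom v v')
  (φ : hom x (F z)) (χ : hom y (G w)) (ψ : hom t (H v)) {ms : dpath p z w} {ns : dpath p z' w'}
  (as_ : qc ms φ χ) (γs : dcells ms ns c d) (as' : qc ns (lhom F c ∘ φ) (lhom G d ∘ χ))
  {no no' : dpath q w' v'} (s : qc no _ _) (b' : qc no' _ _), vqc as_ γs as' ->
  sl _ _ _ _ _ g h _ _ _ _ _ _ d e χ ψ _ _ s b' ->
  sl _ _ _ _ _ f h _ _ _ _ _ _ c e φ ψ _ _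
    (qcons (vp (ev (mmc μ) as_) (qtfl as') (mtot_cell γs)) s) (qcons (ev (mmc μ) as') b')).

Lemma row_slide {F' G' : Fun} {q : mpath F' G'} {F G : Fun} {f : Tr k F F'} {g : Tr k G G'}
    (μs : row q f g) {z w z' w' : D} {x y : E} {ms : dpath (msource _ μs) z w}
    {ns : dpath (msource _ μs) z' w'} {c : hom z z'} {e : hom w w'} {φ : hom x (F z)}
    {ψ : hom y (G w)} (as_ : qc ms φ ψ) (γs : dcells ms ns c e)
    (as' : qc ns (lhom F c ∘ φ) (lhom G e ∘ ψ)) : vqc as_ γs as' ->
  exists mo no no' b γo s b', outer_square μs as_ γs as' (mo := mo) (no := no) (no' := no') b γo s b' /\
    sl _ _ _ _ _ f g _ _ _ _ _ _ c e φ ψ _ _ s b'.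
Proof.
  revert z w z' w' x y ms ns c e φ ψ as_ γs as';
    induction μs as [F F' f | F F' G G' H H' p N f g q h μ μs IH].
  - apply (vqc_nil_ind (fun z w z' w' x y ms ns c e φ ψ as_ γs as' =>
      exists mo no no' b γo s b',
        outer_square (mnil _ f) as_ γs as' (mo := mo) (no := no) (no' := no') b γo s b' /\
        sl _ _ _ _ _ f f _ _ _ _ _ _ c e φ ψ _ _ s b')).
    intros z z' x c φ.
    exists (dnil z), (dnil z'), (dnil z'), (qnil _), (dcnil c), (qnil _), (qnil _).
    split; [|apply sl_nil].
    constructor.
    + exact (rw_qb (qbnil f φ)).
    + exact (rw_qb (qbnil f (lhom F c ∘ φ))).
    + apply vq_nil.
    + apply vsim_refl.
  - intros z v z' v' x t ms ns c e φ ψ.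
    revert ms ns; apply (vqc_unapp_ind p (q := msource _ μs)
      (fun ms ns as_ γs as' => exists mo no no' b γo s b',
        outer_square (mcons _ μ μs) as_ γs as' (mo := mo) (no := no) (no' := no') b γo s b' /\
        sl _ _ _ _ _ f h _ _ _ _ _ _ c e φ ψ _ _ s b')).
    intros w w' y d χ ms1 ns1 as1 γ1 as1' ms ns as_ γs as' V1 V.
    destruct (IH _ _ _ _ _ _ _ _ _ _ _ _ _ _ _ V)
      as (mo & no & no' & b & γo & s & b' & [O1 O2 O3 O4] & O7).
    exists (dcons (mtot ms1) mo), (dcons (mtot ns1) no), (dcons (mtot ns1) no'),
      (qcons (ev (mmc μ) as1) b), (dccons (mtot_cell γ1) γo),
      (qcons (vp (ev (mmc μ) as1) (qtfl as1') (mtot_cell γ1)) s), (qcons (ev (mmc μ) as1') b').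
    split.
    + constructor.
      * change (wsim (rsp μ μs (wsplit p (qword (qapp as1 as_)))) (qword (qcons (ev (mmc μ) as1) b))).
        rewrite (wsplit_qapp as1 as_); exact (ws_mod (wev_qword as1 (mmc μ)) O1).
      * change (wsim (rsp μ μs (wsplit p (qword (qapp as1' as')))) (qword (qcons (ev (mmc μ) as1') b'))).
        rewrite (wsplit_qapp as1' as'); exact (ws_mod (wev_qword as1' (mmc μ)) O2).
      * exact (vq_cons (ev (mmc μ) as1) (qtfl as1') (mtot_cell γ1) O3).
      * exact (vsim_trans (vsim_dcapp γ1 γs as1 as_ as1' as') (vsim_tens (vsim_refl _ _ _) O4)).
    + exact (sl_cons _ _ _ _ _ _ _ _ _ f g h μ _ _ _ _ _ _ _ _ _ c d e φ χ ψ _ _ as1 γ1 as1' _ _ s b' V1 O7).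
Qed.
End Slide.

(** Naturality of one multimodulation exchanges its right comparison for its left one, and the latter is
    the right comparison of its predecessor up to absorption.  So a comparison entry passes from the end
    of the row to its beginning. *)
Lemma row_lax (cm : forall {F G : Fun} (f : Tr k F G) {x : E} {z w : D} (c : hom z w) (φ : hom x (F z)),
    ent (umod G) (lhom G c ∘ (pt_core f z ∘ φ)) (pt_core f w ∘ (lhom F c ∘ φ)))
  (Hcm : forall {F F' G H : Fun} {p : mpath F F'} {N : Mod G H} {α : Tr k F G} {β : Tr k F' H}
    (μ : multimodulation k F F' G H p N α β) {z w z' w' : D} {x y : E} {ms : dpath p z w}
    {ns : dpath p z' w'} {c : hom z z'} {e : hom w w'} {φ : hom x (F z)} {ψ : hom y (F' w)}
    (as_ : qc ms φ ψ) (γs : dcells ms ns c e) (as' : qc ns (lhom F c ∘ φ) (lhom F' e ∘ ψ)),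
    vqc as_ γs as' ->
    ract (vp (ev (mmc μ) as_) (qtfl as') (mtot_cell γs)) (@cm _ _ β _ _ _ e ψ)
      ≃ lact (@cm _ _ α _ _ _ c φ) (ev (mmc μ) as'))
  {F' G' : Fun} {q : mpath F' G'} {F G : Fun} {f : Tr k F F'} {g : Tr k G G'}
  (μs : row q f g) {z w z' w' : D} {x y : E} {ms : dpath (msource _ μs) z w}
  {ns : dpath (msource _ μs) z' w'} {c : hom z z'} {e : hom w w'} {φ : hom x (F z)}
  {ψ : hom y (G w)} (as_ : qc ms φ ψ) (γs : dcells ms ns c e)
  (as' : qc ns (lhom F c ∘ φ) (lhom G e ∘ ψ)) : vqc as_ γs as' ->
  exists mo no no' b γo s b', outer_square μs as_ γs as' (mo := mo) (no := no) (no' := no') b γo s b' /\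
    wsim (wfun (@cm _ _ f _ _ _ c φ) (qword b')) (wsnoc (qword s) (@cm _ _ g _ _ _ e ψ)).
Proof.
  apply (row_slide (fun F G F' G' q f g z w z' w' x y c e φ ψ no no' s b' =>
    wsim (wfun (@cm _ _ f _ _ _ c φ) (qword b')) (wsnoc (qword s) (@cm _ _ g _ _ _ e ψ)))).
  - intros; apply ws_refl.
  - clear - Hcm; intros F G H F' G' H' p N q f g h μ z w v z' w' v' x y t c d e φ χ ψ ms ns as_ γs as'
      no no' s b' V K.
    cbn [qword wsnoc].
    refine (ws_trans (ws_fm _ _ _) (ws_trans (ws_mod (esim_sym
      (@Hcm _ _ _ _ _ _ _ _ μ _ _ _ _ _ _ _ _ _ _ _ _ as_ γs as' V)) (ws_refl _)) _)).
    exact (ws_trans (ws_sym (ws_mf _ _ _)) (ws_mod (esim_refl _) K)).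
Qed.

(** The direction of all comparisons is opposite to that of [row_lax]; the entry passes from the
    beginning of the row to its end. *)
Lemma row_oplax (cm : forall {F G : Fun} (f : Tr k F G) {x : E} {z w : D} (c : hom z w) (φ : hom x (F z)),
    ent (umod G) (pt_core f w ∘ (lhom F c ∘ φ)) (lhom G c ∘ (pt_core f z ∘ φ)))
  (Hcm : forall {F F' G H : Fun} {p : mpath F F'} {N : Mod G H} {α : Tr k F G} {β : Tr k F' H}
    (μ : multimodulation k F F' G H p N α β) {z w z' w' : D} {x y : E} {ms : dpath p z w}
    {ns : dpath p z' w'} {c : hom z z'} {e : hom w w'} {φ : hom x (F z)} {ψ : hom y (F' w)}
    (as_ : qc ms φ ψ) (γs : dcells ms ns c e) (as' : qc ns (lhom F c ∘ φ) (lhom F' e ∘ ψ)),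
    vqc as_ γs as' ->
    lact (@cm _ _ α _ _ _ c φ) (vp (ev (mmc μ) as_) (qtfl as') (mtot_cell γs))
      ≃ ract (ev (mmc μ) as') (@cm _ _ β _ _ _ e ψ))
  {F' G' : Fun} {q : mpath F' G'} {F G : Fun} {f : Tr k F F'} {g : Tr k G G'}
  (μs : row q f g) {z w z' w' : D} {x y : E} {ms : dpath (msource _ μs) z w}
  {ns : dpath (msource _ μs) z' w'} {c : hom z z'} {e : hom w w'} {φ : hom x (F z)}
  {ψ : hom y (G w)} (as_ : qc ms φ ψ) (γs : dcells ms ns c e)
  (as' : qc ns (lhom F c ∘ φ) (lhom G e ∘ ψ)) : vqc as_ γs as' ->
  exists mo no no' b γo s b', outer_square μs as_ γs as' (mo := mo) (no := no) (no' := no') b γo s b' /\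
    wsim (wfun (@cm _ _ f _ _ _ c φ) (qword s)) (wsnoc (qword b') (@cm _ _ g _ _ _ e ψ)).
Proof.
  apply (row_slide (fun F G F' G' q f g z w z' w' x y c e φ ψ no no' s b' =>
    wsim (wfun (@cm _ _ f _ _ _ c φ) (qword s)) (wsnoc (qword b') (@cm _ _ g _ _ _ e ψ)))).
  - intros; apply ws_refl.
  - clear - Hcm; intros F G H F' G' H' p N q f g h μ z w v z' w' v' x y t c d e φ χ ψ ms ns as_ γs as'
      no no' s b' V K.
    cbn [qword wsnoc].
    refine (ws_trans (ws_fm _ _ _) (ws_trans (ws_mod
      (@Hcm _ _ _ _ _ _ _ _ μ _ _ _ _ _ _ _ _ _ _ _ _ as_ γs as' V) (ws_refl _)) _)).
    exact (ws_trans (ws_sym (ws_mf _ _ _)) (ws_mod (esim_refl _) K)).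
Qed.
End Row.

(** * Composition *)

Definition tr_id {k : trans_kind} (F : Fun) : Tr k F F.
Proof.
  destruct k.
  - exists (lax_trans_id F); intros x y f; exact (unital_id f).
  - exists (lax_trans_id F); split.
    + intros x y f; exact (unital_inverse _ _ (unital_id f)).
    + intros X i; exact (unital_id _).
  - exists (lax_trans_id F); intros X i; exact (unital_id _).
  - exists (oplax_trans_id F); intros X i; exact (ounital_id _).
Defined.

Definition tr_comp {k : trans_kind} {F G H : Fun} : Tr k G H -> Tr k F G -> Tr k F H :=
  match k return Tr k G H -> Tr k F G -> Tr k F H with
  | Strict => fun β α => exist (@is_strict D E F H) (lax_comp_trans (proj1_sig β) (proj1_sig α))
      (fun x y f => unital_comp _ _ f (proj2_sig β x y f) (proj2_sig α x y f))
  | Pseudo => fun β α => exist (fun γ => is_pseudo γ /\ lax_preserves PD γ) (lax_comp_trans (proj1_sig β) (proj1_sig α))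
      (conj (pseudo_comp _ _ (proj1 (proj2_sig β)) (proj1 (proj2_sig α)))
        (fun X i => unital_comp _ _ _ (proj2 (proj2_sig β) X i) (proj2 (proj2_sig α) X i)))
  | Lax => fun β α => exist (lax_preserves PD) (lax_comp_trans (proj1_sig β) (proj1_sig α))
      (fun X i => unital_comp _ _ _ (proj2_sig β X i) (proj2_sig α X i))
  | Oplax => fun β α => exist (oplax_preserves PD) (oplax_comp_trans (proj1_sig β) (proj1_sig α))
      (fun X i => ounital_comp _ _ _ (proj2_sig β X i) (proj2_sig α X i))
  end.

Lemma sig_eq {A : Type} {P : A -> Prop} (s t : {a | P a}) : proj1_sig s = proj1_sig t -> s = t.
Proof.
  destruct s as [a p], t as [b q]; cbn; intros <-; f_equal; apply proof_irrelevance.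
Qed.

Lemma tr_comp_idl {k : trans_kind} {F G : Fun} (α : Tr k F G) : tr_comp (tr_id G) α = α.
Proof.
  destruct k; apply sig_eq; first [apply lax_comp_idl | apply oplax_comp_idl].
Qed.

Lemma tr_comp_idr {k : trans_kind} {F G : Fun} (α : Tr k F G) : tr_comp α (tr_id F) = α.
Proof.
  destruct k; apply sig_eq; first [apply lax_comp_idr | apply oplax_comp_idr].
Qed.

Lemma tr_comp_assoc {k : trans_kind} {F G H K : Fun} (γ : Tr k H K) (β : Tr k G H) (α : Tr k F G) :
  tr_comp γ (tr_comp β α) = tr_comp (tr_comp γ β) α.
Proof.
  destruct k; apply sig_eq; first [apply lax_comp_assoc | apply oplax_comp_assoc].
Qed.

Lemma tr_comp_is_composite {k : trans_kind} {F G H : Fun} (β : Tr k G H) (α : Tr k F G) :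
  is_composite PD PE (tr_comp β α) β α.
Proof.
  destruct k; (split; [split; [reflexivity | intros; apply ceq_refl] | intros x y f; apply ceq_cast]).
Qed.

Lemma tr_comp_ob {k : trans_kind} {F G H : Fun} (β : Tr k G H) (α : Tr k F G) (z : D) :
  pt_core (tr_comp β α) z = pt_core β z ∘ pt_core α z.
Proof. destruct k; reflexivity. Qed.

Lemma tm_tr_comp {k : trans_kind} {F G H : Fun} (β : Tr k G H) (α : Tr k F G) {z w : D} {x y : E}
    {f : hom x (F z)} {g : hom y (F w)} (p : ent (umod F) f g) :
  tm (pt_core (tr_comp β α)) p ≃ tm (pt_core β) (tm (pt_core α) p).
Proof. destruct k; apply tm_comp. Qed.

Lemma tr_id_ob {k : trans_kind} {F : Fun} {z : D} {x : E} (f : hom x (F z)) :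
  pt_core (tr_id (k := k) F) z ∘ f = f.
Proof. destruct k; apply (comph_id_l HE). Qed.

Lemma tm_tr_id {k : trans_kind} {F : Fun} {z w : D} {x y : E}
    {f : hom x (F z)} {g : hom y (F w)} (p : ent (umod F) f g) :
  tm (pt_core (tr_id (k := k) F)) p ≃ p.
Proof. destruct k; apply tm_id. Qed.

Section Slide.
Context {k : trans_kind}.
Notation row := (mcells (multimodulation k)).
Context {F G F' G' F'' G'' : Fun} {q : mpath F' G'} {N : Mod F'' G''}
    {f : Tr k F F'} {g : Tr k G G'} {u : Tr k F' F''} {v : Tr k G' G''} (μs : row q f g)
    (ν : multimodulation k F' G' F'' G'' q N u v).

(** The boundary arrows of the pasting formula are equal to those of the composite transformations, so a
    cast of its right-hand side exists. *)
Lemma formula_cast {z w : D} (bs : blocks μs z w) :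
  exists c : cell (pt_core (tr_comp u f) z) (pt_core (tr_comp v g) w) (msrc (bflat bs)) (mpro N (mtot (bflat bs))),
    c ≈ mcell N (bjoin bs) ∙ mm_cell ν (bouter bs) ∙ btens bs ∙ bsplit bs.
Proof.
  eexists (ccast _ _ _); apply ceq_cast.
  Unshelve.
  all: rewrite (lhom_id _ (lf_laws _ _ _)), (comph_id_l HE), (comph_id_r HE), tr_comp_ob; reflexivity.
Qed.

Lemma formula_ent {z w : D} (bs : blocks μs z w)
    (c : cell (pt_core (tr_comp u f) z) (pt_core (tr_comp v g) w) (msrc (bflat bs)) (mpro N (mtot (bflat bs)))) :
  c ≈ mcell N (bjoin bs) ∙ mm_cell ν (bouter bs) ∙ btens bs ∙ bsplit bs <->
  Ent (msrc (bflat bs)) (mtot (bflat bs)) (mfl (bflat bs)) (tfl (bflat bs)) c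
    ≃ wev (mmc ν) (rw μs (qword (ids (bflat bs)))).
Proof.
  assert (K : forall c' : cell (pt_core (tr_comp u f) z) (pt_core (tr_comp v g) w) (msrc (bflat bs)) (mpro N (mtot (bflat bs))),
    c' ≈ mcell N (bjoin bs) ∙ mm_cell ν (bouter bs) ∙ btens bs ∙ bsplit bs ->
    Ent (msrc (bflat bs)) (mtot (bflat bs)) (mfl (bflat bs)) (tfl (bflat bs)) c'
      ≃ wev (mmc ν) (rw μs (qword (ids (bflat bs))))).
  { intros c' Hc.
    refine (esim_trans (esim_sym (cev_ids _ c')) _).
    rewrite <- qbflat_qbids.
    refine (esim_trans (pasting_ev ν c' (qbids bs) Hc) _).
    refine (esim_trans (esim_sym (wev_qword _ (mmc ν))) _).
    apply esim_sym, (wev_sim (mm_equivariant ν)), rw_qb. }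
  split; [apply K|]; intros Hc.
  destruct (formula_cast bs) as [c' Hc'].
  refine (ceq_trans _ Hc'); apply ceq_of_sq.
  exact (esim_sq (esim_trans Hc (esim_sym (K _ Hc')))).
Qed.

Section Family.
Context (μ0 : components (msource _ μs) N (trans_comp (pt_core u) (pt_core f))
  (trans_comp (pt_core v) (pt_core g))).
Context (Hμ0 : forall z w x y (ms : dpath (msource _ μs) z w) (φ : hom x (F z)) (ψ : hom y (G w))
  (as_ : qc ms φ ψ), ev μ0 as_ ≃ wev (mmc ν) (rw μs (qword as_))).

Lemma outer_ev {z w z' w' : D} {x y : E} {ms : dpath (msource _ μs) z w}
    {ns : dpath (msource _ μs) z' w'} {c : hom z z'} {e : hom w w'} {φ : hom x (F z)}
    {ψ : hom y (G w)} {as_ : qc ms φ ψ} {γs : dcells ms ns c e}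
    {as' : qc ns (lhom F c ∘ φ) (lhom G e ∘ ψ)} {mo : dpath q z w} {no no' : dpath q z' w'}
    {b : qc mo _ _} {γo : dcells mo no c e} {s : qc no _ _} {b' : qc no' _ _} :
  outer_square μs as_ γs as' b γo s b' ->
  vp (ev μ0 as_) (qtfl as') (mtot_cell γs) ≃ vp (ev (mmc ν) b) (qtfl s) (mtot_cell γo) /\
  ev μ0 as' ≃ ev (mmc ν) b'.
Proof.
  intros [O1 O2 O3 O4].
  assert (K : forall z w (ms : dpath (msource _ μs) z w) x y (φ : hom x (F z)) (ψ : hom y (G w))
    (as_ : qc ms φ ψ) (mo : dpath q z w) (b : qc mo (pt_core f z ∘ φ) (pt_core g w ∘ ψ)),
    wsim (rw μs (qword as_)) (qword b) -> ev μ0 as_ ≃ ev (mmc ν) b).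
  { clear - Hμ0; intros z w ms x y φ ψ as_ mo b K.
    refine (esim_trans (Hμ0 _ _ _ _ _ _ _ as_) _).
    exact (esim_trans (wev_sim (mm_equivariant ν) K) (wev_qword b (mmc ν))). }
  split; [|exact (K _ _ _ _ _ _ _ _ _ _ O2)].
  exact (vp_vsim (K _ _ _ _ _ _ _ _ _ _ O1) O4).
Qed.

(** The comparison of a composite transformation is a product of two comparisons.  The inner one slides
    through the row and the outer one is moved by the naturality of [ν]. *)
Lemma composite_slide_lax
  (cm : forall {F G : Fun} (f : Tr k F G) {x : E} {z w : D} (c : hom z w) (φ : hom x (F z)),
    ent (umod G) (lhom G c ∘ (pt_core f z ∘ φ)) (pt_core f w ∘ (lhom F c ∘ φ)))
  (Hcm : forall {F F' G H : Fun} {p : mpath F F'} {N : Mod G H} {α : Tr k F G} {β : Tr k F' H}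
    (μ : multimodulation k F F' G H p N α β) {z w z' w' : D} {x y : E} {ms : dpath p z w}
    {ns : dpath p z' w'} {c : hom z z'} {e : hom w w'} {φ : hom x (F z)} {ψ : hom y (F' w)}
    (as_ : qc ms φ ψ) (γs : dcells ms ns c e) (as' : qc ns (lhom F c ∘ φ) (lhom F' e ∘ ψ)),
    vqc as_ γs as' ->
    ract (vp (ev (mmc μ) as_) (qtfl as') (mtot_cell γs)) (@cm _ _ β _ _ _ e ψ)
      ≃ lact (@cm _ _ α _ _ _ c φ) (ev (mmc μ) as'))
  {z w z' w' : D} {x y : E} {ms : dpath (msource _ μs) z w}
  {ns : dpath (msource _ μs) z' w'} {c : hom z z'} {e : hom w w'} {φ : hom x (F z)}
  {ψ : hom y (G w)} (as_ : qc ms φ ψ) (γs : dcells ms ns c e)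
  (as' : qc ns (lhom F c ∘ φ) (lhom G e ∘ ψ)) {a : hom x (F'' z')} {b : hom y (G'' w')}
  {cf : ent (umod F'') a (trans_comp (pt_core u) (pt_core f) z' ∘ (lhom F c ∘ φ))}
  {cg : ent (umod G'') (lhom G'' e ∘ (trans_comp (pt_core v) (pt_core g) w ∘ ψ)) b} : vqc as_ γs as' ->
  cf ≃ lact (@cm _ _ u _ _ _ c (pt_core f z ∘ φ)) (tm (pt_core u) (@cm _ _ f _ _ _ c φ)) ->
  cg ≃ lact (@cm _ _ v _ _ _ e (pt_core g w ∘ ψ)) (tm (pt_core v) (@cm _ _ g _ _ _ e ψ)) ->
  ract (vp (ev μ0 as_) (qtfl as') (mtot_cell γs)) cg
    ≃ lact cf (ev μ0 as').
Proof.
  intros V Hf Hg.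
  destruct (row_lax (@cm) (@Hcm) μs as_ γs as' V) as (mo & no & no' & b0 & γo & s & b' & O & S).
  destruct (outer_ev O) as (K1 & K2).
  refine (esim_trans (ract_cong K1 Hg) _).
  refine (esim_trans (esim_sym (ract_ract _ _ _)) _).
  refine (esim_trans (ract_cong (@Hcm _ _ _ _ _ _ _ _ ν _ _ _ _ _ _ _ _ _ _ _ _ b0 γo s (os_vqc _ _ _ _ _ _ _ _ O))
    (esim_refl _)) _).
  refine (esim_trans (lact_ract _ _ _) _).
  refine (esim_sym (esim_trans (lact_cong Hf K2) (esim_trans (lact_lact _ _ _)
    (lact_cong (esim_refl _) _)))).
  refine (esim_trans (lact_cong (esim_refl _) (esim_sym (wev_qword b' (mmc ν)))) _).
  refine (esim_trans (esim_sym (wev_fun (eqv_src _ (mm_equivariant ν)) _ _)) _).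
  refine (esim_trans (wev_sim (mm_equivariant ν) S) _).
  refine (esim_trans (wev_snoc _ _ (mm_equivariant ν)) (ract_cong (wev_qword s (mmc ν)) (esim_refl _))).
Qed.

Lemma composite_slide_oplax
  (cm : forall {F G : Fun} (f : Tr k F G) {x : E} {z w : D} (c : hom z w) (φ : hom x (F z)),
    ent (umod G) (pt_core f w ∘ (lhom F c ∘ φ)) (lhom G c ∘ (pt_core f z ∘ φ)))
  (Hcm : forall {F F' G H : Fun} {p : mpath F F'} {N : Mod G H} {α : Tr k F G} {β : Tr k F' H}
    (μ : multimodulation k F F' G H p N α β) {z w z' w' : D} {x y : E} {ms : dpath p z w}
    {ns : dpath p z' w'} {c : hom z z'} {e : hom w w'} {φ : hom x (F z)} {ψ : hom y (F' w)}
    (as_ : qc ms φ ψ) (γs : dcells ms ns c e) (as' : qc ns (lhom F c ∘ φ) (lhom F' e ∘ ψ)),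
    vqc as_ γs as' ->
    lact (@cm _ _ α _ _ _ c φ) (vp (ev (mmc μ) as_) (qtfl as') (mtot_cell γs))
      ≃ ract (ev (mmc μ) as') (@cm _ _ β _ _ _ e ψ))
  {z w z' w' : D} {x y : E} {ms : dpath (msource _ μs) z w}
  {ns : dpath (msource _ μs) z' w'} {c : hom z z'} {e : hom w w'} {φ : hom x (F z)}
  {ψ : hom y (G w)} (as_ : qc ms φ ψ) (γs : dcells ms ns c e)
  (as' : qc ns (lhom F c ∘ φ) (lhom G e ∘ ψ)) {a : hom x (F'' z')} {b : hom y (G'' w')}
  {cf : ent (umod F'') a (lhom F'' c ∘ (trans_comp (pt_core u) (pt_core f) z ∘ φ))}
  {cg : ent (umod G'') (trans_comp (pt_core v) (pt_core g) w' ∘ (lhom G e ∘ ψ)) b} : vqc as_ γs as' ->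
  cf ≃ lact (tm (pt_core u) (@cm _ _ f _ _ _ c φ)) (@cm _ _ u _ _ _ c (pt_core f z ∘ φ)) ->
  cg ≃ lact (tm (pt_core v) (@cm _ _ g _ _ _ e ψ)) (@cm _ _ v _ _ _ e (pt_core g w ∘ ψ)) ->
  lact cf (vp (ev μ0 as_) (qtfl as') (mtot_cell γs))
    ≃ ract (ev μ0 as') cg.
Proof.
  intros V Hf Hg.
  destruct (row_oplax (@cm) (@Hcm) μs as_ γs as' V) as (mo & no & no' & b0 & γo & s & b' & O & S).
  destruct (outer_ev O) as (K1 & K2).
  refine (esim_trans (lact_cong Hf K1) _).
  refine (esim_trans (lact_lact _ _ _) _).
  refine (esim_trans (lact_cong (esim_refl _) (@Hcm _ _ _ _ _ _ _ _ ν _ _ _ _ _ _ _ _ _ _ _ _ b0 γo s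
    (os_vqc _ _ _ _ _ _ _ _ O))) _).
  refine (esim_trans (esim_sym (lact_ract _ _ _)) _).
  refine (esim_sym (esim_trans (ract_cong K2 Hg) (esim_trans (esim_sym (ract_ract _ _ _))
    (ract_cong _ (esim_refl _))))).
  refine (esim_trans (ract_cong (esim_sym (wev_qword b' (mmc ν))) (esim_refl _)) _).
  refine (esim_trans (esim_sym (wev_snoc _ _ (mm_equivariant ν))) _).
  refine (esim_trans (wev_sim (mm_equivariant ν) (ws_sym S)) _).
  refine (esim_trans (wev_fun (eqv_src _ (mm_equivariant ν)) _ _) (lact_cong (esim_refl _) (wev_qword s (mmc ν)))).
Qed.
End Family.

End Slide.

Lemma composite_exists {k : trans_kind} {F G F' G' F'' G'' : Fun} {q : mpath F' G'} {N : Mod F'' G''}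
    {f : Tr k F F'} {g : Tr k G G'} {u : Tr k F' F''} {v : Tr k G' G''}
    (μs : mcells (multimodulation k) q f g) (ν : multimodulation k F' G' F'' G'' q N u v) :
  exists κ : multimodulation k F G F'' G'' (msource _ μs) N (tr_comp u f) (tr_comp v g),
  forall z w x y (φ : hom x (F z)) (ψ : hom y (G w)) (s : word (msource _ μs) φ ψ),
  wev (mmc κ) s ≃ wev (mmc ν) (rw μs s).
Proof.
  assert (L : forall F G H (β : Tr k G H) (α : Tr k F G) z x (φ : hom x (F z)),
    pt_core β z ∘ (pt_core α z ∘ φ) = pt_core (tr_comp β α) z ∘ φ).
  { intros; rewrite tr_comp_ob; apply (comph_assoc HE). }
  destruct (multimodulation_of (p := msource _ μs) (N := N) (tr_comp u f) (tr_comp v g) (fun z w x y φ ψ s =>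
    ecast (L _ _ _ u f _ _ φ) (L _ _ _ v g _ _ ψ) (wev (mmc ν) (rw μs s)))) as [κ Hκ].
  - intros z w x y φ ψ Q; destruct (qb_surj μs Q) as (bs & qb & ->).
    destruct (formula_cast μs ν bs) as [c Hc]; exists c; cbn [projT1 projT2].
    rewrite <- qbflat_qbids.
    split; refine (esim_trans (pasting_ev ν c _ Hc) (esim_trans _ (esim_sym (ecast_esim _ _ _))));
      (refine (esim_trans (esim_sym (wev_qword _ (mmc ν))) _);
       apply esim_sym, (wev_sim (mm_equivariant ν)), rw_qb).
  - intros z w x y φ ψ s t Hs.
    refine (esim_trans (ecast_esim _ _ _) (esim_trans _ (esim_sym (ecast_esim _ _ _)))).
    exact (wev_sim (mm_equivariant ν) (rw_sim μs Hs)).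
  - intros z z' w x x' y φ φ' ψ p s.
    refine (esim_trans (ecast_esim _ _ _) _).
    refine (esim_trans (wev_sim (mm_equivariant ν) (rw_fun μs p s)) _).
    refine (esim_trans (wev_fun (tr_gnat u) _ _) _).
    exact (lact_cong (esim_sym (tm_tr_comp _ _ _)) (esim_sym (ecast_esim _ _ _))).
  - intros z w t x y r φ ψ χ s p.
    refine (esim_trans (ecast_esim _ _ _) _).
    refine (esim_trans (wev_sim (mm_equivariant ν) (rw_snoc μs s p)) _).
    refine (esim_trans (wev_snoc _ _ (mm_equivariant ν)) _).
    exact (ract_cong (esim_sym (ecast_esim _ _ _)) (esim_sym (tm_tr_comp _ _ _))).
  - intros μ Hμ.
    assert (Hμ' : forall z w x y (ms : dpath (msource _ μs) z w) (φ : hom x (F z)) (ψ : hom y (G w))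
      (as_ : qc ms φ ψ), ev μ as_ ≃ wev (mmc ν) (rw μs (qword as_))).
    { intros; exact (esim_trans (Hμ _ _ _ _ _ _ _ as_) (ecast_esim _ _ _)). }
    clear - Hμ'; destruct k.
    1-3: intros x y x' y' ms ns c e γs; destruct (vqc_ids γs) as [as' V];
      refine (laxnat_from (α := lax_comp_trans (proj1_sig u) (proj1_sig f))
        (β := lax_comp_trans (proj1_sig v) (proj1_sig g)) _ (coh_giso (tens_ids ms)) V _);
      exact (composite_slide_lax μs ν μ Hμ' (fun F G f x z w c φ => cmL (proj1_sig f) c φ)
        (fun _ _ _ _ _ _ α β μ _ _ _ _ _ _ _ _ _ _ _ _ as_ γs as' V =>
          laxnat_to (α := proj1_sig α) (β := proj1_sig β) _
            (mm_nat _ _ _ _ _ _ _ _ _ _ _ μ _ _ _ _ _ _ _ _ γs) V)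
        (ids ms) γs as' V (cml_composite _ _ _ _) (cml_composite _ _ _ _)).
    intros x y x' y' ms ns c e γs; destruct (vqc_ids γs) as [as' V];
      refine (oplaxnat_from (α := oplax_comp_trans (proj1_sig u) (proj1_sig f))
        (β := oplax_comp_trans (proj1_sig v) (proj1_sig g)) _ (coh_giso (tens_ids ms)) V _);
      exact (composite_slide_oplax μs ν μ Hμ' (fun F G (f : Tr Oplax F G) x z w c φ => cmO (proj1_sig f) c φ)
        (fun _ _ _ _ _ _ α β μ _ _ _ _ _ _ _ _ _ _ _ _ as_ γs as' V =>
          oplaxnat_to (α := proj1_sig α) (β := proj1_sig β) _
            (mm_nat _ _ _ _ _ _ _ _ _ _ _ μ _ _ _ _ _ _ _ _ γs) V)
        (ids ms) γs as' V (cmo_composite _ _ _ _) (cmo_composite _ _ _ _)).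
  - exists κ; intros z w x y φ ψ s; exact (esim_trans (Hκ _ _ _ _ _ _ s) (ecast_esim _ _ _)).
Qed.

Section Comp.
Context {k : trans_kind} {F G F' G' F'' G'' : Fun} {q : mpath F' G'} {N : Mod F'' G''}
    {f : Tr k F F'} {g : Tr k G G'} {u : Tr k F' F''} {v : Tr k G' G''}
    (ν : multimodulation k F' G' F'' G'' q N u v) (μs : mcells (multimodulation k) q f g).

Definition mm_comp :
    multimodulation k F G F'' G'' (msource _ μs) N (tr_comp u f) (tr_comp v g) :=
  proj1_sig (constructive_indefinite_description _ (composite_exists μs ν)).

Lemma wev_comp {z w : D} {x y : E} {φ : hom x (F z)} {ψ : hom y (G w)} (s : word (msource _ μs) φ ψ) :
  wev (mmc mm_comp) s ≃ wev (mmc ν) (rw μs s).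
Proof. exact (proj2_sig (constructive_indefinite_description _ (composite_exists μs ν)) _ _ _ _ _ _ s). Qed.

Lemma mm_comp_pasting : is_pasting mm_comp ν.
Proof.
  intros z w bs; apply (formula_ent μs ν).
  refine (esim_trans (esim_sym (ev_ids (mmc mm_comp) (bflat bs))) _).
  exact (esim_trans (esim_sym (wev_qword _ _)) (wev_comp _)).
Qed.
End Comp.

(** * Identity multimodulations *)

Definition idw {F G : Fun} {N : Mod F G} {z w : D} {x y : E} {f : hom x (F z)} {g : hom y (G w)}
    (s : word (pcons N (pnil G)) f g) : ent N f g :=
  match (whead s : head N (pnil G) f g) with hd a r => ract a (wprod r : ent (umod G) _ _) end.

Lemma idw_sing {F G : Fun} {N : Mod F G} {z w : D} {x y : E} {f : hom x (F z)} {g : hom y (G w)}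
    (a : ent N f g) : idw (wmod a (wnil g)) ≃ a.
Proof. exact (ract_one a). Qed.

Lemma idw_sim {F G : Fun} {N : Mod F G} {z w : D} {x y : E} {f : hom x (F z)} {g : hom y (G w)}
    {s t : word (pcons N (pnil G)) f g} : wsim s t -> idw s ≃ idw t.
Proof.
  intros H; apply whead_sim in H; unfold idw; cbn [hd_rel] in H.
  set (a := whead s) in *; set (b := whead t) in *; clearbody a b; cbn [hd_type] in a, b.
  clear s t; induction H.
  - apply ract_cong; [assumption | exact (wprod_sim H0)].
  - apply ract_ract.
  - apply esim_sym; assumption.
  - eapply esim_trans; eassumption.
Qed.

Lemma idw_fun {F G : Fun} {N : Mod F G} {z z' w : D} {x x' y : E} {f : hom x (F z)}
    {f' : hom x' (F z')} {g : hom y (G w)} (p : ent (umod F) f f') (s : word (pcons N (pnil G)) f' g) :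
  idw (wfun p s) ≃ lact p (idw s).
Proof.
  unfold idw; cbn [whead hd_lact].
  set (a := whead s); clearbody a; cbn [hd_type] in a; destruct a; apply lact_ract.
Qed.

Lemma idw_snoc {F G : Fun} {N : Mod F G} {z w v : D} {x y t : E} {f : hom x (F z)}
    {g : hom y (G w)} {h : hom t (G v)} (s : word (pcons N (pnil G)) f g) (r : ent (umod G) g h) :
  idw (wsnoc s r) ≃ ract (idw s) r.
Proof.
  unfold idw; rewrite (whead_snoc s r).
  set (a := whead s); clearbody a; cbn [hd_type] in a; destruct a as [w' y' g' a u]; cbn [hd_snoc].
  exact (esim_trans (ract_cong (esim_refl _) (wprod_snoc u r)) (esim_sym (ract_ract _ _ _))).
Qed.

(** A path with the single member [m] has composite [m ⊙ id]; the unitor there is invisible on entries. *)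
Lemma unitor_ent {F G : lax_functor D E} {N : module F G} {z w : D} (m : pro z w)
    {i : hom (F z) (F z)} {j : hom (G w) (G w)} (c : cell i j (mpro N m ⊙ punit (G w)) (mpro N (m ⊙ punit w))) :
  ⟦c⟧ = ⟦mcell N (runi m)⟧ ⋆ ⟦run (mpro N m)⟧ ->
  forall {x y : E} {f : hom x (F z)} {g : hom y (G w)} {X : pro x y} (A : fl X) (B : fl m)
    (a : cell f g X (mpro N m)),
  Ent (X ⊙ punit y) (m ⊙ punit w) (fl_tens A (fl_unit y)) (fl_tens B (fl_unit w)) (c ∙ (a ⊗ cunit g))
    ≃ Ent X m A B a.
Proof.
  intros Hc x y f g X A B a.
  exists (run X), (run m); split; [apply coh_run|]; split; [apply coh_run|].
  change (⟦mcell N (run m)⟧ ⋆ ⟦c ∙ (a ⊗ cunit g)⟧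
    = ⟦a⟧ ⋆ ⟦run X⟧).
  rewrite to_sq_comp, Hc, <- !(sq_comp_assoc HE), sq_run_nat, !(sq_comp_assoc HE); f_equal.
  rewrite <- sq_mcell_gcomp, g_run_runi, sq_mcell_id, (sq_comp_idl HE); reflexivity.
Qed.

Lemma id_slide {F G : Fun} {N : Mod F G} {α : trans F F} {β : trans G G}
    (μ : components (pcons N (pnil G)) N α β)
    (Hμ : forall z w x y (ms : dpath (pcons N (pnil G)) z w) (f : hom x (F z)) (g : hom y (G w))
      (as_ : qc ms f g), ev μ as_ ≃ idw (qword as_)) {z w z' w' : D}
    {ms : dpath (pcons N (pnil G)) z w}
    {ns : dpath (pcons N (pnil G)) z' w'} {c : hom z z'} {e : hom w w'} {x y : E} {f : hom x (F z)}
    {g : hom y (G w)} (as_ : qc ms f g) (γs : dcells ms ns c e)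
    (as' : qc ns (lhom F c ∘ f) (lhom G e ∘ g)) : vqc as_ γs as' ->
  vp (ev μ as_) (qtfl as') (mtot_cell γs) ≃ ev μ as'.
Proof.
  revert ms ns as_ γs as'; apply vqc_uncons_ind.
  intros w1 w1' y1 d g1 a n B γ ms ns as_ γs as' V; revert a n B γ;
    revert w1 w w1' w' y1 y ms ns d e g1 g as_ γs as' V.
  apply (vqc_nil_ind (fun w1 w w1' w' y1 y ms ns d e g1 g as_ γs as' => forall (a : ent N f g1)
    (n : pro z' w1') (B : fl n) (γ : cell c d (en a) n),
    vp (ev μ (qcons a as_)) (qtfl (qcons (vp a B γ) as')) (mtot_cell (dccons γ γs))
      ≃ ev μ (qcons (vp a B γ) as'))).
  intros w w' y d g a n B γ.
  refine (esim_trans (vp_vsim (e := ev μ (qcons a (qnil g))) (e' := a) _ (vsim_run (A := eB a) (A' := B) γ))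
    (esim_sym (esim_trans (Hμ _ _ _ _ _ _ _ (qcons (vp a B γ) (qnil _))) (idw_sing _)))).
  exact (esim_trans (Hμ _ _ _ _ _ _ _ (qcons a (qnil g))) (idw_sing a)).
Qed.

(** The functional that multiplies the only module entry of a word by the entries of functors around it. *)
Lemma identity_exists {k : trans_kind} {F G : Fun} (N : Mod F G) :
  exists μ : multimodulation k F G F G (pcons N (pnil G)) N (tr_id F) (tr_id G),
    forall z w x y (f : hom x (F z)) (g : hom y (G w)) (s : word (pcons N (pnil G)) f g),
    wev (mmc μ) s ≃ idw s.
Proof.
  destruct (multimodulation_of (p := pcons N (pnil G)) (N := N) (tr_id (k := k) F) (tr_id G) (fun z w x y f g s =>
    ecast (eq_sym (tr_id_ob f)) (eq_sym (tr_id_ob g)) (idw s))) as [μ Hμ].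
  - intros z w x y f g Q; destruct (qc_uncons Q) as (w' & y' & g' & a & Q' & ->).
    revert w' w y' y g' g Q' a; apply (qc_nil_ind (fun w' w y' y g' g Q' => forall a : ent N f g',
      represented (fun z w x y f g s => ecast (eq_sym (tr_id_ob (k := k) f)) (eq_sym (tr_id_ob g)) (idw s))
        (QCcons a Q'))).
    intros w y g a; destruct a as [X m A B a].
    unshelve eexists (ccast _ _ (mcell N (runi m) ∙ run (mpro N m)));
      [rewrite (lhom_id _ (lf_laws _ _ _)), (comph_id_l HE), <- (comph_id_r HE (pt_core _ _));
       symmetry; apply tr_id_ob .. |].
    split; refine (esim_trans (unitor_ent m _ (sq_cast _ _ _) _ _ _)
      (esim_sym (esim_trans (ecast_esim _ _ _) (idw_sing _)))).
  - intros z w x y f g s t H.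
    exact (esim_trans (ecast_esim _ _ _) (esim_trans (idw_sim H) (esim_sym (ecast_esim _ _ _)))).
  - intros z z' w x x' y f f' g p s.
    refine (esim_trans (ecast_esim _ _ _) (esim_trans (idw_fun p s) _)).
    exact (lact_cong (esim_sym (tm_tr_id p)) (esim_sym (ecast_esim _ _ _))).
  - intros z w v x y t f g h s r.
    refine (esim_trans (ecast_esim _ _ _) (esim_trans (idw_snoc s r) _)).
    exact (ract_cong (esim_sym (ecast_esim _ _ _)) (esim_sym (tm_tr_id r))).
  - intros μ Hμ.
    assert (Hμ' : forall z w x y (ms : dpath (pcons N (pnil G)) z w) (f : hom x (F z)) (g : hom y (G w))
      (as_ : qc ms f g), ev μ as_ ≃ idw (qword as_)).
    { intros; exact (esim_trans (Hμ _ _ _ _ _ _ _ as_) (ecast_esim _ _ _)). }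
    clear - Hμ'; destruct k.
    1-3: intros x y x' y' ms ns c e γs; destruct (vqc_ids γs) as [as' V];
      refine (laxnat_from (α := lax_trans_id F) (β := lax_trans_id G) _ (coh_giso (tens_ids ms)) V _);
      exact (esim_trans (ract_unit _ (cml_idc G _ _)) (esim_trans (id_slide μ Hμ' _ _ _ V)
        (esim_sym (lact_unit _ (cml_idc F _ _))))).
    intros x y x' y' ms ns c e γs; destruct (vqc_ids γs) as [as' V];
      refine (oplaxnat_from (α := oplax_trans_id F) (β := oplax_trans_id G) _ (coh_giso (tens_ids ms)) V _);
      exact (esim_trans (lact_unit _ (cmo_oidc F _ _)) (esim_trans (id_slide μ Hμ' _ _ _ V)
        (esim_sym (ract_unit _ (cmo_oidc G _ _))))).
  - exists μ; intros z w x y f g s; exact (esim_trans (Hμ _ _ _ _ _ _ s) (ecast_esim _ _ _)).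
Qed.

Definition mm_id {k : trans_kind} {F G : Fun} (N : Mod F G) :
    multimodulation k F G F G (pcons N (pnil G)) N (tr_id F) (tr_id G) :=
  proj1_sig (constructive_indefinite_description _ (identity_exists N)).

Lemma wev_id {k : trans_kind} {F G : Fun} (N : Mod F G) {z w : D} {x y : E} {f : hom x (F z)}
    {g : hom y (G w)} (s : word (pcons N (pnil G)) f g) : wev (mmc (mm_id (k := k) N)) s ≃ idw s.
Proof. exact (proj2_sig (constructive_indefinite_description _ (identity_exists N)) _ _ _ _ _ _ s). Qed.

(** * Concatenation of words and of rows *)

(** A multimodulation is determined by its components, which are its values at generic entries. *)
Lemma mm_eq {k : trans_kind} {F F' G H : Fun} {p : mpath F F'} {N : Mod G H} {α : Tr k F G}
    {β : Tr k F' H} (μ ν : multimodulation k F F' G H p N α β) :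
  (forall (z w : D) (ms : dpath p z w), ev (mmc μ) (ids ms) ≃ ev (mmc ν) (ids ms)) -> μ = ν.
Proof.
  intros K.
  assert (e : mmc μ = mmc ν).
  { extensionality z; extensionality w; extensionality ms.
    apply eq_of_ceq, ceq_of_sq; refine (esim_sq (A := mfl ms) (B := tfl ms) _).
    exact (esim_trans (esim_sym (ev_ids (mmc μ) ms)) (esim_trans (K _ _ ms) (ev_ids (mmc ν) ms))). }
  destruct μ as [a a1 a2 a3 a4 a5], ν as [b b1 b2 b3 b4 b5]; unfold mmc in e; cbn in e.
  change ((fun x y ms => a x y ms) = (fun x y ms => b x y ms)) in e.
  assert (e' : a = b) by exact e; clear e; subst b.
  f_equal; apply proof_irrelevance.
Qed.

Definition wtr {F G : Fun} {q q' : mpath F G} (e : q = q') {z w : D} {x y : E} {f : hom x (F z)}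
    {g : hom y (G w)} (s : word q f g) : word q' f g :=
  match e in _ = q' return word q' f g with eq_refl => s end.

(** The sources of the two sides of a law are equal paths without being identical.  Words are
    transported along the equality before they are compared. *)
Lemma mceq_of {k : trans_kind} {F F' G H : Fun} {p p' : mpath F F'} {N : Mod G H} {α α' : Tr k F G}
    {β β' : Tr k F' H} (μ : multimodulation k F F' G H p N α β)
    (ν : multimodulation k F F' G H p' N α' β') (ep : p = p') :
  α = α' -> β = β' ->
  (forall (z w : D) (x y : E) (φ : hom x (F z)) (ψ : hom y (F' w)) (s : word p φ ψ),
     wev (mmc μ) s ≃ wev (mmc ν) (wtr ep s)) -> mceq (multimodulation k) μ ν.
Proof.
  destruct ep; intros <- <- K.
  assert (e : μ = ν).
  { apply mm_eq; intros z w ms.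
    exact (esim_trans (esim_sym (wev_qword _ _)) (esim_trans (K _ _ _ _ _ _ (qword (ids ms))) (wev_qword _ _))). }
  destruct e; constructor.
Qed.

Definition wcast {F G : Fun} {q : mpath F G} {z w : D} {x y : E} {f f' : hom x (F z)}
    {g g' : hom y (G w)} (ef : f = f') (eg : g = g') (s : word q f g) : word q f' g' :=
  match ef in _ = a, eg in _ = b return word q a b with eq_refl, eq_refl => s end.

(** Words whose boundary arrows are equal without being identical, as happens with identity
    transformations and with composites. *)
Definition weq {F G : Fun} {q : mpath F G} {z w : D} {x y : E} {f f' : hom x (F z)}
    {g g' : hom y (G w)} (s : word q f g) (t : word q f' g') : Prop :=
  exists ef eg, wsim (wcast ef eg s) t.

Lemma weq_of_sim {F G : Fun} {q : mpath F G} {z w : D} {x y : E} {f : hom x (F z)}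
    {g : hom y (G w)} {s t : word q f g} : wsim s t -> weq s t.
Proof. intros H; exists eq_refl, eq_refl; exact H. Qed.

Lemma weq_trans {F G : Fun} {q : mpath F G} {z w : D} {x y : E} {f f' f'' : hom x (F z)}
    {g g' g'' : hom y (G w)} {s : word q f g} {t : word q f' g'} {r : word q f'' g''} :
  weq s t -> weq t r -> weq s r.
Proof.
  intros (e1 & e2 & H) (e3 & e4 & K); subst; exists eq_refl, eq_refl; exact (ws_trans H K).
Qed.

Lemma weq_nil {F : Fun} {z : D} {x : E} {f f' : hom x (F z)} : f = f' -> weq (wnil f) (wnil f').
Proof. intros <-; apply weq_of_sim, ws_refl. Qed.

Lemma weq_fun {F G : Fun} {q : mpath F G} {z z' w : D} {x x' y : E} {f f' : hom x (F z)}
    {h h' : hom x' (F z')} {g g' : hom y (G w)} {p : ent (umod F) f h} {p' : ent (umod F) f' h'}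
    {s : word q h g} {t : word q h' g'} : p ≃ p' -> weq s t -> weq (wfun p s) (wfun p' t).
Proof.
  intros Hp (e1 & e2 & H); destruct (esim_bd Hp) as [e3 _]; subst.
  exists eq_refl, eq_refl; exact (ws_fun Hp H).
Qed.

Lemma weq_mod {F G H : Fun} {M : Mod F G} {q : mpath G H} {z z' w : D} {x x' y : E} {f f' : hom x (F z)}
    {h h' : hom x' (G z')} {g g' : hom y (H w)} {a : ent M f h} {a' : ent M f' h'}
    {s : word q h g} {t : word q h' g'} : a ≃ a' -> weq s t -> weq (wmod a s) (wmod a' t).
Proof.
  intros Hp (e1 & e2 & K); destruct (esim_bd Hp) as [e3 _]; subst.
  exists eq_refl, eq_refl; exact (ws_mod Hp K).
Qed.

Lemma wev_weq {F F' G H : Fun} {p : mpath F F'} {N : Mod G H} {α : trans F G} {β : trans F' H}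
    {μ : components p N α β} (Hμ : equivariant μ) {z w : D} {x y : E} {f f' : hom x (F z)}
    {g g' : hom y (F' w)} {s : word p f g} {t : word p f' g'} : weq s t -> wev μ s ≃ wev μ t.
Proof. intros (e1 & e2 & K); subst; exact (wev_sim Hμ K). Qed.

Lemma wtr_sim {F G : Fun} {q q' : mpath F G} (e : q = q') {z w : D} {x y : E} {f : hom x (F z)}
    {g : hom y (G w)} {s t : word q f g} : wsim s t -> wsim (wtr e s) (wtr e t).
Proof. destruct e; exact id. Qed.

Fixpoint wapp {F G H : Fun} {p : mpath F G} {q : mpath G H} {z w v : D} {x y t : E}
    {f : hom x (F z)} {g : hom y (G w)} {h : hom t (H v)} (s : word p f g) :
    word q g h -> word (papp p q) f h :=
  match s in @word F G p z w x y f g return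
    forall q : mpath G H, word q g h -> word (papp p q) f h
  with
  | wnil f => fun q r => r
  | wfun a s => fun q r => wfun a (wapp s r)
  | wmod a s => fun q r => wmod a (wapp s r)
  end q.

Lemma wapp_snoc {F G H : Fun} {p : mpath F G} {q : mpath G H} {z w w' v : D} {x y y' t : E}
    {f : hom x (F z)} {g : hom y (G w)} {g' : hom y' (G w')} {h : hom t (H v)} (s : word p f g)
    (r : ent (umod G) g g') (s' : word q g' h) : wapp (wsnoc s r) s' = wapp s (wfun r s').
Proof. induction s; cbn [wsnoc wapp]; [reflexivity | rewrite IHs; reflexivity ..]. Qed.

Lemma wapp_sim {F G H : Fun} {p : mpath F G} {q : mpath G H} {z w v : D} {x y t : E}
    {f : hom x (F z)} {g : hom y (G w)} {h : hom t (H v)} {s s' : word p f g} {r r' : word q g h} :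
  wsim s s' -> wsim r r' -> wsim (wapp s r) (wapp s' r').
Proof.
  intros Hs Hr; apply (ws_trans (v := wapp s' r)).
  - clear r' Hr; induction Hs.
    + apply ws_refl.
    + apply ws_sym, IHHs.
    + exact (ws_trans (IHHs1 _ _) (IHHs2 _ _)).
    + exact (ws_fun H0 (IHHs _ _)).
    + exact (ws_mod H1 (IHHs _ _)).
    + apply ws_ff.
    + apply ws_one.
    + apply ws_fm.
    + apply ws_mf.
  - clear s Hs; induction s'; cbn [wapp]; [exact Hr | apply ws_fun; [apply esim_refl | apply IHs'; exact Hr]
      | apply ws_mod; [apply esim_refl | apply IHs'; exact Hr]].
Qed.

Definition wglue {F G H : Fun} {p : mpath F G} {q : mpath G H} {z v : D} {x t : E}
    {f : hom x (F z)} {h : hom t (H v)} (s : SP p q f h) : word (papp p q) f h :=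
  match s with sp u1 u2 => wapp u1 u2 end.

Lemma whead_nf {F G H : Fun} {M : Mod F G} {q : mpath G H} {z v : D} {x t : E} {f : hom x (F z)}
    {h : hom t (H v)} (s : word (pcons M q) f h) :
  wsim (match (whead s : head M q f h) with hd a r => wmod a r end) s.
Proof.
  destruct (word_nf s) as (z1 & x1 & f1 & p & ms & as_ & K).
  assert (L : forall s s' : head M q f h, hsim s s' ->
    wsim (match s with hd a r => wmod a r end) (match s' with hd a r => wmod a r end)).
  { clear; induction 1.
    - apply ws_mod; assumption.
    - apply ws_sym, ws_mf.
    - apply ws_sym; assumption.
    - eapply ws_trans; eassumption. }
  refine (ws_trans (L _ _ (whead_sim K)) (ws_trans _ (ws_sym K))).
  assert (R : forall Q : QC (pcons M q) f1 h,
    wsim (match (whead (wfun p (qword (projT2 Q))) : head M q f h) with hd a r => wmod a r end)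
      (wfun p (qword (projT2 Q)))).
  { clear; intros Q; destruct (qc_uncons Q) as (w & y & g & a & Q' & ->); apply ws_sym, ws_fm. }
  exact (R (existT _ ms as_)).
Qed.

Lemma word_uncons {F G H : Fun} {M : Mod F G} {q : mpath G H} {z v : D} {x t : E} {f : hom x (F z)}
    {h : hom t (H v)} (s : word (pcons M q) f h) :
  exists (w : D) (y : E) (g : hom y (G w)) (a : ent M f g) (r : word q g h), wsim s (wmod a r).
Proof.
  pose proof (ws_sym (whead_nf s)) as K.
  destruct (whead s : head M q f h) as [w y g a r]; exists w, y, g, a, r; exact K.
Qed.

Lemma wglue_split {F G H : Fun} (p : mpath F G) {q : mpath G H} {z v : D} {x t : E}
    {f : hom x (F z)} {h : hom t (H v)} (s : word (papp p q) f h) : wsim (wglue (wsplit p s)) s.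
Proof.
  revert z x f s; induction p as [F | F G1 G M p IH]; intros z x f s.
  - apply ws_refl.
  - cbn [papp] in s; refine (ws_trans _ (whead_nf s)); cbn [wsplit papp].
    set (a := whead s); clearbody a; cbn [hd_type] in a; destruct a as [w y g a r].
    pose proof (IH _ _ _ _ r) as K; destruct (wsplit p r); cbn [sp_mod wglue wapp] in *.
    exact (ws_mod (esim_refl _) K).
Qed.

Lemma psim_fun {F G H : Fun} {p1 : mpath F G} {p2 : mpath G H} {z z' v : D}
    {x x' t : E} {f : hom x (F z)} {f' : hom x' (F z')} {h : hom t (H v)} (p : ent (umod F) f f')
    {s s' : SP p1 p2 f' h} : psim s s' -> psim (sp_fun p s) (sp_fun p s').
Proof.
  induction 1; cbn [sp_fun].
  - apply ps_c; [apply ws_fun; [apply esim_refl | assumption] | assumption].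
  - exact (ps_m (wfun p u1) r u2).
  - apply ps_sym; assumption.
  - eapply ps_trans; eassumption.
Qed.

Lemma wsplit_app {F G H : Fun} {p : mpath F G} {q : mpath G H} {z w v : D} {x y t : E}
    {f : hom x (F z)} {g : hom y (G w)} {h : hom t (H v)} (s : word p f g) (r : word q g h) :
  psim (wsplit p (wapp s r)) (sp s r).
Proof.
  induction s as [F z x f | F G q' z z' w x x' y f f' g p s IH | F G K M q' z w u x y s' f g k a s IH].
  - apply psim_refl.
  - refine (ps_trans (wsplit_fun q' p (wapp s r)) (psim_fun p (IH _ r))).
  - exact (psim_mod (esim_refl a) (IH _ r)).
Qed.

Lemma rw_cons {k : trans_kind} {F G F' G' H H' : Fun} {p : mpath F G} {N : Mod F' G'}
    {f : Tr k F F'} {g : Tr k G G'} {q : mpath G' H'} {h : Tr k H H'}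
    (μ : multimodulation k F G F' G' p N f g) (μs : mcells (multimodulation k) q g h) {z w v : D}
    {x y t : E} {φ : hom x (F z)} {ψ : hom y (G w)} {χ : hom t (H v)} (s : word p φ ψ)
    (r : word (msource _ μs) ψ χ) {r' : word (msource _ (mcons _ μ μs)) φ χ} :
  wsim r' (wapp s r) -> wsim (rw (mcons _ μ μs) r') (wmod (wev (mmc μ) s) (rw μs r)).
Proof.
  intros K; refine (ws_trans (rw_sim _ K) _).
  exact (rsp_sim μ μs (fun _ _ _ _ _ _ _ _ => rw_sim μs) (fun _ _ _ _ _ _ _ _ _ => rw_fun μs) (wsplit_app s r)).
Qed.

Lemma word_nil_nf {F : Fun} {z w : D} {x y : E} {f : hom x (F z)} {g : hom y (F w)}
    (s : word (pnil F) f g) : wsim s (wfun (wprod s : ent (umod F) f g) (wnil g)).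
Proof.
  destruct (word_nf s) as (z1 & x1 & f1 & p & ms & as_ & K).
  refine (ws_trans K (ws_sym (ws_trans (ws_fun (wprod_sim K) (ws_refl _)) _))); clear.
  assert (R : forall z1 w x1 y (f1 : hom x1 (F z1)) (g : hom y (F w)) (Q : QC (pnil F) f1 g)
    (p : ent (umod F) f f1),
    wsim (wfun (wprod (wfun p (qword (projT2 Q))) : ent (umod F) f g) (wnil g)) (wfun p (qword (projT2 Q)))).
  { apply (qc_nil_ind (fun z1 w x1 y f1 g Q => forall p : ent (umod F) f f1,
      wsim (wfun (wprod (wfun p (qword (projT2 Q))) : ent (umod F) f g) (wnil g))
        (wfun p (qword (projT2 Q))))).
    intros z2 x2 f2 p2; exact (ws_fun (ract_one (N := umod F) p2) (ws_refl _)). }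
  exact (R _ _ _ _ _ _ (existT _ ms as_) p).
Qed.

Lemma wtr_fun {F G : Fun} {q q' : mpath F G} (e : q = q') {z z' w : D} {x x' y : E}
    {f : hom x (F z)} {f' : hom x' (F z')} {g : hom y (G w)} (p : ent (umod F) f f')
    (s : word q f' g) : wtr e (wfun p s) = wfun p (wtr e s).
Proof. destruct e; reflexivity. Qed.

Lemma wtr_mod {F G H : Fun} {M : Mod F G} {q q' : mpath G H} (e : q = q')
    (e' : pcons M q = pcons M q') {z w v : D} {x y t : E}
    {f : hom x (F z)} {g : hom y (G w)} {h : hom t (H v)} (a : ent M f g) (s : word q g h) :
  wtr e' (wmod a s) = wmod a (wtr e s).
Proof. destruct e; rewrite (proof_irrelevance _ e' eq_refl); reflexivity. Qed.

Lemma wtr_app {F G H : Fun} {p : mpath F G} {q q' : mpath G H} (e : q = q')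
    (e' : papp p q = papp p q') {z w v : D} {x y t : E}
    {f : hom x (F z)} {g : hom y (G w)} {h : hom t (H v)} (s : word p f g) (r : word q g h) :
  wtr e' (wapp s r) = wapp s (wtr e r).
Proof. destruct e; rewrite (proof_irrelevance _ e' eq_refl); reflexivity. Qed.

Lemma wtr_wtr {F G : Fun} {q q' q'' : mpath F G} (e : q = q') (e' : q' = q'') (e'' : q = q'')
    {z w : D} {x y : E} {f : hom x (F z)} {g : hom y (G w)} (s : word q f g) :
  wtr e' (wtr e s) = wtr e'' s.
Proof. destruct e, e'; rewrite (proof_irrelevance _ e'' eq_refl); reflexivity. Qed.

Lemma wtr_refl {F G : Fun} {q : mpath F G} (e : q = q) {z w : D} {x y : E} {f : hom x (F z)}
    {g : hom y (G w)} (s : word q f g) : wtr e s = s.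
Proof. rewrite (proof_irrelevance _ e eq_refl); reflexivity. Qed.

Lemma wapp_assoc {F G H K : Fun} {p : mpath F G} {q : mpath G H} {r : mpath H K}
    (e : papp (papp p q) r = papp p (papp q r)) {z w v u : D} {x y t o : E}
    {f : hom x (F z)} {g : hom y (G w)} {h : hom t (H v)} {k : hom o (K u)} (a : word p f g)
    (b : word q g h) (c : word r h k) : wtr e (wapp (wapp a b) c) = wapp a (wapp b c).
Proof.
  induction a as [F z x f | F G q' z z' w x x' y f f' g s a IH | F G L M q' z w o' x y o'' f g i s a IH].
  - apply wtr_refl.
  - cbn [wapp]; rewrite wtr_fun, (IH _ e b); reflexivity.
  - cbn [wapp]; rewrite <- (IH _ (papp_assoc _ _ _) b).
    exact (wtr_mod (papp_assoc _ _ _) e s _).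
Qed.

Lemma msource_mapp {k : trans_kind} {F' G' H' : Fun} {q : mpath F' G'} {r : mpath G' H'} {F G H : Fun}
    {f : Tr k F F'} {g : Tr k G G'} {h : Tr k H H'} (μs : mcells (multimodulation k) q f g)
    (νs : mcells (multimodulation k) r g h) :
  msource _ (mapp _ μs νs) = papp (msource _ μs) (msource _ νs).
Proof.
  induction μs as [F F' f | F F' G G' L L' p N f g q i μ μs IH]; [reflexivity|].
  cbn [mapp msource]; rewrite (IH _ νs); symmetry; apply papp_assoc.
Qed.

(** Values are computed piece by piece, so rows may be evaluated one after the other.  If the first row is
    empty, its entries of functors are passed on to the second. *)
Lemma rw_mapp {k : trans_kind} {F' G' H' : Fun} {q : mpath F' G'} {r : mpath G' H'} {F G H : Fun}
    {f : Tr k F F'} {g : Tr k G G'} {h : Tr k H H'} (μs : mcells (multimodulation k) q f g)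
    (νs : mcells (multimodulation k) r g h)
    (e : papp (msource _ μs) (msource _ νs) = msource _ (mapp _ μs νs)) {z w v : D} {x y t : E}
    {φ : hom x (F z)} {ψ : hom y (G w)} {χ : hom t (H v)} (s : word (msource _ μs) φ ψ)
    (s' : word (msource _ νs) ψ χ) :
  wsim (rw (mapp _ μs νs) (wtr e (wapp s s'))) (wapp (rw μs s) (rw νs s')).
Proof.
  revert z x φ s; induction μs as [F F' f | F F' G G' L L' p N f g q i μ μs IH]; intros z x φ s.
  - refine (ws_trans (rw_sim νs (_ : wsim _ (wfun (wprod s) s'))) (rw_fun νs _ _)).
    cbn [msource mapp papp] in e; rewrite wtr_refl.
    exact (wapp_sim (word_nil_nf s) (ws_refl _)).
  - pose proof (wglue_split p s) as K; destruct (wsplit p s) as [w' y' ψ' s1 s2]; cbn [wglue] in K.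
    refine (ws_trans _ (wapp_sim (ws_sym (rw_cons μ μs s1 s2 (ws_sym K))) (ws_refl _))).
    cbn [wapp].
    refine (ws_trans (rw_cons μ (mapp _ μs νs) s1 (wtr (eq_sym (msource_mapp μs νs)) (wapp s2 s')) _)
      (ws_mod (esim_refl _) (IH _ _ _ _ _ _ _ _ s2))).
    refine (ws_trans (wtr_sim e (wapp_sim (ws_sym K) (ws_refl s'))) _).
    pose (e1 := eq_sym (msource_mapp μs νs)).
    pose proof (wtr_wtr (papp_assoc _ _ _) (f_equal (papp p) e1) e (wapp (wapp s1 s2) s')) as E1.
    pose proof (wapp_assoc (papp_assoc _ _ _) s1 s2 s') as E2.
    pose proof (wtr_app e1 (f_equal (papp p) e1) s1 (wapp s2 s')) as E3.
    exact (eq_ind _ (wsim _) (ws_refl _) _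
      (eq_trans (eq_sym E1) (eq_trans (f_equal (wtr (f_equal (papp p) e1)) E2) E3))).
Qed.

(** * The virtual double category *)

Definition ops (k : trans_kind) : vdc_data (multimodulation k) :=
  @Build_vdc_data Fun (pp_trans PD PE k) Mod (@multimodulation D E PD PE k)
    (fun F => tr_id F) (fun _ _ _ β α => tr_comp β α) (fun _ _ N => mm_id N)
    (fun _ _ _ _ _ _ _ _ _ _ _ _ ν μs => mm_comp ν μs).

Section Laws.
Context {k : trans_kind}.

Lemma wapp_nil {F G : Fun} {p : mpath F G} (e : papp p (pnil G) = p) {z w v : D} {x y t : E}
    {f : hom x (F z)} {g : hom y (G w)} {h : hom t (G v)} (s : word p f g)
    (r : word (pnil G) g h) :
  wsim (wtr e (wapp s r)) (wsnoc s (wprod r : ent (umod G) g h)).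
Proof.
  induction s as [F z x f | F G q z z' w x x' y f f' g a s IH | F G L M q z w o x y o' f g i a s IH].
  - cbn [papp] in e; rewrite wtr_refl; apply word_nil_nf.
  - cbn [wapp wsnoc]; rewrite wtr_fun; exact (ws_fun (esim_refl _) (IH e h r)).
  - cbn [wapp wsnoc]; refine (eq_ind_r (fun u => wsim u _) _ (wtr_mod (papp_nil_r q) e a (wapp s r))).
    exact (ws_mod (esim_refl _) (IH (papp_nil_r q) h r)).
Qed.

Lemma comp_id_l {F G F' G' : Fun} {p : mpath F G} {N : Mod F' G'} {f : Tr k F F'} {g : Tr k G G'}
    (μ : multimodulation k F G F' G' p N f g) :
  mceq (multimodulation k) (mm_comp (mm_id N) (mcons _ μ (mnil _ g))) μ.
Proof.
  apply (mceq_of _ _ (papp_nil_r p) (tr_comp_idl f) (tr_comp_idl g)).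
  intros z w x y φ ψ s; cbn [msource] in s.
  pose proof (wglue_split p s) as K; destruct (wsplit p s) as [w' y' ψ' s1 s2]; cbn [wglue] in K.
  refine (esim_trans (wev_comp (mm_id N) (mcons _ μ (mnil _ g)) s) (esim_trans (wev_id _ _) _)).
  refine (esim_trans (idw_sim (rw_cons μ (mnil _ g) s1 s2 (ws_sym K))) _).
  refine (esim_trans (ract_cong (esim_refl _) (ract_one (N := umod G') _)) _).
  refine (esim_trans (esim_sym (wev_snoc _ _ (mm_equivariant μ))) _).
  apply (wev_sim (mm_equivariant μ)), ws_sym.
  exact (ws_trans (wtr_sim _ (ws_sym K)) (wapp_nil _ s1 s2)).
Qed.

Lemma msource_mids {F G : Fun} (p : mpath F G) : msource _ (mids _ (ops k) p) = p.
Proof.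
  induction p as [F | F G H N p IH]; [reflexivity|].
  exact (f_equal (pcons N) IH).
Qed.

(** Identities evaluate every piece, which has a single module entry, to itself. *)
Lemma rw_mids {F G : Fun} (p : mpath F G) (e : msource _ (mids _ (ops k) p) = p) {z w : D} {x y : E}
    {f : hom x (F z)} {g : hom y (G w)} (s : word (msource _ (mids _ (ops k) p)) f g) :
  weq (rw (mids _ (ops k) p) s) (wtr e s).
Proof.
  revert z x f s; induction p as [F | F G H N p IH]; intros z x f s.
  - cbn [mids msource] in e; rewrite wtr_refl.
    refine (weq_trans _ (weq_of_sim (ws_sym (word_nil_nf s)))).
    exact (weq_fun (tm_tr_id _) (weq_nil (tr_id_ob g))).
  - destruct (word_uncons (q := msource _ (mids _ (ops k) p)) s) as (w' & y' & ψ' & a & r & K).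
    refine (weq_trans (weq_of_sim (rw_cons (mm_id N) (mids _ (ops k) p) (wmod a (wnil _)) r K)) _).
    refine (weq_trans _ (weq_of_sim (wtr_sim e (ws_sym K)))).
    refine (weq_trans (weq_mod (esim_trans (wev_id N _) (idw_sing a)) (IH (msource_mids p) _ _ _ _ r)) _).
    apply weq_of_sim.
    exact (eq_ind_r (fun u => wsim _ u) (ws_refl _) (wtr_mod (msource_mids p) e a r)).
Qed.

Lemma comp_id_r {F G F' G' : Fun} {p : mpath F G} {N : Mod F' G'} {f : Tr k F F'} {g : Tr k G G'}
    (μ : multimodulation k F G F' G' p N f g) :
  mceq (multimodulation k) (mm_comp μ (mids _ (ops k) p)) μ.
Proof.
  apply (mceq_of _ _ (msource_mids p) (tr_comp_idr f) (tr_comp_idr g)).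
  intros z w x y φ ψ s.
  refine (esim_trans (wev_comp μ (mids _ (ops k) p) s) _).
  exact (wev_weq (mm_equivariant μ) (rw_mids p _ s)).
Qed.

Lemma msource_layer {F'' G'' : Fun} {r : mpath F'' G''} {F' G' : Fun} {u : Tr k F' F''} {v : Tr k G' G''}
    {F G : Fun} {f : Tr k F F'} {g : Tr k G G'} (t : mtree (multimodulation k) r u v f g) :
  msource _ (layer_comp _ (ops k) t) = msource _ (inner _ t).
Proof.
  induction t as [F F' F'' u f | F F' F'' G G' G'' H H' H'' R q r u v w f g h ν μs t IH]; [reflexivity|].
  exact (eq_trans (f_equal (papp (msource _ μs)) IH) (eq_sym (msource_mapp μs (inner _ t)))).
Qed.

(** Associativity for rows.  Both sides cut a word into the same pieces. *)
Lemma rw_layer {F'' G'' : Fun} {r : mpath F'' G''} {F' G' : Fun} {u : Tr k F' F''} {v : Tr k G' G''}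
    {F G : Fun} {f : Tr k F F'} {g : Tr k G G'} (t : mtree (multimodulation k) r u v f g)
    (e : msource _ (layer_comp _ (ops k) t) = msource _ (inner _ t)) {z w : D} {x y : E}
    {φ : hom x (F z)} {ψ : hom y (G w)} (s : word (msource _ (layer_comp _ (ops k) t)) φ ψ) :
  weq (rw (layer_comp _ (ops k) t) s) (rw (outer _ t) (rw (inner _ t) (wtr e s))).
Proof.
  revert z x φ s;
    induction t as [F F' F'' u f | F F' F'' G G' G'' H H' H'' R q r u v o f g h ν μs t IH]; intros z x φ s.
  - cbn [layer_comp inner outer msource] in *; rewrite wtr_refl.
    refine (weq_fun (esim_trans (tm_tr_comp u f _) (esim_sym (tm_cong _ _ (ract_one (N := umod F') _)))) _).
    + apply tr_gnat.
    + apply weq_nil; rewrite tr_comp_ob; symmetry; apply (comph_assoc HE).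
  - cbn [layer_comp msource] in s.
    pose proof (wglue_split (msource _ μs) s) as K.
    destruct (wsplit (msource _ μs) s) as [w' y' ψ' s1 s2]; cbn [wglue] in K.
    refine (weq_trans (weq_of_sim (rw_cons (mm_comp ν μs) (layer_comp _ (ops k) t) s1 s2 (ws_sym K))) _).
    refine (weq_trans (weq_mod (wev_comp ν μs s1) (IH (msource_layer t) _ _ _ _ s2)) _).
    apply weq_of_sim, ws_sym.
    refine (rw_cons ν (outer _ t) (rw μs s1) (rw (inner _ t) (wtr (msource_layer t) s2)) _).
    refine (ws_trans _ (rw_mapp μs (inner _ t) (eq_sym (msource_mapp μs (inner _ t))) s1 (wtr (msource_layer t) s2))).
    apply rw_sim.
    refine (ws_trans (wtr_sim e (ws_sym K)) _).
    pose proof (wtr_app (msource_layer t) (f_equal (papp (msource _ μs)) (msource_layer t)) s1 s2) as E1.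
    pose proof (wtr_wtr (f_equal (papp (msource _ μs)) (msource_layer t))
      (eq_sym (msource_mapp μs (inner _ t))) e (wapp s1 s2)) as E2.
    exact (eq_ind _ (wsim _) (ws_refl _) _ (eq_trans (eq_sym E2) (f_equal (wtr _) E1))).
Qed.

Lemma comp_assoc {F G F' G' F'' G'' F3 G3 : Fun} {r : mpath F'' G''} {S : Mod F3 G3}
    {u : Tr k F' F''} {v : Tr k G' G''} {f : Tr k F F'} {g : Tr k G G'} {a : Tr k F'' F3} {b : Tr k G'' G3}
    (ρ : multimodulation k F'' G'' F3 G3 r S a b) (t : mtree (multimodulation k) r u v f g) :
  mceq (multimodulation k) (mm_comp ρ (layer_comp _ (ops k) t))
    (mm_comp (mm_comp ρ (outer _ t)) (inner _ t)).
Proof.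
  apply (mceq_of (mm_comp ρ (layer_comp _ (ops k) t)) (mm_comp (mm_comp ρ (outer _ t)) (inner _ t))
    (msource_layer t) (tr_comp_assoc a u f) (tr_comp_assoc b v g)).
  intros z w x y φ ψ s.
  refine (esim_trans (wev_comp _ _ _) _).
  refine (esim_trans (wev_weq (mm_equivariant ρ) (rw_layer t (msource_layer t) s)) _).
  refine (esim_sym (esim_trans (wev_comp _ _ _) (wev_comp _ _ _))).
Qed.

Lemma ops_laws : vdc_laws (multimodulation k) (ops k).
Proof.
  constructor; intros.
  - apply tr_comp_idl.
  - apply tr_comp_idr.
  - apply tr_comp_assoc.
  - apply comp_id_l.
  - apply comp_id_r.
  - apply comp_assoc.
Qed.
End Laws.

(** * Unit modules *)

Definition unit_mod (F : Fun) : Mod F F :=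
  @Build_pp_module D E PD PE F F (umod F) (pl_pro _ _ F).

Lemma unit_slide {F : Fun} {α : trans F F} (μ : components (pnil F) (unit_mod F) α α)
    (Hμ : forall z w x y (ms : dpath (pnil F) z w) (f : hom x (F z)) (g : hom y (F w)) (as_ : qc ms f g),
      ev μ as_ ≃ (wprod (qword as_) : ent (umod F) f g)) {z w z' w' : D} {ms : dpath (pnil F) z w}
    {ns : dpath (pnil F) z' w'} {c : hom z z'} {e : hom w w'} {x y : E} {f : hom x (F z)}
    {g : hom y (F w)} (as_ : qc ms f g) (γs : dcells ms ns c e)
    (as' : qc ns (lhom F c ∘ f) (lhom F e ∘ g)) : vqc as_ γs as' ->
  vp (ev μ as_) (qtfl as') (mtot_cell γs) ≃ ev μ as'.
Proof.
  revert z w z' w' x y ms ns c e f g as_ γs as'.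
  apply (vqc_nil_ind (fun z w z' w' x y ms ns c e f g as_ γs as' =>
    vp (ev μ as_) (qtfl as') (mtot_cell γs) ≃ ev μ as')).
  intros z z' x c f.
  refine (esim_trans _ (esim_trans (vp_one f c) (esim_sym (Hμ _ _ _ _ _ _ _ (qnil (lhom F c ∘ f)))))).
  refine (vp_cong (N := umod F) (e := ev μ (qnil f)) (e' := one F f) (fl_unit z') (fl_unit z')
    (cunit c) (cunit c) (Hμ _ _ _ _ _ _ _ (qnil f)) _).
  cbn [eB ev qtfl one]; intros ψ Hψ; rewrite (coh_unique Hψ (coh_id _)).
  exists (cid (punit z')); split; [apply coh_id|].
  rewrite (sq_comp_idl HD), (sq_comp_idr HD); reflexivity.
Qed.

(** An entry of the unit is an entry of [F], so the product of the entries of a word over the empty path is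
    a value in the unit. *)
Lemma unit_cell_exists {k : trans_kind} (F : Fun) :
  exists η : multimodulation k F F F F (pnil F) (unit_mod F) (tr_id F) (tr_id F),
    forall z w x y (f : hom x (F z)) (g : hom y (F w)) (s : word (pnil F) f g),
    wev (mmc η) s ≃ (wprod s : ent (umod F) f g).
Proof.
  pose (e := fun z w x y (f : hom x (F z)) (g : hom y (F w)) (s : word (pnil F) f g) =>
    ecast (N := unit_mod F) (eq_sym (tr_id_ob (k := k) f)) (eq_sym (tr_id_ob (k := k) g))
      (wprod s : ent (umod F) f g)).
  assert (He : forall z w x y (f : hom x (F z)) (g : hom y (F w)) (s : word (pnil F) f g),
    e z w x y f g s ≃ (wprod s : ent (umod F) f g)) by (intros; apply (ecast_esim (N := umod F))).
  destruct (multimodulation_of (p := pnil F) (N := unit_mod F) (tr_id (k := k) F) (tr_id F) e) as [η Hη].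
  - apply (qc_nil_ind (fun z w x y f g Q => represented (N := unit_mod F) e Q)); intros z x f.
    assert (e0 : pt_core (tr_id (k := k) F) z = idh (F z)) by (destruct k; reflexivity).
    exists (ccast (eq_sym e0) (eq_sym e0) (lunit F z)).
    split; refine (esim_trans _ (esim_sym (He _ _ _ _ _ _ (wnil _))));
      apply (esim_of_sq (N := umod F) (A := fl_unit _) (B := fl_unit _));
      rewrite to_sq_comp, sq_cast, sq_gpost; reflexivity.
  - intros z w x y f g s t H.
    exact (esim_trans (He _ _ _ _ _ _ s) (esim_trans (wprod_sim H) (esim_sym (He _ _ _ _ _ _ t)))).
  - intros z z' w x x' y f f' g a s.
    refine (esim_trans (He _ _ _ _ _ _ (wfun a s)) _).
    exact (lact_cong (N := umod F) (esim_sym (tm_tr_id a)) (esim_sym (He _ _ _ _ _ _ s))).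
  - intros z w v x y t f g h s a.
    refine (esim_trans (He _ _ _ _ _ _ (wsnoc s a)) _).
    refine (esim_trans (wprod_snoc s a) _).
    exact (ract_cong (N := umod F) (esim_sym (He _ _ _ _ _ _ s)) (esim_sym (tm_tr_id a))).
  - intros μ Hμ.
    assert (Hμ' : forall z w x y (ms : dpath (pnil F) z w) (f : hom x (F z)) (g : hom y (F w)) (as_ : qc ms f g),
      ev μ as_ ≃ (wprod (qword as_) : ent (umod F) f g)).
    { intros z w x y ms f g as_; exact (esim_trans (Hμ _ _ _ _ _ _ _ as_) (He _ _ _ _ _ _ (qword as_))). }
    clear - Hμ'; destruct k.
    1-3: intros z w z' w' ms ns c e γs; destruct (vqc_ids γs) as [as' V];
      refine (laxnat_from (α := lax_trans_id F) (β := lax_trans_id F) _ (coh_giso (tens_ids ms)) V _);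
      exact (esim_trans (ract_unit _ (cml_idc F _ _)) (esim_trans (unit_slide μ Hμ' _ _ _ V)
        (esim_sym (lact_unit _ (cml_idc F _ _))))).
    intros z w z' w' ms ns c e γs; destruct (vqc_ids γs) as [as' V];
      refine (oplaxnat_from (α := oplax_trans_id F) (β := oplax_trans_id F) _ (coh_giso (tens_ids ms)) V _);
      exact (esim_trans (lact_unit _ (cmo_oidc F _ _)) (esim_trans (unit_slide μ Hμ' _ _ _ V)
        (esim_sym (ract_unit _ (cmo_oidc F _ _))))).
  - exists η; intros z w x y f g s; exact (esim_trans (Hη _ _ _ _ _ _ s) (He _ _ _ _ _ _ s)).
Qed.

(** * Erasing unit entries *)

Lemma wsnoc_app {F G H : Fun} {p : mpath F G} {q : mpath G H} {z w v v' : D} {x y t t' : E}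
    {f : hom x (F z)} {g : hom y (G w)} {h : hom t (H v)} {h' : hom t' (H v')} (s : word p f g)
    (r : word q g h) (a : ent (umod H) h h') : wsnoc (wapp s r) a = wapp s (wsnoc r a).
Proof. induction s; cbn [wsnoc wapp]; [reflexivity | rewrite IHs; reflexivity ..]. Qed.

Lemma qword_app {F G H : Fun} {p : mpath F G} {q : mpath G H} {z w v : D} {ms : dpath p z w}
    {ns : dpath q w v} {x y t : E} {f : hom x (F z)} {g : hom y (G w)} {h : hom t (H v)}
    (as_ : qc ms f g) (bs : qc ns g h) : qword (qapp as_ bs) = wapp (qword as_) (qword bs).
Proof. induction as_; cbn [qapp qword wapp]; [reflexivity | rewrite IHas_; reflexivity]. Qed.

Section Unit.
Context {F : Fun} {H : Fun} {q : mpath F H}.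

(** A module entry of the unit is the same as an entry of [F] as a functor. *)
Definition unw {z w : D} {x y : E} {f : hom x (F z)} {g : hom y (H w)}
    (s : word (pcons (unit_mod F) q) f g) : word q f g :=
  match (whead s : head (unit_mod F) q f g) with
  | hd a r => wfun (a : ent (umod F) _ _) r
  end.

Lemma unw_sim {z w : D} {x y : E} {f : hom x (F z)} {g : hom y (H w)}
    {s t : word (pcons (unit_mod F) q) f g} : wsim s t -> wsim (unw s) (unw t).
Proof.
  intros K; apply whead_sim in K; unfold unw; cbn [hd_rel] in K.
  set (a := whead s) in *; set (b := whead t) in *; clearbody a b; cbn [hd_type] in a, b.
  clear s t; induction K.
  - exact (ws_fun H0 H1).
  - apply ws_sym; exact (ws_ff a p u).
  - apply ws_sym; assumption.
  - eapply ws_trans; eassumption.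
Qed.

Lemma unw_fun {z z' w : D} {x x' y : E} {f : hom x (F z)} {f' : hom x' (F z')} {g : hom y (H w)}
    (p : ent (umod F) f f') (s : word (pcons (unit_mod F) q) f' g) :
  wsim (unw (wfun p s)) (wfun p (unw s)).
Proof.
  unfold unw; cbn [whead hd_lact].
  set (a := whead s); clearbody a; cbn [hd_type] in a; destruct a as [w' y' g' a r].
  apply ws_sym; exact (ws_ff p a r).
Qed.

Lemma unw_snoc {z w v : D} {x y t : E} {f : hom x (F z)} {g : hom y (H w)} {h : hom t (H v)}
    (s : word (pcons (unit_mod F) q) f g) (r : ent (umod H) g h) : unw (wsnoc s r) = wsnoc (unw s) r.
Proof.
  unfold unw; rewrite (whead_snoc s r).
  set (a := whead s); clearbody a; cbn [hd_type] in a; destruct a; reflexivity.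
Qed.

Context {G : Fun} {p : mpath G F}.

Definition erase_sp {z w : D} {x y : E} {f : hom x (G z)} {g : hom y (H w)}
    (s : SP p (pcons (unit_mod F) q) f g) : word (papp p q) f g :=
  match s with sp s1 s2 => wapp s1 (unw s2) end.

Definition erase {z w : D} {x y : E} {f : hom x (G z)} {g : hom y (H w)}
    (s : word (papp p (pcons (unit_mod F) q)) f g) : word (papp p q) f g := erase_sp (wsplit p s).

Lemma erase_sp_sim {z w : D} {x y : E} {f : hom x (G z)} {g : hom y (H w)}
    {s t : SP p (pcons (unit_mod F) q) f g} : psim s t -> wsim (erase_sp s) (erase_sp t).
Proof.
  induction 1; cbn [erase_sp].
  - apply wapp_sim; [assumption | apply unw_sim; assumption].
  - rewrite wapp_snoc; apply wapp_sim; [apply ws_refl | apply ws_sym, unw_fun].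
  - apply ws_sym; assumption.
  - eapply ws_trans; eassumption.
Qed.

Lemma erase_sim {z w : D} {x y : E} {f : hom x (G z)} {g : hom y (H w)}
    {s t : word (papp p (pcons (unit_mod F) q)) f g} : wsim s t -> wsim (erase s) (erase t).
Proof. intros K; exact (erase_sp_sim (wsplit_sim p K)). Qed.

Lemma erase_fun {z z' w : D} {x x' y : E} {f : hom x (G z)} {f' : hom x' (G z')} {g : hom y (H w)}
    (a : ent (umod G) f f') (s : word (papp p (pcons (unit_mod F) q)) f' g) :
  wsim (erase (wfun a s)) (wfun a (erase s)).
Proof.
  refine (ws_trans (erase_sp_sim (wsplit_fun p a s)) _); unfold erase.
  destruct (wsplit p s); apply ws_refl.
Qed.

Lemma erase_snoc {z w v : D} {x y t : E} {f : hom x (G z)} {g : hom y (H w)} {h : hom t (H v)}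
    (s : word (papp p (pcons (unit_mod F) q)) f g) (r : ent (umod H) g h) :
  erase (wsnoc s r) = wsnoc (erase s) r.
Proof.
  unfold erase; rewrite (wsplit_snoc p s r); destruct (wsplit p s); cbn [sp_snoc erase_sp].
  rewrite unw_snoc, wsnoc_app; reflexivity.
Qed.

Lemma erase_app {z w v u : D} {x y t o : E} {f : hom x (G z)} {g : hom y (F w)} {g' : hom t (F v)}
    {h : hom o (H u)} (s : word p f g) (a : ent (umod F) g g') (r : word q g' h) :
  wsim (erase (wapp s (wmod (M := unit_mod F) a r))) (wapp s (wfun a r)).
Proof. exact (erase_sp_sim (wsplit_app s (wmod (M := unit_mod F) a r))). Qed.

Lemma erase_qapp {z w v u : D} {x y t o : E} {f : hom x (G z)} {g : hom y (F w)} {g' : hom t (F v)}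
    {h : hom o (H u)} {ms : dpath p z w} {ns : dpath q v u} (as_ : qc ms f g) (a : ent (umod F) g g')
    (bs : qc ns g' h) :
  erase (qword (qapp as_ (qcons (M := unit_mod F) a bs))) = wapp (qword as_) (wfun a (qword bs)).
Proof.
  unfold erase; rewrite (wsplit_qapp as_ (qcons (M := unit_mod F) a bs)); reflexivity.
Qed.

(** The entry at the unit is the product of a trivial one with an entry of [F], and the latter may be moved
    into the rest of the word. *)
Lemma unit_insert {z u : D} {x o : E} {f : hom x (G z)} {h : hom o (H u)}
    (s : word (papp p (pcons (unit_mod F) q)) f h) :
  exists (w : D) (y : E) (g : hom y (F w)) (s1 : word p f g) (s2 : word q g h),
    wsim s (wapp s1 (wmod (M := unit_mod F) (one F g) s2)).
Proof.
  pose proof (wglue_split p s) as K; destruct (wsplit p s) as [w y g s1 s2]; cbn [wglue] in K.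
  destruct (word_uncons s2) as (w' & y' & g' & a & r & L).
  exists w, y, g, s1, (wfun (a : ent (umod F) g g') r).
  refine (ws_trans (ws_sym K) (wapp_sim (ws_refl _) (ws_trans L _))).
  refine (ws_trans (ws_mod (M := unit_mod F) _ (ws_refl r)) (ws_sym (ws_mf (M := unit_mod F) (one F g) a r))).
  apply esim_sym; exact (one_lact (N := umod F) a).
Qed.
End Unit.

Lemma qc_nqc {F G H : Fun} {M : Mod F G} {p : mpath G H} {z v : D} {x t : E} {f : hom x (F z)}
    {h : hom t (H v)} (Q : QC (pcons M p) f h) :
  exists (ns : npath (pcons M p) z v) (nas : nqc ns f h), Q = existT _ (npath_dpath ns) (nqc_qc nas).
Proof.
  revert F M z x f Q; revert v t h; induction p as [G | G G' H M' p IH]; intros v t h F M z x f Q;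
    destruct (qc_uncons Q) as (w & y & g & a & Q' & ->).
  - revert w v y t g h Q' a; apply (qc_nil_ind (fun w v y t g h Q' => forall a : ent M f g,
      exists (ns : npath (pcons M (pnil G)) z v) (nas : nqc ns f h),
      QCcons a Q' = existT _ (npath_dpath ns) (nqc_qc nas))).
    intros w y g a; exists (nlast (en a)), (nqlast a); reflexivity.
  - destruct (IH _ _ _ _ _ _ _ _ Q') as (ns & nas & ->).
    exists (ncons (en a) ns), (nqcons a nas); reflexivity.
Qed.

Lemma qword_snoc {F G : Fun} {p : mpath F G} {z w v : D} {ns : npath p z w} {x y t : E}
    {f : hom x (F z)} {g : hom y (G w)} {h : hom t (G v)} (nas : nqc ns f g) (a : ent (umod G) g h) :
  wsim (wsnoc (qword (nqc_qc nas)) a) (qword (nqc_snoc nas a)).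
Proof.
  induction nas; cbn [nqc_qc nqc_snoc qword wsnoc]; [apply ws_mf | apply ws_mod; [apply esim_refl | apply IHnas]].
Qed.

Lemma giso_msrc_app {F G H : Fun} {p : mpath F G} {q : mpath G H} {z w v : D} (ms : dpath p z w)
    (ns : dpath q w v) : giso (msrc_app ms ns).
Proof.
  induction ms; cbn [msrc_app].
  - apply giso_luni.
  - exact (giso_comp (giso_associ _ _ _) (giso_tens (giso_cid _) (IHms _ ns))).
Qed.

Lemma giso_mtot_app {F G H : Fun} {p : mpath F G} {q : mpath G H} {z w v : D} (ms : dpath p z w)
    (ns : dpath q w v) : giso (mtot_app ms ns).
Proof.
  induction ms; cbn [mtot_app].
  - apply giso_lun.
  - exact (giso_comp (giso_tens (giso_cid _) (IHms _ ns)) (giso_assoc _ _ _)).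
Qed.

Section Rep.
Context {F H G G' H' : Fun} {p : mpath G F} {q : mpath F H} {N : Mod G' H'} {α : trans G G'}
  {β : trans H H'} (σ : components (papp p q) N α β).

(** The functional after erasure is represented by a cell: the proarrow of the unit is absorbed by the last
    proarrow before it, the component of [σ] is applied, and the result is rebracketed. *)
Lemma merge_cell {z w v u : D} (ns : npath p z w) (m : pro w v) (ms : dpath q v u) :
  exists c : cell (α z) (β u) (msrc (dapp (npath_dpath ns) (dcons (M := unit_mod F) m ms)))
      (mpro N (mtot (dapp (npath_dpath ns) (dcons (M := unit_mod F) m ms)))),
  forall (x y t o : E) (f : hom x (G z)) (g : hom y (F w)) (g' : hom t (F v)) (h : hom o (H u))
    (nas : nqc ns f g) (X : pro y t) (A : fl X) (B : fl m) (a : cell g g' X (mpro (umod F) m))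
    (as_ : qc ms g' h),
  cev c (qapp (nqc_qc nas) (qcons (M := unit_mod F) (Ent X m A B a) as_))
    ≃ ev σ (qapp (nqc_snoc nas (Ent (N := umod F) X m A B a)) as_).
Proof.
  destruct (giso_mtot_app (npath_dpath ns) (dcons (M := unit_mod F) m ms)) as (i & I1 & I2).
  destruct (giso_msrc_app (snoc ns m) ms) as (κ3 & K1 & K2).
  (* The indices are rebracketed by [k] and the sources by [κ]. *)
  pose (k := mtot_app (snoc ns m) ms • ((snoc_tot ns m ⊗ cid (mtot ms))
    • (associ (mtot (npath_dpath ns)) m (mtot ms) • i))).
  assert (Hk : giso k).
  { refine (giso_comp (giso_mtot_app _ _) (giso_comp (giso_tens _ (giso_cid _))
      (giso_comp (giso_associ _ _ _) _))).
    - destruct (snoc_tens (nids ns) (inj (umod F) m)) as (_ & _ & R & _); exact (coh_giso R).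
    - exists (mtot_app (npath_dpath ns) (dcons (M := unit_mod F) m ms)); split; assumption. }
  destruct Hk as (j & J1 & J2).
  pose (κ := κ3 • ((snoc_src ns m ⊗ cid (msrc ms)) • (associ (msrc (npath_dpath ns)) (lpro F m) (msrc ms)
    • msrc_app (npath_dpath ns) (dcons (M := unit_mod F) m ms)))).
  assert (Hc : exists c : cell (α z) (β u) (msrc (dapp (npath_dpath ns) (dcons (M := unit_mod F) m ms)))
      (mpro N (mtot (dapp (npath_dpath ns) (dcons (M := unit_mod F) m ms)))),
      ⟦c⟧ = ⟦mcell N j⟧ ⋆ (⟦σ _ _ (dapp (snoc ns m) ms)⟧ ⋆ ⟦κ⟧)).
  { unshelve eexists (ccast _ _ (mcell N j ∙ (σ _ _ (dapp (snoc ns m) ms) ∙ κ)));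
      [rewrite (lhom_id _ (lf_laws _ _ _)), (comph_id_l HE), (comph_id_r HE); reflexivity .. |].
    rewrite sq_cast; reflexivity. }
  destruct Hc as [c Hc]; exists c; intros x y t o f g g' h nas X A B a as_.
  destruct (qapp_tens (nqc_qc nas) (qcons (M := unit_mod F) (Ent X m A B a) as_)) as (φ1 & P1 & P2).
  destruct (snoc_tens nas (Ent (N := umod F) X m A B a)) as (φ2 & Q1 & Q2 & Q3).
  destruct (qapp_tens (nqc_snoc nas (Ent (N := umod F) X m A B a)) as_) as (φ3 & R1 & R2).
  destruct (coh_inv R1) as (ζ3 & S1 & S2 & S3).
  exists (ζ3 • ((φ2 ⊗ cid (qsrc as_)) • (associ (qsrc (nqc_qc nas)) X (qsrc as_) • φ1))), k.
  split; [exact (coh_comp S1 (coh_comp (coh_tens Q1 (coh_id _)) (coh_comp (coh_associ _ _ _) P1)))|].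
  split.
  - refine (coh_comp (qapp_qtfl _ _) (coh_comp (coh_tens Q2 (coh_id _)) (coh_comp (coh_associ _ _ _) _))).
    exact (coh_sym (qapp_qtfl (nqc_qc nas) (qcons (M := unit_mod F) (Ent X m A B a) as_)) I2).
  - pose proof (sq_merge P2 Q3 R2 K1 S3) as L; fold κ in L.
    cbn [ec cev ev].
    refine (eq_trans (f_equal (fun s => ⟦mcell N k⟧ ⋆ (s ⋆ ⟦tens
      (qapp (nqc_qc nas) (qcons (M := unit_mod F) (Ent X m A B a) as_))⟧)) Hc) _).
    refine (eq_trans _ (eq_trans (f_equal (sq_comp ⟦σ _ _ (dapp (snoc ns m) ms)⟧) L)
      (sq_comp_assoc HE _ _ _))).
    rewrite !(sq_comp_assoc HE), <- sq_mcell_gcomp, J2, sq_mcell_id, (sq_comp_idl HE); reflexivity.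
Qed.
End Rep.

Lemma wev_erase_qapp {k : trans_kind} {F G H G' H' : Fun} {p : mpath G F} {q : mpath F H} {N : Mod G' H'}
    {α : Tr k G G'} {β : Tr k H H'} (σ : multimodulation k G H G' H' (papp p q) N α β)
    {z w v u : D} {x y t o : E} {f : hom x (G z)} {g : hom y (F w)} {g' : hom t (F v)} {h : hom o (H u)}
    {ms : dpath p z w} {ms' : dpath p z v} {ns : dpath q v u} (as_ : qc ms f g) (as' : qc ms' f g')
    (a : ent (umod F) g g') (bs : qc ns g' h) :
  wsim (wsnoc (qword as_) a) (qword as') ->
  ev (mmc σ) (qapp as' bs) ≃
  wev (mmc σ) (erase (F := F) (p := p) (qword (qapp as_ (qcons (M := unit_mod F) a bs)))).
Proof.
  intros K; refine (esim_trans (esim_sym (wev_qword _ (mmc σ))) (wev_sim (mm_equivariant σ) _)).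
  rewrite (erase_qapp as_ a bs), (qword_app as' bs), <- wapp_snoc.
  exact (wapp_sim (ws_sym K) (ws_refl _)).
Qed.

(** If there is a module before the unit, its last entry absorbs the one of the unit ([merge_cell]).
    Otherwise the entry of the unit acts from the left through [α]. *)
Lemma unit_represented {k : trans_kind} {F G H G' H' : Fun} {p : mpath G F} {q : mpath F H} {N : Mod G' H'}
    {α : Tr k G G'} {β : Tr k H H'} (σ : multimodulation k G H G' H' (papp p q) N α β)
    {z w : D} {x y : E} {f : hom x (G z)} {g : hom y (H w)} (Q : QC (papp p (pcons (unit_mod F) q)) f g) :
  represented (fun z w x y f g s => wev (mmc σ) (erase s)) Q.
Proof.
  destruct (qc_unapp p Q) as (w1 & y1 & g1 & Q1 & Q2 & ->).
  destruct (qc_uncons Q2) as (w2 & y2 & g2 & a & Q3 & ->).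
  revert α σ w1 y1 g1 Q1 a; destruct p as [F | G G1 F M p]; intros α σ w1 y1 g1 Q1 a.
  - revert z w1 x y1 f g1 Q1 a; apply (qc_nil_ind (fun z w1 x y1 f g1 Q1 => forall a : ent (unit_mod F) g1 g2,
      represented (p := papp (pnil F) (pcons (unit_mod F) q)) (fun z w x y f g s => wev (mmc σ) (erase s))
        (QCapp Q1 (QCcons a Q3)))).
    intros z x f a; destruct a as [X m A B a], Q3 as [ms as_].
    pose (c := gpost (mactl N m (mtot ms)) (tpro (pt_core α) m ⊗ mmc σ _ _ ms) :
      cell (pt_core α z) (pt_core β w) (lpro F m ⊙ msrc ms) (mpro N (m ⊙ mtot ms))).
    exists c.
    assert (K : forall x y2 y (f : hom x (F z)) (g2 : hom y2 (F w2)) (g : hom y (H w)) X (A : fl X) (B : fl m)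
      (a : cell f g2 X (lpro F m)) (as_ : qc ms g2 g),
      cev (ms := dcons (M := unit_mod F) m ms) (N := N) c (qcons (M := unit_mod F) (Ent (N := umod F) X m A B a) as_) ≃
      wev (mmc σ) (wfun (Ent (N := umod F) X m A B a : ent (umod F) f g2) (qword as_))).
    { clear - c; intros x y2 y f g2 g X A B a as_.
      refine (esim_sym (esim_trans (wev_fun (tr_gnat α) _ _) (esim_trans
        (lact_cong (esim_refl _) (wev_qword as_ (mmc σ))) _))).
      apply esim_of_sq; cbn [ec tm lact cev ev c]; subst c.
      rewrite to_sq_comp, !sq_gpost, <- (sq_comp_assoc HE); f_equal.
      rewrite <- to_sq_comp. exact (f_equal to_sq (ctens_comp _ HE _ _ _ _ _ _ _ _ _ _ _ _ _ _ _ _ _ _ _ _ _ _ _ _ _)). }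
    split; [exact (K _ _ _ _ _ _ _ (fl_atom _) (fl_atom m) _ (ids ms)) | exact (K _ _ _ _ _ _ _ A B a as_)].
  - destruct (qc_nqc Q1) as (ns & nas & ->), a as [X m A B a], Q3 as [ms as_].
    destruct (merge_cell (mmc σ) ns m ms) as [c Hc]; exists c; cbn [projT1 projT2 QCapp QCcons].
    rewrite ids_dapp; cbn [ids]; rewrite <- nids_ids.
    split.
    + refine (esim_trans (Hc _ _ _ _ _ _ _ _ (nids ns) (lpro F m) (fl_atom _) (fl_atom m) (cid _) (ids ms)) _).
      exact (wev_erase_qapp σ (nqc_qc (nids ns)) (nqc_snoc (nids ns) (inj (umod F) m)) (inj (umod F) m) (ids ms)
        (qword_snoc _ _)).
    + refine (esim_trans (Hc _ _ _ _ _ _ _ _ nas X A B a as_) _).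
      exact (wev_erase_qapp σ (nqc_qc nas) (nqc_snoc nas (Ent (N := umod F) X m A B a)) (Ent (N := umod F) X m A B a) as_
        (qword_snoc _ _)).
Qed.

Lemma vqc_app {F G H : Fun} {p : mpath F G} {q : mpath G H} {z w v z' w' v' : D} {x y t : E}
    {ms1 : dpath p z w} {ns1 : dpath p z' w'} {ms2 : dpath q w v} {ns2 : dpath q w' v'}
    {c : hom z z'} {d : hom w w'} {e : hom v v'} {f : hom x (F z)} {g : hom y (G w)} {h : hom t (H v)}
    {as1 : qc ms1 f g} {γ1 : dcells ms1 ns1 c d} {as1' : qc ns1 (lhom F c ∘ f) (lhom G d ∘ g)}
    {as2 : qc ms2 g h} {γ2 : dcells ms2 ns2 d e} {as2' : qc ns2 (lhom G d ∘ g) (lhom H e ∘ h)} :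
  vqc as1 γ1 as1' -> vqc as2 γ2 as2' -> vqc (qapp as1 as2) (dcapp γ1 γ2) (qapp as1' as2').
Proof.
  induction 1; intros V2; [exact V2 | exact (vq_cons a B γ (IHvqc _ _ _ _ _ _ V2))].
Qed.

(** The conclusion of [vqc_snoc]: entries with [a] absorbed, and cells acting on them as [γs] and [γ] do. *)
Definition absorbed {F G : Fun} {q : mpath F G} {z w v z' w' v' : D} {x y t : E}
    {ms : dpath q z w} {ns : dpath q z' w'}
    {c : hom z z'} {d : hom w w'} {e : hom v v'} {f : hom x (F z)} {g : hom y (G w)} {h : hom t (G v)}
    (as_ : qc ms f g) (γs : dcells ms ns c d) (as' : qc ns (lhom F c ∘ f) (lhom G d ∘ g))
    (a : ent (umod G) g h) {n : pro w' v'} (B : fl n) (γ : cell d e (en a) n) : Prop :=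
  exists (ms1 : dpath q z v) (ns1 : dpath q z' v') (bs : qc ms1 f h)
    (δs : dcells ms1 ns1 c e) (bs' : qc ns1 (lhom F c ∘ f) (lhom G e ∘ h)),
  vqc bs δs bs' /\ wsim (wsnoc (qword as_) a) (qword bs) /\
  wsim (wsnoc (qword as') (vp a B γ)) (qword bs') /\
  vsim (fl_tens (qtfl as_) (eB a)) (fl_tens (qtfl as') B) (mtot_cell γs ⊗ γ)
    (qtfl bs) (qtfl bs') (mtot_cell δs).

Lemma vqc_snoc {F0 F G : Fun} {M : Mod F0 F} (p : mpath F G) {z w v z' w' v' : D} {x y t : E}
    {ms : dpath (pcons M p) z w} {ns : dpath (pcons M p) z' w'}
    {c : hom z z'} {d : hom w w'} {e : hom v v'} {f : hom x (F0 z)} {g : hom y (G w)} {h : hom t (G v)}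
    {as_ : qc ms f g} {γs : dcells ms ns c d} {as' : qc ns (lhom F0 c ∘ f) (lhom G d ∘ g)}
    (a : ent (umod G) g h) {n : pro w' v'} (B : fl n) (γ : cell d e (en a) n) :
  vqc as_ γs as' -> absorbed as_ γs as' a B γ.
Proof.
  intros V; revert ms ns as_ γs as' V n B γ; revert w w' y d g a; revert F0 M z z' x c f;
    induction p as [G | F G1 G M1 p IH]; intros F0 M z z' x c f w w' y d g a.
  - apply (vqc_uncons_ind (q := pnil G) (fun ms ns as_ γs as' => forall (n : pro w' v') B γ,
      absorbed as_ γs as' a (n := n) B γ)).
    intros w1 w1' y1 d1 g1 b n1 B1 γ1 ms ns as_ γs as' V; revert b n1 B1 γ1 a.
    revert w1 w w1' w' y1 y ms ns d1 d g1 g as_ γs as' V;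
      apply (vqc_nil_ind (fun w1 w w1' w' y1 y ms ns d1 d g1 g as_ γs as' =>
        forall (b : ent M f g1) (n1 : pro z' w1') (B1 : fl n1) (γ1 : cell c d1 (en b) n1)
          (a : ent (umod G) g h) (n : pro w' v') (B : fl n) (γ : cell d e (en a) n),
        absorbed (qcons b as_) (dccons γ1 γs) (qcons (vp b B1 γ1) as') a B γ)).
    intros w w' y d g b n1 B1 γ1 a n B γ.
    exists _, _, (qcons (ract b a) (qnil h)), (dccons (γ1 ⊗ γ) (dcnil e)),
      (qcons (vp (ract b a) (fl_tens B1 B) (γ1 ⊗ γ)) (qnil _)).
    split; [apply vq_cons, vq_nil|]; split; [apply ws_mf|]; split.
    + refine (ws_trans (ws_mf _ _ _) (ws_mod (esim_sym (vp_ract _ _ _ _ _ _)) (ws_refl _))).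
    + exact (vsim_trans (vsim_tens (vsim_run γ1) (vsim_refl _ _ γ)) (vsim_sym (vsim_run (γ1 ⊗ γ)))).
  - apply (vqc_uncons_ind (q := pcons M1 p) (fun ms ns as_ γs as' => forall (n : pro w' v') B γ,
      absorbed as_ γs as' a (n := n) B γ)).
    intros w1 w1' y1 d1 g1 b n1 B1 γ1 ms ns as_ γs as' V n B γ.
    destruct (IH _ _ _ _ _ _ _ _ _ _ _ _ _ a _ _ _ _ _ V n B γ) as (ms1 & ns1 & bs & δs & bs' & K1 & K2 & K3 & K4).
    exists _, _, (qcons b bs), (dccons γ1 δs), (qcons (vp b B1 γ1) bs').
    split; [exact (vq_cons b B1 γ1 K1)|]; split; [exact (ws_mod (esim_refl _) K2)|];
      split; [exact (ws_mod (esim_refl _) K3)|].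
    exact (vsim_trans (vsim_assoc γ1 (mtot_cell γs) γ) (vsim_tens (vsim_refl _ _ _) K4)).
Qed.

Section Slide.
Context {H G' H' : Fun} {N : Mod G' H'}.

(** Absorbing the entry of the unit into the one before it is compatible with cells of [D], so a naturality
    square of the extension is one of [σ]. *)
Lemma unit_absorb {G F0 F : Fun} {M : Mod G F0} {p : mpath F0 F} {q : mpath F H} {α : trans G G'} {β : trans H H'}
    (σ : components (papp (pcons M p) q) N α β) (Hσ : equivariant σ)
    (μ : components (papp (pcons M p) (pcons (unit_mod F) q)) N α β)
    (Hμ : forall z w x y (ms : dpath (papp (pcons M p) (pcons (unit_mod F) q)) z w) (f : hom x (G z))
      (g : hom y (H w)) (as_ : qc ms f g), ev μ as_ ≃ wev σ (erase (p := pcons M p) (qword as_)))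
    {z v z' v' : D} {x t : E} {c : hom z z'} {e : hom v v'} {f : hom x (G z)} {h : hom t (H v)}
    {ms : dpath (papp (pcons M p) (pcons (unit_mod F) q)) z v}
    {ns : dpath (papp (pcons M p) (pcons (unit_mod F) q)) z' v'}
    {as_ : qc ms f h} {γs : dcells ms ns c e} {as' : qc ns (lhom G c ∘ f) (lhom H e ∘ h)} :
  vqc as_ γs as' ->
  exists (ms1 : dpath (papp (pcons M p) q) z v) (ns1 : dpath (papp (pcons M p) q) z' v')
    (bs : qc ms1 f h) (δs : dcells ms1 ns1 c e) (bs' : qc ns1 (lhom G c ∘ f) (lhom H e ∘ h)),
  vqc bs δs bs' /\ vp (ev μ as_) (qtfl as') (mtot_cell γs) ≃ vp (ev σ bs) (qtfl bs') (mtot_cell δs) /\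
  ev μ as' ≃ ev σ bs'.
Proof.
  revert ms ns as_ γs as'; apply (vqc_unapp_ind (pcons M p) (q := pcons (unit_mod F) q)
    (fun ms ns as_ γs as' => exists ms1 ns1 bs δs bs', vqc (q := papp (pcons M p) q) (ms := ms1) (ns := ns1) bs δs bs' /\
      vp (ev μ as_) (qtfl as') (mtot_cell γs) ≃ vp (ev σ bs) (qtfl bs') (mtot_cell δs) /\ ev μ as' ≃ ev σ bs')).
  intros w w' y d g ms1 ns1 as1 γ1 as1' ms ns as_ γs as' V1 V; revert ms ns as_ γs as' V.
  apply (vqc_uncons_ind (fun ms ns as_ γs as' => exists ms2 ns2 bs δs bs',
      vqc (q := papp (pcons M p) q) (ms := ms2) (ns := ns2) bs δs bs' /\
      vp (ev μ (qapp as1 as_)) (qtfl (qapp as1' as')) (mtot_cell (dcapp γ1 γs)) ≃ vp (ev σ bs) (qtfl bs') (mtot_cell δs) /\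
      ev μ (qapp as1' as') ≃ ev σ bs')).
  intros u u' y2 d2 g2 a n B γ ms ns as_ γs as' V.
  destruct (vqc_snoc p a B γ V1) as (ms2 & ns2 & bs & δs & bs' & K1 & K2 & K3 & K4).
  assert (L : forall (z w v u : D) (x y t o : E) (f : hom x (G z)) (g : hom y (F w)) (g' : hom t (F v))
    (h : hom o (H u)) (ms : dpath (pcons M p) z w) (ms' : dpath (pcons M p) z v) (ns : dpath q v u)
    (as_ : qc ms f g) (as' : qc ms' f g') (a : ent (umod F) g g') (bs : qc ns g' h),
    wsim (wsnoc (qword as_) a) (qword as') ->
    ev μ (qapp as_ (qcons (M := unit_mod F) a bs)) ≃ ev σ (qapp as' bs)).
  { clear - Hμ Hσ; intros z w v u x y t o f g g' h ms ms' ns as_ as' a bs K.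
    refine (esim_trans (Hμ _ _ _ _ _ _ _ _) (esim_trans (wev_sim Hσ _) (wev_qword _ σ))).
    rewrite (erase_qapp as_ a bs), (qword_app as' bs), <- wapp_snoc.
    exact (wapp_sim K (ws_refl _)). }
  exists _, _, (qapp bs as_), (dcapp δs γs), (qapp bs' as').
  split; [exact (vqc_app K1 V)|]; split; [|exact (L _ _ _ _ _ _ _ _ _ _ _ _ _ _ _ _ _ _ _ K3)].
  refine (vp_vsim (L _ _ _ _ _ _ _ _ _ _ _ _ _ _ _ _ _ a _ K2) _).
  refine (vsim_trans (vsim_dcapp γ1 (dccons γ γs) as1 (qcons (M := unit_mod F) a as_) as1'
    (qcons (M := unit_mod F) (vp a B γ) as')) (vsim_trans (vsim_sym (vsim_assoc _ _ _)) _)).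
  refine (vsim_trans (vsim_tens K4 (vsim_refl _ _ _)) (vsim_sym (vsim_dcapp δs γs bs as_ bs' as'))).
Qed.

Lemma unit_front {G : Fun} {q : mpath G H} {α : trans G G'} {β : trans H H'}
    (σ : components q N α β) (Hσ : equivariant σ)
    (μ : components (pcons (unit_mod G) q) N α β)
    (Hμ : forall z w x y (ms : dpath (pcons (unit_mod G) q) z w) (f : hom x (G z))
      (g : hom y (H w)) (as_ : qc ms f g), ev μ as_ ≃ wev σ (erase (p := pnil G) (qword as_)))
    {z v z' v' : D} {x t : E} {c : hom z z'} {e : hom v v'} {f : hom x (G z)} {h : hom t (H v)}
    {ms : dpath (pcons (unit_mod G) q) z v} {ns : dpath (pcons (unit_mod G) q) z' v'}
    {as_ : qc ms f h} {γs : dcells ms ns c e} {as' : qc ns (lhom G c ∘ f) (lhom H e ∘ h)} :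
  vqc as_ γs as' ->
  exists (w w' : D) (y : E) (d : hom w w') (g : hom y (G w)) (a : ent (umod G) f g) (n : pro z' w') (B : fl n)
    (γ : cell c d (en a) n) (ms1 : dpath q w v) (ns1 : dpath q w' v')
    (bs : qc ms1 g h) (δs : dcells ms1 ns1 d e) (bs' : qc ns1 (lhom G d ∘ g) (lhom H e ∘ h)),
  vqc bs δs bs' /\ vp (ev μ as_) (qtfl as') (mtot_cell γs)
    ≃ lact (vp (tm α a) B γ) (vp (ev σ bs) (qtfl bs') (mtot_cell δs)) /\
  ev μ as' ≃ lact (tm α (vp a B γ)) (ev σ bs').
Proof.
  revert ms ns as_ γs as'; apply vqc_uncons_ind.
  intros w w' y d g a n B γ ms ns as_ γs as' V.
  assert (L : forall (z w v : D) (x y t : E) (f : hom x (G z)) (g : hom y (G w)) (h : hom t (H v))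
    (ms : dpath q w v) (a : ent (umod G) f g) (bs : qc ms g h),
    ev μ (qcons (M := unit_mod G) a bs) ≃ lact (tm α a) (ev σ bs)).
  { clear - Hμ Hσ; intros z w v x y t f g h ms a bs.
    refine (esim_trans (Hμ _ _ _ _ _ _ _ (qcons (M := unit_mod G) a bs)) (esim_trans (wev_fun (eqv_src _ Hσ) _ _) _)).
    exact (lact_cong (esim_refl _) (wev_qword bs σ)). }
  exists w, w', y, d, g, a, n, B, γ, ms, ns, as_, γs, as'; split; [exact V|]; split; [|exact (L _ _ _ _ _ _ _ _ _ _ _ _)].
  refine (esim_trans _ (vp_lact (tm α a) (ev σ as_) B (qtfl as') γ (mtot_cell γs))).
  exact (vp_vsim (e := ev μ (qcons (M := unit_mod G) a as_)) (L _ _ _ _ _ _ _ _ _ _ _ _) (vsim_refl _ _ _)).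
Qed.

(** Reduces to the naturality of [σ]; at the front of a path the comparison also has to be moved past the
    entry of the unit, by the law of [α] for cells. *)
Lemma unit_slide_lax {F G : Fun} {p : mpath G F} {q : mpath F H} {α : lax_trans G G'} {β : lax_trans H H'}
    (σ : components (papp p q) N α β) (Hσ : equivariant σ) (Nσ : lax_natural α β σ)
    (μ : components (papp p (pcons (unit_mod F) q)) N α β)
    (Hμ : forall z w x y (ms : dpath (papp p (pcons (unit_mod F) q)) z w) (f : hom x (G z))
      (g : hom y (H w)) (as_ : qc ms f g), ev μ as_ ≃ wev σ (erase (qword as_)))
    {z v z' v' : D} {x t : E} {c : hom z z'} {e : hom v v'} {f : hom x (G z)} {h : hom t (H v)}
    {ms : dpath (papp p (pcons (unit_mod F) q)) z v}
    {ns : dpath (papp p (pcons (unit_mod F) q)) z' v'}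
    {as_ : qc ms f h} {γs : dcells ms ns c e} {as' : qc ns (lhom G c ∘ f) (lhom H e ∘ h)} :
  vqc as_ γs as' -> laxnat_ent μ γs as_ as'.
Proof.
  intros V; revert α σ Hσ Nσ μ Hμ c f ms ns as_ γs as' V; destruct p as [G | G F0 F M p];
    intros α σ Hσ Nσ μ Hμ c f ms ns as_ γs as' V; unfold laxnat_ent.
  - destruct (unit_front σ Hσ μ Hμ V) as (w & w' & y & d & g & a & n & B & γ & ms1 & ns1 & bs & δs & bs' & K1 & K2 & K3).
    refine (esim_trans (ract_cong K2 (esim_refl _)) (esim_trans (lact_ract _ _ _) _)).
    refine (esim_trans (lact_cong (esim_refl _) (laxnat_to σ (Nσ _ _ _ _ _ _ _ _ δs) K1)) _).
    refine (esim_trans (esim_sym (lact_lact _ _ _)) (esim_trans (lact_cong (cmL_cell α _ _ _ _ _ _ _ _ _ _ a n B γ) (esim_refl _)) _)).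
    exact (esim_trans (lact_lact _ _ _) (lact_cong (esim_refl _) (esim_sym K3))).
  - destruct (unit_absorb σ Hσ μ Hμ V) as (ms1 & ns1 & bs & δs & bs' & K1 & K2 & K3).
    refine (esim_trans (ract_cong K2 (esim_refl _)) (esim_trans (laxnat_to σ (Nσ _ _ _ _ _ _ _ _ δs) K1) _)).
    exact (lact_cong (esim_refl _) (esim_sym K3)).
Qed.

Lemma unit_slide_oplax {F G : Fun} {p : mpath G F} {q : mpath F H} {α : oplax_trans G G'} {β : oplax_trans H H'}
    (σ : components (papp p q) N α β) (Hσ : equivariant σ) (Nσ : oplax_natural α β σ)
    (μ : components (papp p (pcons (unit_mod F) q)) N α β)
    (Hμ : forall z w x y (ms : dpath (papp p (pcons (unit_mod F) q)) z w) (f : hom x (G z))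
      (g : hom y (H w)) (as_ : qc ms f g), ev μ as_ ≃ wev σ (erase (qword as_)))
    {z v z' v' : D} {x t : E} {c : hom z z'} {e : hom v v'} {f : hom x (G z)} {h : hom t (H v)}
    {ms : dpath (papp p (pcons (unit_mod F) q)) z v}
    {ns : dpath (papp p (pcons (unit_mod F) q)) z' v'}
    {as_ : qc ms f h} {γs : dcells ms ns c e} {as' : qc ns (lhom G c ∘ f) (lhom H e ∘ h)} :
  vqc as_ γs as' -> oplaxnat_ent μ γs as_ as'.
Proof.
  intros V; revert α σ Hσ Nσ μ Hμ c f ms ns as_ γs as' V; destruct p as [G | G F0 F M p];
    intros α σ Hσ Nσ μ Hμ c f ms ns as_ γs as' V; unfold oplaxnat_ent.
  - destruct (unit_front σ Hσ μ Hμ V) as (w & w' & y & d & g & a & n & B & γ & ms1 & ns1 & bs & δs & bs' & K1 & K2 & K3).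
    refine (esim_trans (lact_cong (esim_refl _) K2) (esim_trans (esim_sym (lact_lact _ _ _)) _)).
    refine (esim_trans (lact_cong (cmO_cell α _ _ _ _ _ _ _ _ _ _ a n B γ) (esim_refl _)) _).
    refine (esim_trans (lact_lact _ _ _) (esim_trans (lact_cong (esim_refl _) (oplaxnat_to σ (Nσ _ _ _ _ _ _ _ _ δs) K1)) _)).
    exact (esim_trans (esim_sym (lact_ract _ _ _)) (ract_cong (esim_sym K3) (esim_refl _))).
  - destruct (unit_absorb σ Hσ μ Hμ V) as (ms1 & ns1 & bs & δs & bs' & K1 & K2 & K3).
    refine (esim_trans (lact_cong (esim_refl _) K2) (esim_trans (oplaxnat_to σ (Nσ _ _ _ _ _ _ _ _ δs) K1) _)).
    exact (ract_cong (esim_sym K3) (esim_refl _)).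
Qed.
End Slide.

Lemma unit_extension_exists {k : trans_kind} {F G H G' H' : Fun} {p : mpath G F} {q : mpath F H} {N : Mod G' H'}
    {α : Tr k G G'} {β : Tr k H H'} (σ : multimodulation k G H G' H' (papp p q) N α β) :
  exists ρ : multimodulation k G H G' H' (papp p (pcons (unit_mod F) q)) N α β,
    forall z w x y (f : hom x (G z)) (g : hom y (H w)) (s : word (papp p (pcons (unit_mod F) q)) f g),
    wev (mmc ρ) s ≃ wev (mmc σ) (erase s).
Proof.
  apply (multimodulation_of α β (fun z w x y f g s => wev (mmc σ) (erase s))).
  - intros; apply unit_represented.
  - intros z w x y f g s t K; exact (wev_sim (mm_equivariant σ) (erase_sim K)).
  - intros z z' w x x' y f f' g a s.
    exact (esim_trans (wev_sim (mm_equivariant σ) (erase_fun a s)) (wev_fun (tr_gnat α) _ _)).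
  - intros z w v x y t f g h s a; rewrite erase_snoc; exact (wev_snoc _ _ (mm_equivariant σ)).
  - intros μ Hμ; pose proof (mm_equivariant σ) as Hσ; clear - Hμ Hσ; destruct k.
    1-3: intros z w z' w' ms ns c e γs; destruct (vqc_ids γs) as [as' V];
      exact (laxnat_from _ (coh_giso (tens_ids ms)) V
        (unit_slide_lax (α := proj1_sig α) (β := proj1_sig β) (mmc σ) Hσ (mm_nat _ _ _ _ _ _ _ _ _ _ _ σ) μ Hμ V)).
    intros z w z' w' ms ns c e γs; destruct (vqc_ids γs) as [as' V];
      exact (oplaxnat_from _ (coh_giso (tens_ids ms)) V
        (unit_slide_oplax (α := proj1_sig α) (β := proj1_sig β) (mmc σ) Hσ (mm_nat _ _ _ _ _ _ _ _ _ _ _ σ) μ Hμ V)).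
Qed.

Lemma weq_app {F G H : Fun} {p : mpath F G} {q : mpath G H} {z w v : D} {x y t : E}
    {f f' : hom x (F z)} {g g' : hom y (G w)} {h h' : hom t (H v)} {s : word p f g} {s' : word p f' g'}
    {r : word q g h} {r' : word q g' h'} : weq s s' -> weq r r' -> weq (wapp s r) (wapp s' r').
Proof.
  intros (e1 & e2 & K) (e3 & e4 & L); destruct e1, e2, e4.
  rewrite (proof_irrelevance _ e3 eq_refl) in L; exact (weq_of_sim (wapp_sim K L)).
Qed.

Lemma wtr_wapp {F G H : Fun} {p p' : mpath F G} {q q' : mpath G H} (e1 : p = p') (e2 : q = q')
    (e : papp p q = papp p' q') {z w v : D} {x y t : E} {f : hom x (F z)} {g : hom y (G w)}
    {h : hom t (H v)} (s : word p f g) (r : word q g h) :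
  wtr e (wapp s r) = wapp (wtr e1 s) (wtr e2 r).
Proof. destruct e1, e2; apply wtr_refl. Qed.

Lemma wev_mceq {k : trans_kind} {F F' G H : Fun} {p p' : mpath F F'} {N : Mod G H} {α α' : Tr k F G}
    {β β' : Tr k F' H} {μ : multimodulation k F F' G H p N α β}
    {ν : multimodulation k F F' G H p' N α' β'} (e : p = p') :
  mceq (multimodulation k) μ ν -> forall {z w : D} {x y : E} {φ : hom x (F z)} {ψ : hom y (F' w)}
    (s : word p φ ψ), wev (mmc μ) s ≃ wev (mmc ν) (wtr e s).
Proof. intros K; destruct K; intros; rewrite wtr_refl; apply esim_refl. Qed.

Section Unit.
Context {k : trans_kind} {F : Fun} (η : multimodulation k F F F F (pnil F) (unit_mod F) (tr_id F) (tr_id F))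
  (Hη : forall z w x y (f : hom x (F z)) (g : hom y (F w)) (s : word (pnil F) f g),
    wev (mmc η) s ≃ (wprod s : ent (umod F) f g)).
Context {G H G' H' : Fun} {p : mpath G F} {q : mpath F H} {N : Mod G' H'} {α : Tr k G G'} {β : Tr k H H'}.

Notation ids_p := (mids _ (ops k) p).
Notation ids_q := (mcons (multimodulation k) η (mids _ (ops k) q)).

Lemma wev_unit_row (ρ : multimodulation k G H G' H' (papp p (pcons (unit_mod F) q)) N α β)
    (e : papp (msource _ ids_p) (msource _ ids_q) = msource _ (mapp _ ids_p ids_q))
    (e1 : msource _ ids_p = p) (e2 : msource _ ids_q = q) {z w v : D} {x y t : E} {f : hom x (G z)}
    {g : hom y (F w)} {h : hom t (H v)} (s : word (msource _ ids_p) f g) (r : word (msource _ ids_q) g h) :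
  wev (mmc (mm_comp ρ (mapp _ ids_p ids_q))) (wtr e (wapp s r))
    ≃ wev (mmc ρ) (wapp (wtr e1 s) (wmod (M := unit_mod F) (one F g) (wtr e2 r))).
Proof.
  refine (esim_trans (wev_comp ρ (mapp _ ids_p ids_q) _) (wev_weq (mm_equivariant ρ) _)).
  refine (weq_trans (weq_of_sim (rw_mapp ids_p ids_q e s r)) (weq_app (rw_mids p e1 s) _)).
  refine (weq_trans (weq_of_sim (rw_cons η (mids _ (ops k) q) (wnil g) r (ws_refl _))) _).
  exact (weq_mod (Hη _ _ _ _ _ _ (wnil g)) (rw_mids q e2 r)).
Qed.

(** Composition with the unit multicell inserts a trivial entry, and every word over [p, q] is cut at [F]
    by [wsplit]. *)
Lemma unit_iff (ρ : multimodulation k G H G' H' (papp p (pcons (unit_mod F) q)) N α β)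
    (σ : multimodulation k G H G' H' (papp p q) N α β) :
  mceq (multimodulation k) (mm_comp ρ (mapp _ ids_p ids_q)) σ <->
  forall (z w v : D) (x y t : E) (f : hom x (G z)) (g : hom y (F w)) (h : hom t (H v)) (s : word p f g)
    (r : word q g h),
  wev (mmc ρ) (wapp s (wmod (M := unit_mod F) (one F g) r)) ≃ wev (mmc σ) (wapp s r).
Proof.
  pose (e1 := msource_mids p : msource _ ids_p = p).
  pose (e2 := msource_mids q : msource _ ids_q = q).
  pose (e := eq_sym (msource_mapp ids_p ids_q)).
  assert (e0 : msource _ (mapp _ ids_p ids_q) = papp p q).
  { exact (eq_trans (eq_sym e) (f_equal2 papp e1 e2)). }
  assert (T : forall (z w v : D) (x y t : E) (f : hom x (G z)) (g : hom y (F w)) (h : hom t (H v))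
    (s : word (msource _ ids_p) f g) (r : word (msource _ ids_q) g h),
    wtr e0 (wtr e (wapp s r)) = wapp (wtr e1 s) (wtr e2 r)).
  { intros; refine (eq_trans (wtr_wtr e e0 (eq_trans e e0) _) (wtr_wapp e1 e2 _ s r)). }
  split.
  - intros K z w v x y t f g h s r.
    pose proof (wev_unit_row ρ e e1 e2 (wtr (eq_sym e1) s) (wtr (eq_sym e2) r)) as L.
    pose proof (wev_mceq e0 K (wtr e (wapp (wtr (eq_sym e1) s) (wtr (eq_sym e2) r)))) as M.
    rewrite T in M.
    rewrite !(wtr_wtr _ _ eq_refl) in L, M.
    exact (esim_trans (esim_sym L) M).
  - intros K; apply (mceq_of _ _ e0 (tr_comp_idr α) (tr_comp_idr β)).
    intros z v x t f h s.
    pose proof (wglue_split (msource _ ids_p) (wtr (eq_sym e) s)) as L.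
    destruct (wsplit (msource _ ids_p) (wtr (eq_sym e) s)) as [w y g s1 s2]; cbn [wglue] in L.
    assert (L' : wsim (wtr e (wapp s1 s2)) s).
    { refine (eq_ind _ (wsim _) (wtr_sim e L) _ (wtr_wtr (eq_sym e) e eq_refl s)). }
    refine (esim_trans (wev_sim (mm_equivariant _) (ws_sym L')) (esim_trans (wev_unit_row ρ e e1 e2 s1 s2) _)).
    refine (esim_trans (K _ _ _ _ _ _ _ _ _ _ _) (wev_sim (mm_equivariant σ) _)).
    exact (eq_ind _ (fun u => wsim u _) (wtr_sim e0 L') _ (T _ _ _ _ _ _ _ _ _ s1 s2)).
Qed.

Lemma unit_universal (σ : multimodulation k G H G' H' (papp p q) N α β) :
  exists! ρ : multimodulation k G H G' H' (papp p (pcons (unit_mod F) q)) N α β,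
  mceq (multimodulation k) (mm_comp ρ (mapp _ ids_p ids_q)) σ.
Proof.
  destruct (unit_extension_exists (F := F) σ) as [ρ Hρ].
  assert (K : forall (z w v : D) (x y t : E) (f : hom x (G z)) (g : hom y (F w)) (h : hom t (H v)) (s : word p f g)
    (r : word q g h), wev (mmc ρ) (wapp s (wmod (M := unit_mod F) (one F g) r)) ≃ wev (mmc σ) (wapp s r)).
  { intros; refine (esim_trans (Hρ _ _ _ _ _ _ _) (wev_sim (mm_equivariant σ) _)).
    exact (ws_trans (erase_app s (one F g) r) (wapp_sim (ws_refl _) (ws_one r))). }
  exists ρ; split; [apply unit_iff; exact K|].
  intros ρ' K'; apply mm_eq; intros z w ms.
  refine (esim_trans (esim_sym (wev_qword _ _)) (esim_trans _ (wev_qword _ _))).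
  destruct (unit_insert (qword (ids ms))) as (w' & y' & g' & s1 & s2 & L).
  refine (esim_trans (wev_sim (mm_equivariant ρ) L) (esim_sym (esim_trans (wev_sim (mm_equivariant ρ') L) _))).
  exact (esim_trans (proj1 (unit_iff ρ' σ) K' _ _ _ _ _ _ _ _ _ s1 s2) (esim_sym (K _ _ _ _ _ _ _ _ _ s1 s2))).
Qed.
End Unit.

End Multimodulations.

Theorem theorem11p6 (D E : double_category) (PD : lax_products D) (PE : lax_products E)
    (k : trans_kind) :
  exists V : virtual_double_category (multimodulation PD PE k),
    has_pasting_composition V /\ has_units V.
Proof.
  exists {| vdc_ops := ops k; vdc_ax := ops_laws |}; split; [split|].
  - intros; apply tr_comp_is_composite.
  - intros; apply mm_comp_pasting.
  - intros F; destruct (unit_cell_exists (k := k) F) as [η Hη]; exists (unit_mod F), η.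
    intros; exact (unit_universal η Hη σ).
Qed.
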